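(* Let $\alpha\in(0,\infty)$, $p\in(1,\infty)$, $\delta_1,\dots,\delta_N\ge 0$, $\Lambda\ge1$, and let $f\in L^\sigma(\Omega_T)$ for some $\sigma>\frac{N+p}{p}$. Suppose that $p>\frac{N(\alpha+1)}{N+\alpha+1}$, and set $P:=\max\{\alpha+1,p\}$, $P':=\frac{P}{P-1}$. Let $u\in\mathcal{A}(\alpha,p,\{\delta_i\},\Omega_T,f,\mathcal{C})$. Then for every cylinder $Q_r(z_o)\Subset\Omega_T$ and every $s\in(0,1)$, $$\operatorname*{ess\,sup}_{Q_{sr}(z_o)}u\le c\left(\big[1+(r(1-s))^{-(N+p)}\big]\iint_{Q_r(z_o)}u_+^P\,dx\,dt\right)^{\frac{p}{p(N+\alpha+1)-NP}}+c\left(1+\iint_{Q_r(z_o)}|f|^\sigma\,dx\,dt\right)^{\frac{p}{p(N+\alpha+1)-NP+pP\min\{0,\frac{\sigma}{P'}-1\}}},$$ where $c>0$ depends only on $N,\alpha,p,\Lambda,\sigma$ and $\max\{\delta_1,\dots,\delta_N\}$. An analogous lower bound holds for the essential infimum: $-\operatorname*{ess\,inf}_{Q_{sr}(z_o)}u$ is bounded from above by the same right-hand side with $u_-$ in place of $u_+$. In particular, if $\Lambda^{-1}\le a_i\le\Lambda$ a.e. in $\Omega_T$ for all $i$, these estimates hold for all weak solutions $u$ in $\Omega_T$ of $$\partial_t(|u|^{\alpha-1}u)-\sum_{i=1}^N\partial_i\Big[a_i(x,t)\,(|\partial_iu|-\delta_i)_+^{p-1}\frac{\partial_iu}{|\p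artial_iu|}\Big]=f.$$
   Context: Let $N\ge2$, $T\in(0,\infty)$, $\Omega\subset\mathbb{R}^N$ a bounded open set, $\Omega_T:=\Omega\times(0,T)$, $a_1,\dots,a_N:\Omega_T\to\mathbb{R}$ measurable. Write $s_+=\max\{s,0\}$, $s_-=\max\{-s,0\}$; for $\gamma>0$ and $a\in\mathbb{R}$, $|a|^{\gamma-1}a:=0$ if $a=0$, and $a^\gamma:=|a|^{\gamma-1}a$ also when $a<0$. $\nabla$ and $\partial_i$ are spatial derivatives. For $z_o=(x_o,t_o)$ and $r>0$, $Q_r(z_o):=B_r(x_o)\times(t_o-r^p,t_o)$. Weak solution: set $A_i(x,t,\xi):=a_i(x,t)(|\xi_i|-\delta_i)_+^{p-1}\frac{\xi_i}{|\xi_i|}$ (equal to $0$ if $\xi_i=0$), $A=(A_1,\dots,A_N)$. A function $u\in L^p(0,T;W^{1,p}(\Omega))\cap C^0([0,T];L^{\alpha+1}(\Omega))$ is a weak solution of the equation (with $f\in L^1_{\mathrm{loc}}(\Omega_T)$) if for all $\varphi\in C_0^\infty(\Omega_T)$ $$\iint_{\Omega_T}\big(\langle A(x,t,\nabla u),\nabla\varphi\rangle-|u|^{\alpha-1}u\,\partial_t\varphi\big)\,dx\,dt=\iint_{\Omega_T}f\varphi\,dx\,dt.$$ Energy class: for measurable $f:\Omega_T\to\mathbb{R}$ and a constant $\mathcal{C}>0$, which depends only on $N,\alpha,p,\Lambda$, a function $u:\Omega_T\to\mathbb{R}$ belongs to $\mathcal{A}(\alpha,p,\{\delta_i\},\Omega_T,f,\mathcal{C})$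 if $u\in L^p(0,T;W^{1,p}(\Omega))\cap C^0([0,T];L^{\alpha+1}(\Omega))$ and, for every $k\in\mathbb{R}$, every $\eta\in C_0^\infty(\Omega;[0,\infty))$ and every $\varphi\in C^\infty([0,T];[0,\infty))$ vanishing in a neighborhood of $0$, both inequalities (one with all signs $+$, one with all signs $-$ in $\pm$) $$\sup_{\tau\in[0,T]}\int_{\Omega\times\{\tau\}}(u^{\frac{\alpha+1}{2}}-k^{\frac{\alpha+1}{2}})_\pm^2\,\eta^p\varphi\,dx+\sum_{i=1}^N\iint_{\Omega_T}(|\partial_iu|-\delta_i)_+^p\,\eta^p\varphi\,\chi_{\{(u-k)_\pm>0\}}\,dx\,dt$$ $$\le\mathcal{C}\iint_{\Omega_T}(u-k)_\pm^p|\nabla\eta|^p\varphi\,dx\,dt+\mathcal{C}\iint_{\Omega_T}(u^{\frac{\alpha+1}{2}}-k^{\frac{\alpha+1}{2}})_\pm^2\,\eta^p(\partial_t\varphi)_+\,dx\,dt+\mathcal{C}\iint_{\Omega_T}(u-k)_\pm|f|\,\eta^p\varphi\,dx\,dt$$ hold. *)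

(* Defs.v *)
From HB Require Import structures.
From mathcomp Require Import all_boot all_order all_algebra.
From mathcomp Require Import all_classical all_reals all_analysis ess_sup_inf.

Set Implicit Arguments.
Unset Strict Implicit.
Unset Printing Implicit Defensive.

Import Order.TTheory GRing.Theory Num.Theory.
Import numFieldNormedType.Exports.

Local Open Scope classical_set_scope.
Local Open Scope ring_scope.

(* The sigma-algebra generated by the coordinates is the Borel one. *)
Section measurable_rV.
Context {R : realType} (n : nat).

Let coord (i : 'I_n) (x : 'rV[R]_n) : measurableTypeR R := x ord0 i.

Let rV_set0 : g_sigma_preimage coord set0.
Proof. exact: sigma_algebra0. Qed.

Let rV_setC A : g_sigma_preimage coord A -> g_sigma_preimage coord (~` A).
Proof. exact: sigma_algebraC. Qed.

Let rV_bigcup (F : _^nat) : (forall i, g_sigma_preimage coord (F i)) ->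
  g_sigma_preimage coord (\bigcup_i (F i)).
Proof. exact: sigma_algebra_bigcup. Qed.

HB.instance Definition _ := @isMeasurable.Build default_measure_display
  'rV[R]_n (g_sigma_preimage coord) rV_set0 rV_setC rV_bigcup.

Lemma measurable_fun_rVP d (X : measurableType d) (f : X -> 'rV[R]_n) :
  (forall i, measurable_fun setT (fun x => f x ord0 i : measurableTypeR R)) ->
  measurable_fun setT f.
Proof.
move=> mf.
suff sub : g_sigma_preimage (fun i => coord i \o f) `<=` measurable.
  move=> _ A mA; apply: sub; rewrite g_sigma_preimage_comp.
  by exists A.
apply: smallest_sub; first exact: sigma_algebra_measurable.
rewrite -bigcup_seq; apply: bigcup_sub => i _.
by move=> A [B mB <-]; exact: mf.
Qed.

Lemma measurable_coord (i : 'I_n) :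
  measurable_fun setT (fun x : 'rV[R]_n => x ord0 i : measurableTypeR R).
Proof.
move=> _ Y mY; rewrite setTI; apply: sub_sigma_algebra => /=.
rewrite -bigcup_seq/=; exists i => /=; first by rewrite mem_index_enum.
by exists Y => //; rewrite setTI.
Qed.

End measurable_rV.

Section lebesgue_rV.
Context {R : realType}.

Definition rV_cons (n : nat) (z : 'rV[R]_n * measurableTypeR R) : 'rV[R]_n.+1 :=
  \row_i (if unlift ord0 i is Some j then z.1 ord0 j else z.2).

Lemma measurable_rV_cons (n : nat) : measurable_fun setT (@rV_cons n).
Proof.
apply: measurable_fun_rVP => i; under eq_fun do rewrite mxE.
case: unliftP => [j _|_]; last exact: measurable_snd.
exact: measurableT_comp (measurable_coord j) measurable_fst.
Qed.

Section step.
Variables (n : nat) (m : {measure set 'rV[R]_n -> \bar R}).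

Definition lebesgue_rVS : set 'rV[R]_n.+1 -> \bar R :=
  pushforward (m \x @lebesgue_measure R)%E (@rV_cons n).

Let mf := @measurable_rV_cons n.

Let lebesgue_rVS0 : lebesgue_rVS set0 = 0%E.
Proof. exact: measure0. Qed.

Let lebesgue_rVS_ge0 A : (0 <= lebesgue_rVS A)%E.
Proof. exact: measure_ge0. Qed.

Let lebesgue_rVS_sigma_additive : semi_sigma_additive lebesgue_rVS.
Proof. exact: measure_semi_sigma_additive. Qed.

HB.instance Definition _ := isMeasure.Build _ _ _ lebesgue_rVS
  lebesgue_rVS0 lebesgue_rVS_ge0 lebesgue_rVS_sigma_additive.

End step.

(* R^(n+1) is identified with R^n x R by rV_cons. *)
Fixpoint lebesgue_rV (n : nat) : {measure set 'rV[R]_n -> \bar R} :=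
  match n return {measure set 'rV[R]_n -> \bar R} with
  | 0%N => dirac (0 : 'rV[R]_0)
  | n'.+1 => lebesgue_rVS (lebesgue_rV n')
  end.

Definition lebesgue_rVxR (n : nat) :
    {measure set ('rV[R]_n * measurableTypeR R) -> \bar R} :=
  (lebesgue_rV n \x @lebesgue_measure R)%E.

End lebesgue_rV.

Section real_functions.
Context {R : realType}.

Definition sgn_part (plus : bool) (s : R) : R :=
  if plus then Num.max s 0 else Num.max (- s) 0.

(* a^g := |a|^(g-1) a; it is 0 for a = 0, whatever the value of 0 `^ (g - 1). *)
Definition spow (a g : R) : R := `|a| `^ (g - 1) * a.

End real_functions.

Section Lp_spaces.
Context {R : realType} {d : measure_display} {X : measurableType d}.
Variable mu : {measure set X -> \bar R}.

(* mu lives on a Borel sigma-algebra: Lebesgue measurable functions are those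
   that agree a.e. with a Borel one. *)
Definition ae_measurable (D : set X) (f : X -> R) :=
  exists2 g, measurable_fun D g & {ae mu, forall x, D x -> f x = g x}.

Definition LpNorm (D : set X) (p : R) (f : X -> R) : \bar R :=
  'N[mu]_(p%:E)[(EFin \o f) \_ D].

Definition inLp (D : set X) (p : R) (f : X -> R) :=
  ae_measurable D f /\ (LpNorm D p f < +oo)%E.

Definition ess_sup_on (D : set X) (f : X -> R) : \bar R :=
  ess_sup mu (patch (fun=> -oo%E) D (EFin \o f)).

Definition ess_inf_on (D : set X) (f : X -> R) : \bar R :=
  ess_inf mu (patch (fun=> +oo%E) D (EFin \o f)).

End Lp_spaces.

Section test_functions.
Context {R : realType} {V : normedModType R}.

Fixpoint iter_derive (vs : seq V) (f : V -> R) : V -> R :=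
  if vs is v :: vs' then 'D_v (iter_derive vs' f) else f.

(* In finite dimension, this is C^infty. *)
Definition smooth (f : V -> R) := forall vs : seq V,
  continuous (iter_derive vs f) /\
  forall x v, derivable (iter_derive vs f) x v.

Definition test_fun (D : set V) (f : V -> R) :=
  let supp := closure [set x | f x != 0] in
  [/\ smooth f, compact supp & supp `<=` D].

End test_functions.

Section parabolic.
Context {R : realType} (N : nat).
Implicit Types (Om : set 'rV[R]_N) (T : R).

Local Notation leb := (lebesgue_rV N).
Local Notation mu := (lebesgue_rVxR N).

Definition dspace (i : 'I_N) (phi : 'rV[R]_N * R -> R) : 'rV[R]_N * R -> R :=
  'D_((delta_mx ord0 i, 0) : 'rV[R]_N * R) phi.

Definition dtime (phi : 'rV[R]_N * R -> R) : 'rV[R]_N * R -> R :=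
  'D_((0, 1) : 'rV[R]_N * R) phi.

Definition pderiv (i : 'I_N) (eta : 'rV[R]_N -> R) : 'rV[R]_N -> R :=
  'D_(delta_mx ord0 i : 'rV[R]_N) eta.

(* The library norm on 'rV is the max norm. *)
Definition enorm (x : 'rV[R]_N) : R := Num.sqrt (\sum_i x ord0 i ^+ 2).

Definition grad (eta : 'rV[R]_N -> R) (x : 'rV[R]_N) : 'rV[R]_N :=
  \row_i pderiv i eta x.

Definition cyl Om T : set ('rV[R]_N * R) := Om `*` `]0, T[.

Definition Qcyl (p r : R) (zo : 'rV[R]_N * R) : set ('rV[R]_N * R) :=
  [set x | enorm (x - zo.1) < r] `*` `]zo.2 - r `^ p, zo.2[.

Definition compactly_contained (X : topologicalType) (A B : set X) :=
  compact (closure A) /\ closure A `<=` B.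

Definition L1loc (D : set ('rV[R]_N * R)) (f : 'rV[R]_N * R -> R) :=
  ae_measurable mu D f /\
  forall K, compact K -> K `<=` D -> (\int[mu]_(z in K) `|f z|%:E < +oo)%E.

Definition weak_pderiv Om (i : 'I_N) (v g : 'rV[R]_N -> R) :=
  forall eta, test_fun Om eta ->
  (\int[leb]_(x in Om) (v x * pderiv i eta x)%:E =
   - \int[leb]_(x in Om) (g x * eta x)%:E)%E.

Definition W1p Om (p : R) (v : 'rV[R]_N -> R) (Dv : 'I_N -> 'rV[R]_N -> R) :=
  inLp leb Om p v /\
  forall i, inLp leb Om p (Dv i) /\ weak_pderiv Om i v (Dv i).

(* u belongs to L^p(0,T;W^{1,p}(Om)) with spatial weak gradient Du. W^{1,p}(Om)
   being separable, the joint measurability of u and Du amounts to the strong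
   measurability of t |-> u(., t). *)
Definition LpW1p Om T (p : R) (u : 'rV[R]_N * R -> R)
    (Du : 'I_N -> 'rV[R]_N * R -> R) :=
  [/\ ae_measurable mu (cyl Om T) u,
      forall i, ae_measurable mu (cyl Om T) (Du i),
      {ae @lebesgue_measure R, forall t, `]0, T[%classic t ->
         W1p Om p (fun x => u (x, t)) (fun i x => Du i (x, t))} &
      (\int[@lebesgue_measure R]_(t in `]0%R, T[)
         (LpNorm leb Om p (fun x => u (x, t)) `^ p +
          \sum_(i < N) LpNorm leb Om p (fun x => Du i (x, t)) `^ p) < +oo)%E].

(* ut is the representative of u in C^0([0,T];L^q(Om)); it gives a meaning to
   the value of u at every time, including 0 and T. *)
Definition C0Lq Om T (q : R) (u : 'rV[R]_N * R -> R)
    (ut : R -> 'rV[R]_N -> R) :=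
  [/\ forall t, `[0, T]%classic t -> inLp leb Om q (ut t),
      forall t, `[0, T]%classic t ->
        (fun s => LpNorm leb Om q (ut s \- ut t)) @ within `[0, T] (nbhs t)
          --> 0%E &
      {ae @lebesgue_measure R, forall t, `]0, T[%classic t ->
         {ae leb, forall x, Om x -> u (x, t) = ut t x}}].

Definition flux (a : 'I_N -> 'rV[R]_N * R -> R) (p : R) (delta : 'I_N -> R)
    (i : 'I_N) (z : 'rV[R]_N * R) (xi : 'I_N -> R) : R :=
  a i z * (Num.max (`|xi i| - delta i) 0) `^ (p - 1) * (xi i / `|xi i|).

Definition weak_solution Om T (alpha p : R) (delta : 'I_N -> R)
    (a : 'I_N -> 'rV[R]_N * R -> R) (f u : 'rV[R]_N * R -> R) :=
  L1loc (cyl Om T) f /\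
  exists (Du : 'I_N -> 'rV[R]_N * R -> R) (ut : R -> 'rV[R]_N -> R),
  [/\ LpW1p Om T p u Du, C0Lq Om T (alpha + 1) u ut &
  forall phi, test_fun (cyl Om T) phi ->
  (\int[mu]_(z in cyl Om T)
     (\sum_(i < N) flux a p delta i z (Du^~ z) * dspace i phi z -
      spow (u z) alpha * dtime phi z)%:E =
   \int[mu]_(z in cyl Om T) (f z * phi z)%:E)%E].

(* The supremum over all times uses the continuous representative ut. A function
   of C^infty([0,T]) is the restriction to [0,T] of a smooth phi : R -> R. *)
Definition energy_inequality Om T (alpha p : R) (delta : 'I_N -> R)
    (f u : 'rV[R]_N * R -> R) (Du : 'I_N -> 'rV[R]_N * R -> R)
    (ut : R -> 'rV[R]_N -> R) (C k : R) (eta : 'rV[R]_N -> R) (phi : R -> R)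
    (plus : bool) :=
  let h := (alpha + 1) / 2 in
  (ereal_sup [set \int[leb]_(x in Om)
       (sgn_part plus (spow (ut tau x) h - spow k h) ^+ 2
        * eta x `^ p * phi tau)%:E | tau in `[0%R, T]] +
   \sum_(i < N) \int[mu]_(z in cyl Om T)
       ((Num.max (`|Du i z| - delta i) 0) `^ p * eta z.1 `^ p * phi z.2
        * \1_[set y | 0 < sgn_part plus (u y - k)]%R z)%:E
   <= C%:E * \int[mu]_(z in cyl Om T)
        (sgn_part plus (u z - k) `^ p * enorm (grad eta z.1) `^ p
         * phi z.2)%:E
    + C%:E * \int[mu]_(z in cyl Om T)
        (sgn_part plus (spow (u z) h - spow k h) ^+ 2 * eta z.1 `^ p
         * Num.max (phi^`()%classic z.2) 0)%:E
    + C%:E * \int[mu]_(z in cyl Om T)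
        (sgn_part plus (u z - k) * `|f z| * eta z.1 `^ p * phi z.2)%:E)%E.

Definition energy_class Om T (alpha p : R) (delta : 'I_N -> R)
    (f : 'rV[R]_N * R -> R) (C : R) (u : 'rV[R]_N * R -> R) :=
  ae_measurable mu (cyl Om T) f /\
  exists (Du : 'I_N -> 'rV[R]_N * R -> R) (ut : R -> 'rV[R]_N -> R),
  [/\ LpW1p Om T p u Du, C0Lq Om T (alpha + 1) u ut &
  forall (k : R) (eta : 'rV[R]_N -> R) (phi : R -> R),
    test_fun Om eta -> (forall x, 0 <= eta x) ->
    smooth phi -> (forall t, 0 <= t <= T -> 0 <= phi t) ->
    (exists2 e, 0 < e & forall t, 0 <= t < e -> phi t = 0) ->
    forall plus : bool,
      energy_inequality Om T alpha p delta f u Du ut C k eta phi plus].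

Definition local_bound (alpha p sigma c : R) (f w : 'rV[R]_N * R -> R)
    (zo : 'rV[R]_N * R) (r s : R) : \bar R :=
  let P : R := Num.max (alpha + 1) p in
  let P' : R := P / (P - 1) in
  let D : R := p * (N%:R + alpha + 1) - N%:R * P in
  let e1 : R := p / D in
  let e2 : R := p / (D + p * P * Num.min 0 (sigma / P' - 1)) in
  (c%:E * ((1 + (r * (1 - s)) `^ (- (N%:R + p)))%:E
           * \int[mu]_(z in Qcyl p r zo) (w z `^ P)%:E) `^ e1
   + c%:E * (1 + \int[mu]_(z in Qcyl p r zo) (`|f z| `^ sigma)%:E) `^ e2)%E.

Definition local_estimates Om T (alpha p sigma c : R)
    (f u : 'rV[R]_N * R -> R) :=
  forall (zo : 'rV[R]_N * R) (r s : R), 0 < r ->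
  compactly_contained (Qcyl p r zo) (cyl Om T) -> 0 < s < 1 ->
  (ess_sup_on mu (Qcyl p (s * r) zo) u
     <= local_bound alpha p sigma c f (sgn_part true \o u) zo r s)%E /\
  (- ess_inf_on mu (Qcyl p (s * r) zo) u
     <= local_bound alpha p sigma c f (sgn_part false \o u) zo r s)%E.

End parabolic.

(* Main.v *)
(* De Giorgi iteration on boxes. With product cut-offs, the energy inequality
bounds the truncations of [w] in L^oo(L^q), q = alpha + 1, and their gradients
in L^p. A weak-type Gagliardo-Nirenberg inequality, obtained by comparing a
function with its translates, turns this into fast decay of the integrals of
[|w|^P] over [w > k] along shrinking boxes and increasing levels; countably many
boxes cover the smaller cylinder. A weak solution satisfies the same energy
inequality: its equation is tested with translates of a truncation, and the
convexity of the time term replaces a chain rule in time. The lower bound is the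
upper bound for [- u]. *)

Require Import Defs.
From HB Require Import structures.
From mathcomp Require Import all_boot all_order all_algebra.
From mathcomp Require Import all_classical all_reals all_analysis ess_sup_inf.
From mathcomp Require Import measurable_realfun lebesgue_integral.
From mathcomp Require Import ring lra.

Set Implicit Arguments.
Unset Strict Implicit.
Unset Printing Implicit Defensive.

Import Order.TTheory GRing.Theory Num.Theory.
Import numFieldNormedType.Exports.

Local Open Scope classical_set_scope.
Local Open Scope ring_scope.

Local Notation measT := (measurable_fun setT).
Local Notation letr y := (@le_trans _ _ y).
Local Notation mfunM := measurable_funM.
Local Notation mcomp := measurableT_comp.
Local Notation mEFinP := measurable_EFinP.
Local Notation mindic := measurable_indic.
Local Notation mpowR r := (mcomp (measurable_powR r)).
Local Notation mR := measurableTypeR.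

Ltac ext := apply/funext.
Ltac powR_mono := apply: ge0_ler_powR; rewrite ?nnegrE.

(** The energy inequality has the integral of [(w - k)_+ |f|] on its right. For [f] in L^sigma this
    term can only be estimated by the weak-type bound that the energy itself yields, so one step
    gives an implicit inequality in which the energy reappears with a power above 1; the free
    splitting level of the layer-cake bound is what makes it absorbable. Two strict inequalities
    drive the iteration: [P < m] for the exponent [m = p + p q / N], whose essential half is the
    lower bound on [p], and [sigma' < 1 + p / N], which is the lower bound on [sigma]. All powers of
    [k] balance when the energy is measured in units of [k^(D/p) R0^N] and the norm of [f] in units
    of [k^X]; solving the two resulting smallness conditions for [k] gives the exponents [p / D] and
    [1 / (sigma X)]. Levels stay above 1/2, so that every lower power of [w] is at most [2^P w^P];
    this costs an additive 1 in [k]. Test functions are products of one-variable functions, with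
    explicit powers, derivatives and supports. Correlations [xi |-> int F(z + xi) V(z) dz] take the
    place of mollification: they are continuous, so mean-value arguments apply to them. *)

Lemma le_of_eq d (T : porderType d) (x y : T) : x = y -> (x <= y)%O.
Proof. by move->. Qed.

(** * Real-valued integrals, Fubini and superlevel sets *)

Section real_integrals.
Context d (X : measurableType d) (R : realType).
Variable m : {measure set X -> \bar R}.
Implicit Types F G : X -> R.

Definition Rintg (F : X -> R) := m.-integrable setT (EFin \o F).
Definition Rint (F : X -> R) : R := \int[m]_z F z.

Lemma itgm F : Rintg F -> measT F.
Proof. by move=> /integrableP[/mEFinP]. Qed.

Lemma itgN F : Rintg F -> Rintg (fun z => - F z).
Proof. exact: integrableN. Qed.

Lemma itgD F G : Rintg F -> Rintg G -> Rintg (fun z => F z + G z).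
Proof. by move=> h1 h2; apply: (integrableD _ h1 h2). Qed.

Lemma itgB F G : Rintg F -> Rintg G -> Rintg (fun z => F z - G z).
Proof. by move=> h1 h2; apply: itgD => //; exact: itgN. Qed.

Lemma itgZ c F : Rintg F -> Rintg (fun z => c * F z).
Proof. by move=> h1; apply: (@integrableZl _ _ _ m setT measurableT c _ h1). Qed.

Lemma itg_sum (I : Type) (s : seq I) (F : I -> X -> R) :
 (forall i, Rintg (F i)) -> Rintg (fun z => \sum_(i <- s) F i z).
Proof.
move=> h; elim: s => [|i s IH].
 by under eq_fun do rewrite big_nil; exact: integrable0.
by under eq_fun do rewrite big_cons; exact: itgD.
Qed.

Lemma itg_norm F : Rintg F -> Rintg (fun z => `|F z|).
Proof. by move=> h; apply: (integrable_norm h). Qed.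

Lemma itg_le F G : measurable_fun [set: X] F -> (forall z, `|F z| <= `|G z|) ->
 Rintg G -> Rintg F.
Proof.
move=> mF FG iG; apply: (le_integrable _ _ _ iG) => //; first exact/mEFinP.
by move=> z _; rewrite /= lee_fin.
Qed.

Lemma itg_bnd F G (M : R) : measT G -> (forall z, `|G z| <= M) ->
 Rintg F -> Rintg (fun z => F z * G z).
Proof.
move=> mG GM iF; apply: (@itg_le _ (fun z => M * F z)); last exact: itgZ.
 by apply: mfunM => //; exact: itgm.
move=> z; rewrite !normrM mulrC ler_wpM2r//.
by apply: (le_trans (GM z)); exact: ler_norm.
Qed.

Lemma IID F G : Rintg F -> Rintg G -> Rint (fun z => F z + G z) = Rint F + Rint G.
Proof. by move=> h1 h2; exact: RintegralD. Qed.

Lemma IIB F G : Rintg F -> Rintg G -> Rint (fun z => F z - G z) = Rint F - Rint G.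
Proof. by move=> h1 h2; exact: RintegralB. Qed.

Lemma IIZ c F : Rintg F -> Rint (fun z => c * F z) = c * Rint F.
Proof. by move=> h1; exact: RintegralZl. Qed.

Lemma IIN F : Rintg F -> Rint (fun z => - F z) = - Rint F.
Proof.
move=> h; rewrite -[RHS]mulN1r -IIZ//; congr Rint.
by ext => z; rewrite mulN1r.
Qed.

Lemma II_sum (I : Type) (s : seq I) (F : I -> X -> R) : (forall i, Rintg (F i)) ->
 Rint (fun z => \sum_(i <- s) F i z) = \sum_(i <- s) Rint (F i).
Proof.
move=> h; elim: s => [|i s IH].
 rewrite big_nil /Rint /Rintegral; under eq_integral do rewrite big_nil.
 by rewrite integral0.
rewrite big_cons -IH -IID//; last exact: itg_sum.
by congr Rint; ext => z; rewrite big_cons.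
Qed.

Lemma le_II F G : Rintg F -> Rintg G -> (forall z, F z <= G z) -> Rint F <= Rint G.
Proof. by move=> h1 h2 h; apply: le_Rintegral. Qed.

Lemma II_ge0 F : (forall z, 0 <= F z) -> 0 <= Rint F.
Proof. by move=> h; apply: Rintegral_ge0. Qed.

Lemma normII F : Rintg F -> `|Rint F| <= Rint (fun z => `|F z|).
Proof. by move=> h; apply: le_normr_Rintegral. Qed.

Lemma IIE F : Rintg F -> (Rint F)%:E = (\int[m]_z (F z)%:E)%E.
Proof.
by move=> h; rewrite /Rint /Rintegral fineK//; exact: integrable_fin_num.
Qed.

(** The sigma-algebras in use are not complete, so the measurability of [G] has to be assumed: it
    does not follow from equality almost everywhere. *)
Lemma eq_II_ae F G : Rintg F -> measT G ->
 {ae m, forall z, F z = G z} -> Rintg G /\ Rint G = Rint F.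
Proof.
move=> iF mG FG.
have mF := itgm iF.
split; last first.
 rewrite /Rint /Rintegral; congr fine; apply: ae_eq_integral => //.
 - exact/mEFinP.
 - exact/mEFinP.
 - by apply: filterS FG => z -> _.
apply/integrableP; split; first exact/mEFinP.
have /integrableP[_] := iF; congr (_ < _)%E.
apply: ae_eq_integral => //.
- by apply: mcomp => //; exact/mEFinP.
- by apply: mcomp => //; exact/mEFinP.
- by apply: filterS FG => z /= -> _.
Qed.

Lemma itg_dom (g F : X -> R) : measurable_fun [set: X] F ->
 (forall z, `|F z| <= g z) -> Rintg g -> Rintg F.
Proof.
move=> mF h; apply: itg_le => // z; apply: (le_trans (h z)); exact: ler_norm.
Qed.

Lemma II_dct (f_ : nat -> X -> R) (f g : X -> R) :
 (forall n, measT (f_ n)) -> measT f ->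
 {ae m, forall z, f_ n z @[n --> \oo] --> f z} -> Rintg g ->
 (forall n z, `|f_ n z| <= g z) ->
 Rintg f /\ forall e, 0 < e -> exists n0, forall n, (n0 <= n)%N ->
  Rint (fun z => `|f_ n z - f z|) <= e.
Proof.
move=> mf_ mf cvf ig fg.
have [] := @dominated_convergence _ _ _ m setT measurableT
 (fun n => EFin \o f_ n) (EFin \o f) (EFin \o g).
- by move=> n; exact/mEFinP.
- exact/mEFinP.
- by apply: filterS cvf => z h _; exact: (cvg_comp _ _ h).
- exact: ig.
- by apply: aeW => z n _; rewrite /= lee_fin.
move=> if_ h _; split; first exact: if_.
move=> e e0; move/fine_cvgP : h => [_] /cvgrPdist_le /(_ e e0)[n0 _ hn0].
exists n0 => n nn0; have := hn0 n nn0; rewrite sub0r normrN.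
by apply: le_trans; rewrite /Rint /Rintegral /=; exact: ler_norm.
Qed.

Lemma II_cvg (f_ : nat -> X -> R) (f g : X -> R) :
 (forall n, measT (f_ n)) -> measT f ->
 {ae m, forall z, f_ n z @[n --> \oo] --> f z} -> Rintg g ->
 (forall n z, `|f_ n z| <= g z) -> Rint (f_ n) @[n --> \oo] --> Rint f.
Proof.
move=> mf_ mf cvf ig fg; have [if_ h] := II_dct mf_ mf cvf ig fg.
apply/cvgrPdist_le => e e0; have [n0 hn0] := h e e0.
exists n0 => // n /= nn0; apply: le_trans (hn0 n nn0).
have ifn : Rintg (f_ n) by exact: itg_dom ig.
rewrite distrC -IIB//; apply: normII; exact: itgB.
Qed.

Lemma integral_indicT (A : set X) : measurable A ->
 (\int[m]_x (\1_A x)%:E = m A)%E.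
Proof. by move=> mA; rewrite integral_indic// setIT. Qed.

Lemma itg_indic (A : set X) : measurable A -> (m A < +oo)%E -> Rintg \1_A.
Proof. move=> mA fA; apply/integrableP; split.
 by apply/mEFinP; exact: mindic.
rewrite (eq_integral (fun x => (\1_A x)%:E)); last first.
 by move=> x _; rewrite /= ger0_norm// indicE.
by rewrite integral_indicT. Qed.

End real_integrals.

Section measure_preserving.
Context d (X : measurableType d) (R : realType).
Variable m : {measure set X -> \bar R}.
Variable phi : X -> X.
Hypothesis mphi : measT phi.
Hypothesis phiP : forall A, measurable A -> m (phi @^-1` A) = m A.

Lemma ge0_integral_preserving (F : X -> \bar R) : measT F ->
 (forall z, 0 <= F z)%E -> (\int[m]_z F (phi z) = \int[m]_z F z)%E.
Proof.
move=> mF F0.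
have := @ge0_integral_pushforward _ _ _ _ _ _ mphi m setT F measurableT mF (fun x _ => F0 x).
rewrite preimage_setT => <-.
by apply: eq_measure_integral => A mA _; exact: phiP.
Qed.

Lemma itg_preserving (F : X -> R) : Rintg m F -> Rintg m (fun z => F (phi z)).
Proof.
move=> /integrableP[mF iF]; apply/integrableP; split.
 exact: (mcomp mF mphi).
by rewrite (@ge0_integral_preserving (fun z => `|(F z)%:E|%E))//; exact: mcomp.
Qed.

Lemma II_preserving (F : X -> R) : Rintg m F -> Rint m (fun z => F (phi z)) = Rint m F.
Proof.
move=> iF; have /integrableP[mF _] := iF; rewrite /Rint /Rintegral; congr fine.
have := @integral_pushforward _ _ _ _ _ _ mphi m setT (EFin \o F) mF.
rewrite preimage_setT => <-//; last exact: itg_preserving.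
by apply: eq_measure_integral => A mA _; exact: phiP.
Qed.

End measure_preserving.

(** The inner integrals in Fubini's theorem are extended reals, finite only almost everywhere.
    Passing to [fine] puts 0 at the exceptional points and changes no integral. *)
Lemma itg_fine d (X : measurableType d) (R : realType) (m : {measure set X -> \bar R})
  (G : X -> \bar R) : m.-integrable setT G ->
 Rintg m (fine \o G) /\ Rint m (fine \o G) = fine (\int[m]_x G x)%E.
Proof.
move=> iG; have /integrableP[mG oG] := iG.
have mF : measT (EFin \o (fine \o G)).
 by apply/mEFinP; apply: mcomp.
have E : {ae m, forall x, (setT : set X) x -> G x = (EFin \o (fine \o G)) x}.
 apply: filterS (integrable_ae measurableT iG) => x /(_ I) + _.
 by move=> h; rewrite /= fineK.
split; last first.
 by rewrite /Rint /Rintegral -(ae_eq_integral _ _ _ _ _ E).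
apply/integrableP; split => //; apply: le_lt_trans oG; rewrite le_eqVlt.
apply/orP; left; apply/eqP; apply: ae_eq_integral => //.
- exact: mcomp.
- exact: mcomp.
- by apply: filterS E => x /= h1 _; rewrite [in RHS]h1.
Qed.

Section fubini_real.
Context d1 d2 (X : measurableType d1) (Y : measurableType d2) (R : realType).
Variables (m1 : {sigma_finite_measure set X -> \bar R})
 (m2 : {sigma_finite_measure set Y -> \bar R}) (f : X * Y -> R).

Lemma itg_prod (g : X -> R) : measT f -> Rintg m1 g ->
 (forall x, Rintg m2 (fun y => f (x, y)) /\ Rint m2 (fun y => `|f (x, y)|) <= g x) ->
 (m1 \x m2)%E.-integrable setT (EFin \o f).
Proof.
move=> mf ig h; apply/integrable12ltyP; first exact/mEFinP.
have /integrableP[_] := ig; apply: le_lt_trans.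
apply: ge0_le_integral => //.
- by move=> x _; exact: integral_ge0.
- apply: (@measurable_fun_fubini_tonelli_F _ _ _ _ _ m2 (abse \o EFin \o f)) => //.
  by apply: mcomp => //; exact/mEFinP.
 by move=> z; exact: abse_ge0.
- by have /integrableP[mg _] := ig; apply: mcomp.
move=> x _; have [i le] := h x.
rewrite (_ : (\int[m2]_y _)%E = (Rint m2 (fun y => `|f (x, y)|))%:E).
 by rewrite lee_fin; apply: le_trans le _; exact: ler_norm.
by rewrite IIE//; exact: itg_norm.
Qed.

Hypothesis if_ : (m1 \x m2)%E.-integrable setT (EFin \o f).

Lemma itg_fubini1 : Rintg m1 (fun x => Rint m2 (fun y => f (x, y))).
Proof. by have [] := itg_fine (integrable_fubini_F if_). Qed.

Let if_swap : (m2 \x m1)%E.-integrable setT (EFin \o (fun z => f (z.2, z.1))).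
Proof.
have /integrableP[mf _] := if_.
apply/integrable12ltyP; last exact/(integrable21ltyP _ _ mf).
by apply: (mcomp mf); apply: measurable_fun_pair; [exact: measurable_snd|exact: measurable_fst].
Qed.

Lemma itg_fubini2 : Rintg m2 (fun y => Rint m1 (fun x => f (x, y))).
Proof. by have [] := itg_fine (integrable_fubini_F if_swap). Qed.

Lemma II_fubini : Rint m1 (fun x => Rint m2 (fun y => f (x, y))) =
 Rint m2 (fun y => Rint m1 (fun x => f (x, y))).
Proof.
have [_ h1] := itg_fine (integrable_fubini_F if_).
have [_ h2] := itg_fine (integrable_fubini_F if_swap).
rewrite [LHS]h1 [RHS]h2; congr fine; exact: Fubini.
Qed.

End fubini_real.

Section superlevel_sets.
Context d (X : measurableType d) (R : realType).
Variable m : {measure set X -> \bar R}.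
Implicit Types (F G : X -> R) (k : R).

Lemma mset_itv F (i : interval R) : measT F -> measurable [set x | F x \in i].
Proof.
move=> mF; rewrite (_ : [set x | _] = setT `&` F @^-1` [set` i]); last by rewrite setTI.
by apply: mF => //; exact: measurable_itv.
Qed.

Lemma mset_gt F k : measT F -> measurable [set x | k < F x].
Proof.
move=> /(@mset_itv F `]k, +oo[); congr measurable.
by apply/seteqP; split => x /=; rewrite in_itv/= andbT.
Qed.

Lemma mset_lt F k : measT F -> measurable [set x | F x < k].
Proof. by move=> /(@mset_itv F `]-oo, k[); congr measurable. Qed.

Lemma mset_le F k : measT F -> measurable [set x | F x <= k].
Proof. by move=> /(@mset_itv F `]-oo, k]); congr measurable. Qed.

Lemma measurable_indicE (A : set X) : measurable A ->
 measT (fun x => (\1_A x)%:E : \bar R).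
Proof. by move=> mA; apply/mEFinP; exact: mindic. Qed.

Lemma integral_cindic (c : R) (A : set X) : 0 <= c -> measurable A ->
 (\int[m]_x (c * \1_A x)%:E = c%:E * m A)%E.
Proof.
move=> c0 mA; rewrite -(integral_indicT m mA) -ge0_integralZl//.
exact: measurable_indicE.
Qed.

Lemma markov_itg F k : Rintg m F -> (forall x, 0 <= F x) -> 0 < k ->
 (m [set x | (k < F x)%R] <= (Rint m F / k)%:E)%E.
Proof.
move=> iF F0 k0; have mA := mset_gt k (itgm iF).
have : (\int[m]_x (k * \1_[set x | (k < F x)%R] x)%:E <= (Rint m F)%:E)%E.
 rewrite (IIE iF); apply: ge0_le_integral => //.
 - by move=> x _; rewrite lee_fin mulr_ge0// ltW.
 - by apply/mEFinP; apply: mfunM => //; exact: mindic.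
 - by apply/mEFinP; exact: (itgm iF).
 move=> x _; rewrite lee_fin indicE; case: (boolP (x \in _)).
  by rewrite inE mulr1 => /ltW.
 by rewrite mulr0.
rewrite integral_cindic ?(ltW k0)// => h.
by rewrite EFinM lee_pdivlMr// muleC.
Qed.

Lemma markov_fin F k : Rintg m F -> (forall x, 0 <= F x) -> 0 < k ->
 (m [set x | (k < F x)%R] < +oo)%E.
Proof. by move=> iF F0 k0; apply: le_lt_trans (markov_itg iF F0 k0) (ltry _). Qed.

End superlevel_sets.

(** * Lebesgue measure on row vectors: boxes, translations, reflections *)

Section lebesgue_rV_theory.
Context {R : realType}.
Notation lam := (@lebesgue_measure R).

Lemma measurable_rV_box n (A : 'I_n -> set R) :
 (forall i, measurable (A i : set (mR R))) ->
 measurable [set x : 'rV[R]_n | forall i, A i (x ord0 i)].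
Proof.
move=> mA.
rewrite (_ : [set x | _] = \big[setI/setT]_(i < n) ((fun x : 'rV[R]_n => x ord0 i) @^-1` (A i))).
 apply: bigsetI_measurable => i _.
 by rewrite -[X in measurable X]setTI; exact: measurable_coord.
rewrite -bigcap_seq; apply/seteqP; split => x /= h i.
 by move=> _; exact: h.
by apply: h; rewrite /= mem_index_enum.
Qed.

Lemma rV_cons_coord n (x : 'rV[R]_n) (t : R) :
 rV_cons (x, t : mR R) ord0 ord0 = t.
Proof. by rewrite mxE unlift_none. Qed.

Lemma rV_cons_lift n (x : 'rV[R]_n) (t : R) i :
 rV_cons (x, t : mR R) ord0 (lift ord0 i) = x ord0 i.
Proof. by rewrite mxE liftK. Qed.

(** This ties the recursively built measure to volume. [rV_cons] inserts the new coordinate at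
    position 0, so the preimage of a box is a smaller box times the interval of that coordinate. *)
Lemma lebesgue_rV_box n (a b : 'I_n -> R) : (forall i, a i <= b i) ->
 lebesgue_rV n [set x : 'rV[R]_n | forall i, `]a i, b i[%classic (x ord0 i)] =
 (\prod_i (b i - a i))%:E.
Proof.
elim: n a b => [|n IH] a b ab.
 by rewrite big_ord0 /= diracE mem_set// => -[].
rewrite [LHS]/=/lebesgue_rVS/pushforward.
rewrite (_ : _ @^-1` _ =
 [set x : 'rV[R]_n | forall i, `]a (lift ord0 i), b (lift ord0 i)[%classic (x ord0 i)]
 `*` `]a ord0, b ord0[%classic); last first.
 apply/seteqP; split => -[x t] /=.
  by move=> h; split => [i|]; [have := h (lift ord0 i)|have := h ord0];
   rewrite ?rV_cons_lift ?rV_cons_coord.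
 move=> [h1 h2] i; case: (unliftP ord0 i) => [j|] ->.
  by rewrite rV_cons_lift; exact: h1.
 by rewrite rV_cons_coord.
rewrite product_measure1E//=; last first.
 exact: (measurable_rV_box (A := fun i => `]a (lift ord0 i), b (lift ord0 i)[%classic)).
rewrite IH// lebesgue_measure_itv/= big_ord_recl mulrC lte_fin.
case: ltP => [_|]; first by rewrite EFinM.
move=> h; have -> : b ord0 = a ord0 by apply/eqP; rewrite eq_le h ab.
by rewrite subrr mulr0 mule0.
Qed.

(** A copy of [lebesgue_rV n] as a bare set function, to which the sigma-finite structure demanded
    by Fubini's theorem can be attached. *)
Definition leb n : set 'rV[R]_n -> \bar R := lebesgue_rV n.
HB.instance Definition _ n := Measure.on (@leb n).

Lemma leb_sigma_finite n : sigma_finite setT (@leb n).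
Proof.
exists (fun k : nat => [set x : 'rV[R]_n | forall i, `]- k%:R, k%:R[%classic (x ord0 i)]).
 apply/seteqP; split => // x _.
 have [k hk] : exists k : nat, forall i, `|x ord0 i| < k%:R.
  exists (\max_(i < n) (Num.truncn `|x ord0 i|).+1)%N => i.
  apply: lt_le_trans (truncnS_gt _) _; rewrite ler_nat.
  exact: (leq_bigmax i).
 by exists k => // i; rewrite /= in_itv/= -ltr_norml.
move=> k; split.
 exact: (measurable_rV_box (A := fun i => `]- k%:R, k%:R[%classic)).
have := @lebesgue_rV_box n (fun=> - k%:R) (fun=> k%:R) (fun _ => (ge0_cp (ler0n _ _)).2).
by rewrite /leb => ->; rewrite ltry.
Qed.

HB.instance Definition _ n :=
 Measure_isSigmaFinite.Build _ _ _ (@leb n) (@leb_sigma_finite n).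

(** Translations and point reflections in one definition, so that invariance is proved once.
    Reflections occur when the roles of the two factors of a correlation are exchanged. *)
Definition affl (V : zmodType) (b : bool) (y x : V) : V := (if b then - x else x) + y.

Lemma lebesgue_affl b (y : R) (A : set (mR R)) : measurable A ->
 lam (affl b y @^-1` A) = lam A.
Proof.
move=> mA; have ms : measT (affl b y : mR R -> mR R).
 apply: measurable_funD => //.
 by case: b; [exact: measurable_funN|exact: measurable_id].
symmetry.
have := @lebesgue_measure_unique R (pushforward lam (affl b y : mR R -> mR R)).
apply => // X [[u v] /= _ <-].
rewrite lebesgue_measure_itv /pushforward; case: b ms => ms.
 (* A reflection turns the half-open interval round; the other endpoint is now included, which does
    not change the length. *)
 rewrite (_ : _ @^-1` _ = `[y - v, y - u[%classic).
  rewrite lebesgue_measure_itv/= !lte_fin ltrD2l ltrN2; case: ifP => // _.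
  by rewrite -!EFinB; congr EFin; ring.
 apply/seteqP; split => x /=; rewrite /affl !in_itv/= => /andP[h1 h2];
  by apply/andP; split; lra.
rewrite (_ : _ @^-1` _ = `]u - y, v - y]%classic).
 rewrite lebesgue_measure_itv/= !lte_fin ltrD2r; case: ifP => // _.
 by rewrite -!EFinB; congr EFin; ring.
by apply/seteqP; split => x /=; rewrite /affl !in_itv/= ltrBlDr lerBrDr.
Qed.

(** The image of the product measure has the right values on measurable rectangles, and these
    determine a product of sigma-finite measures. *)
Lemma product_measure_map d1 d2 (T1 : measurableType d1) (T2 : measurableType d2)
 (m1 : {sigma_finite_measure set T1 -> \bar R})
 (m2 : {sigma_finite_measure set T2 -> \bar R}) (f1 : T1 -> T1) (f2 : T2 -> T2) :
 measT f1 -> measT f2 ->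
 (forall A, measurable A -> m1 (f1 @^-1` A) = m1 A) ->
 (forall A, measurable A -> m2 (f2 @^-1` A) = m2 A) ->
 forall A, measurable A ->
 (m1 \x m2)%E ((fun z => (f1 z.1, f2 z.2)) @^-1` A) = (m1 \x m2)%E A.
Proof.
move=> mf1 mf2 h1 h2 A mA.
have ms : measT (fun z : T1 * T2 => (f1 z.1, f2 z.2)).
 by apply: measurable_fun_pair; apply: mcomp.
symmetry; apply: (@product_measure_unique _ _ _ _ _ m1 m2
 (pushforward (m1 \x m2)%E (fun z : T1 * T2 => (f1 z.1, f2 z.2)))) => // B C mB mC.
have mB' : measurable (f1 @^-1` B) by rewrite -[X in measurable X]setTI; apply: mf1.
have mC' : measurable (f2 @^-1` C) by rewrite -[X in measurable X]setTI; apply: mf2.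
rewrite -h1// -h2//.
rewrite -[RHS](@product_measure1E _ _ _ _ _ m1 m2)//.
Qed.

Lemma measurable_rV_add d (X : measurableType d) n (f g : X -> 'rV[R]_n) :
 measT f -> measT g ->
 measT (fun x => f x + g x).
Proof.
move=> mf mg; apply: measurable_fun_rVP => i; under eq_fun do rewrite mxE.
by apply: measurable_funD;
 apply: (mcomp (measurable_coord i)).
Qed.

Lemma measurable_rV_opp d (X : measurableType d) n (f : X -> 'rV[R]_n) :
 measT f -> measT (fun x => - f x).
Proof.
move=> mf; apply: measurable_fun_rVP => i; under eq_fun do rewrite mxE.
by apply: measurable_funN; apply: (mcomp (measurable_coord i)).
Qed.

(** Induction on the dimension: through [rV_cons] the map acts separately on the first coordinate
    and on the remaining ones. *)
Lemma leb_affl n b (y : 'rV[R]_n) (A : set 'rV[R]_n) : measurable A ->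
 leb (affl b y @^-1` A) = leb A.
Proof.
rewrite /leb; elim: n y A => [|n IH] y A mA.
 rewrite /= !diracE; congr (_%:R%:E); congr nat_of_bool.
 by rewrite (_ : _ @^-1` _ = A)//; apply/seteqP; split => x /=;
  rewrite (_ : affl b y x = x)//; apply/matrixP => ? [].
rewrite /= /lebesgue_rVS /pushforward.
pose f1 : 'rV[R]_n -> 'rV[R]_n := affl b (\row_i y ord0 (lift ord0 i)).
pose f2 : mR R -> mR R := affl b (y ord0 ord0).
rewrite (_ : _ @^-1` _ = (fun z => (f1 z.1, f2 z.2)) @^-1` ((@rV_cons R n) @^-1` A)); last first.
 rewrite [RHS](_ : _ = (fun z => rV_cons (f1 z.1, f2 z.2)) @^-1` A)//.
 rewrite [LHS](_ : _ = (fun z => affl b y (rV_cons z)) @^-1` A)//.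
 apply: (congr1 (fun f => f @^-1` A)).
 ext => -[x t]; apply/rowP => i.
 by rewrite /f1 /f2 /affl; case: (b); rewrite !mxE;
  case: (unliftP ord0 i) => [j|] ->; rewrite ?mxE.
apply: (@product_measure_map _ _ _ _ (@leb n) lam) => //.
- apply: measurable_rV_add => //.
 by case: (b); [exact: measurable_rV_opp|exact: measurable_id].
- apply: measurable_funD => //.
 by case: (b); [exact: measurable_funN|exact: measurable_id].
- by move=> B mB; rewrite /leb IH.
- by move=> B mB; exact: lebesgue_affl.
- by rewrite -[X in measurable X]setTI; exact: measurable_rV_cons.
Qed.

(** The sigma-algebra is generated by the coordinates, so openness must be expressed by countably
    many boxes: those with rational centre and half-side [1 / (k + 1)] that the set contains. *)
Lemma open_measurable_rV n (A : set 'rV[R]_n) : open A -> measurable A.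
Proof.
move=> oA.
pose box (qk : 'rV[rat]_n * nat) : set 'rV[R]_n :=
 [set x | forall i, `]ratr (qk.1 ord0 i) - qk.2.+1%:R^-1, ratr (qk.1 ord0 i) + qk.2.+1%:R^-1[%classic (x ord0 i)].
pose F (qk : 'rV[rat]_n * nat) := if `[< box qk `<=` A >] then box qk else set0.
have -> : A = \bigcup_qk F qk.
 apply/seteqP; split => [x Ax|x [qk _]]; last first.
  by rewrite /F; case: asboolP => // h /h.
 have [e e0 xeA] : exists2 e : R, 0 < e & ball x e `<=` A.
  by have := oA x Ax; rewrite nbhs_ballP => -[e /= e0 h]; exists e.
 have [k hk] : exists k : nat, k.+1%:R^-1 < e / 2.
  exists (Num.truncn (e / 2)^-1); rewrite invf_plt ?posrE ?divr_gt0//.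
  exact: truncnS_gt.
 have hq i : exists q : rat, x ord0 i - k.+1%:R^-1 < ratr q < x ord0 i + k.+1%:R^-1.
  have [|q] := @rat_in_itvoo R (x ord0 i - k.+1%:R^-1) (x ord0 i + k.+1%:R^-1).
   by rewrite ltrD2l gtrN// invr_gt0.
  by rewrite in_itv/=; exists q.
 exists (\row_i projT1 (cid (hq i)), k) => //.
 have bx : box (\row_i projT1 (cid (hq i)), k) x.
  move=> i; rewrite /= mxE in_itv/=; case: cid => q /= /andP[h1 h2].
  by rewrite ltrBlDr h2/= -ltrBlDr.
 rewrite /F; case: asboolP => // -[] y by_; apply: xeA.
 split => // i j; rewrite (ord1 i).
 have := bx j; have := by_ j; rewrite /= !in_itv/= => /andP[h1 h2] /andP[h3 h4].
 rewrite /ball/= ltr_norml; move: hk h1 h2 h3 h4.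
 move: (_^-1) (ratr _) => u v; lra.
apply: countable_bigcupT_measurable => [|qk]; first exact: countableP.
rewrite /F; case: ifP => // _.
exact: (measurable_rV_box (A := fun i => `]ratr (qk.1 ord0 i) - qk.2.+1%:R^-1, ratr (qk.1 ord0 i) + qk.2.+1%:R^-1[%classic)).
Qed.

End lebesgue_rV_theory.

Local Notation Zsp R N := ('rV[R]_N * mR R)%type.

(** * Space-time coordinates and translation invariance *)

Section coordinates.
Context {R : realType} {N : nat}.
Notation Z := (Zsp R N).
Notation mu := (@leb R N \x @lebesgue_measure R)%E.
Implicit Types (z w : Z) (o : option 'I_N).

(* Space-time coordinates, [None] being time. *)
Definition co o z : R := if o is Some i then z.1 ord0 i else z.2.

Definition dir o (s : R) : Z :=
 if o is Some i then (s *: delta_mx ord0 i, 0) else (0, s).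

Lemma coD o z w : co o (z + w) = co o z + co o w.
Proof. by case: o => [i|] //=; rewrite mxE. Qed.

Lemma coN o z : co o (- z) = - co o z.
Proof. by case: o => [i|] //=; rewrite mxE. Qed.

Lemma coB o z w : co o (z - w) = co o z - co o w.
Proof. by rewrite coD coN. Qed.

Lemma co0 o : co o (0 : Z) = 0.
Proof. by case: o => [i|] //=; rewrite mxE. Qed.

Lemma co_dir o o' s : co o (dir o' s) = if o == o' then s else 0.
Proof.
case: o o' => [i|] [j|] //=; rewrite !mxE//=.
rewrite (inj_eq (@Some_inj _)).
by case: (i == j); rewrite ?mulr1 ?mulr0.
Qed.

Lemma coP z w : (forall o, co o z = co o w) -> z = w.
Proof.
case: z w => [x t] [y u] h; congr pair; last exact: (h None).
by apply/rowP => i; exact: (h (Some i)).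
Qed.

Lemma measurable_co o : measT (co o : Z -> mR R).
Proof.
case: o => [i|]; last exact: measurable_snd.
exact: (mcomp (measurable_coord i) measurable_fst).
Qed.

Lemma measurable_coP d (X : measurableType d) (f : X -> Z) :
 (forall o, measT (fun x => co o (f x) : mR R)) ->
 measT f.
Proof.
move=> h; apply/measurable_fun_pairP; split.
 by apply: measurable_fun_rVP => i; exact: (h (Some i)).
exact: (h None).
Qed.

Lemma measurable_addZ d (X : measurableType d) (f g : X -> Z) :
 measT f -> measT g ->
 measT (fun x => f x + g x).
Proof.
move=> mf mg; apply: measurable_coP => o; under eq_fun do rewrite coD.
by apply: measurable_funD; apply: (mcomp (measurable_co o)).
Qed.

Lemma measurable_oppZ d (X : measurableType d) (f : X -> Z) :
 measT f -> measT (fun x => - f x).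
Proof.
move=> mf; apply: measurable_coP => o; under eq_fun do rewrite coN.
by apply: measurable_funN; apply: (mcomp (measurable_co o)).
Qed.

Lemma measurable_affl b (y : Z) : measT (affl b y : Z -> Z).
Proof.
apply: measurable_addZ; last exact: measurable_cst.
by case: b; [apply: measurable_oppZ|]; exact: measurable_id.
Qed.

Lemma mu_affl b (y : Z) (A : set Z) : measurable A -> mu (affl b y @^-1` A) = mu A.
Proof.
move=> mA.
rewrite (_ : affl b y = fun z : Z => (affl b y.1 z.1, affl b y.2 z.2)).
 apply: (@product_measure_map _ _ _ _ _ (@leb R N) (@lebesgue_measure R)) => //.
 - apply: measurable_rV_add; last exact: measurable_cst.
  by case: b; [exact: measurable_rV_opp|exact: measurable_id].
 - apply: measurable_funD; last exact: measurable_cst.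
  by case: b; [exact: measurable_funN|exact: measurable_id].
 - by move=> B mB; exact: leb_affl.
 - by move=> B mB; exact: lebesgue_affl.
by ext => -[x t]; rewrite /affl; case: b.
Qed.

Notation itg := (Rintg mu).
Notation II := (Rint mu).

Lemma itg_shift (w : Z) (F : Z -> R) : itg F -> itg (fun z => F (z + w)).
Proof. exact: (itg_preserving (measurable_affl false w) (@mu_affl false w)). Qed.

Lemma II_shift (w : Z) (F : Z -> R) : itg F -> II (fun z => F (z + w)) = II F.
Proof. exact: (II_preserving (measurable_affl false w) (@mu_affl false w)). Qed.

Lemma itg_refl (w : Z) (F : Z -> R) : itg F -> itg (fun z => F (- z + w)).
Proof. exact: (itg_preserving (measurable_affl true w) (@mu_affl true w)). Qed.

Lemma II_refl (w : Z) (F : Z -> R) : itg F -> II (fun z => F (- z + w)) = II F.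
Proof. exact: (II_preserving (measurable_affl true w) (@mu_affl true w)). Qed.

End coordinates.

(** * Continuity of translations in L^1 *)

Section translation_continuity.
Context {R : realType} {N : nat}.
Notation Z := ('rV[R]_N * mR R)%type.
Notation mu := (@leb R N \x @lebesgue_measure R)%E.
Notation itg := (Rintg mu).
Notation II := (Rint mu).

Definition rect (A : option 'I_N -> set R) : set Z := [set z | forall o, A o (co o z)].

Lemma measurable_rect A : (forall o, measurable (A o : set (mR R))) ->
 measurable (rect A).
Proof.
move=> mA; rewrite (_ : rect A =
  [set x : 'rV[R]_N | forall i, A (Some i) (x ord0 i)] `*` A None).
 by apply: measurableX => //; apply: (measurable_rV_box (A := A \o Some)) => i /=.
apply/seteqP; split => [z h|z [h1 h2] [i|]]; last 2 first.
- exact: h1.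
- exact: h2.
by split => [i|]; [exact: (h (Some i))|exact: (h None)].
Qed.

Lemma measurable_rect_open A : (forall o, open (A o)) -> measurable (rect A).
Proof. by move=> oA; apply: measurable_rect => o; exact: open_measurable. Qed.

Definition obox (a b : option 'I_N -> R) := rect (fun o => `]a o, b o[%classic).

Lemma mset_obox a b : measurable (obox a b).
Proof. by apply: measurable_rect => o. Qed.

Lemma mu_obox a b : (forall o, a o <= b o) ->
 mu (obox a b) = ((\prod_i (b (Some i) - a (Some i))) * (b None - a None))%:E.
Proof.
move=> ab; rewrite (_ : obox a b =
  [set x : 'rV[R]_N | forall i, `]a (Some i), b (Some i)[%classic (x ord0 i)]
  `*` `]a None, b None[%classic); last first.
 apply/seteqP; split => [z h|z [h1 h2] [i|]]; last 2 first.
 - exact: h1.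
 - exact: h2.
 by split => [i|]; [exact: (h (Some i))|exact: (h None)].
rewrite (@product_measure1E _ _ _ _ _ (@leb R N) (@lebesgue_measure R))//; last first.
 exact: (measurable_rV_box (A := fun i => `]a (Some i), b (Some i)[%classic)).
rewrite [X in (_ * X)%E]lebesgue_measure_itv /leb lebesgue_rV_box//= lte_fin.
case: ltP => [_|h]; first by rewrite EFinM.
have -> : b None = a None by apply/eqP; rewrite eq_le h ab.
by rewrite subrr mulr0 mule0.
Qed.

Definition near0 (d : R) (w : Z) := forall o, `|co o w| < d.

(** Continuity of translations in L^1. That all integrable functions have it is proved by ascending
    from open boxes through measurable sets of finite measure and simple functions to L^1 limits. *)
Definition tcont (F : Z -> R) := itg F /\ forall e, 0 < e -> exists2 d, 0 < d &
 forall w, near0 d w -> II (fun z => `|F (z + w) - F z|) <= e.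

Lemma itg_diff F (w : Z) : itg F -> itg (fun z => `|F (z + w) - F z|).
Proof. by move=> h; apply: itg_norm; apply: itgB => //; exact: itg_shift. Qed.

(** An argument with three thirds of [e]: translations are isometries of L^1, so the error of the
    approximation is the same before and after the shift. *)
Lemma tcont_lim F : itg F ->
 (forall e, 0 < e -> exists2 H, tcont H & II (fun z => `|F z - H z|) <= e) -> tcont F.
Proof.
move=> iF h; split => // e e0.
have e3 : 0 < e / 3 by rewrite divr_gt0.
have [H [iH cH] FH] := h _ e3; have [d d0 hd] := cH _ e3.
exists d => // w wd.
have iFH : itg (fun z => `|F z - H z|) by apply: itg_norm; exact: itgB.
have i1 := itg_shift w iFH.
have i2 := itg_diff w iH.
apply: (letr (II (fun z => (`|F (z + w) - H (z + w)| + `|H (z + w) - H z|) + `|F z - H z|))).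
 apply: le_II.
 - exact: itg_diff.
 - by apply: itgD => //; exact: itgD.
 move=> z; rewrite (_ : F (z + w) - F z = ((F (z + w) - H (z + w)) + (H (z + w) - H z)) - (F z - H z)); last ring.
 apply: (le_trans (ler_normB _ _)); rewrite lerD2r; exact: ler_normD.
rewrite IID//; last exact: itgD.
rewrite IID//.
rewrite (@II_shift R N w (fun z => `|F z - H z|) iFH).
have := hd w wd; move: FH; lra.
Qed.

Lemma tcontD F G : tcont F -> tcont G -> tcont (fun z => F z + G z).
Proof.
move=> [iF cF] [iG cG]; split => [|e e0]; first exact: itgD.
have e2 : 0 < e / 2 by rewrite divr_gt0.
have [d1 d10 h1] := cF _ e2; have [d2 d20 h2] := cG _ e2.
exists (Num.min d1 d2); first by rewrite lt_min d10.
move=> w wd; apply: (letr (II (fun z => `|F (z + w) - F z| + `|G (z + w) - G z|))).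
 apply: le_II.
 - by apply: itg_diff; exact: itgD.
 - by apply: itgD; exact: itg_diff.
 move=> z; rewrite (_ : F (z + w) + G (z + w) - (F z + G z) = (F (z + w) - F z) + (G (z + w) - G z)); last ring.
 exact: ler_normD.
rewrite IID; [|exact: itg_diff|exact: itg_diff].
rewrite [e]splitr lerD//; [apply: h1|apply: h2] => o; apply: (lt_le_trans (wd o)).
 by rewrite ge_min lexx.
by rewrite ge_min lexx orbT.
Qed.

Lemma tcontZ c F : tcont F -> tcont (fun z => c * F z).
Proof.
move=> [iF cF]; split => [|e e0]; first exact: itgZ.
have e2 : 0 < e / (`|c| + 1) by rewrite divr_gt0// ltr_wpDl.
have [d d0 h] := cF _ e2; exists d => // w wd.
rewrite (_ : (fun z => _) = (fun z => `|c| * `|F (z + w) - F z|)); last first.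
 by ext => z; rewrite -mulrBr normrM.
rewrite IIZ; last exact: itg_diff.
apply: (letr (`|c| * (e / (`|c| + 1)))); first by rewrite ler_wpM2l// h.
by rewrite mulrA ler_pdivrMr ?ltr_wpDl// mulrC ler_pM2l// lerDl.
Qed.

Lemma tcont0 : tcont (fun=> 0).
Proof.
split; first exact: integrable0.
move=> e e0; exists 1 => // w _.
rewrite (_ : (fun z => _) = (fun=> 0)); last by ext => z; rewrite subrr normr0.
by rewrite /II /Rintegral integral0 ltW.
Qed.

Lemma tcont_sum (I : Type) (s : seq I) (F : I -> Z -> R) :
 (forall i, tcont (F i)) -> tcont (fun z => \sum_(i <- s) F i z).
Proof.
move=> h; elim: s => [|i s IH].
 by under eq_fun do rewrite big_nil; exact: tcont0.
by under eq_fun do rewrite big_cons; exact: tcontD.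
Qed.

Lemma fin_obox a b : (forall o, a o <= b o) -> (mu (obox a b) < +oo)%E.
Proof. by move=> ab; rewrite mu_obox// ltry. Qed.

(** The L^1 distance of the indicator of [E] from its translate is [2 (|E| - |E cap (E - w)|)]. As
    [E] is open, the indicators of the intersections converge pointwise along shifts tending to 0,
    and dominated convergence contradicts a lower bound [e]. *)
Lemma tcont_open_rect A M : 0 <= M -> (forall o, open (A o)) ->
 (forall o x, A o x -> `|x| < M) -> tcont (\1_(rect A)).
Proof.
move=> M0 oA AM; set E := rect A.
have mE : measurable E by exact: measurable_rect_open.
have iE : itg \1_E.
 apply: itg_indic => //.
 apply: (@le_lt_trans _ _ (mu (obox (fun=> - M) (fun=> M)))); last first.
  by apply: fin_obox => _; rewrite ge0_cp.
 apply: le_measure; rewrite ?inE//; first exact: mset_obox.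
 by move=> z Ez o; rewrite /= in_itv/= -ltr_norml; exact: AM (Ez o).
split => // e e0; apply/not_exists2P => H.
have {}H n : exists w, near0 n.+1%:R^-1 w /\ e < II (fun z => `|\1_E (z + w) - \1_E z| : R).
 have [|/existsNP[w /not_implyP[wn /negP]]] := H n.+1%:R^-1; first by rewrite invr_gt0.
 by rewrite -ltNge; exists w.
pose w n := projT1 (cid (H n)).
have wn n : near0 n.+1%:R^-1 (w n) by rewrite /w; case: cid => ? [].
have we n : e < II (fun z : Z => `|\1_E (z + w n) - \1_E z| : R) by rewrite /w; case: cid => ? [].
have mf n : measT (fun z : Z => \1_E (z + w n) : R).
 by apply: itgm; exact: (itg_shift (w n) iE).
have /cvgrPdist_lt/(_ (e / 2)) : II (fun z : Z => \1_E z * \1_E (z + w n)) @[n --> \oo] --> II (\1_E : Z -> R).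
 apply: (@II_cvg _ _ _ _ _ _ \1_E) => //.
 - by move=> n; apply: mfunM => //; exact: itgm.
 - apply: aeW => z; case: (pselect (E z)) => [Ez|nEz]; last first.
   under eq_fun do rewrite indicE memNset// mul0r.
   by rewrite indicE memNset//; exact: cvg_cst.
  apply: cvg_near_cst; near=> n; rewrite !indicE !mem_set ?mulr1//.
  near: n; apply: filter_forall => o.
  have := oA o _ (Ez o); rewrite nbhs_ballP => -[r /= r0 hr].
  have := near_infty_natSinv_lt (PosNum r0); apply: filterS => n nr.
  apply: hr; rewrite /ball/= coD opprD addNKr normrN.
  exact: lt_trans (wn n o) nr.
 - by move=> n z; rewrite !indicE; case: (_ \in _); case: (_ \in _); rewrite ?mulr1 ?mulr0 ?mul0r ?normr0 ?normr1.
rewrite divr_gt0// => /(_ isT)[n _ /(_ n (leqnn n))/=].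
have iEE : itg (fun z : Z => \1_E z * \1_E (z + w n)).
 apply: (itg_dom (g := \1_E)) => //; first by apply: mfunM => //; exact: itgm.
 by move=> z; rewrite !indicE; case: (_ \in _); case: (_ \in _); rewrite ?mulr1 ?mulr0 ?mul0r ?normr0 ?normr1.
have iw := itg_shift (w n) iE.
have : II (fun z : Z => `|\1_E (z + w n) - \1_E z| : R) =
  2 * (II \1_E - II (fun z : Z => \1_E z * \1_E (z + w n))).
 rewrite (_ : (fun z => `|_|) = (fun z : Z => (\1_E (z + w n) + \1_E z) - 2 * (\1_E z * \1_E (z + w n)))).
  rewrite IIB ?IID ?IIZ//; last 2 first.
  - exact: itgD.
  - exact: itgZ.
  rewrite (@II_shift R N (w n) (\1_E) iE); ring.
 ext => z; rewrite !indicE; case: (_ \in _); case: (_ \in _);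
  by rewrite ?(mulr0, mulr1, mul0r, subrr, subr0, sub0r, addr0, add0r, normr0, normrN, normr1)//; ring.
move=> eq1; have := we n; rewrite eq1 ltr_norml => h1 /andP[_]; move: h1; lra.
Unshelve. all: by end_near. Qed.

Let Grect := [set E : set Z | exists A : option 'I_N -> set R,
 (forall o, open (A o)) /\ E = rect A].

Lemma sigma_algebra_preim (T : pointedType) (U : Type) (G : set (set T)) (phi : T -> U) :
 sigma_algebra setT [set B | <<s G >> (phi @^-1` B)].
Proof.
split => /= [|A hA|F hF].
- by rewrite preimage_set0; exact: sigma_algebra0.
- rewrite setTD preimage_setC; exact: (sigma_algebraC hA).
- by rewrite preimage_bigcup; exact: sigma_algebra_bigcup.
Qed.

(** A set constraining one coordinate to an open interval is an open rectangle whose other sides are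
    the whole line, so all coordinates are measurable for the generated sigma-algebra. *)
Lemma measurable_sub_rect : measurable `<=` <<s Grect >>.
Proof.
have Sco o (B : set (mR R)) : measurable B -> <<s Grect >> (co o @^-1` B).
 move=> mB; have {}mB : (RGenOpens.G (R:=R)).-sigma.-measurable B.
  by rewrite -RGenOpens.measurableE.
 move: B mB; apply: smallest_sub; first exact: sigma_algebra_preim.
 move=> _ [x [y ->]] /=; apply: sub_sigma_algebra.
 exists (fun o' => if o' == o then `]x, y[%classic else setT); split.
  by move=> o'; case: ifP => _; [exact: itv_open|exact: openT].
 apply/seteqP; split => [z h o'|z]; first by case: eqP => // ->.
 by move=> /(_ o); rewrite eqxx.
apply: smallest_sub; first exact: smallest_sigma_algebra.
move=> E [] [B mB <-]; rewrite setTI; last exact: (Sco None).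
move: B mB; apply: smallest_sub; first exact: sigma_algebra_preim.
rewrite -bigcup_seq; apply: bigcup_sub => i _ _ [C mC <-] /=.
by rewrite setTI; exact: (Sco (Some i)).
Qed.

Let bb (n : nat) : set Z := obox (fun=> - n%:R) (fun=> n%:R).

Lemma measurable_bb n : measurable (bb n).
Proof. exact: mset_obox. Qed.

Lemma fin_bb n : (mu (bb n) < +oo)%E.
Proof. by apply: fin_obox => _; rewrite ge0_cp. Qed.

Lemma itg_bb (E : set Z) n : measurable E -> itg \1_(E `&` bb n).
Proof.
move=> mE; have mb := measurable_bb n.
apply: itg_indic; first exact: measurableI.
by apply: le_lt_trans (fin_bb n); apply: le_measure; rewrite ?inE//; exact: measurableI.
Qed.

Lemma tcont_cvg (f_ : nat -> Z -> R) (f g : Z -> R) :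
 (forall n, tcont (f_ n)) -> measT f ->
 (forall z, f_ n z @[n --> \oo] --> f z) -> itg g ->
 (forall n z, `|f_ n z| <= g z) -> tcont f.
Proof.
move=> cf mf ff ig fg.
have [if_ h] := II_dct (m := mu) (fun n => itgm (cf n).1) mf (aeW _ ff) ig fg.
apply: tcont_lim => // e e0; have [n hn] := h e e0.
exists (f_ n) => //; have := hn n (leqnn n).
by congr (_ <= _); congr (Rint _ _); ext => z; rewrite distrC.
Qed.

(** The pi-lambda theorem: open rectangles are stable under intersection. Intersecting with the
    bounded boxes [bb n] keeps all indicators integrable, which the stability under differences and
    increasing unions requires. *)
Lemma tcont_bb (E : set Z) n : measurable E -> tcont (\1_(E `&` bb n)).
Proof.
move: E; suff sub : measurable `<=` [set E : set Z | measurable E /\ forall n, tcont (\1_(E `&` bb n))].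
 by move=> E /sub[].
have GI : setI_closed Grect.
 move=> _ _ [A [oA ->]] [B [oB ->]]; exists (fun o => A o `&` B o); split.
  by move=> o; exact: openI.
 by apply/seteqP; split => [z [h1 h2] o|z h]; [split; [exact: h1|exact: h2]|split=> o; have [] := h o].
apply: subset_trans measurable_sub_rect _.
apply: (lambda_system_subset GI) => //; last first.
 move=> _ [A [oA ->]]; split => [|{}n]; first exact: measurable_rect_open.
 rewrite (_ : _ `&` _ = rect (fun o => A o `&` `]- n%:R, n%:R[%classic)).
  apply: (@tcont_open_rect _ n%:R) => //.
   by move=> o; apply: openI => //; exact: itv_open.
  by move=> o x [_] /=; rewrite in_itv/= -ltr_norml.
 by apply/seteqP; split => [z [h1 h2] o|z h]; [split; [exact: h1|exact: h2]|split=> o; have [] := h o].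
split => //.
- split => [|{}n]; first exact: measurableT.
 rewrite setTI; apply: (@tcont_open_rect _ n%:R) => //.
 by move=> o x /=; rewrite in_itv/= -ltr_norml.
- move=> A B BA [mA hA] [mB hB]; split => [|{}n]; first exact: measurableD.
 rewrite (_ : \1_(_) = (fun z => \1_(A `&` bb n) z + (-1) * \1_(B `&` bb n) z)).
  by apply: tcontD => //; exact: tcontZ.
 ext => z; rewrite setDE !indicE !in_setI in_setC mulN1r.
 case: (boolP (z \in B)) => [zB|_]; last by rewrite andbT/= subr0.
 by rewrite (mem_set (BA _ (set_mem zB)))/= subrr.
- move=> F ndF hF; split => [|{}n]; first by apply: bigcupT_measurable => i; case: (hF i).
 have mF : measurable (\bigcup_i F i) by apply: bigcupT_measurable => i; case: (hF i).
 apply: (@tcont_cvg (fun i => \1_(F i `&` bb n)) _ \1_(bb n)).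
 + by move=> i; case: (hF i).
 + by apply: itgm; exact: itg_bb.
 + move=> z; apply: cvg_near_cst; case: (pselect ((\bigcup_i F i) z)) => [[i _ Fz]|nz].
   near=> j; rewrite !indicE !in_setI; congr ((_ && _)%:R).
   rewrite !mem_set//; first by exists i.
   have : (F i <= F j)%O by apply: ndF; near: j; exact: nbhs_infty_ge.
   by move/subsetPset; apply.
  near=> j; rewrite !indicE !in_setI; congr ((_ && _)%:R).
  by rewrite !memNset// => Fj; apply: nz; exists j.
 + by have := @itg_bb setT n; rewrite setTI; apply.
 + by move=> i z; rewrite !indicE in_setI; case: (_ \in _); case: (_ \in _); rewrite ?normr1 ?normr0.
Unshelve. all: by end_near. Qed.

Lemma tcont_indic (E : set Z) : measurable E -> (mu E < +oo)%E -> tcont (\1_E).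
Proof.
move=> mE fE; apply: (@tcont_cvg (fun n => \1_(E `&` bb n)) _ \1_E).
- by move=> n; exact: tcont_bb.
- exact: mindic.
- move=> z; apply: cvg_near_cst.
 pose M := \sum_(o : option 'I_N) `|co o z|.
 near=> n; rewrite !indicE in_setI; congr (_%:R).
 rewrite (@mem_set _ (bb n) z) ?andbT// => o; rewrite /= in_itv/= -ltr_norml.
 apply: (@le_lt_trans _ _ M); last by near: n; exact: nbhs_infty_gtr.
 by rewrite /M (bigD1 o)//= lerDl sumr_ge0.
- exact: itg_indic.
- by move=> i z; rewrite !indicE in_setI; case: (_ \in _); case: (_ \in _); rewrite ?normr1 ?normr0.
Unshelve. all: by end_near. Qed.

Import HBSimple.

Lemma tcont_sfun (g : {sfun Z >-> R}) : itg g -> tcont g.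
Proof.
move=> ig.
have -> : (g : Z -> R) = fun z => \sum_(y <- finmap.enum_fset (fset_set (range g))) y * \1_(g @^-1` [set y]) z.
 by ext => z; rewrite {1}fimfunE fsbig_finite.
apply: tcont_sum => y; have my : measurable (g @^-1` [set y]) by [].
have [->|y0] := eqVneq y 0; first by under eq_fun do rewrite mul0r; exact: tcont0.
apply: tcontZ; apply: tcont_indic => //.
have y0' : 0 < `|y| by rewrite normr_gt0.
have iy : itg (fun z => `|g z| / `|y|).
 by under eq_fun do rewrite mulrC; apply: itgZ; exact: itg_norm.
have /integrableP[_] := iy; apply: le_lt_trans.
rewrite -(integral_indicT mu my); apply: ge0_le_integral => //.
- by apply/mEFinP; exact: mindic.
- by apply: mcomp => //; apply/mEFinP; exact: (itgm iy).
move=> z _; rewrite lee_fin indicE; case: (boolP (z \in _)) => [|_]; last exact: normr_ge0.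
by rewrite inE /= => ->; rewrite divff ?gt_eqF// normr1.
Qed.

Lemma itg_tcont F : itg F -> tcont F.
Proof.
move=> iF; apply: tcont_lim => // e e0.
have [g_ [ig _]] := approximation_sfun_integrable measurableT iF.
move/fine_cvgP => [_] /cvgrPdist_le /(_ e e0)[n _ /(_ n (leqnn n))].
rewrite sub0r normrN => hn; exists (g_ n); first by apply: tcont_sfun; exact: ig.
by apply: le_trans hn; rewrite /= /Rint /Rintegral; exact: ler_norm.
Qed.

End translation_continuity.

(** * Smooth functions and bumps of one variable *)

Section smooth_functions.
Context {R : realType}.

(** Smoothness graded by order. Closure under sums, products, inverses and affine substitutions then
    follows by induction on [n], and [Cinf_smooth] leads back to the condition on lists of
    directions. *)
Fixpoint Ck (V : normedModType R) (n : nat) (f : V -> R) : Prop :=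
 continuous f /\ if n is n'.+1 then
  forall v, (forall x, derivable f x v) /\ Ck n' ('D_v f) else True.

Definition Cinf (V : normedModType R) (f : V -> R) := forall n, Ck n f.

Section general.
Context {V : normedModType R}.
Implicit Types f g : V -> R.

Lemma Ck_cont n f : Ck n f -> continuous f.
Proof. by case: n => [|n] []. Qed.

Lemma CkW n f : Ck n.+1 f -> Ck n f.
Proof.
elim: n f => [|n IH] f; first by case.
by move=> [cf hf]; split => // v; have [h1 h2] := hf v; split => //; apply: IH.
Qed.

Lemma Cinf_smooth f : Cinf f -> smooth f.
Proof.
(* [iter_derive] differentiates along the last entry of the list first, so peeling entries off the
   end exposes the innermost derivative of [f]. *)
move=> h vs; elim/last_ind: vs f h => [|vs v IH] f h /=.
 split; first exact: Ck_cont (h 0%N).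
 by move=> x v; have [_ /(_ v)[+ _]] := h 1%N; apply.
have -> : iter_derive (rcons vs v) f = iter_derive vs ('D_v f).
 by elim: (vs) => //= w ws ->.
by apply: IH => n; have [_ /(_ v)[]] := h n.+1.
Qed.

Lemma Ck_cst n (c : R) : Ck n (fun _ : V => c).
Proof.
elim: n c => [|n IH] c; split => //; try exact: cst_continuous.
move=> v; split => [x|]; first exact: derivable_cst.
rewrite (_ : 'D_v _ = fun=> 0)//; ext => x.
exact: derive_cst.
Qed.

Lemma CkD n f g : Ck n f -> Ck n g -> Ck n (fun x => f x + g x).
Proof.
elim: n f g => [|n IH] f g [cf hf] [cg hg]; split => //; try
 by move=> x; apply: cvgD; [exact: cf|exact: cg].
move=> v; have [df cdf] := hf v; have [dg cdg] := hg v; split => [x|].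
 exact: derivableD.
rewrite (_ : 'D_v _ = fun x => 'D_v f x + 'D_v g x); first exact: IH.
by ext => x; exact: deriveD.
Qed.

Lemma CkM n f g : Ck n f -> Ck n g -> Ck n (fun x => f x * g x).
Proof.
elim: n f g => [|n IH] f g; first by
 move=> [cf hf] [cg hg]; split => // x; apply: cvgM; [exact: cf|exact: cg].
move=> Cf Cg; have [cf hf] := Cf; have [cg hg] := Cg; split.
 by move=> x; apply: cvgM; [exact: cf|exact: cg].
move=> v; have [df cdf] := hf v; have [dg cdg] := hg v; split => [x|].
 exact: derivableM.
rewrite (_ : 'D_v _ = fun x => f x * 'D_v g x + g x * 'D_v f x).
 by apply: CkD; apply: IH => //; exact: CkW.
by ext => x; rewrite deriveM.
Qed.

Lemma CkZ n c f : Ck n f -> Ck n (fun x => c * f x).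
Proof. by apply: CkM; exact: Ck_cst. Qed.

Lemma Ck_prod (I : Type) (s : seq I) n (F : I -> V -> R) :
 (forall i, Ck n (F i)) -> Ck n (fun x => \prod_(i <- s) F i x).
Proof.
move=> h; elim: s => [|i s IH].
 by under eq_fun do rewrite big_nil; exact: Ck_cst.
by under eq_fun do rewrite big_cons; exact: CkM.
Qed.

End general.

Section affine.
Context {V W : normedModType R}.
Variables (l : V -> W) (d : W).
Hypothesis hl : forall (h : R) u v, l (h *: u + v) = h *: l u + l v.
Hypothesis cl : continuous l.

Let quotE (f : W -> R) (x v : V) :
 (fun h : R => h^-1 *: (f (l (h *: v + x) + d) - f (l x + d))) =
 (fun h : R => h^-1 *: (f (h *: l v + (l x + d)) - f (l x + d))).
Proof. by ext => h; rewrite hl addrA. Qed.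

Lemma derive_comp_affine (f : W -> R) (x v : V) :
 'D_v (fun y => f (l y + d)) x = 'D_(l v) f (l x + d).
Proof. exact: (congr1 (fun F : R -> R => lim (F @ (0 : R)^')) (quotE f x v)). Qed.

Lemma derivable_comp_affine (f : W -> R) (x v : V) :
 derivable f (l x + d) (l v) -> derivable (fun y => f (l y + d)) x v.
Proof.
move=> h.
exact: (eq_ind _ (fun F : R -> R => cvg (F @ (0 : R)^')) h _ (esym (quotE f x v))).
Qed.

Lemma Ck_comp_affine n (f : W -> R) : Ck n f -> Ck n (fun y => f (l y + d)).
Proof.
have ca : continuous (fun y => l y + d).
 by move=> x; apply: cvgD; [exact: cl|exact: cvg_cst].
elim: n f => [|n IH] f [cf hf]; split => //; try
 by move=> x; apply: (continuous_comp (ca x)); exact: cf.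
move=> v; have [df cdf] := hf (l v); split => [x|].
 exact: derivable_comp_affine.
rewrite (_ : 'D_v _ = fun y => 'D_(l v) f (l y + d)); last first.
 by ext => x; exact: derive_comp_affine.
exact: (IH _ cdf).
Qed.

End affine.

Lemma derive_real (f : R -> R) (g x v : R) : is_derive x 1 f g ->
 derivable f x v /\ 'D_v f x = v * g.
Proof.
move=> [df <-]; have /derivable1_diffP dif := df.
split; first exact: diff_derivable.
by rewrite !deriveE// -{1}(mulr1 v) -[v * 1]/(v *: (1 : R)) linearZ.
Qed.

Lemma Ck_is_derive n (f g : R -> R) : (forall x : R, is_derive x 1 f (g x)) ->
 Ck n g -> Ck n.+1 f.
Proof.
move=> h Cg; split.
 move=> x; apply: differentiable_continuous; apply/derivable1_diffP.
 by have [] := h x.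
move=> v; split => [x|]; first by have [] := derive_real v (h x).
rewrite (_ : 'D_v f = fun x => v * g x); first exact: CkZ.
by ext => x; have [] := derive_real v (h x).
Qed.

(** The function [x^(-k) e^(-1/x)] extended by 0. The family over all [k] is closed under
    differentiation, [ek k' = ek (k+2) - k ek (k+1)], so one induction proves all its members
    smooth. *)
Definition ek (k : nat) (x : R) : R :=
 if 0 < x then x^-1 ^+ k * expR (- x^-1) else 0.

Lemma ek_gt0 k x : 0 < x -> ek k x = x^-1 ^+ k * expR (- x^-1).
Proof. by rewrite /ek => ->. Qed.

Lemma ek_le0 k x : x <= 0 -> ek k x = 0.
Proof. by rewrite /ek leNgt; case: ltP. Qed.

Lemma ek_ge0 k x : 0 <= ek k x.
Proof.
rewrite /ek; case: ifP => // x0.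
by rewrite mulr_ge0 ?expR_ge0// exprn_ge0// invr_ge0 ltW.
Qed.

(** From [e^y >= y^n / n!] at [y = 1/x]: the function vanishes at 0 to every order. *)
Lemma ek_le k n x : ek k x <= (k + n.+1)`!%:R * `|x| ^+ n.+1.
Proof.
rewrite /ek; case: ifPn => [x0|_]; last by rewrite mulr_ge0// exprn_ge0.
set y := x^-1; have y0 : 0 < y by rewrite invr_gt0.
rewrite (_ : `|x| = y^-1); last by rewrite invrK gtr0_norm.
clearbody y.
rewrite expRN exprVn ler_pdivrMr ?expR_gt0// mulrAC ler_pdivlMr ?exprn_gt0// -exprD.
have := expR_ge1Dxn (k + n) (ltW y0); rewrite addnS.
have f0 : 0 < ((k + n).+1`!)%:R :> R by rewrite ltr0n fact_gt0.
move=> h; rewrite mulrC -ler_pdivrMr//; apply: le_trans h; lra.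
Qed.

Lemma ek_derive k (x : R) : is_derive x 1 (ek k) (ek k.+2 x - k%:R * ek k.+1 x).
Proof.
have [x0|x0|->] := ltgtP x 0.
- rewrite !ek_le0 ?ltW// mulr0 subr0.
 apply: (@near_eq_is_derive _ _ _ (cst 0)).
  by near=> y; rewrite ek_le0// ltW//; near: y; exact: lt_nbhsl.
- rewrite !ek_gt0//.
 pose V : R -> R := fun y => y^-1.
 apply: (@near_eq_is_derive R R R (V ^+ k * (expR \o (- V)))).
  near=> y; rewrite ek_gt0; last by near: y; exact: lt_nbhsr.
  by rewrite /V /= [RHS]/(_ * _) /= /V; congr (_ * _); rewrite fctE.
 have xn : x != 0 by rewrite gt_eqF.
 have dV : is_derive x 1 V (- x ^- 2).
  have := @is_deriveV _ id x 1 1 xn (is_derive_id _ _).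
  by rewrite [_ *: 1]mulr1.
 have dk := is_deriveX k dV.
 have dE := @is_derive1_comp _ expR (- V) x _ _ (is_derive_expR _) (is_deriveN dV).
 apply: is_derive_eq (is_deriveM dk dE) _.
 have sE (a c : R) : a *: (c : R) = a * c by [].
 rewrite opprK !sE !fctE /V.
 set E := expR _; case: k {dk} => [|k]; first by rewrite !expr0 !mul0r /= !exprVn; ring.
 by rewrite /= -!exprVn !exprS expr0; ring.
- rewrite !ek_le0// mulr0 subr0.
 (* At the gluing point the difference quotient is at most a constant times [|h|], by the quadratic
    case of [ek_le]. *)
 have h : (fun h => h^-1 *: (ek k (h *: 1 + 0) - ek k 0)) @ (0 : R)^' --> (0 : R).
  apply/cvgrPdist_le => e e0; near=> h.
  rewrite sub0r normrN addr0 [_ *: 1]mulr1 (ek_le0 _ (lexx 0)) subr0.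
  rewrite normrZ normfV [`|ek _ _|]ger0_norm ?ek_ge0//.
  have h0 : h != 0 by near: h; exact: nbhs_dnbhs_neq.
  rewrite mulrC ler_pdivrMr ?normr_gt0//.
  apply: le_trans (ek_le k 1 h) _; rewrite expr2 mulrA ler_wpM2r//.
  rewrite -ler_pdivlMl ?ltr0n ?fact_gt0//.
  by near: h; apply: dnbhs0_le; rewrite mulr_gt0 ?invr_gt0 ?ltr0n ?fact_gt0.
 by apply: DeriveDef; [exact: cvgP h|exact: cvg_lim h].
Unshelve. all: by end_near. Qed.

Lemma Cinf_ek k : Cinf (ek k).
Proof.
move=> n; elim: n k => [|n IH] k.
 split => // x; apply: differentiable_continuous; apply/derivable1_diffP.
 by have [] := ek_derive k x.
apply: Ck_is_derive (ek_derive k) _.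
have -> : (fun x => ek k.+2 x - k%:R * ek k.+1 x) = (fun x => ek k.+2 x + (- k%:R) * ek k.+1 x).
 by ext => x; rewrite mulNr.
by apply: CkD => //; exact: CkZ.
Qed.

Lemma Ck_inv (V : normedModType R) n (f : V -> R) : (forall x, f x != 0) ->
 Ck n f -> Ck n (fun x => (f x)^-1).
Proof.
move=> f0; elim: n => [|n IH] Cf.
 by split => // x; apply: cvgV => //; exact: (Ck_cont Cf).
have [cf hf] := Cf; split; first by move=> x; apply: cvgV => //; exact: cf.
move=> v; have [df cdf] := hf v.
have E x : derivable (fun x => (f x)^-1) x v /\
  'D_v (fun x => (f x)^-1) x = (-1) * ((f x)^-1 * (f x)^-1 * 'D_v f x).
 have dv := @derivableV _ _ f x v (f0 x) (df x).
 split; first exact: dv.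
 rewrite [LHS](@deriveV _ _ f x v (f0 x) (df x)).
 by rewrite -exprVn expr2 mulN1r -[_ *: _]/(_ * _) mulNr.
split => [x|]; first by have [] := E x.
rewrite (_ : 'D_v _ = fun x => (-1) * ((f x)^-1 * (f x)^-1 * 'D_v f x)); last first.
 by ext => x; have [] := E x.
have Cv := IH (CkW Cf).
by apply: CkZ; apply: CkM => //; exact: CkM.
Qed.

Lemma Cinf_affine (f : R -> R) (a c : R) : Cinf f -> Cinf (fun x => f (a * x + c)).
Proof.
move=> Cf n; apply: (@Ck_comp_affine _ _ (fun x => a * x) c) => //.
 by move=> h u v; rewrite -[h *: u]/(h * u) -[h *: (a * u)]/(h * (a * u)); ring.
by move=> x; apply: cvgM; [exact: cvg_cst|exact: cvg_id].
Qed.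

Lemma CinfM (V : normedModType R) (f g : V -> R) : Cinf f -> Cinf g -> Cinf (fun x => f x * g x).
Proof. by move=> h1 h2 n; exact: CkM. Qed.

Lemma CinfD (V : normedModType R) (f g : V -> R) : Cinf f -> Cinf g -> Cinf (fun x => f x + g x).
Proof. by move=> h1 h2 n; exact: CkD. Qed.

Lemma Cinf_cst (V : normedModType R) (c : R) : Cinf (fun _ : V => c).
Proof. by move=> n; exact: Ck_cst. Qed.

Lemma Cinf_derive1 (f : R -> R) : Cinf f -> Cinf (derive1 f).
Proof.
move=> Cf n; rewrite (_ : (derive1 f) = 'D_1 f); last by ext => x; rewrite derive1E.
by have [_ /(_ 1)[]] := Cf n.+1.
Qed.

Lemma Cinf_cont (V : normedModType R) (f : V -> R) : Cinf f -> continuous f.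
Proof. by move=> /(_ 0%N)[]. Qed.

Lemma Cinf_is_derive (f : R -> R) (x : R) : Cinf f -> is_derive x 1 f ((derive1 f) x).
Proof.
move=> /(_ 1%N)[_ /(_ 1)[df _]]; rewrite derive1E.
by apply: DeriveDef => //; exact: df.
Qed.

Definition bump1 (b : R -> R) :=
 Cinf b /\ exists A : R, forall x, A <= `|x| -> b x = 0.

Lemma bump1_bounded b : bump1 b -> exists M : R, forall x, `|b x| <= M.
Proof.
move=> [Cb [A hA]].
have A0 : - (`|A| + 1) <= `|A| + 1 by rewrite ge0_cp// addr_ge0.
have cb : {within `[- (`|A| + 1), `|A| + 1], continuous (fun x => `|b x|)}.
 by apply: continuous_subspaceT => x; apply: continuous_comp; [exact: (Cinf_cont Cb)|exact: norm_continuous].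
have [M _ hM] := EVT_max A0 cb.
exists (Num.max `|b M| 0) => x; have [xA|Ax] := leP `|x| (`|A| + 1); last first.
 rewrite hA ?normr0 ?le_max ?lexx ?orbT//.
 by apply: le_trans (ltW Ax); apply: le_trans (ler_norm A) _; rewrite lerDl.
by rewrite le_max hM//= in_itv/= -ler_norml.
Qed.

Lemma bump1_derive b : bump1 b -> bump1 (derive1 b).
Proof.
move=> [Cb [A hA]]; split; first exact: Cinf_derive1.
exists (A + 1) => x hx; rewrite derive1E.
rewrite (@near_eq_derive _ _ _ b (cst 0))//; first exact: derive_cst.
near=> y; rewrite hA//.
have : `|y - x| < 1 by near: y; exact: (@cvgr_distC_lt _ _ _ _ _ id x cvg_id).
move=> yx; have := ler_distD y x 0; rewrite !subr0 distrC => h; lra.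
Unshelve. all: by end_near. Qed.

Lemma bump1_mul b c : bump1 b -> Cinf c -> bump1 (fun x => b x * c x).
Proof.
move=> [Cb [A hA]] Cc; split; first exact: CinfM.
by exists A => x /hA ->; rewrite mul0r.
Qed.

Lemma bump1_affine b (a c : R) : bump1 b -> a != 0 -> bump1 (fun x => b (a * x + c)).
Proof.
move=> [Cb [A hA]] a0; split; first exact: Cinf_affine.
have na : 0 < `|a| by rewrite normr_gt0.
exists ((A + `|c|) / `|a|) => x; rewrite ler_pdivrMr// => h; apply: hA.
have := ler_normD (a * x + c) (- c); rewrite addrK normrN normrM [`|a| * _]mulrC.
move: h; lra.
Qed.

End smooth_functions.

(** * Layer-cake bounds and inequalities for powers *)

Section layer_cake.
Context d (X : measurableType d) (R : realType).
Variable mu : {measure set X -> \bar R}.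

(** The sum over [i] of the geometric series [2^r (2^(r - m))^i], convergent for [r < m]. *)
Definition layerC (m r : R) : R := 2 `^ r / (1 - 2 `^ (r - m)).

(* Dyadic layers: [W^r] is at most the sum of [(2^(i+1) L)^r] over the [i] with
 [2^i L < W]. *)
Lemma layer_cake (W : X -> R) (M m r L : R) : measT W ->
 0 < r -> r < m -> 0 <= M -> 0 < L ->
 (forall l, 0 < l -> (mu [set z | (l < W z)%R] <= (M * l `^ (- m))%:E)%E) ->
 (\int[mu]_z (W z `^ r * \1_[set z | (L < W z)%R] z)%:E <=
  (layerC m r * M * L `^ (r - m))%:E)%E.
Proof.
move=> mW r0 rm M0 L0 hM.
pose l i : R := 2 ^+ i * L.
have l0 i : 0 < l i by rewrite mulr_gt0// exprn_gt0.
pose A i := [set z | l i < W z].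
have mA i : measurable (A i) by exact: mset_gt.
pose f i z : \bar R := (((2 * l i) `^ r) * \1_(A i) z)%:E.
have f0 i z : (0 <= f i z)%E by rewrite lee_fin mulr_ge0// powR_ge0.
have mf i : measT (f i).
 by apply/mEFinP; apply: mfunM => //; exact: mindic.
have intf i : (\int[mu]_z f i z <= (2 `^ r * M * L `^ (r - m) * (2 `^ (r - m)) ^+ i)%:E)%E.
 rewrite integral_cindic ?powR_ge0//.
 apply: (letr (((2 * l i) `^ r)%:E * (M * l i `^ (- m))%:E)%E).
  by apply: lee_wpmul2l; [rewrite lee_fin powR_ge0|exact: hM].
 rewrite -EFinM lee_fin powRM ?(ltW (l0 i))//.
 rewrite mulrACA.
 rewrite -powRD; last by rewrite (gt_eqF (l0 i)) implybT.
 rewrite /l powRM ?exprn_ge0 ?(ltW L0)// -powR_mulrn// -powRrM mulrC.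
 rewrite (mulrC i%:R) powRrM powR_mulrn ?powR_ge0//.
 by apply: le_of_eq; ring.
have q1 : `|2 `^ (r - m)| < 1 :> R.
 rewrite ger0_norm ?powR_ge0// -[ltRHS](powRr0 2).
 by rewrite /powR pnatr_eq0/= ltr_expR ltr_pM2r ?ln_gt0 ?ltr1n// subr_lt0.
apply: (letr (\int[mu]_z \sum_(0 <= i <oo) f i z)%E).
 apply: ge0_le_integral => //.
 - by move=> z _; rewrite lee_fin mulr_ge0// powR_ge0.
 - apply/mEFinP; apply: mfunM.
   exact: (mpowR r).
  by apply: mindic; exact: mset_gt.
 - exact: ge0_emeasurable_sum.
 move=> z _; rewrite [X in (X%:E <= _)%E]mulrC indicE; case: (boolP (z \in _)); last first.
  by rewrite mul0r => _; apply: nneseries_ge0.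
 rewrite inE mul1r /= => Lz.
 (* The layer of [z] is the least [n] with [W z <= 2^(n+1) L]. Minimality gives the lower
    inequality, and for [n = 0] it is [L < W z]. *)
 have [n /andP[n1 n2]] : exists n, l n < W z <= 2 * l n.
  have ex : exists n, W z <= 2 * l n.
   exists (Num.truncn (W z / L)); rewrite /l mulrA -exprS -ler_pdivrMr//.
   apply: ltW; apply: (lt_trans (truncnS_gt _)); rewrite -natrX ltr_nat.
   exact: ltn_expl.
  exists (ex_minn ex); case: ex_minnP => n hn hmin; rewrite hn andbT.
  case: n hn hmin => [|n] hn hmin; first by rewrite /l expr0 mul1r.
  rewrite ltNge; apply/negP => h; have := hmin n; rewrite ltnn => /(_ _)/negP; apply => //.
  by move: h; rewrite /l exprS mulrA.
 apply: (letr (\sum_(0 <= i < n.+1) f i z)%E); last exact: nneseries_lim_ge.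
 rewrite big_nat_recr//=; apply: (letr (f n z)); last by rewrite leeDr// sume_ge0.
 rewrite lee_fin indicE mem_set// mulr1; apply: ge0_ler_powR => //; rewrite ?nnegrE ?(ltW r0)//.
  by apply: ltW; exact: lt_trans Lz.
 by rewrite mulr_ge0// ltW.
rewrite integral_nneseries//; apply: lime_le.
 by apply: is_cvg_nneseries => i _ _; exact: integral_ge0.
apply: nearW => n.
apply: (letr (\sum_(0 <= i < n) (2 `^ r * M * L `^ (r - m) * (2 `^ (r - m)) ^+ i)%:E)%E).
 by apply: lee_sum => i _.
rewrite sumEFin lee_fin.
have := @geometric_le_lim R n (2 `^ r * M * L `^ (r - m)) (2 `^ (r - m)).
rewrite !mulr_ge0 ?powR_ge0// => /(_ isT (powR_gt0 _ _) q1); rewrite ltr0n => /(_ isT).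
move=> h; apply: le_trans h _.
by rewrite /layerC; apply: le_of_eq; ring.
Qed.

End layer_cake.

Section scalar_inequalities.
Context {R : realType}.

Lemma powRD_le (a b p : R) : 0 <= a -> 0 <= b -> 0 <= p ->
 (a + b) `^ p <= 2 `^ p * (a `^ p + b `^ p).
Proof.
move=> a0 b0 p0; wlog ab : a b a0 b0 / a <= b.
 move=> h; have [ab|/ltW ba] := leP a b; first exact: h.
 by rewrite addrC (addrC (a `^ p)); exact: h.
apply: (letr ((2 * b) `^ p)).
 by powR_mono; rewrite ?addr_ge0 ?mulr_ge0//; lra.
by rewrite powRM// ler_pM2l ?powR_gt0// lerDr powR_ge0.
Qed.

Lemma powR_le1W (a s t : R) : 0 <= a <= 1 -> 0 < s -> s <= t -> a `^ t <= a `^ s.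
Proof.
move=> /andP[a0 a1] s0 st; have [->|an0] := eqVneq a 0.
 by rewrite !powR0// ?gt_eqF//; exact: lt_le_trans st.
rewrite -(subrKC s t) powRD ?an0 ?implybT// ler_piMr ?powR_ge0//.
have [->|ts] := eqVneq (t - s) 0; first by rewrite powRr0.
apply: (letr (1 `^ (t - s))); last by rewrite powR1.
by powR_mono; rewrite ?subr_ge0.
Qed.

(** Since [(e^(-1/y))^s = e^(-s/y)], a power of a cut-off is the same cut-off with its gap
    multiplied by [s]. *)
Lemma ek_powR (y s : R) : 0 < s -> ek 0 y `^ s = ek 0 (y / s).
Proof.
move=> s0; rewrite /ek pmulr_lgt0 ?invr_gt0//.
case: ltP => [y0|_]; last by rewrite powR0 ?gt_eqF.
rewrite !expr0 !mul1r -expRM invf_div.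
by congr expR; rewrite mulNr mulrC.
Qed.

Lemma ek0_le1 (x : R) : ek 0 x <= 1.
Proof.
rewrite /ek; case: ltP => // x0; rewrite expr0 mul1r -[leRHS]expR0 ler_expR.
by rewrite oppr_le0 invr_ge0 ltW.
Qed.

Lemma ek2_le2 (x : R) : ek 2 x <= 2.
Proof.
rewrite /ek; case: ltP => // x0; set y := x^-1.
have y0 : 0 <= y by rewrite invr_ge0 ltW.
rewrite expRN ler_pdivrMr ?expR_gt0//.
have := expR_ge1Dxn 1 y0; rewrite (_ : 2`!%:R = 2) //.
set e := expR y; set t := y ^+ 2; lra.
Qed.

Lemma ek0_ge (x s : R) : 0 < s -> s <= x -> expR (- s^-1) <= ek 0 x.
Proof.
move=> s0 sx; rewrite /ek (lt_le_trans s0 sx) expr0 mul1r ler_expR lerN2.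
by rewrite lef_pV2 ?posrE// (lt_le_trans s0 sx).
Qed.

End scalar_inequalities.

Section hoelder_real.
Context d (X : measurableType d) (R : realType).
Variable mu : {measure set X -> \bar R}.

Lemma hoelder_int (f g : X -> R) (s t : R) : measT f -> measT g ->
 0 < s -> 0 < t -> s^-1 + t^-1 = 1 -> (forall x, 0 <= f x) -> (forall x, 0 <= g x) ->
 Rintg mu (fun x => f x `^ s) -> Rintg mu (fun x => g x `^ t) ->
 Rintg mu (fun x => f x * g x) /\
 Rint mu (fun x => f x * g x) <=
  Rint mu (fun x => f x `^ s) `^ s^-1 * Rint mu (fun x => g x `^ t) `^ t^-1.
Proof.
move=> mf mg s0 t0 st f0 g0 If Ig.
have := hoelder mu mf mg s0 t0 st.
have NE (h : X -> R) r : 0 < r -> (forall x, 0 <= h x) -> Rintg mu (fun x => h x `^ r) ->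
  'N[mu]_r%:E[EFin \o h]%E = (Rint mu (fun x => h x `^ r) `^ r^-1)%:E.
 move=> r0 h0 Ih; rewrite unlock -poweR_EFin (IIE Ih); congr (_ `^ _)%E.
 by apply: eq_integral => x _; rewrite /= ger0_norm.
rewrite (NE f)// (NE g)// Lnorm1 -EFinM => h.
have E : (\int[mu]_x `|(EFin \o (f \* g)%R) x| = \int[mu]_x (f x * g x)%:E)%E.
 by apply: eq_integral => x _; rewrite /= ger0_norm ?mulr_ge0.
have i : Rintg mu (fun x => f x * g x).
 apply/integrableP; split; first by apply/mEFinP; exact: mfunM.
 exact: le_lt_trans h (ltry _).
by split => //; move: h; rewrite E -(IIE i) lee_fin.
Qed.

End hoelder_real.

(** * Products of one-variable functions *)

Section tensors.
Context {R : realType} {N : nat}.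
Notation Z := ('rV[R]_N * mR R)%type.
Notation mu := (@leb R N \x @lebesgue_measure R)%E.
Notation itg := (Rintg mu).
Notation II := (Rint mu).
Notation fam := (option 'I_N -> R -> R).
Implicit Types (b : fam) (o : option 'I_N) (z w : Z).

(** Test functions and cut-offs have this form throughout: supports lie in boxes, translations act
    on each factor, and a partial derivative changes a single factor. *)
Definition tens b z : R := \prod_o b o (co o z).
Definition dt o b : fam := fun o' => if o' == o then derive1 (b o) else b o'.
Definition bumps b := forall o, bump1 (b o).
Definition shb z b : fam := fun o x => b o (x - co o z).

Lemma tens_shb z0 b z : tens (shb z0 b) z = tens b (z - z0).
Proof. by apply: eq_bigr => o _; rewrite /shb coB. Qed.

Lemma bumps_shb z b : bumps b -> bumps (shb z b).
Proof.
move=> hb o; rewrite /shb; under eq_fun do rewrite -[X in X - _]mul1r.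
by apply: bump1_affine => //; exact: oner_neq0.
Qed.

Lemma derive1_shift (f : R -> R) c x : derive1 (fun y => f (y + c)) x = derive1 f (x + c).
Proof.
apply: (congr1 (fun F : R -> R => lim (F @ (0 : R)^'))).
by ext => h; rewrite /= addrA.
Qed.

Lemma dt_shb o z b : dt o (shb z b) = shb z (dt o b).
Proof.
ext => o'; ext => x; rewrite /dt /shb; case: eqP => // ->.
by rewrite derive1_shift.
Qed.

Lemma bumps_dt o b : bumps b -> bumps (dt o b).
Proof. by move=> hb o'; rewrite /dt; case: eqP => // _; exact: bump1_derive. Qed.

Lemma tens_bounded b : bumps b -> exists M : R, forall z, `|tens b z| <= M.
Proof.
move=> hb; pose M o := projT1 (cid (bump1_bounded (hb o))).
have hM o x : `|b o x| <= M o by rewrite /M; case: cid.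
exists (\prod_o M o) => z; rewrite /tens normr_prod.
by apply: ler_prod => o _; rewrite normr_ge0 hM.
Qed.

Lemma tens_supp b : bumps b -> exists2 A : R, 0 <= A &
 forall z, tens b z != 0 -> forall o, `|co o z| < A.
Proof.
move=> hb; pose A o := projT1 (cid (hb o).2).
have hA o x : A o <= `|x| -> b o x = 0 by rewrite /A; case: cid => A' /= h'; exact: h'.
exists (\sum_o `|A o|) => [|z nz o]; first by rewrite sumr_ge0.
apply: (@lt_le_trans _ _ (A o)).
 rewrite ltNge; apply: contraNN nz => /hA h.
 by rewrite /tens (bigD1 o)//= h mul0r.
by rewrite (bigD1 o)//=; apply: (le_trans (ler_norm _)); rewrite lerDl sumr_ge0.
Qed.

Lemma measurable_tens b : (forall o, continuous (b o)) -> measT (tens b).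
Proof.
move=> cb; apply: measurable_prod => o _.
by apply: (mcomp (f := b o)); [exact: continuous_measurable_fun|exact: measurable_co].
Qed.

Lemma bumps_meas b : bumps b -> measT (tens b).
Proof. by move=> hb; apply: measurable_tens => o; exact: Cinf_cont (hb o).1. Qed.

Lemma itg_mul_tens b (F : Z -> R) : bumps b -> itg F -> itg (fun z => F z * tens b z).
Proof.
by move=> hb; have [M hM] := tens_bounded hb; exact: itg_bnd (bumps_meas hb) hM.
Qed.

Lemma itg_bounded_supp (F : Z -> R) (M A : R) : measT F -> 0 <= A ->
 (forall z, `|F z| <= M) -> (forall z, F z != 0 -> forall o, `|co o z| < A) -> itg F.
Proof.
move=> mF A0 FM FA.
pose E : set Z := obox (fun=> - A) (fun=> A).
apply: (itg_dom (g := fun z => M * \1_E z)) => //.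
 move=> z; have [->|nz] := eqVneq (F z) 0.
  rewrite normr0 mulr_ge0//; exact: le_trans (normr_ge0 _) (FM z).
 rewrite indicE mem_set ?mulr1// => o; rewrite /= in_itv/= -ltr_norml; exact: FA.
apply: itgZ; apply: itg_indic; first exact: mset_obox.
by apply: fin_obox => _; rewrite ge0_cp.
Qed.

Lemma itg_tens b : bumps b -> itg (tens b).
Proof.
move=> hb; have [M hM] := tens_bounded hb; have [A A0 hA] := tens_supp hb.
by apply: itg_bounded_supp A0 hM hA; exact: bumps_meas.
Qed.

Lemma tens_split o b z : tens b z = b o (co o z) * \prod_(o' | o' != o) b o' (co o' z).
Proof. by rewrite /tens (bigD1 o). Qed.

Lemma tens_dt o b z :
 tens (dt o b) z = derive1 (b o) (co o z) * \prod_(o' | o' != o) b o' (co o' z).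
Proof.
rewrite (tens_split o) /dt eqxx; congr (_ * _).
by apply: eq_bigr => o' /negbTE ->.
Qed.

Lemma is_derive_tens o b z (r : R) : (forall o, Cinf (b o)) ->
 is_derive r 1 (fun r => tens b (z - dir o r)) (- tens (dt o b) (z - dir o r)).
Proof.
move=> cb; pose P := \prod_(o' | o' != o) b o' (co o' z).
have E r' : \prod_(o' | o' != o) b o' (co o' (z - dir o r')) = P.
 by apply: eq_bigr => o' /negbTE h; rewrite coB co_dir h subr0.
rewrite tens_dt E (_ : (fun r => _) = (P *: (b o \o (fun r => co o z - r)))); last first.
 ext => r'; rewrite (tens_split o) E coB co_dir eqxx mulrC.
 by [].
have h1 : is_derive r 1 (fun r : R => co o z - r) (- 1).
 have := is_deriveB (is_derive_cst (co o z) r (1 : R)) (is_derive_id r 1).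
 by rewrite sub0r.
have h2 := @is_derive1_comp _ (b o) (fun r => co o z - r) r _ _ (Cinf_is_derive _ (cb o)) h1.
apply: is_derive_eq (is_deriveZ P h2) _.
by rewrite -[P *: _]/(P * _) coB co_dir eqxx; ring.
Qed.

(** Weak differentiability on the whole space, tested only with products of bumps. It is applied to
    functions that have already been cut off, so there is no domain to carry along. *)
Definition wpd o (F G : Z -> R) := forall b, bumps b ->
 II (fun z => F z * tens (dt o b) z) = - II (fun z => G z * tens b z).

End tensors.

(* The library's sigma-finite instance on products is shadowed by the
 probability one, hence this copy of the product measure. *)
Section space_time_measure.
Context {R : realType} (N : nat).
Notation Z := ('rV[R]_N * mR R)%type.

Definition muZ : set Z -> \bar R := (@leb R N \x @lebesgue_measure R)%E.
HB.instance Definition _ := Measure.on muZ.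

Lemma muZ_sigma_finite : sigma_finite setT muZ.
Proof.
exists (fun n => obox (fun=> - n%:R) (fun=> n%:R)).
 apply/seteqP; split => // z _.
 pose M := \sum_(o : option 'I_N) `|co o z|.
 exists (Num.truncn M).+1 => // o; rewrite /= in_itv/= -ltr_norml.
 apply: (@le_lt_trans _ _ M); first by rewrite /M (bigD1 o)//= lerDl sumr_ge0.
 exact: truncnS_gt.
move=> n; split; first exact: mset_obox.
by apply: fin_obox => _; rewrite ge0_cp.
Qed.

HB.instance Definition _ := Measure_isSigmaFinite.Build _ _ _ muZ muZ_sigma_finite.

End space_time_measure.

Section space_time.
Context {R : realType} {N : nat}.
Notation Z := ('rV[R]_N * mR R)%type.
Notation mu := (@leb R N \x @lebesgue_measure R)%E.
Notation lam := (@lebesgue_measure R).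
Notation itg := (Rintg mu).
Notation II := (Rint mu).
Notation muS := (@muZ R N).
Implicit Types (o : option 'I_N) (z : Z).

(** * Weak derivatives of continuous functions *)

Section weak_derivative_of_continuous.
Notation fam := (option 'I_N -> R -> R).
Implicit Types (b : fam) (w : Z).

Definition bmp (e x : R) : R := ek 0 (e + x) * ek 0 (e - x).

Lemma bmp_bump1 e : bump1 (bmp e).
Proof.
split.
 rewrite /bmp; apply: CinfM.
  rewrite (_ : (fun x => _) = fun x => ek 0 (1 * x + e)).
   by apply: Cinf_affine; exact: Cinf_ek.
  by ext => x; rewrite mul1r addrC.
 rewrite (_ : (fun x => _) = fun x => ek 0 (- 1 * x + e)).
  by apply: Cinf_affine; exact: Cinf_ek.
 by ext => x; rewrite mulN1r addrC.
exists e => x; rewrite /bmp ler_normr => /orP[h|h].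
 by rewrite [ek 0 (e - x)]ek_le0 ?mulr0// subr_le0.
by rewrite [ek 0 (e + x)]ek_le0 ?mul0r// -[x]opprK subr_le0.
Qed.

Lemma bmp_ge0 e x : 0 <= bmp e x.
Proof. by rewrite mulr_ge0// ek_ge0. Qed.

Lemma bmp_supp e x : bmp e x != 0 -> `|x| < e.
Proof.
have [_ _] := bmp_bump1 e; rewrite ltNge; apply: contraNN; rewrite /bmp ler_normr => /orP[h|h].
 by rewrite [ek 0 (e - x)]ek_le0 ?mulr0// subr_le0.
by rewrite [ek 0 (e + x)]ek_le0 ?mul0r// -[x]opprK subr_le0.
Qed.

Definition bmpZ (e : R) (a : Z) : fam := shb a (fun=> bmp e).

Lemma bumps_bmpZ e a : bumps (bmpZ e a).
Proof. by apply: bumps_shb => o; exact: bmp_bump1. Qed.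

Lemma bmpZ_supp e a z : tens (bmpZ e a) z != 0 -> near0 e (z - a).
Proof.
rewrite tens_shb => h o; apply: bmp_supp; apply: contraNN h => /eqP h.
by rewrite (tens_split o) h mul0r.
Qed.

Lemma bmpZ_ge0 e a z : 0 <= tens (bmpZ e a) z.
Proof. by rewrite tens_shb; apply: prodr_ge0 => o _; exact: bmp_ge0. Qed.

(** The bumps are not normalised; later arguments divide by their mass. Its positivity comes from a
    lower bound for the bump on the box of half the size. *)
Lemma II_bmpZ_gt0 e a : 0 < e -> 0 < II (tens (bmpZ e a)).
Proof.
move=> e0; have ib := itg_tens (bumps_bmpZ e a).
pose E : set Z := obox (fun o => co o a - e / 2) (fun o => co o a + e / 2).
have mE : measurable E by exact: mset_obox.
have ab o : co o a - e / 2 <= co o a + e / 2 by rewrite lerD2l ge0_cp// divr_ge0// ltW.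
pose m := (expR (- 2%:R / e) * expR (- 2%:R / e)) ^+ #|{: option 'I_N}|.
have m0 : 0 < m by rewrite exprn_gt0// mulr_gt0// expR_gt0.
have iE : itg \1_E by apply: itg_indic => //; exact: fin_obox.
apply: (@lt_le_trans _ _ (II (fun z => m * \1_E z))); last first.
 apply: le_II => //; first exact: itgZ.
 move=> z; rewrite indicE; case: (boolP (z \in E)); last by rewrite mulr0 bmpZ_ge0.
 rewrite inE mulr1 => Ez; rewrite tens_shb /m -prodr_const.
 apply: ler_prod => o _; rewrite mulr_ge0 ?expR_ge0//=.
 have := Ez o; rewrite /= in_itv/= coB => /andP[h1 h2].
 have ekb x : e / 2 < x -> expR (- 2%:R / e) <= ek 0 x.
  move=> hx; have x0 : 0 < x by apply: lt_trans hx; rewrite divr_gt0.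
  rewrite ek_gt0// expr0 mul1r ler_expR mulNr lerN2.
  rewrite -[X in _ <= X]invrK lef_pV2 ?posrE ?invr_gt0 ?divr_gt0//.
  by rewrite invf_div ltW.
 by apply: ler_pM; rewrite ?expR_ge0//; apply: ekb; lra.
rewrite IIZ// mulr_gt0//.
have e1 := IIE iE; rewrite (integral_indicT _ mE) in e1.
have [->] := etrans e1 (mu_obox ab).
by rewrite mulr_gt0//; [apply: prodr_gt0 => i _; lra|lra].
Qed.

Lemma itg_bounded_tens (F : Z -> R) b C : bumps b -> measT F ->
 (forall z, `|F z| <= C) -> itg (fun z => F z * tens b z).
Proof.
move=> hb mF FC; rewrite (_ : (fun z => _) = fun z => tens b z * F z); last first.
 by ext => z; rewrite mulrC.
by apply: (itg_bnd mF FC); exact: itg_tens.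
Qed.

Lemma tens_shift_dir b a o r z : tens (shb (a + dir o r) b) z = tens (shb a b) (z - dir o r).
Proof. by rewrite !tens_shb; congr (tens _ _); rewrite opprD addrA addrAC. Qed.

(* Translating the bump instead of [K] turns the weak equation into an ordinary
 derivative in the translation parameter. *)
Lemma is_derive_translate (K : Z -> R) b o (C r : R) : bumps b ->
 measT K -> (forall z, `|K z| <= C) ->
 is_derive r 1 (fun r => II (fun z => K z * tens b (z - dir o r)))
  (- II (fun z => K z * tens (dt o b) (z - dir o r))).
Proof.
move=> hb mK KC.
have C0 : 0 <= C by exact: le_trans (normr_ge0 _) (KC 0).
have hd := bumps_dt o hb.
have [M hM] := tens_bounded hd; have [A A0 hA] := tens_supp hd.
pose f r z := K z * tens b (z - dir o r).
have fE r' : f r' = (fun z => K z * tens (shb (dir o r') b) z).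
 by ext => z; rewrite tens_shb.
have df (r' : R) z : is_derive r' 1 (f ^~ z) (- (K z * tens (dt o b) (z - dir o r'))).
 have := is_deriveZ (K z) (@is_derive_tens _ _ o b z r' (fun o => (hb o).1)).
 by move/is_derive_eq; apply; rewrite -[K z *: _]/(K z * _) mulrN.
have dfE r' z : partial1of2 f r' z = - (K z * tens (dt o b) (z - dir o r')).
 by rewrite partial1of2E; have [_] := df r' z.
(* For shifts within 1 of [r] all translated supports lie in one box, whose indicator supplies the
   integrable majorant for differentiating under the integral. *)
pose B := A + `|r| + 1.
have B0 : 0 <= B by rewrite !addr_ge0.
pose E : set Z := obox (fun=> - B) (fun=> B).
pose G z := C * `|M| * \1_E z.
have iG : itg G.
 apply: itgZ; apply: itg_indic; first exact: mset_obox.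
 by apply: fin_obox => _; rewrite ge0_cp.
have Ir : `]r - 1, r + 1[%classic r by rewrite /= in_itv/=; apply/andP; split; lra.
have intf r' : `]r - 1, r + 1[%classic r' -> itg (f r').
 by move=> _; rewrite fE; apply: itg_bounded_tens KC => //; exact: bumps_shb.
have der r' z : `]r - 1, r + 1[%classic r' -> (setT : set Z) z -> derivable (f ^~ z) r' 1.
 by move=> _ _; have [] := df r' z.
have G0 z : 0 <= G z by rewrite mulr_ge0// mulr_ge0.
have GU r' z : `]r - 1, r + 1[%classic r' -> (setT : set Z) z -> `|partial1of2 f r' z| <= G z.
 rewrite /= in_itv/= => /andP[r1 r2] _; rewrite dfE normrN normrM /G.
 have [->|nz] := eqVneq (tens (dt o b) (z - dir o r')) 0.
  by rewrite normr0 mulr0 G0.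
 rewrite indicE mem_set ?mulr1.
  by apply: ler_pM => //; apply: le_trans (hM _) (ler_norm _).
 move=> o'; rewrite /= in_itv/= -ltr_norml.
 have := hA _ nz o'; rewrite coB co_dir.
 have : `|r'| <= `|r| + 1.
  have := ler_normD (r' - r) r; rewrite subrK => h; apply: le_trans h _.
  rewrite addrC lerD2l ler_norml; apply/andP; split; lra.
 case: eqP => _; last first.
  by rewrite subr0 /B => _ h; apply: lt_le_trans h _; rewrite -addrA lerDl addr_ge0.
 move=> h1 h2; have := ler_normD (co o' z - r') r'; rewrite subrK /B; lra.
have h1 := @derivable_under_integral _ _ _ mu f setT measurableT r _ _ Ir intf der G G0 iG GU.
have h2 := @differentiation_under_integral _ _ _ mu f setT measurableT r _ _ Ir intf der G G0 iG GU.
apply: DeriveDef; first exact: h1.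
rewrite -derive1E [LHS]h2 -IIN; last first.
 rewrite (_ : (fun z => _) = fun z => K z * tens (shb (dir o r) (dt o b)) z).
  by apply: itg_bounded_tens KC => //; exact: bumps_shb.
 by ext => z; rewrite tens_shb.
by rewrite /Rint; congr Rintegral; ext => z; rewrite dfE.
Qed.

Definition cont_at (K : Z -> R) a := forall e, 0 < e -> exists2 d, 0 < d &
 forall w, near0 d w -> `|K (a + w) - K a| <= e.

Lemma near0W d d' w : d <= d' -> near0 d w -> near0 d' w.
Proof. by move=> dd h o; exact: lt_le_trans (h o) dd. Qed.

(** Shrinking bumps act as an approximate identity; both sides carry the mass of the bump as a
    factor. *)
Lemma cont_at_bmpZ (K : Z -> R) a e C : measT K -> (forall z, `|K z| <= C) ->
 cont_at K a -> 0 < e -> exists2 d, 0 < d & forall d', 0 < d' <= d ->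
 `|II (fun z => K z * tens (bmpZ d' a) z) - K a * II (tens (bmpZ d' a))|
  <= e * II (tens (bmpZ d' a)).
Proof.
move=> mK KC cK e0; have [d d0 hd] := cK e e0.
exists d => // d' /andP[d'0 d'd].
have hb := bumps_bmpZ d' a; have it := itg_tens hb.
have i1 := itg_bounded_tens hb mK KC.
rewrite -IIZ// -IIB//; last exact: itgZ.
apply: le_trans (normII (itgB i1 (itgZ _ it))) _; rewrite -IIZ//.
apply: le_II; [by apply: itg_norm; apply: itgB => //; exact: itgZ|exact: itgZ|].
move=> z; rewrite -mulrBl normrM [`|tens _ _|]ger0_norm ?bmpZ_ge0//.
have [->|nz] := eqVneq (tens (bmpZ d' a) z) 0; first by rewrite !mulr0.
rewrite ler_wpM2r ?bmpZ_ge0//.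
by have := hd _ (near0W d'd (bmpZ_supp nz)); rewrite subrKC.
Qed.

(** A mean value inequality. Averaging [K] against a narrow bump that slides along the segment gives
    a differentiable function of the sliding parameter, whose derivative is the average of [M]; then
    the bump shrinks. The weak equation is required only for bumps supported near the segment, so
    that it may be a local one. *)
Lemma weak_increment (K M : Z -> R) a o (h m om d0 CK CM : R) :
 measT K -> (forall z, `|K z| <= CK) ->
 measT M -> (forall z, `|M z| <= CM) ->
 0 < h -> 0 < d0 ->
 (forall b, bumps b -> (forall z, tens b z != 0 ->
   exists2 r, 0 <= r <= h & near0 d0 (z - (a + dir o r))) ->
  II (fun z => K z * tens (dt o b) z) = - II (fun z => M z * tens b z)) ->
 cont_at K a -> cont_at K (a + dir o h) ->
 (forall r w, 0 <= r <= h -> near0 d0 w -> `|M (a + dir o r + w) - m| <= om) ->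
 `|K (a + dir o h) - K a - h * m| <= h * om.
Proof.
move=> mK KC mM MC h0 d00 weq cK0 cKh Mm.
apply/ler_addgt0Pr => e e0.
have e2 : 0 < e / 2 by rewrite divr_gt0.
have [d1 d10 hd1] := cont_at_bmpZ mK KC cK0 e2.
have [d2 d20 hd2] := cont_at_bmpZ mK KC cKh e2.
pose d := Num.min d0 (Num.min d1 d2).
have dp : 0 < d by rewrite !lt_min d00 d10.
have dd0 : d <= d0 by rewrite ge_min lexx.
have {}hd1 := hd1 d; have {}hd2 := hd2 d.
rewrite dp !ge_min !lexx !orbT/= in hd1 hd2.
move: hd1 hd2 => /(_ isT) hd1 /(_ isT) hd2.
set b := bmpZ d a in hd1; have hb : bumps b by exact: bumps_bmpZ.
set c := II (tens b) in hd1; have c0 : 0 < c by exact: II_bmpZ_gt0.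
have bE r z : tens (bmpZ d (a + dir o r)) z = tens b (z - dir o r).
 exact: tens_shift_dir.
have cE r : II (tens (bmpZ d (a + dir o r))) = c.
 by rewrite /c -(II_shift (- dir o r) (itg_tens hb)); congr Rint; ext => z; rewrite bE.
rewrite cE in hd2.
pose Phi r := II (fun z => K z * tens b (z - dir o r)).
pose Psi r := II (fun z => M z * tens b (z - dir o r)).
have dPhi r : 0 <= r <= h -> is_derive r 1 Phi (Psi r).
 move=> rh; apply: is_derive_eq (is_derive_translate o r hb mK KC) _.
 pose b' := shb (dir o r) b.
 have -> : (fun z => K z * tens (dt o b) (z - dir o r)) = (fun z => K z * tens (dt o b') z).
  by ext => z; rewrite (dt_shb o (dir o r) b) (tens_shb (dir o r) (dt o b)).
 rewrite weq; last 2 first.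
 - exact: bumps_shb.
 - move=> z; rewrite (tens_shb (dir o r) b) -bE => /bmpZ_supp h1; exists r => //; exact: near0W h1.
 by rewrite opprK; congr Rint; ext => z; rewrite (tens_shb (dir o r) b).
have PsiB r : 0 <= r <= h -> `|Psi r - m * c| <= om * c.
 move=> rh; rewrite /Psi (_ : (fun z => _) = fun z => M z * tens (bmpZ d (a + dir o r)) z); last first.
  by ext => z; rewrite bE.
 rewrite -(cE r); have hbr := bumps_bmpZ d (a + dir o r); have itr := itg_tens hbr.
 have i1 := itg_bounded_tens hbr mM MC.
 rewrite -!IIZ// -IIB//; last exact: itgZ.
 apply: le_trans (normII (itgB i1 (itgZ _ itr))) _.
 apply: le_II; [by apply: itg_norm; apply: itgB => //; exact: itgZ|exact: itgZ|].
 move=> z; rewrite -mulrBl normrM [`|tens _ _|]ger0_norm ?bmpZ_ge0//.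
 have [->|nz] := eqVneq (tens (bmpZ d (a + dir o r)) z) 0; first by rewrite !mulr0.
 rewrite ler_wpM2r ?bmpZ_ge0//.
 by have := Mm r _ rh (near0W dd0 (bmpZ_supp nz)); rewrite subrKC.
have dP x : x \in `]0, h[ -> is_derive x 1 Phi (Psi x).
 by rewrite in_itv/= => /andP[r1 r2]; apply: dPhi; rewrite !ltW.
have cP : {within `[0, h], continuous Phi}.
 apply: derivable_within_continuous => r; rewrite in_itv/= => rh.
 by have [] := dPhi r rh.
have [r rh PhiE] := MVT h0 dP cP.
have P0 : Phi 0 = II (fun z => K z * tens b z).
 congr Rint; ext => z; congr (_ * tens _ _).
 by apply: coP => o'; rewrite coB co_dir; case: eqP; rewrite subr0.
have Ph : Phi h = II (fun z => K z * tens (bmpZ d (a + dir o h)) z).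
 by congr Rint; ext => z; rewrite bE.
rewrite -P0 in hd1; rewrite -Ph in hd2.
have rh' : 0 <= r <= h by move: rh; rewrite in_itv/= => /andP[r1 r2]; rewrite !ltW.
have {}PsiB := PsiB r rh'.
have key : `|(K (a + dir o h) - K a - h * m) * c| <= (h * om + e) * c.
 rewrite subr0 in PhiE.
 move: hd1 hd2 PsiB PhiE c0 h0; clear.
 move: (Phi h) (Phi 0) (Psi r) (K a) (K (a + dir o h)) c; clear.
 move=> ph p0 ps ka kb c hd1 hd2 PsiB E c0 h0.
 have -> : (kb - ka - h * m) * c = - (ph - kb * c) + (p0 - ka * c) + h * (ps - m * c).
  by rewrite -[ph](subrK p0) E; ring.
 have t2 : `|h * (ps - m * c)| <= h * (om * c) by rewrite normrM gtr0_norm// ler_pM2l.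
 have -> : (h * om + e) * c = (e / 2 * c + e / 2 * c) + h * (om * c) by field.
 apply: le_trans (ler_normD _ _) _; apply: lerD => //.
 by apply: le_trans (ler_normD _ _) _; rewrite normrN; exact: lerD.
by move: key; rewrite normrM (gtr0_norm c0) ler_pM2r.
Qed.

End weak_derivative_of_continuous.

(** * Correlations and difference quotients *)

Section correlation.
Implicit Types (b : option 'I_N -> R -> R) (w : Z) (F G V : Z -> R).

(** For integrable [F] and bounded integrable [V] it is uniformly continuous in the shift and
    inherits the weak derivatives of [F]. Pointwise arguments about it thus give information on [F],
    which has only weak derivatives. *)
Definition corr F V (xi : Z) : R := II (fun z => F (z + xi) * V z).

Lemma measurable_addZZ F : measT F ->
 measT (fun zx : Z * Z => F (zx.1 + zx.2)).
Proof.
move=> mF; apply: (mcomp mF).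
by apply: measurable_addZ; [exact: measurable_fst|exact: measurable_snd].
Qed.

Section bounded.
Variables (V : Z -> R) (MV : R).
Hypotheses (iV : itg V) (VM : forall z, `|V z| <= MV).

Lemma itg_corr F xi : itg F -> itg (fun z => F (z + xi) * V z).
Proof.
by move=> iF; apply: (itg_bnd (itgm iV) VM); exact: itg_shift.
Qed.

Lemma corr_bnd F xi : itg F -> `|corr F V xi| <= MV * II (fun z => `|F z|).
Proof.
move=> iF; apply: le_trans (normII (itg_corr xi iF)) _.
rewrite -(II_shift xi (itg_norm iF)) -IIZ; last exact: (itg_shift xi (itg_norm iF)).
apply: le_II.
- by apply: itg_norm; exact: itg_corr.
- by apply: itgZ; exact: (itg_shift xi (itg_norm iF)).
- by move=> z; rewrite normrM mulrC ler_wpM2r.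
Qed.

Lemma corrB F xi w : itg F ->
 `|corr F V (xi + w) - corr F V xi| <= MV * II (fun z => `|F (z + w) - F z|).
Proof.
move=> iF; have := @corr_bnd (fun z => F (z + w) - F z) xi.
move=> /(_ (itgB (itg_shift w iF) iF)).
rewrite {1}/corr (_ : (fun z => _) = fun z => F (z + (xi + w)) * V z - F (z + xi) * V z).
 by rewrite IIB//; exact: itg_corr.
by ext => z; rewrite mulrBl addrA.
Qed.

Lemma corr_ucont F : itg F -> forall e, 0 < e -> exists2 d, 0 < d &
 forall xi w, near0 d w -> `|corr F V (xi + w) - corr F V xi| <= e.
Proof.
move=> iF e e0.
have MV0 : 0 <= MV by exact: le_trans (normr_ge0 _) (VM 0).
have e1 : 0 < e / (MV + 1) by rewrite divr_gt0// ltr_wpDl.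
have [_ /(_ _ e1)[d d0 hd]] := itg_tcont iF.
exists d => // xi w wd; apply: le_trans (corrB xi w iF) _.
apply: (letr ((MV + 1) * (e / (MV + 1)))).
 apply: ler_pM => //; [exact: II_ge0|by rewrite lerDl|exact: hd].
by rewrite mulrC divfK// gt_eqF// ltr_wpDl.
Qed.

Lemma corr_cont_at F xi : itg F -> cont_at (corr F V) xi.
Proof.
by move=> iF e e0; have [d d0 hd] := corr_ucont iF e0; exists d => // w; exact: hd.
Qed.

Lemma itg_corr2 F (rho : Z -> R) Mr : itg F -> measT rho ->
 (forall z, `|rho z| <= Mr) ->
 (muS \x muS)%E.-integrable setT (EFin \o (fun zx : Z * Z => F (zx.1 + zx.2) * V zx.1 * rho zx.2)).
Proof.
move=> iF mr rM.
have Mr0 : 0 <= Mr by exact: le_trans (normr_ge0 _) (rM 0).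
apply: (@itg_prod _ _ _ _ _ muS muS _ (fun z => Mr * II (fun x => `|F x|) * `|V z|)).
- apply: mfunM; first apply: mfunM.
 + exact: (measurable_addZZ (itgm iF)).
 + by apply: (mcomp (itgm iV)); exact: measurable_fst.
 + by apply: (mcomp mr); exact: measurable_snd.
- by apply: itgZ; exact: itg_norm.
move=> z /=.
have iz : itg (fun x => F (z + x)).
 by rewrite (_ : (fun x => _) = fun x => F (x + z)); [exact: itg_shift|ext => x; rewrite addrC].
have i1 : itg (fun x => F (z + x) * V z * rho x).
 apply: (itg_bnd mr rM).
 by rewrite (_ : (fun x => _) = fun x => V z * F (z + x)); [exact: itgZ|ext => x; rewrite mulrC].
split => //.
have -> : II (fun x => `|F x|) = II (fun x => `|F (z + x)|).
 rewrite -(II_shift z (itg_norm iF)); congr Rint; ext => x.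
 by rewrite addrC.
rewrite mulrAC -IIZ; last exact: itg_norm.
apply: le_II; [exact: itg_norm|by apply: itgZ; exact: itg_norm|].
move=> x; rewrite (mulrC (Mr * _)) (mulrC Mr) mulrA !normrM.
by apply: ler_wpM2l; [exact: mulr_ge0|exact: rM].
Qed.

Lemma corr_measurable F : itg F -> measT (corr F V).
Proof.
move=> iF.
have h := @itg_corr2 F (fun=> 1) 1 iF (@measurable_cst _ _ _ _ _ _) (fun=> _).
have {}h := h (ltac:(by rewrite normr1)).
have := itgm (@itg_fubini2 _ _ _ _ _ muS muS _ h).
rewrite (_ : (fun y => _) = corr F V)//.
by ext => x; rewrite /corr; congr Rint; ext => z; rewrite /= mulr1.
Qed.

Lemma corr_fubini F (rho : Z -> R) Mr : itg F -> measT rho ->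
 (forall z, `|rho z| <= Mr) -> itg rho ->
 II (fun xi => corr F V xi * rho xi) =
 II (fun z => V z * II (fun x => F x * rho (x - z))).
Proof.
move=> iF mr rM ir.
have h := itg_corr2 iF mr rM.
have := @II_fubini _ _ _ _ _ muS muS _ h => /= E.
transitivity (II (fun xi => II (fun z => F (z + xi) * V z * rho xi))).
 congr Rint; ext => xi; rewrite mulrC -IIZ; last exact: itg_corr.
 by congr Rint; ext => z; rewrite mulrC.
rewrite -E; congr Rint; ext => z.
have i1 : itg (fun x => F x * rho (x - z)).
 apply: (itg_bnd (M := Mr)) => //.
 by apply: itgm; exact: (itg_shift (- z) ir).
rewrite -(II_shift z i1) -IIZ; last exact: (itg_shift z i1).
by congr Rint; ext => x; rewrite addrK (addrC x z); ring.
Qed.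

(** After Fubini the inner integral tests [F] with the translated bump [shb z b], to which the
    hypothesis on [F] applies for every [z]. *)
Lemma corr_wpd F G o b : itg F -> itg G -> wpd o F G -> bumps b ->
 II (fun z => corr F V z * tens (dt o b) z) = - II (fun z => corr G V z * tens b z).
Proof.
move=> iF iG FG hb; have hd := bumps_dt o hb.
have [M1 hM1] := tens_bounded hd; have [M2 hM2] := tens_bounded hb.
rewrite (corr_fubini iF (bumps_meas hd) hM1 (itg_tens hd)).
rewrite (corr_fubini iG (bumps_meas hb) hM2 (itg_tens hb)).
have h1 := @itg_corr2 G (tens b) M2 iG (bumps_meas hb) hM2.
rewrite -IIN.
 congr Rint; ext => z; rewrite -mulrN; congr (_ * _).
 have := FG _ (bumps_shb z hb); rewrite dt_shb => E.
 transitivity (II (fun x => F x * tens (shb z (dt o b)) x)).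
  by congr Rint; ext => x; rewrite tens_shb.
 by rewrite E; congr (- Rint _ _); ext => x; rewrite tens_shb.
have h2 := @itg_fubini1 _ _ _ _ _ muS muS _ h1.
suff <- : (fun z => Rint muS (fun y => G (z + y) * V z * tens b y)) =
  (fun z => V z * II (fun x => G x * tens b (x - z))) by exact: h2.
ext => z; rewrite -[Rint muS]/(II).
have i1 : itg (fun x => G x * tens b (x - z)).
 apply: (itg_bnd (M := M2)) => //.
 by apply: itgm; exact: (itg_shift (- z) (itg_tens hb)).
rewrite -(II_shift z i1) -IIZ; last exact: (itg_shift z i1).
by congr Rint; ext => x; rewrite addrK (addrC x z); ring.
Qed.

Lemma corr_increment F G o h m om : itg F -> itg G -> wpd o F G -> 0 < h ->
 (forall r, 0 <= r <= h -> `|corr G V (dir o r) - m| <= om) ->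
 `|corr F V (dir o h) - corr F V 0 - h * m| <= h * om.
Proof.
move=> iF iG FG h0 hm.
apply/ler_addgt0Pr => e e0.
have e1 : 0 < e / h by rewrite divr_gt0.
have [d d0 hd] := corr_ucont iG e1.
have := @weak_increment (corr F V) (corr G V) 0 o h m (om + e / h) d _ _
 (corr_measurable iF) (fun z => corr_bnd z iF) (corr_measurable iG)
 (fun z => corr_bnd z iG) h0 d0.
rewrite add0r mulrDr [h * (e / h)]mulrC divfK ?gt_eqF//; apply.
- by move=> b hb _; exact: corr_wpd.
- exact: corr_cont_at.
- exact: corr_cont_at.
move=> r w rh wd; rewrite add0r.
have -> : corr G V (dir o r + w) - m = (corr G V (dir o r + w) - corr G V (dir o r)) + (corr G V (dir o r) - m) by ring.
apply: le_trans (ler_normD _ _) _; rewrite addrC.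
by apply: lerD; [exact: hm|exact: hd].
Qed.

End bounded.

(* Tested against the sign of the difference. *)
Lemma wpd_quotient F G o : itg F -> itg G -> wpd o F G -> forall e, 0 < e ->
 exists2 d, 0 < d & forall h, 0 < h < d ->
  II (fun z => `|F (z + dir o h) - F z - h * G z|) <= h * e.
Proof.
move=> iF iG FG e e0; have [_ /(_ _ e0)[d d0 hd]] := itg_tcont iG.
exists d => // h /andP[h0 hd'].
pose D z := F (z + dir o h) - F z - h * G z.
have iD : itg D by apply: itgB; [apply: itgB => //; exact: itg_shift|exact: itgZ].
have mD := itgm iD.
pose bb n : set Z := obox (fun=> - n%:R) (fun=> n%:R).
have mbb n : measurable (bb n) by exact: mset_obox.
(* The sign is cut off to a box so that it becomes integrable; dominated convergence removes the
   boxes at the end. *)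
pose V n z := Num.sg (D z) * \1_(bb n) z.
have mV n : measT (V n).
 apply: mfunM; last exact: mindic.
 rewrite (_ : (fun z => _) = fun z => \1_(D @^-1` `]0, +oo[) z - \1_(D @^-1` `]-oo, 0[) z).
  by apply: measurable_funB; apply: mindic; rewrite -[X in measurable X]setTI; exact: mD.
 ext => z; rewrite !indicE.
 have [D0|D0|D0] := ltgtP (D z) 0.
 - rewrite ltr0_sg// memNset ?mem_set ?sub0r//= in_itv/= ?andbT//.
  by rewrite ltNge ltW.
 - rewrite gtr0_sg// mem_set ?memNset ?subr0//= in_itv/= ?andbT//.
  by rewrite ltNge ltW.
 - by rewrite D0 sgr0 !memNset ?subr0//= in_itv/= D0 ltxx.
have V1 n z : `|V n z| <= 1.
 rewrite normrM indicE normr_sg; case: (_ \in _); rewrite ?normr1 ?normr0 ?mulr0 ?mulr1//.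
 by case: (_ != 0).
have iV n : itg (V n).
 apply: (itg_dom (g := \1_(bb n))) => //.
  move=> z; rewrite normrM indicE normr_sg; case: (_ \in _); rewrite ?normr1 ?normr0 ?mulr0 ?mulr1//.
  by case: (_ != 0).
 by apply: itg_indic => //; apply: fin_obox => _; rewrite ge0_cp.
have DV n : II (fun z => `|D z| * \1_(bb n) z) <= h * e.
 have key : `|corr F (V n) (dir o h) - corr F (V n) 0 - h * corr G (V n) 0| <= h * e.
  apply: (corr_increment (iV n) (V1 n) iF iG FG h0).
  move=> r /andP[r0 rh]; rewrite -[dir o r]add0r.
  apply: le_trans (corrB (iV n) (V1 n) 0 (dir o r) iG) _; rewrite mul1r.
  apply: hd => o'; rewrite co_dir; case: eqP => _; last by rewrite normr0.
  by rewrite ger0_norm//; exact: le_lt_trans rh hd'.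
 apply: le_trans (le_trans (ler_norm _) key); apply: le_of_eq.
 have i1 := itg_corr (iV n) (V1 n) (dir o h) iF.
 have i2 := itg_corr (iV n) (V1 n) 0 iF.
 have i3 := itg_corr (iV n) (V1 n) 0 iG.
 rewrite /corr -IIB// -IIZ// -IIB//; [|exact: itgB|exact: itgZ].
 congr Rint; ext => z; rewrite addr0 -mulrBl.
 rewrite mulrA -mulrBl -/(D z) /V mulrA; congr (_ * _).
 by rewrite normrEsg mulrC.
have : II (fun z => `|D z| * \1_(bb n) z) @[n --> \oo] --> II (fun z => `|D z|).
 apply: (II_cvg (g := fun z => `|D z|)).
 - by move=> n; apply: mfunM; [exact: itgm (itg_norm iD)|exact: mindic].
 - exact: itgm (itg_norm iD).
 - apply: aeW => z; apply: cvg_near_cst.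
  pose M := \sum_(o : option 'I_N) `|co o z|.
  near=> n; rewrite indicE mem_set ?mulr1// => o'; rewrite /= in_itv/= -ltr_norml.
  apply: (@le_lt_trans _ _ M); last by near: n; exact: nbhs_infty_gtr.
  by rewrite /M (bigD1 o')//= lerDl sumr_ge0.
 - exact: itg_norm.
 - by move=> n z; rewrite normrM normr_id indicE; case: (_ \in _); rewrite ?normr1 ?normr0 ?mulr0 ?mulr1.
move/cvgr_to_le; apply; apply: nearW => n; exact: DV.
Unshelve. all: by end_near. Qed.

End correlation.

(** * Product and chain rules for weak derivatives *)

Section calculus_of_weak_derivatives.
Implicit Types (b : option 'I_N -> R -> R) (w : Z) (F G V : Z -> R).

Lemma itgMC F G (M : R) : measT G -> (forall z, `|G z| <= M) ->
 itg F -> itg (fun z => G z * F z).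
Proof.
move=> mG GM iF; have := itg_bnd mG GM iF.
by congr (itg _); ext => z; rewrite mulrC.
Qed.

Lemma tens_mul b b' z : tens (fun o x => b o x * b' o x) z = tens b z * tens b' z.
Proof. by rewrite /tens -big_split. Qed.

Lemma tens_dt_mul o b b' z : bumps b -> bumps b' ->
 tens (dt o (fun o x => b o x * b' o x)) z =
 tens (dt o b) z * tens b' z + tens b z * tens (dt o b') z.
Proof.
move=> hb hb'; rewrite !tens_dt !(tens_split o) big_split/=.
have -> : derive1 (fun x => b o x * b' o x) (co o z) =
  derive1 (b o) (co o z) * b' o (co o z) + b o (co o z) * derive1 (b' o) (co o z).
 have := is_deriveM (Cinf_is_derive (co o z) (hb o).1) (Cinf_is_derive (co o z) (hb' o).1).
 move=> [_ h]; rewrite derive1E [LHS]h -[_ *: _]/(_ * _) -[_ *: _]/(_ * _); ring.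
ring.
Qed.

(** The factor is moved to the test function: the product of two products of bumps is again one. *)
Lemma wpd_mul o F G b : itg F -> itg G -> wpd o F G -> bumps b ->
 wpd o (fun z => F z * tens b z) (fun z => G z * tens b z + F z * tens (dt o b) z).
Proof.
move=> iF iG FG hb b' hb'.
have hbb : bumps (fun o x => b o x * b' o x).
 by move=> o'; apply: bump1_mul; [exact: hb|exact: (hb' o').1].

have hd := bumps_dt o hb; have hd' := bumps_dt o hb'.

have i1 := itg_mul_tens hd' (itg_mul_tens hb iF).
have i2 := itg_mul_tens hb' (itg_mul_tens hd iF).
have i3 := itg_mul_tens hb' (itg_mul_tens hb iG).
have := FG _ hbb.
have -> : (fun z => G z * tens (fun o x => b o x * b' o x) z) =
  (fun z => G z * tens b z * tens b' z).
 by ext => z; rewrite tens_mul mulrA.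
have -> : (fun z => F z * tens (dt o (fun o x => b o x * b' o x)) z) =
  (fun z => F z * tens (dt o b) z * tens b' z + F z * tens b z * tens (dt o b') z).
 by ext => z; rewrite tens_dt_mul//; ring.
rewrite (IID i2 i1) => E.
have -> : (fun z => (G z * tens b z + F z * tens (dt o b) z) * tens b' z) =
 (fun z => G z * tens b z * tens b' z + F z * tens (dt o b) z * tens b' z).
 by ext => z; rewrite mulrDl.
by rewrite (IID i3 i2) opprD -E addrAC subrr add0r.
Qed.

Lemma tens_lipschitz b o : bumps b -> exists2 M : R, 0 <= M & forall z h, 0 < h ->
 `|tens b (z - dir o h) - tens b z| <= M * h.
Proof.
move=> hb; have [M hM] := tens_bounded (bumps_dt o hb).
exists M; first exact: le_trans (normr_ge0 _) (hM 0).
move=> z h h0; pose phi r := tens b (z - dir o r).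
have d (r : R) : is_derive r 1 phi (- tens (dt o b) (z - dir o r)).
 by apply: is_derive_tens => o'; exact: (hb o').1.
have c : {within `[0, h], continuous phi}.
 by apply: derivable_within_continuous => r _; have [] := d r.
have [r _ E] := MVT h0 (fun x _ => d x) c.
have <- : phi 0 = tens b z.
 by congr tens; apply: coP => o'; rewrite coB co_dir; case: eqP; rewrite subr0.
rewrite -[tens b (z - dir o h)]/(phi h) E subr0 normrM normrN gtr0_norm//.
by rewrite ler_wpM2r// ltW.
Qed.

Lemma tens_quotient_cvg b o z : bumps b ->
 n.+1%:R * (tens b (z - dir o n.+1%:R^-1) - tens b z) @[n --> \oo] --> - tens (dt o b) z.
Proof.
move=> hb; pose phi r := tens b (z - dir o r).
have z0 : z - dir o 0 = z.
 by apply: coP => o'; rewrite coB co_dir; case: eqP; rewrite subr0.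
have [d E] : is_derive (0 : R) 1 phi (- tens (dt o b) z).
 by rewrite -[in tens _ z]z0; apply: is_derive_tens => o'; exact: (hb o').1.
have /cvgr_dnbhsP c : h^-1 *: (phi (h *: 1 + 0) - phi 0) @[h --> (0 : R)^'] --> - tens (dt o b) z.
 by rewrite -E; exact: d.
have := c harmonic (conj (fun n => _) cvg_harmonic).
rewrite /= => /(_ (fun n => lt0r_neq0 (harmonic_gt0 n))).
apply: cvg_trans; apply: near_eq_cvg; apply: nearW => n /=.
rewrite invrK addr0 -[_ *: 1]/(_ * _) mulr1 -[_ *: _]/(_ * _).
by rewrite /phi z0.
Qed.

Lemma cvg_dist0 (a c : nat -> R) (A C : R) : a @ \oo --> A -> c @ \oo --> C ->
 (forall e, 0 < e -> \forall n \near \oo, `|a n - c n| <= e) -> A = C.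
Proof.
move=> aA cC ac; apply/eqP; rewrite -subr_eq0; apply/eqP.
have ac0 : a n - c n @[n --> \oo] --> A - C by exact: cvgB.
rewrite -(cvg_lim (@norm_hausdorff _ R) ac0); apply: (cvg_lim (@norm_hausdorff _ R)).
by apply/cvgr0Pnorm_le => e e0; exact: ac.
Qed.

(* One-sided difference quotients suffice, so that [H] may have corners: at a
 corner the right-hand directional derivative [D] is the correct choice. *)
Lemma wpd_chain o F G (H : R -> R) (D : Z -> R) : itg F -> itg G -> wpd o F G ->
 measT H -> (forall s t, `|H s - H t| <= `|s - t|) ->
 itg (fun z => H (F z)) -> measT D ->
 (forall z, n.+1%:R * (H (F z + n.+1%:R^-1 * G z) - H (F z)) @[n --> \oo] --> D z) ->
 wpd o (fun z => H (F z)) D.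
Proof.
move=> iF iG FG mH HL iH mD Dcvg b hb.
have [M hM] := tens_bounded hb.
have M0 : 0 <= M by exact: le_trans (normr_ge0 _) (hM 0).
have [M' M'0 hM'] := tens_lipschitz o hb.
have n0 n : (0 : R) < n.+1%:R^-1 by rewrite invr_gt0.
have nK n : n.+1%:R * n.+1%:R^-1 = 1 :> R by rewrite divff.
have mb := bumps_meas hb.
have mbs n := itgm (itg_shift (- dir o n.+1%:R^-1) (itg_tens hb)).
pose q n z := n.+1%:R * (tens b (z - dir o n.+1%:R^-1) - tens b z).
have mq n : measT (q n).
 by apply: mfunM => //; apply: measurable_funB => //; exact: mbs.
have qM n z : `|q n z| <= M'.
 rewrite normrM gtr0_norm// (_ : M' = n.+1%:R * (M' * n.+1%:R^-1)).
  by rewrite ler_pM2l//; exact: hM'.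
 by rewrite mulrCA nK mulr1.
have A : II (fun z => q n z * H (F z)) @[n --> \oo] --> II (fun z => - tens (dt o b) z * H (F z)).
 apply: (@II_cvg _ _ _ mu _ _ (fun z => M' * `|H (F z)|)).
 - by move=> n; apply: mfunM => //; exact: itgm iH.
 - apply: mfunM; last exact: itgm iH.
  by apply: measurable_funN; apply: bumps_meas; exact: bumps_dt.
 - by apply: aeW => z; apply: cvgM; [exact: tens_quotient_cvg|exact: cvg_cst].
 - by apply: itgZ; exact: itg_norm.
 - by move=> n z; rewrite normrM ler_wpM2r.
pose c n z := n.+1%:R * (H (F z + n.+1%:R^-1 * G z) - H (F z)).
have mHn n : measT (fun z => H (F z + n.+1%:R^-1 * G z)).
 by apply: (mcomp mH); apply: itgm (itgD iF (itgZ _ iG)).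
have cG n z : `|c n z| <= `|G z|.
 rewrite normrM gtr0_norm//; apply: (letr (n.+1%:R * `|n.+1%:R^-1 * G z|)).
  by rewrite ler_pM2l//; apply: le_trans (HL _ _) _; rewrite addrAC subrr add0r.
 by rewrite normrM gtr0_norm// mulrA nK mul1r.
have mc n : measT (c n).
 by apply: mfunM => //; apply: measurable_funB => //; exact: itgm iH.
have B : II (fun z => c n z * tens b z) @[n --> \oo] --> II (fun z => D z * tens b z).
 apply: (@II_cvg _ _ _ mu _ _ (fun z => M * `|G z|)).
 - by move=> n; apply: mfunM.
 - exact: mfunM.
 - by apply: aeW => z; apply: cvgM; [exact: Dcvg|exact: cvg_cst].
 - by apply: itgZ; exact: itg_norm.
 - by move=> n z; rewrite normrM mulrC; apply: ler_pM.
suff AB : II (fun z => - tens (dt o b) z * H (F z)) = II (fun z => D z * tens b z).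
 rewrite -AB -IIN; last first.
  apply: itgMC iH; first by apply: measurable_funN; exact: bumps_meas (bumps_dt o hb).
  by move=> z; rewrite normrN; exact: (projT2 (cid (tens_bounded (bumps_dt o hb)))).
 by congr (Rint _ _); ext => z; rewrite mulNr opprK mulrC.
(* The two limits are compared at a finite step [h]. A shift of variables moves the quotient from
   the bump to [H (F z)]; then [F (z + h)] is replaced by [F z + h * G z]. As [H] is 1-Lipschitz,
   [wpd_quotient] controls the error. *)
apply: cvg_dist0 A B _ => e e0.
have e1 : 0 < e / (M + 1) by rewrite divr_gt0// ltr_wpDl.
have [d d0 hd] := wpd_quotient iF iG FG e1.
have iHs n : itg (fun z => H (F (z + dir o n.+1%:R^-1))) by exact: (itg_shift (dir o n.+1%:R^-1) iH).
near=> n.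
have nd : n.+1%:R^-1 < d by near: n; exact: near_infty_natSinv_lt (PosNum d0).
have {}hd := hd _ (introT andP (conj (n0 n) nd)).
have i1 : itg (fun z => H (F (z + dir o n.+1%:R^-1)) * tens b z) by exact: itg_bnd hM _.
have i2 : itg (fun z => H (F z) * tens b z) by exact: itg_bnd hM _.
have i3 : itg (fun z => H (F z) * tens b (z - dir o n.+1%:R^-1)).
 by apply: itg_bnd iH => //; exact: mbs.
have E1 : II (fun z => q n z * H (F z)) =
  II (fun z => n.+1%:R * (H (F (z + dir o n.+1%:R^-1)) * tens b z - H (F z) * tens b z)).
 rewrite IIZ; last exact: itgB.
 rewrite (IIB i1 i2).
 have -> : (fun z => q n z * H (F z)) =
  (fun z => n.+1%:R * (H (F z) * tens b (z - dir o n.+1%:R^-1) - H (F z) * tens b z)).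
  by ext => z; rewrite /q; ring.
 rewrite IIZ; last exact: itgB.
 rewrite (IIB i3 i2); congr (_ * (_ - _)).
 rewrite -(II_shift (dir o n.+1%:R^-1) i3); congr (Rint _ _); ext => z.
 by rewrite addrK.
have i4 : itg (fun z => c n z * tens b z).
 apply: itg_bnd hM _ => //; apply: (itg_le _ _ iG) => //; exact: cG.
have i5 : itg (fun z => n.+1%:R * (H (F (z + dir o n.+1%:R^-1)) * tens b z - H (F z) * tens b z)).
 by apply: itgZ; exact: itgB.
have i6 : itg (fun z => `|F (z + dir o n.+1%:R^-1) - F z - n.+1%:R^-1 * G z|).
 by apply: itg_norm; apply: itgB; [apply: itgB => //; exact: itg_shift|exact: itgZ].
rewrite E1 -(IIB i5 i4).
apply: le_trans (normII (itgB i5 i4)) _.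
apply: (letr (n.+1%:R * M * II (fun z => `|F (z + dir o n.+1%:R^-1) - F z - n.+1%:R^-1 * G z|))).
 rewrite -IIZ//; apply: le_II; [by apply: itg_norm; exact: itgB|exact: itgZ|].
 move=> z; rewrite (_ : _ - _ = n.+1%:R * ((H (F (z + dir o n.+1%:R^-1)) - H (F z + n.+1%:R^-1 * G z)) * tens b z)); last by rewrite /c; ring.
 rewrite normrM gtr0_norm// -mulrA ler_pM2l// normrM mulrC.
 apply: ler_pM => //; apply: le_trans (HL _ _) _.
 by rewrite opprD addrA.
apply: (letr (n.+1%:R * M * (n.+1%:R^-1 * (e / (M + 1))))).
 by rewrite ler_wpM2l// mulr_ge0.
rewrite (_ : _ * _ = n.+1%:R * n.+1%:R^-1 * (M * (e / (M + 1)))); last by ring.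
rewrite nK mul1r mulrA ler_pdivrMr ?ltr_wpDl// mulrC ler_pM2l//.
by rewrite lerDl.
Unshelve. all: by end_near. Qed.

Lemma wpdD o F G F' G' : itg F -> itg G -> itg F' -> itg G' -> wpd o F G -> wpd o F' G' ->
 wpd o (fun z => F z + F' z) (fun z => G z + G' z).
Proof.
move=> iF iG iF' iG' FG FG' b hb.
have hd := bumps_dt o hb.
have [M1 hM1] := tens_bounded hb; have [M2 hM2] := tens_bounded hd.
have mb := bumps_meas hb; have md := bumps_meas hd.
have E A A' (c : Z -> R) : (fun z => (A z + A' z) * c z) = (fun z => A z * c z + A' z * c z).
 by ext => z; rewrite mulrDl.
rewrite !E (IID (itg_bnd md hM2 iF) (itg_bnd md hM2 iF')).
by rewrite (IID (itg_bnd mb hM1 iG) (itg_bnd mb hM1 iG')) FG// FG'// opprD.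
Qed.

Lemma wpdN o F G : itg F -> itg G -> wpd o F G ->
 wpd o (fun z => - F z) (fun z => - G z).
Proof.
move=> iF iG FG b hb.
have hd := bumps_dt o hb.
have [M1 hM1] := tens_bounded hb; have [M2 hM2] := tens_bounded hd.
have E A (c : Z -> R) : (fun z => - A z * c z) = (fun z => - (A z * c z)).
 by ext => z; rewrite mulNr.
rewrite !E IIN; last by apply: itg_bnd hM2 iF; exact: bumps_meas.
rewrite IIN; last by apply: itg_bnd hM1 iG; exact: bumps_meas.
by rewrite FG.
Qed.

(** The factor of [G] in the right-hand directional derivative of [max (F - k) 0]: at the corner
    [F = k] the quotient tends to [G] if [G > 0] and to 0 otherwise. *)
Definition pos_slope (k : R) F G z : R := ((k < F z) || ((F z == k) && (0 < G z)))%:R.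

Lemma measurable_pos_slope k F G : measT F -> measT G ->
 measT (pos_slope k F G).
Proof.
move=> mF mG; rewrite /pos_slope.
have -> : (fun z => ((k < F z) || ((F z == k) && (0 < G z)))%:R) =
  \1_((F @^-1` `]k, +oo[) `|` ((F @^-1` [set k]) `&` (G @^-1` `]0, +oo[))) :> (Z -> R).
 ext => z; rewrite indicE; congr (nat_of_bool _)%:R.
 apply/idP/idP => [/orP[h|/andP[/eqP h1 h2]]|].
 - by rewrite inE; left; rewrite /= in_itv/= andbT.
 - by rewrite inE; right; split => //=; rewrite in_itv/= andbT.
 - rewrite inE => -[h|[h1 h2]].
   by move: h; rewrite /= in_itv/= andbT => ->.
  by move: h1 h2; rewrite /= in_itv/= andbT => -> ->; rewrite eqxx orbT.
apply: mindic; apply: measurableU; last apply: measurableI.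
- by rewrite -[X in measurable X]setTI; exact: mF.
- by rewrite -[X in measurable X]setTI; apply: mF => //; exact: measurable_set1.
- by rewrite -[X in measurable X]setTI; exact: mG.
Qed.

(** The condition [0 <= k] makes the truncation integrable on the whole space, because it is then
    dominated by [|F|]. *)
Lemma wpd_pos o F G k : 0 <= k -> itg F -> itg G -> wpd o F G ->
 wpd o (fun z => Num.max (F z - k) 0) (fun z => pos_slope k F G z * G z).
Proof.
move=> k0 iF iG FG; pose H (s : R) := Num.max (s - k) 0.
have HL s t : `|H s - H t| <= `|s - t|.
 rewrite /H /Num.max; case: ifPn; case: ifPn; rewrite -?leNgt ?subr_le0 ?subr_lt0 => h1 h2;
  rewrite ?subrr ?subr0 ?sub0r ?normr0 ?normrN//.
 - by rewrite ger0_norm// ler0_norm; lra.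
 - by rewrite !ger0_norm; lra.
 - by rewrite opprB addrA subrK.
apply: (wpd_chain iF iG FG _ HL).
- apply: measurable_maxr; last exact: measurable_cst.
 by apply: measurable_funB; [exact: measurable_id|exact: measurable_cst].
- apply: (itg_le _ _ iF).
  apply: measurable_maxr; last exact: measurable_cst.
  by apply: measurable_funB; [exact: (itgm iF)|exact: measurable_cst].
 move=> z; rewrite /H ger0_norm ?le_max ?lexx ?orbT// ge_max normr_ge0 andbT.
 by apply: le_trans (ler_norm _); rewrite lerBlDr lerDl.
- apply: mfunM; last exact: (itgm iG).
 exact: (measurable_pos_slope k (itgm iF) (itgm iG)).
move=> z; apply: cvg_near_cst.
have small e : 0 < e -> \forall n \near \oo, `|n.+1%:R^-1 * G z| < e.
 move=> e0; have e1 : 0 < e / (`|G z| + 1) by rewrite divr_gt0// ltr_wpDl.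
 near=> n; have nd : n.+1%:R^-1 < e / (`|G z| + 1).
  by near: n; exact: near_infty_natSinv_lt (PosNum e1).
 rewrite normrM gtr0_norm ?invr_gt0//.
 apply: (@le_lt_trans _ _ (n.+1%:R^-1 * (`|G z| + 1))).
  by rewrite ler_pM2l ?invr_gt0// lerDl.
 by rewrite -ltr_pdivlMr// ltr_wpDl.
have nK n : n.+1%:R * n.+1%:R^-1 = 1 :> R by rewrite divff.
rewrite /pos_slope /H; have [Fk|Fk|Fk] := ltgtP (F z) k.
- near=> n; have h : `|n.+1%:R^-1 * G z| < k - F z by near: n; apply: small; rewrite subr_gt0.
 have {}h := le_lt_trans (ler_norm _) h.
 have h1 : F z + n.+1%:R^-1 * G z - k <= 0 by rewrite subr_le0 addrC -lerBrDr ltW.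
 have h2 : F z - k <= 0 by rewrite subr_le0 ltW.
 by rewrite (max_r h1) (max_r h2) subrr mulr0 mul0r.
- near=> n; have h : `|n.+1%:R^-1 * G z| < F z - k by near: n; apply: small; rewrite subr_gt0.
 move: h; rewrite ltr_norml => /andP[h _].
 have h1 : 0 <= F z + n.+1%:R^-1 * G z - k by rewrite subr_ge0 -lerBlDl -opprB ltW.
 have h2 : 0 <= F z - k by rewrite subr_ge0 ltW.
 rewrite (max_l h1) (max_l h2).
 by rewrite mul1r addrAC [X in _ * X](_ : _ = n.+1%:R^-1 * G z) ?mulrA ?nK ?mul1r//; ring.
- near=> n; rewrite Fk addrAC subrr add0r maxxx subr0/=.
 have [g0|g0] := ltP 0 (G z).
  by rewrite max_l ?mulrA ?nK// ltW// mulr_gt0// invr_gt0.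
 by rewrite max_r ?mulr0 ?mul0r// mulr_ge0_le0// invr_ge0.
Unshelve. all: by end_near. Qed.

End calculus_of_weak_derivatives.

Lemma ae_snd d1 d2 (X : measurableType d1) (Y : measurableType d2) (R0 : realType)
  (m1 : {sigma_finite_measure set X -> \bar R0})
  (m2 : {sigma_finite_measure set Y -> \bar R0}) (P : Y -> Prop) :
 {ae m2, forall y, P y} -> {ae (m1 \x m2)%E, forall xy, P xy.2}.
Proof.
move=> [A [mA A0 PA]]; exists (setT `*` A); split.
- exact: measurableX.
- by rewrite product_measure1E//= A0 mule0.
- by move=> [x y] /= h; split => //; exact: PA.
Qed.

(** * A weak-type Sobolev inequality by translation *)

Section weak_sobolev.
Implicit Types (w : Z) (F G V : Z -> R).

(** [corr_increment] with reference slope 0, carried to an arbitrary base point by translating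
    [V]. *)
Lemma corr_mvt V MV F G o xi h om : itg V -> (forall z, `|V z| <= MV) ->
 itg F -> itg G -> wpd o F G -> 0 < h ->
 (forall r, 0 <= r <= h -> `|corr G V (xi + dir o r)| <= om) ->
 `|corr F V (xi + dir o h) - corr F V xi| <= h * om.
Proof.
move=> iV VM iF iG FG h0 hom.
pose V' z := V (z - xi).
have iV' : itg V' by exact: (itg_shift (- xi) iV).
have V'M z : `|V' z| <= MV by exact: VM.
have cE A e : itg A -> corr A V (xi + e) = corr A V' e.
 move=> iA; rewrite /corr -(II_shift xi (itg_corr iV' V'M e iA)).
 by congr (Rint _ _); ext => z; rewrite /V' addrK addrA.
have := @corr_increment V' MV iV' V'M F G o h 0 om iF iG FG h0.
rewrite mulr0 subr0 -[in corr F V xi](addr0 xi) !cE//; apply => r rh.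
by rewrite subr0 -cE//; exact: hom.
Qed.

Lemma young_split (a c p : R) : 0 <= a -> 0 < c -> 1 <= p ->
 a <= c + a `^ p * c `^ (1 - p).
Proof.
move=> a0 c0 p1; have [ac|ca] := leP a c.
 by rewrite ler_wpDr// mulr_ge0// powR_ge0.
have a0' : 0 < a by exact: lt_trans ca.
rewrite ler_wpDl// ?(ltW c0)//.
have -> : a `^ p * c `^ (1 - p) = a * (a / c) `^ (p - 1).
 rewrite powRM ?invr_ge0 ?(ltW c0)// -powR_inv1 ?(ltW c0)// -powRrM mulN1r opprB.
 rewrite mulrA; congr (_ * _); rewrite -[X in X * _]powRr1//.
 by rewrite -powRD ?subrKC// (gt_eqF a0') implybT.
rewrite ler_peMr// -[leLHS](powRr0 (a / c)) ler_powR ?subr_ge0//.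
by rewrite ler_pdivlMr// mul1r ltW.
Qed.

Section statement.
Variables (W : Z -> R) (g : 'I_N -> Z -> R) (p q S Gam l : R).
Hypotheses (iW : itg W) (W0 : forall z, 0 <= W z) (ig : forall i, itg (g i))
 (Wg : forall i, wpd (Some i) W (g i)) (p1 : 1 <= p) (q0 : 0 < q)
 (ip : forall i, itg (fun z => `|g i z| `^ p))
 (hG : \sum_i II (fun z => `|g i z| `^ p) <= Gam)
 (S0 : 0 < S)
 (hS : {ae @lebesgue_measure R, forall t : mR R,
  (\int[@leb R N]_x ((W (x, t) `^ q)%:E) <= S%:E)%E})
 (l0 : 0 < l) (N0 : (0 < N)%N).

Let NR0 : 0 < N%:R :> R. Proof. by rewrite ltr0n. Qed.
Let mW := itgm iW.
(** Chosen so that the linear terms of the [N] coordinate steps add up to [l / 4] times the measure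
    of [A y], half of the drop that occurs there. *)
Let c := l / (4 * N%:R).
Let c0 : 0 < c. Proof. by rewrite divr_gt0// mulr_gt0. Qed.

(** The cube of this side has volume [2 (2/l)^q S], twice the Chebyshev bound for a slice of
    [W > l/2]. Hence at least half of the translations in the cube lead from any point to values at
    most [l/2]. *)
Definition sobolev_radius : R := (2 * (2 / l) `^ q * S) `^ N%:R^-1.
Notation rho := sobolev_radius.

Let rho0 : 0 < rho. Proof. by rewrite powR_gt0// !mulr_gt0// powR_gt0// divr_gt0. Qed.

Let rhoN : rho ^+ N = 2 * (2 / l) `^ q * S.
Proof.
rewrite -powR_mulrn ?(ltW rho0)// /sobolev_radius -powRrM mulVf ?gt_eqF// powRr1//.
by rewrite !mulr_ge0 ?powR_ge0 ?ltW.
Qed.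

Let E := [set z : Z | l < W z].
Let mE : measurable E.
Proof. exact: (mset_gt l mW). Qed.
Let Efin : (mu E < +oo)%E.
Proof. exact: (markov_fin iW W0 l0). Qed.

Definition sobolev_bound : R := 4 / l * (c `^ (1 - p) * rho `^ p * Gam).
Notation K := sobolev_bound.

Definition sp (y : 'rV[R]_N) : Z := (y, 0).

Let A (y : 'rV[R]_N) : set Z := E `&` [set z | W (z + sp y) <= l / 2].

Let mA y : measurable (A y).
Proof.
apply: measurableI; first exact: mE.
exact: (mset_le (l / 2) (itgm (itg_shift (sp y) iW))).
Qed.

Let Afin y : (mu (A y) < +oo)%E.
Proof.
apply: le_lt_trans Efin; apply: le_measure; rewrite ?inE; [exact: mA|exact: mE|].
exact: subIsetl.
Qed.

Let iA y : itg \1_(A y). Proof. exact: (itg_indic (mA y) (Afin y)). Qed.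
Let A1 y z : `|\1_(A y) z : R| <= 1.
Proof. by rewrite indicE; case: (_ \in _); rewrite ?normr0 ?normr1. Qed.

Let corr_g y i xi : rho * `|corr (g i) \1_(A y) xi| <=
 c * II \1_(A y) + c `^ (1 - p) * rho `^ p * II (fun z => `|g i z| `^ p).
Proof.
have i1 := itg_corr (iA y) (A1 y) xi (ig i).
have i2 := itg_shift xi (ip i).
apply: (letr (rho * II (fun z => `|g i (z + xi) * \1_(A y) z|))).
 by rewrite ler_wpM2l ?(ltW rho0)//; exact: normII i1.
rewrite -(II_shift xi (ip i)) -(IIZ rho (itg_norm i1)) -(IIZ c (iA y)) -(IIZ _ i2).
rewrite -IID; [|exact: (itgZ c (iA y))|exact: (itgZ _ i2)].
apply: le_II; [by apply: itgZ; exact: itg_norm|by apply: itgD; [exact: (itgZ c (iA y))|exact: (itgZ _ i2)]|].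
move=> z; rewrite normrM indicE; case: (_ \in _); last first.
 by rewrite normr0 !mulr0 add0r !mulr_ge0// powR_ge0.
rewrite normr1 !mulr1; have := @young_split (rho * `|g i (z + xi)|) c p.
rewrite powRM ?(ltW rho0)// => /(_ (mulr_ge0 (ltW rho0) (normr_ge0 _)) c0 p1).
by rewrite mulrAC (mulrC (_ `^ (1 - p))).
Qed.

(** The translation by [y] is carried out one coordinate at a time. Each step has length at most
    [rho], a factor that [corr_g] already contains. *)
Let path (y : 'rV[R]_N) (s : seq 'I_N) : (forall i, 0 < y ord0 i <= rho) -> forall xi,
 corr W \1_(A y) xi - corr W \1_(A y) (xi + \sum_(i <- s) dir (Some i) (y ord0 i)) <=
 \sum_(i <- s) (c * II \1_(A y) + c `^ (1 - p) * rho `^ p * II (fun z => `|g i z| `^ p)).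
Proof.
move=> hy; elim: s => [|i s IH] xi; first by rewrite !big_nil addr0 subrr.
rewrite !big_cons addrA; have {}IH := IH (xi + dir (Some i) (y ord0 i)).
have /andP[y0 y1] := hy i.
set B := _ + _ * II (fun z => `|g i z| `^ p).
have B0 : 0 <= B by apply: le_trans (corr_g y i 0); rewrite mulr_ge0// ltW.
have := @corr_mvt \1_(A y) 1 W (g i) (Some i) xi (y ord0 i) (B / rho) (iA y) (A1 y) iW (ig i) (Wg i) y0.
have hB r : 0 <= r <= y ord0 i -> `|corr (g i) \1_(A y) (xi + dir (Some i) r)| <= B / rho.
 by move=> _; rewrite ler_pdivlMr// mulrC; exact: corr_g.
move=> /(_ hB); rewrite distrC => /(le_trans (ler_norm _)) h.
have h1 : y ord0 i * (B / rho) <= B.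
 by rewrite mulrCA ler_piMr// ler_pdivrMr// mul1r.
have {}h := le_trans h h1.
by have := lerD h IH; rewrite addrA subrK.
Qed.

Let sp_sum y : sp y = \sum_i dir (Some i) (y ord0 i).
Proof.
apply: coP => o; rewrite (_ : co o (\sum_i _) = \sum_i co o (dir (Some i) (y ord0 i))); last first.
 by elim/big_rec2: _ => [|i a b _ <-]; rewrite ?co0 ?coD.
under eq_bigr do rewrite co_dir; case: o => [j|] /=.
 rewrite (bigD1 j)//= eqxx big1 ?addr0// => i ij.
 by rewrite (inj_eq (@Some_inj _)) eq_sym (negbTE ij).
by rewrite big1.
Qed.

(** On [A y] the function drops by at least [l / 2] under the translation, and [path] pays for the
    drop with gradients. The part linear in the measure of [A y] is [l / 4] of it and is
    absorbed. *)
Let muA (y : 'rV[R]_N) : (forall i, 0 < y ord0 i <= rho) -> (mu (A y) <= K%:E)%E.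
Proof.
move=> hy; rewrite -(integral_indicT _ (mA y)) -(IIE (iA y)) lee_fin.
have := path (index_enum 'I_N) hy 0; rewrite -sp_sum add0r.
rewrite big_split/= sumr_const card_ord -mulr_sumr.
set a := II \1_(A y); move=> h.
have key : l / 2 * a <= corr W \1_(A y) 0 - corr W \1_(A y) (sp y).
 have i1 := itg_corr (iA y) (A1 y) 0 iW; have i2 := itg_corr (iA y) (A1 y) (sp y) iW.
 rewrite /corr -IIB// -IIZ//; apply: le_II; [exact: itgZ|exact: itgB|].
 move=> z; rewrite addr0 -mulrBl indicE; case: (boolP (z \in A y)); last by rewrite !mulr0.
 rewrite inE => -[]; rewrite /E /= => h1 h2; rewrite !mulr1; lra.
have {key h} := le_trans key h.
have -> : c * a *+ N = l / 4 * a.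
 by rewrite -mulr_natl /c; field; rewrite pnatr_eq0 -lt0n.
move=> h; have h2 : l / 4 * a <= c `^ (1 - p) * rho `^ p * Gam.
 apply: (letr (c `^ (1 - p) * rho `^ p * \sum_i II (fun z => `|g i z| `^ p))); first lra.
 by rewrite ler_wpM2l// mulr_ge0// powR_ge0.
rewrite /K -ler_pdivrMl ?divr_gt0// invf_div; exact: h2.
Qed.

Let Y : set 'rV[R]_N := [set y | forall i, `]0, rho[%classic (y ord0 i)].
Let mY : measurable Y.
Proof. by apply: (@measurable_rV_box _ _ (fun=> `]0, rho[%classic)). Qed.
Let lebY : leb Y = (rho ^+ N)%:E.
Proof.
rewrite /leb (@lebesgue_rV_box _ _ (fun=> 0) (fun=> rho)); last by move=> _; exact: (ltW rho0).
by rewrite prodr_const card_ord subr0.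
Qed.

Let T : set (Z * 'rV[R]_N) := [set zy | Y zy.2 /\ A zy.2 zy.1].
Let mT : measurable T.
Proof.
have m2 : measT (fun zy : Z * 'rV[R]_N => W (zy.1 + sp zy.2)).
 apply: (mcomp mW); apply: measurable_addZ; first exact: measurable_fst.
 by apply: measurable_fun_pair; [exact: measurable_snd|exact: measurable_cst].
have -> : T = (setT `*` Y) `&` ((E `*` setT) `&`
  [set zy : Z * 'rV[R]_N | W (zy.1 + sp zy.2) <= l / 2]).
 apply/seteqP; split => zy /=; first by move=> [h1 [h2 h3]].
 by move=> [[_ h1] [[h2 _] h3]].
apply: measurableI; [|apply: measurableI].
- exact: measurableX.
- exact: measurableX.
- exact: mset_le.
Qed.

(** Double counting of the pairs [(z, y)] with [y] in the cube and [z] in [A y]. For fixed [y] there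
    are at most [K] of them; for almost every [z] in [E] they fill at least half of the cube. *)
Lemma weak_sobolev : (mu E <= (2 * K)%:E)%E.
Proof.
have mf : measT (fun zy : Z * 'rV[R]_N => (\1_T zy)%:E : \bar R).
 by apply/mEFinP; exact: mindic.
have f0 (zy : Z * 'rV[R]_N) : (0 <= (\1_T zy)%:E :> \bar R)%E by rewrite lee_fin.
have Fub := @fubini_tonelli _ _ _ _ R muS (@leb R N) (fun zy => (\1_T zy)%:E) mf f0.
have U : (\int[@leb R N]_y \int[muS]_z (\1_T (z, y))%:E <= K%:E * (rho ^+ N)%:E)%E.
 have K0 : 0 <= K.
  have G0 : 0 <= Gam.
   by apply: le_trans hG; apply: sumr_ge0 => i _; apply: II_ge0 => z; exact: powR_ge0.
  by rewrite !mulr_ge0 ?powR_ge0 ?invr_ge0 ?(ltW l0).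
 have rN0 : 0 <= rho ^+ N by rewrite exprn_ge0// ltW.
 rewrite -lebY -integral_cindic//; apply: ge0_le_integral => //.
 - by move=> y _; apply: integral_ge0 => z _.
 - exact: (@measurable_fun_fubini_tonelli_G _ _ _ _ _ muS (fun zy => (\1_T zy)%:E)).
 - by apply/mEFinP; apply: mfunM => //; exact: mindic.
 move=> y _; rewrite [X in (_ <= (_ * X)%:E)%E]indicE; case: (boolP (y \in Y)).
  rewrite inE => Yy; rewrite mulr1.
  have -> : (fun z : Z => (\1_T (z, y))%:E) = (fun z => (\1_(A y) z)%:E) :> (Z -> \bar R).
   ext => z; rewrite !indicE; congr ((nat_of_bool _)%:R%:E).
   by apply/idP/idP; rewrite !inE => // -[].
  have h : forall i, 0 < y ord0 i <= rho.
   by move=> i; have := Yy i; rewrite /= in_itv/= => /andP[-> /ltW ->].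
  by apply: le_trans (muA h); rewrite -(integral_indicT _ (mA y)).
 move=> Yy; rewrite mulr0 integral0_eq// => z _.
 by rewrite indicE memNset// => -[/= h _]; move: Yy; rewrite mem_set.
have L : ((rho ^+ N / 2)%:E * mu E <= \int[muS]_z \int[@leb R N]_y (\1_T (z, y))%:E)%E.
 have r2 : 0 <= rho ^+ N / 2 by rewrite divr_ge0// exprn_ge0// ltW.
 have -> := esym (@integral_cindic _ _ _ muS _ _ r2 mE).
 apply: (@ae_ge0_le_integral _ _ _ muS setT measurableT).
 - by move=> z _; rewrite lee_fin mulr_ge0.
 - by apply/mEFinP; apply: mfunM => //; exact: mindic.
 - by move=> z _; apply: integral_ge0 => y _.
 - exact: (@measurable_fun_fubini_tonelli_F _ _ _ _ _ (@leb R N) (fun zy => (\1_T zy)%:E)).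
 have := @ae_snd _ _ _ _ _ (@leb R N) (@lebesgue_measure R) _ hS.
 apply: filterS => -[x t] /= hxt _.
 rewrite indicE; case: (boolP (_ \in E)); last by rewrite mulr0 integral_ge0.
 rewrite inE => Ez; rewrite mulr1.
 pose T' : set 'rV[R]_N := [set y | T ((x, t), y)].
 have mT' : measurable T'.
  by rewrite -[T']setTI; exact: (@pair1_measurable _ _ Z 'rV[R]_N (x, t) measurableT _ mT).
 rewrite (_ : (fun y => (\1_T (x, t, y))%:E) = (fun y => (\1_T' y)%:E)); last first.
  by ext => y; rewrite !indicE; congr ((nat_of_bool _)%:R%:E); apply/idP/idP; rewrite !inE.
 rewrite integral_indicT//.
 pose B : set 'rV[R]_N := [set y | l / 2 < W (y, t)].
 have mWt : measT (fun y => W (y, t)) by exact: (mcomp mW (pair2_measurable t)).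
 have mB : measurable B by exact: mset_gt.
 (* Chebyshev's inequality at level [l / 2]; the choice of [rho] makes the bound exactly half the
    volume of the cube. *)
 have lB : (leb B <= (rho ^+ N / 2)%:E)%E.
  have l2 : 0 < l / 2 by rewrite divr_gt0.
  have l2q : 0 < (l / 2) `^ q by rewrite powR_gt0.
  have : (\int[@leb R N]_y ((l / 2) `^ q * \1_B y)%:E <= S%:E)%E.
   apply: le_trans hxt; apply: ge0_le_integral => //.
   - by move=> y _; rewrite lee_fin mulr_ge0// ltW.
   - by apply/mEFinP; apply: mfunM => //; exact: mindic.
   - by apply/mEFinP; apply: (mpowR q).
   move=> y _; rewrite lee_fin indicE; case: (boolP (_ \in B)); last by rewrite mulr0 powR_ge0.
   by rewrite inE mulr1 => /ltW h; apply: ge0_ler_powR => //; rewrite ?nnegrE// ltW.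
  rewrite integral_cindic ?(ltW l2q)// => h.
  have -> : rho ^+ N / 2 = S / (l / 2) `^ q.
   rewrite rhoN; suff -> : (2 / l) `^ q = ((l / 2) `^ q)^-1 by field; rewrite gt_eqF.
   by have := powRrM (l / 2) (- 1) q; rewrite mulN1r powRN powR_inv1 ?(ltW l2)// invf_div.
  by rewrite EFinM lee_pdivlMr// muleC.
 pose B' := affl false x @^-1` B.
 have mB' : measurable B'.
  by rewrite -[B']setTI; apply: (measurable_rV_add (@measurable_id _ _ _) (@measurable_cst _ _ _ _ _ x)).
 have YT : Y `<=` T' `|` B'.
  move=> y Yy; have [h|h] := leP (W (x + y, t)) (l / 2).
   left; split => //; split => //=.
   by rewrite (_ : (x, t) + sp y = (x + y, t))//; congr pair; rewrite addr0.
  by right; rewrite /B' /B /affl /= addrC.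
 have h1 : (leb Y <= leb T' + leb B')%E.
  apply: (letr (leb (T' `|` B'))); last exact: (@measureU2 _ _ _ (@leb R N)).
  by apply: le_measure; rewrite ?inE//; exact: measurableU.
 rewrite leb_affl// in h1.
 have h2 := le_trans h1 (leeD2l _ lB).
 rewrite lebY in h2.
 have half (v : \bar R) (a : R) : (a%:E <= v + (a / 2)%:E -> (a / 2)%:E <= v)%E.
  by case: v => [r| |]; rewrite ?leey// -EFinD !lee_fin; lra.
 exact: half h2.
have h := le_trans L (le_trans (_ : _ <= _)%E U).
have {}h : ((rho ^+ N / 2)%:E * mu E <= K%:E * (rho ^+ N)%:E)%E.
 by apply: h; rewrite Fub.
have r0 : 0 < rho ^+ N by rewrite exprn_gt0.
rewrite -(@lee_pmul2l _ (rho ^+ N / 2)%:E)// ?lte_fin ?divr_gt0//.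
by apply: le_trans h _; rewrite -!EFinM lee_fin; apply: le_of_eq; field.
Qed.

End statement.
End weak_sobolev.

(** * Product cut-offs *)

Section cutoffs.
Implicit Types (w : Z) (x : R).

Lemma prod_le1 (I : Type) (r : seq I) (P : pred I) (F : I -> R) :
 (forall i, 0 <= F i <= 1) -> \prod_(i <- r | P i) F i <= 1.
Proof.
move=> F01; suff /andP[] : 0 <= \prod_(i <- r | P i) F i <= 1 by [].
elim/big_rec: _ => [|i y _ /andP[y0 y1]]; first by rewrite ler01 lexx.
by have /andP[f0 f1] := F01 i; rewrite mulr_ge0//= mulr_ile1.
Qed.

Section one_family.
Variables (a b gl gr : option 'I_N -> R).
Hypotheses (gl0 : forall o, 0 < gl o) (gr0 : forall o, 0 < gr o).

(* The parameter [s] realises the [s]-th power of the spatial factors. *)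
Definition cutw (s : R) o : R := if o is Some _ then s else 1.

(** For [s = 1] this is [exp(- gl/(x - a)) exp(- gr/(b - x))] on []a, b[]. It has no plateau: on the
    inner box it is only bounded below, see [tens_cutf_ge]. In exchange its powers and derivatives
    are explicit. *)
Definition cutf (s : R) o x : R :=
 ek 0 ((x - a o) / (cutw s o * gl o)) * ek 0 ((b o - x) / (cutw s o * gr o)).

Lemma cutw_gt0 s o : 0 < s -> 0 < cutw s o.
Proof. by case: o. Qed.

Lemma cutf_ge0 s o x : 0 <= cutf s o x.
Proof. by rewrite mulr_ge0 ?ek_ge0. Qed.

Lemma cutf_le1 s o x : cutf s o x <= 1.
Proof. by rewrite mulr_ile1 ?ek_ge0 ?ek0_le1. Qed.

Lemma ek_div_le0 k x c : 0 < c -> x <= 0 -> ek k (x / c) = 0.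
Proof. by move=> c0 x0; rewrite ek_le0// mulr_le0_ge0// invr_ge0 ltW. Qed.

Lemma cutf_supp s o x : 0 < s -> cutf s o x != 0 -> a o < x < b o.
Proof.
move=> s0; have gs := mulr_gt0 (cutw_gt0 o s0) (gl0 o); have hs := mulr_gt0 (cutw_gt0 o s0) (gr0 o).
apply: contraNT; rewrite negb_and -!leNgt /cutf => /orP[h|h].
 by rewrite ek_div_le0 ?mul0r// subr_le0.
by rewrite mulrC ek_div_le0 ?mul0r// subr_le0.
Qed.

Lemma Cinf_cutf s o : Cinf (cutf s o).
Proof.
rewrite /cutf; apply: CinfM.
 rewrite (_ : (fun x => _) = fun x => ek 0 ((cutw s o * gl o)^-1 * x + - (a o / (cutw s o * gl o)))).
  by apply: Cinf_affine; exact: Cinf_ek.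
 by ext => x; congr ek; rewrite mulrBl mulrC.
rewrite (_ : (fun x => _) = fun x => ek 0 (- (cutw s o * gr o)^-1 * x + (b o / (cutw s o * gr o)))).
 by apply: Cinf_affine; exact: Cinf_ek.
by ext => x; congr ek; rewrite mulrBl mulNr addrC mulrC.
Qed.

Lemma bumps_cutf s : 0 < s -> bumps (cutf s).
Proof.
move=> s0 o; split; first exact: Cinf_cutf.
exists (`|a o| + `|b o|) => x; rewrite ler_normr => /orP[h|h]; apply/eqP; apply: contraTT isT => /(cutf_supp s0)/andP[h1 h2].
 have := le_lt_trans h h2; rewrite ltNge => /negP[].
 by apply: le_trans (ler_norm _) _; rewrite lerDr.
have : - x < - a o by rewrite ltrN2.
move=> h3; have := le_lt_trans h h3; rewrite ltNge => /negP[].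
by apply: (le_trans (ler_norm _)); rewrite normrN lerDl.
Qed.

Lemma derive1_cutf s o x : derive1 (cutf s o) x =
 ek 2 ((x - a o) / (cutw s o * gl o)) / (cutw s o * gl o) * ek 0 ((b o - x) / (cutw s o * gr o)) -
 ek 0 ((x - a o) / (cutw s o * gl o)) * (ek 2 ((b o - x) / (cutw s o * gr o)) / (cutw s o * gr o)).
Proof.
set cg := cutw s o * gl o; set ch := cutw s o * gr o.
have h1 : is_derive x 1 (fun x : R => (x - a o) / cg) cg^-1.
 rewrite (_ : (fun x => _) = (cg^-1 *: (fun x => x - a o))); last first.
  by ext => y; rewrite mulrC.
 have := is_deriveZ cg^-1 (is_deriveB (is_derive_id x (1 : R)) (is_derive_cst (a o) x 1)).
 by rewrite subr0 [_ *: 1]mulr1.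
have h2 : is_derive x 1 (fun x : R => (b o - x) / ch) (- ch^-1).
 rewrite (_ : (fun x => _) = (ch^-1 *: (fun x => b o - x))); last first.
  by ext => y; rewrite mulrC.
 have := is_deriveZ ch^-1 (is_deriveB (is_derive_cst (b o) x (1 : R)) (is_derive_id x 1)).
 by rewrite sub0r [_ *: -1]mulrN1.
have d0 (y : R) : is_derive y 1 (ek 0) (ek 2 y).
 by have := ek_derive 0 y; rewrite mul0r subr0.
have e1 := @is_derive1_comp _ (ek 0) (fun x : R => (x - a o) / cg) x _ _ (d0 _) h1.
have e2 := @is_derive1_comp _ (ek 0) (fun x : R => (b o - x) / ch) x _ _ (d0 _) h2.
have [_ E] := is_deriveM e1 e2.
rewrite derive1E [LHS]E /= -[X in X + _]/(_ * _) -[X in _ + X]/(_ * _).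
by rewrite /cutf -/cg -/ch; ring.
Qed.

Lemma derive1_cutf_le s o (x : R) : 0 < s ->
 `|derive1 (cutf s o) x| <= (2 / (cutw s o * gl o) + 2 / (cutw s o * gr o)) * ((a o < x < b o)%R)%:R.
Proof.
move=> s0; have gs := mulr_gt0 (cutw_gt0 o s0) (gl0 o); have hs := mulr_gt0 (cutw_gt0 o s0) (gr0 o).
rewrite derive1_cutf; case: (boolP (a o < x < b o)).
 move=> _; rewrite mulr1; apply: le_trans (ler_normB _ _) _; apply: lerD.
  rewrite normrM ger0_norm ?mulr_ge0 ?ek_ge0 ?invr_ge0 ?(ltW gs)//.
  rewrite ger0_norm ?ek_ge0// -[leRHS]mulr1; apply: ler_pM; rewrite ?ek_ge0 ?ek0_le1//.
   by rewrite mulr_ge0 ?ek_ge0 ?invr_ge0 ?(ltW gs).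
  by rewrite ler_pM2r ?invr_gt0// ek2_le2.
 rewrite normrM (ger0_norm (ek_ge0 _ _)) ger0_norm ?mulr_ge0 ?ek_ge0 ?invr_ge0 ?(ltW hs)//.
 rewrite -[leRHS]mul1r; apply: ler_pM; rewrite ?ek_ge0 ?ek0_le1//.
  by rewrite mulr_ge0 ?ek_ge0 ?invr_ge0 ?(ltW hs).
 by rewrite ler_pM2r ?invr_gt0// ek2_le2.
rewrite negb_and -!leNgt => /orP[h|h].
 by rewrite !(ek_div_le0 _ gs) ?subr_le0// !mul0r subr0 normr0 mulr0.
by rewrite !(ek_div_le0 _ hs) ?subr_le0// mul0r !mulr0 subr0 normr0.
Qed.

Lemma tens_cutf_ge0 s z : 0 <= tens (cutf s) z.
Proof. by apply: prodr_ge0 => o _; exact: cutf_ge0. Qed.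

Lemma tens_cutf_le1 s z : tens (cutf s) z <= 1.
Proof. by apply: prod_le1 => o; rewrite cutf_ge0 cutf_le1. Qed.

Lemma tens_cutf_supp s z : 0 < s -> tens (cutf s) z != 0 -> obox a b z.
Proof.
move=> s0 nz o; rewrite /= in_itv/=; apply: (cutf_supp s0).
by apply: contraNN nz => /eqP h; rewrite (tens_split o) h mul0r.
Qed.

Lemma tens_dt_cutf_le s o z : 0 < s ->
 `|tens (dt o (cutf s)) z| <= (2 / (cutw s o * gl o) + 2 / (cutw s o * gr o)) * \1_(obox a b) z.
Proof.
move=> s0; have gs := mulr_gt0 (cutw_gt0 o s0) (gl0 o); have hs := mulr_gt0 (cutw_gt0 o s0) (gr0 o).
have B0 : 0 <= 2 / (cutw s o * gl o) + 2 / (cutw s o * gr o).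
 by rewrite addr_ge0// divr_ge0// ltW.
have [->|nz] := eqVneq (tens (dt o (cutf s)) z) 0.
 by rewrite normr0 mulr_ge0// indicE.
have zb : obox a b z.
 move=> o'; rewrite /= in_itv/=; have [oo|oo] := eqVneq o' o.
  have := derive1_cutf_le o (co o z) s0; rewrite oo.
  case: (_ < _ < _) => //; rewrite mulr0 normr_le0 => /eqP h.
  by move: nz; rewrite tens_dt h mul0r eqxx.
 apply: (cutf_supp s0); apply: contraNN nz => /eqP h.
 by rewrite tens_dt (bigD1 o')//= h mul0r mulr0.
rewrite indicE mem_set// tens_dt normrM; apply: ler_pM => //.
 apply: le_trans (derive1_cutf_le _ _ s0) _.
 by rewrite -[leRHS]mulr1 ler_wpM2l// lern1 leq_b1.
rewrite ger0_norm; last by apply: prodr_ge0 => o' _; exact: cutf_ge0.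
by apply: prod_le1 => o'; rewrite cutf_ge0 cutf_le1.
Qed.

Lemma tens_cutf_ge s z : 1 <= s -> (forall o, a o + gl o <= co o z <= b o - gr o) ->
 expR (- 2 * s) ^+ #|{: option 'I_N}| <= tens (cutf s) z.
Proof.
move=> s1 hz; have s0 : 0 < s by lra.
rewrite -prodr_const; apply: ler_prod => o _; rewrite expR_ge0/=.
have cs : 0 < cutw s o <= s by rewrite cutw_gt0//=; case: (o).
have /andP[c0 cs'] := cs; have /andP[h1 h2] := hz o.
have -> : - 2 * s = (- s) + (- s) by ring.
have lo y c : 0 < c -> c <= y -> expR (- s) <= ek 0 (y / (cutw s o * c)).
 move=> cp cy; apply: le_trans (ek0_ge (s := s^-1) _ _); rewrite ?invrK ?invr_gt0//.
 rewrite -(mul1r s^-1) ler_pdivrMr// mulrAC ler_pdivlMr ?mulr_gt0// mul1r mulrC.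
 by apply: ler_pM => //; rewrite ltW.
by rewrite expRD; apply: ler_pM; rewrite ?expR_ge0//; apply: lo => //; lra.
Qed.

Definition cutx z : R := \prod_(i : 'I_N) cutf 1 (Some i) (co (Some i) z).

Lemma prod_option (F : option 'I_N -> R) : \prod_o F o = F None * \prod_i F (Some i).
Proof.
rewrite (bigD1 None)//=; congr (_ * _).
rewrite (reindex_omap Some id); last by case.
by apply: eq_bigl => i; rewrite /= eqxx.
Qed.

Lemma cutx_ge0 z : 0 <= cutx z. Proof. by apply: prodr_ge0 => i _; exact: cutf_ge0. Qed.
Lemma cutx_le1 z : cutx z <= 1.
Proof. by apply: prod_le1 => i; rewrite cutf_ge0 cutf_le1. Qed.

Lemma prod_powR (I : Type) (r : seq I) (F : I -> R) (s : R) : (forall i, 0 <= F i) ->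
 (\prod_(i <- r) F i) `^ s = \prod_(i <- r) (F i `^ s).
Proof.
move=> F0; elim: r => [|i r IH]; first by rewrite !big_nil powR1.
by rewrite !big_cons powRM ?prodr_ge0// IH.
Qed.

(** The bridge to the weight [eta^p phi] of the energy inequality: raising only the spatial factors
    to a power means enlarging their gaps. *)
Lemma tens_cutfE s z : 0 < s -> tens (cutf s) z = cutx z `^ s * cutf 1 None (co None z).
Proof.
move=> s0; rewrite /tens prod_option mulrC; congr (_ * _).
rewrite /cutx prod_powR => [|i]; last exact: cutf_ge0.
apply: eq_bigr => i _; rewrite /cutf powRM ?ek_ge0// !ek_powR//=.
by rewrite !mul1r -!mulrA -!invfM ![_ * s]mulrC.
Qed.

(** All factors lie between 0 and 1, so a larger exponent makes them smaller: [l * s >= p] handles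
    the spatial ones and [s >= 1] the one in time. *)
Lemma tens_cutf_powR l s p z : 0 < l -> 0 < p -> 1 <= s -> p <= l * s ->
 tens (cutf l) z `^ s <= tens (cutf p) z.
Proof.
move=> l0 p0 s1 ls; rewrite !tens_cutfE// powRM ?powR_ge0 ?cutf_ge0// -powRrM.
apply: ler_pM; rewrite ?powR_ge0//.
 by apply: powR_le1W => //; rewrite cutx_ge0 cutx_le1.
rewrite -[leRHS](powRr1 (cutf_ge0 _ _ _)); apply: powR_le1W => //.
by rewrite cutf_ge0 cutf_le1.
Qed.

End one_family.
End cutoffs.

Lemma layerC_ge0 (m r : R) : r < m -> 0 <= layerC m r.
Proof.
move=> rm; rewrite /layerC divr_ge0 ?powR_ge0// subr_ge0.
by rewrite -[leRHS](powRr0 2) ler_powR ?ler1n// subr_le0 ltW.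
Qed.

Section weak_type.

Definition sobolevC (p q : R) : R := 8 * (4 * N%:R) `^ (p - 1) * (2 * 2 `^ q) `^ (p / N%:R).

(** The exponent of the parabolic embedding: functions bounded in L^oo(L^q) with spatial gradient in
    L^p lie in L^m for this [m], here in its weak form. *)
Definition weak_exp (p q : R) : R := p + p * q / N%:R.

Lemma weak_type_bound (W : Z -> R) (g : 'I_N -> Z -> R) (p q S Gam l : R) :
 itg W -> (forall z, 0 <= W z) -> (forall i, itg (g i)) ->
 (forall i, wpd (Some i) W (g i)) -> 1 <= p -> 0 < q ->
 (forall i, itg (fun z => `|g i z| `^ p)) ->
 \sum_i II (fun z => `|g i z| `^ p) <= Gam -> 0 < S ->
 {ae @lebesgue_measure R, forall t : mR R,
  (\int[@leb R N]_x ((W (x, t) `^ q)%:E) <= S%:E)%E} -> 0 < l -> (0 < N)%N ->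
 (mu [set z | (l < W z)%R] <=
  (sobolevC p q * S `^ (p / N%:R) * Gam * l `^ (- weak_exp p q))%:E)%E.
Proof.
move=> iW W0 ig Wg p1 q0 ip hG S0 hS l0 N0.
apply: (le_trans (weak_sobolev iW W0 ig Wg p1 q0 ip hG S0 hS l0 N0)).
rewrite lee_fin; apply: le_of_eq.
have NR0 : 0 < N%:R :> R by rewrite ltr0n.
have l1 := ltW l0.
rewrite /sobolev_bound /sobolevC /weak_exp /sobolev_radius.
rewrite -powRrM [N%:R^-1 * p]mulrC.
have -> : 2 * (2 / l) `^ q * S = (2 * 2 `^ q) * S * (l `^ (- q)).
 rewrite powRM ?invr_ge0// -[l^-1]powR_inv1// -powRrM mulN1r; ring.
rewrite !(powRM (p / N%:R)) ?mulr_ge0 ?powR_ge0 ?(ltW S0)// -powRrM.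
have -> : (l / (4 * N%:R)) `^ (1 - p) = l `^ (1 - p) * (4 * N%:R) `^ (p - 1).
 rewrite powRM ?invr_ge0 ?mulr_ge0//; congr (_ * _).
 by rewrite -[(4 * _)^-1]powR_inv1 ?mulr_ge0// -powRrM; congr (_ `^ _); ring.
have -> : l `^ (- (p + p * q / N%:R)) = l^-1 * (l `^ (1 - p) * (l `^ (- q)) `^ (p / N%:R)).
 rewrite -powRrM -[l^-1]powR_inv1// -!powRD ?(gt_eqF l0) ?implybT//; congr (_ `^ _).
 by field; rewrite gt_eqF.
ring.
Qed.

(* The level [L] splits the integral. *)
Lemma weak_type_power (W : Z -> R) (A : set Z) (M m r L : R) : measT W ->
 (forall z, 0 <= W z) -> measurable A -> (mu A < +oo)%E -> (forall z, W z != 0 -> A z) ->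
 0 < r -> r < m -> 0 <= M -> 0 < L ->
 (forall l, 0 < l -> (mu [set z | (l < W z)%R] <= (M * l `^ (- m))%:E)%E) ->
 itg (fun z => W z `^ r) /\
 II (fun z => W z `^ r) <= L `^ r * II \1_A + layerC m r * M * L `^ (r - m).
Proof.
move=> mW W0 mA fA WA r0 rm M0 L0 hM.
have iA : itg \1_A by exact: itg_indic.
have mWr : measT (fun z => W z `^ r).
 exact: (mcomp (measurable_powR r) mW).
pose V z := W z `^ r * \1_[set z | (L < W z)%R] z.
have mV : measT V.
 by apply: mfunM => //; apply: mindic; exact: mset_gt.
have V0 z : 0 <= V z by rewrite mulr_ge0 ?powR_ge0.
have hV := layer_cake mW r0 rm M0 L0 hM.
have iV : itg V.
 apply/integrableP; split; first exact/mEFinP.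
 apply: le_lt_trans (le_lt_trans hV (ltry _)); apply: le_of_eq.
 by apply: eq_integral => z _; rewrite /= ger0_norm.
have iLA : itg (fun z => L `^ r * \1_A z) by exact: itgZ.
have le z : W z `^ r <= L `^ r * \1_A z + V z.
 have [W0'|Wn] := eqVneq (W z) 0.
  by rewrite W0' powR0 ?gt_eqF// addr_ge0// mulr_ge0 ?powR_ge0.
 have [WL|LW] := leP (W z) L.
  rewrite ler_wpDr// indicE mem_set ?mulr1; last exact: WA.
  by powR_mono; rewrite ?(ltW L0) ?(ltW r0).
 rewrite ler_wpDl ?mulr_ge0 ?powR_ge0// /V indicE mem_set ?mulr1//.
have iWr : itg (fun z => W z `^ r).
 apply: (itg_dom mWr _ (itgD iLA iV)) => z; rewrite ger0_norm ?powR_ge0//; exact: le.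
split => //; apply: le_trans (le_II iWr (itgD iLA iV) le) _.
rewrite (IID iLA iV) (IIZ _ iA) lerD2l -lee_fin (IIE iV); exact: hV.
Qed.

End weak_type.

End space_time.

Arguments sobolevC {R} N p q.
Arguments weak_exp {R} N p q.

(** * Consequences of the energy inequalities on one pair of boxes *)

Section energy_estimates.
Context {R : realType} {N : nat}.
Notation Z := ('rV[R]_N * mR R)%type.
Notation mu := (@leb R N \x @lebesgue_measure R)%E.
Notation itg := (Rintg mu).
Notation II := (Rint mu).
Implicit Types (o : option 'I_N) (z : Z).

Definition ppart (w : Z -> R) (k : R) z : R := Num.max (w z - k) 0.

Definition above (w : Z -> R) (k : R) : set Z := [set z | k < w z].

(** The quantity that is iterated. Taking [|w|^P] and not the power of [w - k] lets it control the
    superlevel set as well, whose measure is at most [k^(-P)] times it. *)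
Definition mass (w : Z -> R) (P k : R) (a b : option 'I_N -> R) : R :=
 II (fun z => `|w z| `^ P * (\1_(above w k) z * \1_(obox a b) z)).

Definition source (w f : Z -> R) (p k : R) (a b gl gr : option 'I_N -> R) z : R :=
 ppart w k z * `|f z| * tens (cutf a b gl gr p) z.

Definition energy_rhs (w f : Z -> R) (p P k gam : R) (a b gl gr : option 'I_N -> R) : R :=
 gam `^ (- p) * mass w P k a b + II (source w f p k a b gl gr).

(* [w] is a localised solution; the energy inequalities are those for the
 explicit cut-offs [cutf], with gaps at least [gam] in space and [gam `^ p] at
 the bottom in time. The gap at the top in time is arbitrary. *)
Record energy_data (w f : Z -> R) (Dw : 'I_N -> Z -> R) (dl : 'I_N -> R)
  (p q P sig C dmax : R) (A B : option 'I_N -> R) : Prop := EnergyData {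
 ed_w : itg w;
 ed_D : forall i, itg (Dw i);
 ed_wpd : forall i, wpd (Some i) w (Dw i);
 ed_Dp : forall i, itg (fun z => `|Dw i z| `^ p);
 ed_fin : exists S0 : R, {ae @lebesgue_measure R, forall t : mR R,
  (\int[@leb R N]_x ((`|w (x, t)| `^ q)%:E) <= S0%:E)%E};
 ed_P : itg (fun z => `|w z| `^ P * \1_(obox A B) z);
 ed_f : measT f;
 ed_fsig : itg (fun z => `|f z| `^ sig);
 ed_dl : forall i, 0 <= dl i <= dmax;
 ed_energy : forall a b gl gr gam k, (forall o, A o <= a o) -> (forall o, b o <= B o) ->
  (forall o, a o <= b o) ->
  (forall o, 0 < gl o) -> (forall o, 0 < gr o) -> 0 < gam <= 1 ->
  (forall i, gam <= gl (Some i)) -> (forall i, gam <= gr (Some i)) ->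
  gam `^ p <= gl None -> 2^-1 <= k -> itg (source w f p k a b gl gr) ->
  (forall i, II (fun z => Num.max (`|Dw i z| - dl i) 0 `^ p *
   (\1_(above w k) z * tens (cutf a b gl gr p) z)) <= C * energy_rhs w f p P k gam a b gl gr) /\
  (forall kap, k < kap -> {ae @lebesgue_measure R, forall t : mR R,
   (\int[@leb R N]_x ((`|w (x, t)| `^ q * (\1_(above w kap) (x, t) * tens (cutf a b gl gr p) (x, t)))%:E)
    <= (C * (1 - k / kap) ^- 2 * energy_rhs w f p P k gam a b gl gr)%:E)%E})
}.

Section step.
Variables (w f : Z -> R) (Dw : 'I_N -> Z -> R) (dl : 'I_N -> R) (p q P sig C dmax : R)
 (A B : option 'I_N -> R).
Hypothesis (ED : energy_data w f Dw dl p q P sig C dmax A B).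
Hypotheses (N0 : (0 < N)%N) (p1 : 1 < p) (q1 : 1 < q) (PE : P = Num.max q p)
 (C0 : 0 < C) (sig1 : (N%:R + p) / p < sig) (hD : N%:R * q / (N%:R + q) < p).

Variables (a b gl gr : option 'I_N -> R) (gam k : R).
Hypotheses (Aa : forall o, A o <= a o) (bB : forall o, b o <= B o) (ab : forall o, a o <= b o)
 (gl0 : forall o, 0 < gl o) (gr0 : forall o, 0 < gr o) (gam01 : 0 < gam <= 1)
 (ggl : forall i, gam <= gl (Some i)) (ggr : forall i, gam <= gr (Some i))
 (ggt : gam `^ p <= gl None) (k2 : 2^-1 <= k).

Let p0 : 0 < p := lt_trans ltr01 p1.
Let q0 : 0 < q := lt_trans ltr01 q1.
Let pP : p <= P. Proof. by rewrite PE le_max lexx orbT. Qed.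
Let qP : q <= P. Proof. by rewrite PE le_max lexx. Qed.
Let P0 : 0 < P. Proof. exact: lt_le_trans pP. Qed.
Let k0 : 0 < k. Proof. by apply: lt_le_trans k2; rewrite invr_gt0. Qed.
Let gam0 : 0 < gam. Proof. by have /andP[] := gam01. Qed.
Let NR0 : 0 < N%:R :> R. Proof. by rewrite ltr0n. Qed.
Let mw := itgm (ed_w ED).
Let mf := ed_f ED.
Let Q := obox a b.
Let mQ : measurable Q. Proof. exact: mset_obox. Qed.
Let ze s := tens (cutf a b gl gr s).
Let hb s : 0 < s -> bumps (cutf a b gl gr s). Proof. exact: bumps_cutf. Qed.
Let Y := mass w P k a b.
Let E := above w k `&` Q.
Let mE : measurable E. Proof. by apply: measurableI => //; exact: mset_gt. Qed.
Let md (z : Z) : R := `|w z| `^ P * (\1_(above w k) z * \1_Q z).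

Let indE z : \1_E z = \1_(above w k) z * \1_Q z :> R.
Proof. by rewrite /E indicI. Qed.

Let iY : itg md.
Proof.
apply: (itg_dom _ _ (ed_P ED)).
 apply: mfunM.
  by apply: (mpowR P); exact: mcomp.
 by apply: mfunM; apply: mindic => //; exact: mset_gt.
move=> z; rewrite /md -indE ger0_norm ?mulr_ge0 ?powR_ge0//.
rewrite ler_wpM2l ?powR_ge0// !indicE; case: (boolP (z \in E)) => // h.
rewrite mem_set// => o; move: h; rewrite inE => -[_ /(_ o)] /=.
rewrite !in_itv/= => /andP[h1 h2].
by rewrite (le_lt_trans (Aa o) h1) (lt_le_trans h2 (bB o)).
Qed.

Let Y0 : 0 <= Y. Proof. by apply: II_ge0 => z; rewrite !mulr_ge0 ?powR_ge0. Qed.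

(* On the superlevel sets of levels at least 1/2 powers can be raised to [P]. *)
Let pow_above r z : 0 <= r <= P -> \1_E z * `|w z| `^ r <= 2 `^ P * md z.
Proof.
move=> /andP[r0 rP]; rewrite /md -indE indicE; case: (boolP (z \in E)); last first.
 by rewrite !(mul0r, mulr0).
rewrite inE => -[/= wk _]; rewrite mul1r mulr1.
have w2 : 1 <= 2 * `|w z|.
 have : 2^-1 < `|w z| by apply: lt_le_trans (ler_norm _); exact: le_lt_trans wk.
 by move=> /ltW h; rewrite -[leLHS](@mulfV _ 2)// ler_pM2l.
rewrite -powRM//; apply: (letr ((2 * `|w z|) `^ r)); last exact: ler_powR.
by powR_mono; rewrite ?mulr_ge0// ler_peMl// ler1n.
Qed.

Let fE : (mu E < +oo)%E.
Proof.
apply: le_lt_trans (fin_obox ab); apply: le_measure; rewrite ?inE//.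
exact: subIsetr.
Qed.

Let iE : itg \1_E. Proof. exact: itg_indic. Qed.

Let muE : II \1_E <= k `^ (- P) * Y.
Proof.
rewrite /Y /mass -(IIZ _ iY); apply: le_II => //; first exact: itgZ.
move=> z; rewrite /md -indE indicE; case: (boolP (z \in E)); last by rewrite !mulr0.
rewrite inE => -[/= wk _]; rewrite !mulr1.
rewrite powRN ler_pdivlMl ?powR_gt0// mulr1.
powR_mono; rewrite ?(ltW P0) ?(ltW k0)//.
by apply: le_trans (ler_norm _); exact: ltW.
Qed.

Section truncation.
Variables (kap s : R).
Hypotheses (kkap : k <= kap) (s1 : 1 <= s).
Let s0 : 0 < s. Proof. exact: lt_le_trans s1. Qed.
Let kap0 : 0 <= kap. Proof. by apply: le_trans kkap; exact: ltW. Qed.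

(** The exponent [s] of the cut-off is left free: the integrability of the source takes [s = p], the
    iteration takes [s = max 1 (p/q)]. *)
Definition wtrunc z : R := ppart w kap z * ze s z.

Definition dtrunc i z : R := pos_slope kap w (Dw i) z * Dw i z * ze s z +
 ppart w kap z * tens (dt (Some i) (cutf a b gl gr s)) z.

Let mpp : measT (ppart w kap).
Proof.
apply: measurable_maxr; last exact: measurable_cst.
by apply: measurable_funB => //; exact: measurable_cst.
Qed.

Let ipp : itg (ppart w kap).
Proof.
apply: (itg_le mpp _ (ed_w ED)) => z; rewrite /ppart.
rewrite ger0_norm ?le_max ?lexx ?orbT// ge_max normr_ge0 andbT.
by apply: le_trans (ler_norm _); rewrite lerBlDr lerDl.
Qed.

Let ps01 i z : 0 <= pos_slope kap w (Dw i) z <= 1.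
Proof. by rewrite /pos_slope; case: (_ || _); rewrite ?lexx ?ler01. Qed.

Let mps i : measT (pos_slope kap w (Dw i)).
Proof. exact: (measurable_pos_slope kap mw (itgm (ed_D ED i))). Qed.

Let ips i : itg (fun z => pos_slope kap w (Dw i) z * Dw i z).
Proof.
apply: (itgMC (mps i) (M := 1) _ (ed_D ED i)) => z.
by have /andP[h1 h2] := ps01 i z; rewrite ger0_norm.
Qed.

Let ze1 z : `|ze s z| <= 1.
Proof. by rewrite ger0_norm ?tens_cutf_ge0 ?tens_cutf_le1. Qed.

Let mze : measT (ze s). Proof. exact: (bumps_meas (hb s0)). Qed.

Lemma wtrunc_itg : itg wtrunc.
Proof. exact: (itg_bnd mze ze1 ipp). Qed.

Lemma wtrunc_ge0 z : 0 <= wtrunc z.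
Proof. by rewrite mulr_ge0 ?tens_cutf_ge0// /ppart le_max lexx orbT. Qed.

Lemma dtrunc_itg i : itg (dtrunc i).
Proof.

apply: itgD; first exact: (itg_bnd mze ze1 (ips i)).
exact: (itg_mul_tens (bumps_dt (Some i) (hb s0)) ipp).
Qed.

Lemma wtrunc_wpd i : wpd (Some i) wtrunc (dtrunc i).
Proof.
have h := wpd_pos kap0 (ed_w ED) (ed_D ED i) (ed_wpd ED i).
exact: (wpd_mul ipp (ips i) h (hb s0)).
Qed.

Lemma wtrunc_supp z : wtrunc z != 0 -> E z.
Proof.
move=> h; split; last first.
 by apply: (tens_cutf_supp gl0 gr0 s0); apply: contraNN h => /eqP h; rewrite /wtrunc /ze h mulr0.
rewrite /above /=; apply: le_lt_trans kkap _; rewrite ltNge; apply: contraNN h => h.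
by rewrite /wtrunc /ppart max_r ?mul0r// subr_le0.
Qed.

Lemma ppart_le z : ppart w kap z * \1_Q z <= \1_E z * `|w z|.
Proof.
rewrite /ppart indE -mulrA; have [wk|kw] := leP (w z) kap.
 by rewrite max_r ?subr_le0// mul0r mulr_ge0// mulr_ge0.
rewrite max_l ?subr_ge0 ?(ltW kw)// [\1_(above w k) z]indicE mem_set ?mul1r; last first.
 exact: le_lt_trans kw.
rewrite mulrC ler_wpM2l//; apply: le_trans (ler_norm _); by rewrite lerBlDr lerDl.
Qed.

Let md_ge0 z : 0 <= md z. Proof. by rewrite !mulr_ge0 ?powR_ge0. Qed.

Let cdt i z : `|tens (dt (Some i) (cutf a b gl gr s)) z| <= 4 / gam * \1_Q z.
Proof.
apply: le_trans (tens_dt_cutf_le _ _ gl0 gr0 (Some i) z s0) _.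
apply: ler_wpM2r => //=; rewrite (_ : 4 / gam = 2 / gam + 2 / gam); last by rewrite -mulrDl; congr (_ / _); ring.
apply: lerD.
 rewrite ler_pM2l// lef_pV2 ?posrE ?mulr_gt0//; apply: le_trans (ggl i) _.
 by rewrite ler_peMl// ltW.
rewrite ler_pM2l// lef_pV2 ?posrE ?mulr_gt0//; apply: le_trans (ggr i) _.
by rewrite ler_peMl// ltW.
Qed.

Definition dpow i z : R := Num.max (`|Dw i z| - dl i) 0 `^ p *
 (\1_(above w k) z * ze p z).

Lemma dpow_itg i : itg (dpow i).
Proof.
apply: (itg_dom _ _ (ed_Dp ED i)).
 apply: mfunM.
  apply: (mpowR p); apply: measurable_maxr; last exact: measurable_cst.
  apply: measurable_funB; last exact: measurable_cst.
  by apply: mcomp => //; exact: itgm (ed_D ED i).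
 apply: mfunM; first by apply: mindic; exact: mset_gt.
 exact: (bumps_meas (hb p0)).
have /andP[dl0 _] := ed_dl ED i.
move=> z; rewrite /dpow ger0_norm; last by rewrite !mulr_ge0 ?powR_ge0 ?tens_cutf_ge0.
rewrite -[leRHS]mulr1; apply: ler_pM; rewrite ?powR_ge0 ?mulr_ge0 ?tens_cutf_ge0//.
 powR_mono; rewrite ?(ltW p0) ?le_max ?lexx ?orbT//.
 by rewrite ge_max normr_ge0 andbT lerBlDr lerDl.
by rewrite mulr_ile1 ?tens_cutf_ge0 ?tens_cutf_le1.
Qed.

Let dl0 i : 0 <= dl i. Proof. by have /andP[] := ed_dl ED i. Qed.
Let dlm i : dl i <= dmax. Proof. by have /andP[] := ed_dl ED i. Qed.
Let dm0 : 0 <= dmax. Proof. exact: le_trans (dl0 (Ordinal N0)) (dlm _). Qed.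
Let pp0 z : 0 <= ppart w kap z. Proof. by rewrite /ppart le_max lexx orbT. Qed.

Let dtrunc_split i z : `|dtrunc i z| `^ p <=
 2 `^ p * (`|pos_slope kap w (Dw i) z * Dw i z * ze s z| `^ p +
  4 `^ p * gam `^ (- p) * (2 `^ P * md z)).
Proof.
have p0' := ltW p0.
have nn : `|dtrunc i z| <= `|pos_slope kap w (Dw i) z * Dw i z * ze s z| +
  ppart w kap z * `|tens (dt (Some i) (cutf a b gl gr s)) z|.
 by apply: le_trans (ler_normD _ _) _; rewrite lerD2l normrM [X in X * _]ger0_norm.
apply: (letr (2 `^ p * (`|pos_slope kap w (Dw i) z * Dw i z * ze s z| `^ p +
  (ppart w kap z * `|tens (dt (Some i) (cutf a b gl gr s)) z|) `^ p))).
 apply: le_trans (powRD_le _ _ p0'); rewrite ?mulr_ge0//.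
 by powR_mono; rewrite ?addr_ge0 ?mulr_ge0.
rewrite ler_wpM2l ?powR_ge0// lerD2l.
apply: (letr ((4 / gam * (\1_E z * `|w z|)) `^ p)).
 powR_mono; rewrite ?mulr_ge0 ?invr_ge0 ?(ltW gam0)//.
 apply: (letr (ppart w kap z * (4 / gam * \1_Q z))).
  by apply: ler_wpM2l => //; exact: cdt.
 by rewrite mulrCA ler_wpM2l ?ppart_le// divr_ge0 ?(ltW gam0).
rewrite powRM ?mulr_ge0 ?invr_ge0 ?(ltW gam0)// powRM ?invr_ge0 ?(ltW gam0)//.
rewrite -[gam^-1]powR_inv1 ?(ltW gam0)// -powRrM mulN1r ler_wpM2l ?mulr_ge0 ?powR_ge0//.
apply: le_trans (pow_above z (r := p) _); last by rewrite p0' pP.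
by rewrite indicE; case: (_ \in _); rewrite ?mul1r// !mul0r powR0 ?gt_eqF.
Qed.

Lemma dtrunc_pow_itg i : itg (fun z => `|dtrunc i z| `^ p).
Proof.
apply: (itg_dom (g := fun z => 2 `^ p * (`|Dw i z| `^ p +
  4 `^ p * gam `^ (- p) * (2 `^ P * md z)))).
- apply: (mpowR p); apply: mcomp => //.
 exact: itgm (dtrunc_itg i).
- move=> z; rewrite ger0_norm ?powR_ge0//; apply: le_trans (dtrunc_split i z) _.
 rewrite ler_wpM2l ?powR_ge0// lerD2r.
 powR_mono; rewrite ?(ltW p0)// !normrM -mulrA mulrCA ler_piMr//.
 have /andP[h1 h2] := ps01 i z.
 by rewrite mulr_ile1// ger0_norm.
- by apply: itgZ; apply: itgD; [exact: (ed_Dp ED i)|apply: itgZ; exact: (itgZ _ iY)].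
Qed.

(** The gradient is at most its excess over [dl i] plus [dmax]; the constant part lives on a
    superlevel set and is controlled by the mass. The gap [k < kap] places the points with
    [w = kap], where the slope may be 1, inside [above w k]. *)
Lemma dtrunc_pow i z : k < kap -> `|dtrunc i z| `^ p <=
 4 `^ p * dpow i z + (4 `^ p * dmax `^ p + 8 `^ p * gam `^ (- p)) * (2 `^ P * md z).
Proof.
move=> kk; have p0' := ltW p0; apply: le_trans (dtrunc_split i z) _.
have T1 : `|pos_slope kap w (Dw i) z * Dw i z * ze s z| `^ p <=
  2 `^ p * (dpow i z + dmax `^ p * (2 `^ P * md z)).
 have R0 : 0 <= 2 `^ p * (dpow i z + dmax `^ p * (2 `^ P * md z)).
  by rewrite mulr_ge0 ?powR_ge0// addr_ge0// !mulr_ge0 ?powR_ge0 ?tens_cutf_ge0.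
 have [zw|zw] := leP kap (w z); last first.
  rewrite /pos_slope ltNge (ltW zw)/= (lt_eqF zw)/= !mul0r normr0 powR0// gt_eqF//.
 have [zQ|zQ] := boolP (z \in Q); last first.
  have -> : ze s z = 0.
   apply/eqP; apply: contraNT zQ => /(tens_cutf_supp gl0 gr0 s0); by rewrite inE.
  by rewrite mulr0 normr0 powR0// gt_eqF.
 have zE : z \in E by rewrite inE; split; [exact: lt_le_trans zw|exact: set_mem].
 apply: (letr (`|Dw i z| `^ p * ze s z `^ p)).
  rewrite -powRM ?tens_cutf_ge0//; powR_mono; rewrite ?mulr_ge0 ?tens_cutf_ge0//.
  rewrite !normrM [`|ze s z|]ger0_norm ?tens_cutf_ge0// ler_wpM2r ?tens_cutf_ge0//.
  by have /andP[h1 h2] := ps01 i z; rewrite ler_piMl// ger0_norm.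
 have D1 : `|Dw i z| `^ p <= 2 `^ p * (Num.max (`|Dw i z| - dl i) 0 `^ p + dmax `^ p).
  apply: (letr ((Num.max (`|Dw i z| - dl i) 0 + dmax) `^ p)).
   powR_mono; rewrite ?addr_ge0 ?le_max ?lexx ?orbT//.
   by rewrite -lerBlDr le_max lerB.
  by apply: powRD_le; rewrite ?le_max ?lexx ?orbT.
 have Z1 : ze s z `^ p <= ze p z.
  by apply: tens_cutf_powR; rewrite ?(ltW p1)// ler_peMl ?(ltW p0).
 have Z2 : ze s z `^ p <= 1.
  by apply: le_trans Z1 _; exact: tens_cutf_le1.
 apply: (letr (2 `^ p * (Num.max (`|Dw i z| - dl i) 0 `^ p + dmax `^ p) * ze s z `^ p)).
  by rewrite ler_wpM2r ?powR_ge0.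
 rewrite -mulrA ler_wpM2l ?powR_ge0// mulrDl; apply: lerD.
  rewrite /dpow ler_wpM2l ?powR_ge0// [\1_(above w k) z]indicE mem_set ?mul1r//.
  exact: lt_le_trans zw.
 rewrite ler_wpM2l ?powR_ge0//; apply: le_trans Z2 _.
 apply: le_trans (pow_above z (r := 0) _); last by rewrite lexx (ltW P0).
 by rewrite powRr0 mulr1 indicE zE.
apply: (letr (2 `^ p * (2 `^ p * (dpow i z + dmax `^ p * (2 `^ P * md z)) +
 4 `^ p * gam `^ (- p) * (2 `^ P * md z)))).
 by rewrite ler_wpM2l ?powR_ge0// lerD2r.
have -> : 4 `^ p = 2 `^ p * 2 `^ p :> R by rewrite -powRM//; congr (_ `^ _); ring.
have -> : 8 `^ p = 2 `^ p * (2 `^ p * 2 `^ p) :> R by rewrite -!powRM//; congr (_ `^ _); ring.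
by apply: le_of_eq; ring.
Qed.

Notation Phi := (energy_rhs w f p P k gam a b gl gr).
Hypothesis (isrc : itg (source w f p k a b gl gr)).

Let en := ed_energy ED Aa bB ab gl0 gr0 gam01 ggl ggr ggt k2 isrc.

Let gamV : 1 <= gam `^ (- p).
Proof.
have /andP[_ g1] := gam01.
rewrite powRN -[leLHS]invr1 lef_pV2 ?posrE ?powR_gt0//.
apply: (letr (1 `^ p)); last by rewrite powR1.
by powR_mono; rewrite ?(ltW p0) ?(ltW gam0).
Qed.

Lemma source_ge0 z : 0 <= source w f p k a b gl gr z.
Proof. by rewrite !mulr_ge0 ?tens_cutf_ge0// /ppart le_max lexx orbT. Qed.

Let Phi_ge : gam `^ (- p) * Y <= Phi.
Proof. by rewrite lerDl; apply: II_ge0 => z; exact: source_ge0. Qed.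

Definition gamC : R := N%:R * (4 `^ p * C + 2 `^ P * (4 `^ p * dmax `^ p + 8 `^ p)).

Lemma dtrunc_sum : k < kap -> \sum_i II (fun z => `|dtrunc i z| `^ p) <= gamC * Phi.
Proof.
move=> kk; have PhiY := Phi_ge.
have : \sum_i II (fun z => `|dtrunc i z| `^ p) <=
  \sum_(i < N) ((4 `^ p * C + 2 `^ P * (4 `^ p * dmax `^ p + 8 `^ p)) * Phi).
 apply: ler_sum => i _; pose c := (4 `^ p * dmax `^ p + 8 `^ p * gam `^ (- p)).
 have i1 := itgZ (4 `^ p) (dpow_itg i); have i2 := itgZ c (itgZ (2 `^ P) iY).
 apply: (le_trans (le_II (dtrunc_pow_itg i) (itgD i1 i2) (fun z => dtrunc_pow i z kk))).
 rewrite (IID i1 i2) (IIZ _ (dpow_itg i)) (IIZ _ (itgZ (2 `^ P) iY)) (IIZ _ iY) -/Y.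
 rewrite [X in _ <= X]mulrDl; apply: lerD.
  by rewrite -mulrA ler_wpM2l ?powR_ge0//; exact: (en.1 i).
 apply: (letr (2 `^ P * (4 `^ p * dmax `^ p + 8 `^ p) * (gam `^ (- p) * Y))); last first.
  by rewrite ler_wpM2l// mulr_ge0 ?powR_ge0// addr_ge0 ?mulr_ge0 ?powR_ge0.
 rewrite mulrCA -mulrA ler_wpM2l ?powR_ge0// mulrA ler_wpM2r// /c mulrDl lerD2r.
 by rewrite ler_peMr// mulr_ge0 ?powR_ge0.
rewrite sumr_const card_ord => h; apply: (le_trans h).
by rewrite -[X in X <= _]mulr_natl mulrA.
Qed.

Let slice_measurable (F : Z -> R) (t : mR R) :
 measT F -> measT (fun x => (F (x, t))%:E : \bar R).
Proof. by move=> mF; apply/mEFinP; exact: (mcomp mF (pair2_measurable t)). Qed.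

Let slice_le (F G : Z -> R) (M : R) : measT F -> measT G ->
 (forall z, 0 <= F z <= G z) ->
 {ae @lebesgue_measure R, forall t : mR R,
   (\int[@leb R N]_x (G (x, t))%:E <= M%:E)%E} ->
 {ae @lebesgue_measure R, forall t : mR R,
   (\int[@leb R N]_x (F (x, t))%:E <= M%:E)%E}.
Proof.
move=> mF mG FG; apply: filterS => t; apply: le_trans; apply: ge0_le_integral => //.
- by move=> x _; have /andP[h _] := FG (x, t); rewrite lee_fin.
- exact: slice_measurable.
- exact: slice_measurable.
- by move=> x _; have /andP[_ h] := FG (x, t); rewrite lee_fin.
Qed.

Let mtr : measT (fun z => wtrunc z `^ q).
Proof. exact: (mcomp (measurable_powR q) (itgm wtrunc_itg)). Qed.

Let mwq : measT (fun z => `|w z| `^ q).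
Proof. by apply: (mpowR q); exact: mcomp. Qed.

(** With [p <= s * q] the power [zeta_s^q] of the cut-off is dominated by the weight [zeta_p] of the
    energy inequality. *)
Lemma trunc_slice : k < kap -> p <= s * q ->
 {ae @lebesgue_measure R, forall t : mR R,
  (\int[@leb R N]_x (wtrunc (x, t) `^ q)%:E <= (C * (1 - k / kap) ^- 2 * Phi)%:E)%E}.
Proof.
move=> kk sq; apply: (slice_le (G := fun z => `|w z| `^ q * (\1_(above w kap) z * ze p z)) mtr _ _ (en.2 _ kk)).
 apply: mfunM => //; apply: mfunM; last exact: (bumps_meas (hb p0)).
 by apply: mindic; exact: (mset_gt kap mw).
move=> z; rewrite powR_ge0 /wtrunc /=; have [zw|zw] := leP (w z) kap.
 rewrite {1}/ppart max_r ?subr_le0// mul0r powR0 ?gt_eqF//.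
 by rewrite !mulr_ge0 ?powR_ge0 ?tens_cutf_ge0.
rewrite [\1_(above w kap) z]indicE mem_set// mul1r powRM ?tens_cutf_ge0//.
apply: ler_pM; rewrite ?powR_ge0//.
 powR_mono; rewrite ?(ltW q0)//.
 rewrite /ppart max_l ?subr_ge0 ?(ltW zw)//.
 by apply: le_trans (ler_norm _); rewrite lerBlDr lerDl.
by apply: tens_cutf_powR => //; rewrite ltW.
Qed.

Definition weakM : R :=
 sobolevC N p q * (C * (1 - k / kap) ^- 2 * Phi) `^ (p / N%:R) * (gamC * Phi).

Lemma trunc_weak l : k < kap -> p <= s * q -> 0 < Phi -> 0 < l ->
 (mu [set z | (l < wtrunc z)%R] <= (weakM * l `^ (- weak_exp N p q))%:E)%E.
Proof.
move=> kk sq Phi0 l0.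
have d0 : 0 < 1 - k / kap.
 by rewrite subr_gt0 ltr_pdivrMr ?mul1r//; exact: lt_trans kk.
apply: weak_type_bound (dtrunc_sum kk) _ (trunc_slice kk sq) l0 N0.
- exact: wtrunc_itg.
- exact: wtrunc_ge0.
- exact: dtrunc_itg.
- exact: wtrunc_wpd.
- exact: ltW.
- exact: q0.
- exact: dtrunc_pow_itg.
- by rewrite !mulr_gt0// invr_gt0 exprn_gt0.
Qed.

End truncation.

Let sigp : 1 < sig.
Proof.
apply: lt_trans sig1; rewrite ltr_pdivlMr// mul1r ltrDr//.
Qed.

Definition sigc : R := sig / (sig - 1).

Let sigc0 : 0 < sigc. Proof. by rewrite divr_gt0 ?subr_gt0// (lt_trans ltr01). Qed.

Let sigcV : sig^-1 + sigc^-1 = 1.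
Proof. by rewrite /sigc invf_div; field; rewrite gt_eqF// (lt_trans ltr01). Qed.

(** Equivalent to the lower bound [(N + p) / p < sig] by clearing denominators. *)
Lemma sigc_lt : sigc < 1 + p / N%:R.
Proof.
have s10 : 0 < sig - 1 by rewrite subr_gt0.
rewrite /sigc ltr_pdivrMr// -subr_gt0.
have -> : (1 + p / N%:R) * (sig - 1) - sig = (p * sig - (N%:R + p)) / N%:R.
 by field; rewrite gt_eqF.
by rewrite divr_gt0// subr_gt0 -ltr_pdivrMl// mulrC.
Qed.

Let m := weak_exp N p q.

Lemma sigc_lt_weak : sigc < m.
Proof.
apply: lt_trans sigc_lt _; rewrite /m /weak_exp; apply: ltrD => //.
by rewrite ltr_pM2r ?invr_gt0// ltr_pMr.
Qed.

(** [p < m] is clear, and [q < m] is the hypothesis [hD] multiplied out. *)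
Lemma P_lt_weak : P < m.
Proof.
rewrite PE gt_max; apply/andP; split.
 rewrite /m /weak_exp -subr_gt0.
 have -> : p + p * q / N%:R - q = (p * (N%:R + q) - N%:R * q) / N%:R.
  by field; rewrite gt_eqF.
 by rewrite divr_gt0// subr_gt0 -ltr_pdivrMr// addr_gt0.
by rewrite ltrDl divr_gt0// mulr_gt0.
Qed.

(* A priori finiteness: here the bounds need not be uniform. *)
Lemma source_itg : itg (source w f p k a b gl gr).
Proof.
have [S0 hS0] := ed_fin ED.
have kk := lexx k; have p1' := ltW p1.
have iT := wtrunc_itg kk p1'; have T0 := wtrunc_ge0 k p.
pose M := sobolevC N p q * (`|S0| + 1) `^ (p / N%:R) * \sum_i II (fun z => `|dtrunc k p i z| `^ p).
have hM l : 0 < l -> (mu [set z | (l < wtrunc k p z)%R] <= (M * l `^ (- m))%:E)%E.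
 move=> l0; apply: (weak_type_bound iT T0 (dtrunc_itg kk p1') (wtrunc_wpd kk p1') p1' q0
  (dtrunc_pow_itg kk p1') (lexx _) _ _ l0 N0); first by rewrite ltr_wpDl.
 apply: filterS hS0 => t h.
 apply: (@le_trans _ _ S0%:E); last by rewrite lee_fin ler_wpDr// ler_norm.
 apply: le_trans h; apply: ge0_le_integral => //.
 - by move=> x _; rewrite lee_fin powR_ge0.
 - apply/mEFinP; apply: (mpowR q).
  exact: (mcomp (itgm iT) (pair2_measurable t)).
 - apply/mEFinP; apply: (mpowR q); apply: mcomp => //.
  exact: (mcomp mw (pair2_measurable t)).
 move=> x _; rewrite lee_fin; powR_mono; rewrite ?(ltW q0)//.
 rewrite /wtrunc -[leRHS]mulr1; apply: ler_pM; rewrite ?tens_cutf_ge0 ?tens_cutf_le1//.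
  by rewrite /ppart le_max lexx orbT.
 by rewrite ge_max normr_ge0 andbT lerBlDr ler_wpDr ?(ltW k0)// ler_norm.
have M0 : 0 <= M.
 rewrite !mulr_ge0 ?powR_ge0//; apply: sumr_ge0 => i _; apply: II_ge0 => z; exact: powR_ge0.
have [iTr _] := weak_type_power (itgm iT) T0 mE fE (wtrunc_supp kk p1') sigc0 sigc_lt_weak M0 ltr01 hM.
have sig0 : 0 < sig by exact: lt_trans sigp.
have mf' : measT (fun z => `|f z|) by exact: mcomp.
have [h _] := hoelder_int mf' (itgm iT) sig0 sigc0 sigcV (fun z => normr_ge0 _) T0 (ed_fsig ED) iTr.
apply: (itg_dom _ _ h).
 apply: mfunM; last exact: (bumps_meas (hb p0)).
 apply: mfunM => //; apply: measurable_maxr; last exact: measurable_cst.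
 by apply: measurable_funB => //; exact: measurable_cst.
move=> z; rewrite ger0_norm ?source_ge0// /source /wtrunc.
by rewrite mulrAC mulrC mulrA.
Qed.

Notation Phi := (energy_rhs w f p P k gam a b gl gr).
(** The smallest exponent satisfying both [1 <= s], used for the gradient, and [p <= s * q], used
    for the slices. It is at most [p], so that the source weight [zeta_p] is below [zeta_s]. *)
Let s := Num.max 1 (p / q).
Let s1 : 1 <= s. Proof. by rewrite le_max lexx. Qed.
Let sq : p <= s * q. Proof. by rewrite -ler_pdivrMr// le_max lexx orbT. Qed.
Let sp : s <= p.
Proof. by rewrite ge_max (ltW p1)/= ler_pdivrMr// ler_peMr// ltW. Qed.
Let isrc := source_itg.

Section levels.
Variable kap : R.
Hypotheses (kk : k < kap) (Phi0 : 0 < Phi).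
Let kk' := ltW kk.
Let iT := wtrunc_itg kk' s1.
Let T0 := wtrunc_ge0 kap s.
Let hT l (l0 : 0 < l) := trunc_weak kk' s1 isrc kk sq Phi0 l0.

Let M0 : 0 <= weakM kap.
Proof.
rewrite /weakM !mulr_ge0 ?powR_ge0 ?(ltW Phi0) ?ler0n ?addr_ge0 ?mulr_ge0 ?powR_ge0 ?(ltW C0)//.
by rewrite addr_ge0 ?mulr_ge0 ?powR_ge0.
Qed.

(** The weak-type bound is available only above a level [kap > k]. So the truncation at [k] is split
    as the one at [kap] plus [kap - k] on the superlevel set, and Hoelder's inequality is applied to
    each part. The level [L] stays free for the later absorption. *)
Lemma source_bound L : 0 < L -> II (source w f p k a b gl gr) <=
 II (fun z => `|f z| `^ sig) `^ sig^-1 *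
 ((L `^ sigc * (k `^ (- P) * Y) + layerC m sigc * weakM kap * L `^ (sigc - m)) `^ sigc^-1 +
 (kap - k) * (k `^ (- P) * Y) `^ sigc^-1).
Proof.
move=> L0; have sig0 : 0 < sig by exact: lt_trans sigp.
have mf' : measT (fun z => `|f z|) by exact: mcomp.
have [iTr le1] := weak_type_power (itgm iT) T0 mE fE (wtrunc_supp kk' s1) sigc0 sigc_lt_weak M0 L0 hT.
have [h1 le2] := hoelder_int mf' (itgm iT) sig0 sigc0 sigcV (fun z => normr_ge0 _) T0 (ed_fsig ED) iTr.
have E0 z : 0 <= \1_E z :> R by rewrite indicE.
have EE : (fun z => \1_E z `^ sigc) = \1_E :> (Z -> R).
 by ext => z; rewrite indicE; case: (_ \in _); rewrite ?powR1 ?powR0 ?gt_eqF.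
have iEs : itg (fun z => \1_E z `^ sigc) by rewrite EE.
have [h2 le3] := hoelder_int mf' (itgm iE) sig0 sigc0 sigcV (fun z => normr_ge0 _) E0 (ed_fsig ED) iEs.
set FF := _ `^ sig^-1 in le2 le3 *.
have R0 z : 0 <= `|f z| * wtrunc kap s z + (kap - k) * (`|f z| * \1_E z).
 apply: addr_ge0; first exact: mulr_ge0 (normr_ge0 _) (T0 z).
 by apply: mulr_ge0; [rewrite subr_ge0|exact: mulr_ge0].
have le z : source w f p k a b gl gr z <= `|f z| * wtrunc kap s z + (kap - k) * (`|f z| * \1_E z).
 have [kw|wk] := leP (w z) k.
  by rewrite {1}/source {1}/ppart max_r ?subr_le0// !mul0r.
 have [zQ|zQ] := boolP (z \in Q); last first.
  suff e0 : tens (cutf a b gl gr p) z = 0 by rewrite {1}/source e0 mulr0.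
  by apply/eqP; apply: contraNT zQ => /(tens_cutf_supp gl0 gr0 p0); rewrite inE.
 have -> : \1_E z = 1 :> R by rewrite indicE mem_set//; split => //; exact: set_mem.
 rewrite /source /wtrunc mulr1 (mulrC (ppart w k z)) -mulrA (mulrC _ `|f z|) -mulrDr ler_wpM2l//.
 have Zp : ze p z <= ze s z.
  rewrite /ze !tens_cutfE ?(lt_le_trans ltr01 s1)// ler_wpM2r ?cutf_ge0//.
  by apply: powR_le1W; rewrite ?cutx_ge0 ?cutx_le1// (lt_le_trans ltr01 s1).
 apply: (letr ((ppart w kap z + (kap - k)) * ze p z)).
  rewrite ler_wpM2r ?tens_cutf_ge0// /ppart ge_max addr_ge0 ?subr_ge0 ?le_max ?lexx ?orbT// andbT.
  by rewrite -lerBlDr le_max opprB addrA subrK lexx.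
 rewrite mulrDl; apply: lerD.
  by rewrite ler_wpM2l// /ppart le_max lexx orbT.
 by rewrite ler_piMr ?subr_ge0// tens_cutf_le1.
have i3 := itgZ (kap - k) h2.
apply: le_trans (le_II isrc (itgD h1 i3) le) _.
rewrite (IID h1 i3) (IIZ _ h2) mulrDr; apply: lerD.
 apply: le_trans le2 _; rewrite ler_wpM2l ?powR_ge0//.
 powR_mono; rewrite ?invr_ge0 ?(ltW sigc0) ?II_ge0//.
 - by move=> z; exact: powR_ge0.
 - apply: addr_ge0; apply: mulr_ge0; rewrite ?powR_ge0//.
   exact: mulr_ge0 (powR_ge0 _ _) Y0.
  exact: mulr_ge0 (layerC_ge0 sigc_lt_weak) M0.
 apply: le_trans le1 _; rewrite lerD2r ler_wpM2l ?powR_ge0//; exact: muE.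
rewrite mulrCA ler_wpM2l ?subr_ge0//; apply: le_trans le3 _.
rewrite ler_wpM2l ?powR_ge0// EE; powR_mono; rewrite ?invr_ge0 ?(ltW sigc0) ?II_ge0 ?mulr_ge0 ?powR_ge0//.
Qed.

Let c0 := expR (- 2 * s) ^+ #|{: option 'I_N}|.

(** On the inner box the cut-off is at least [c0], so a point with [w > k'] has
    [wtrunc > c0 (k' - kap)]. Only the layers above this height are needed, which avoids the term of
    the small values of [wtrunc]. *)
Lemma next_mass k' a' b' : kap < k' -> (forall o, a o + gl o <= a' o) ->
 (forall o, b' o <= b o - gr o) ->
 mass w P k' a' b' <= (k' / (k' - kap) / c0) `^ P *
  (layerC m P * weakM kap * (c0 * (k' - kap)) `^ (P - m)).
Proof.
move=> kk2 aa bb.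
have c00 : 0 < c0 by rewrite exprn_gt0// expR_gt0.
have d0 : 0 < k' - kap by rewrite subr_gt0.
have k'0 : 0 < k' by rewrite (lt_trans k0)// (lt_trans kk).
have cd0 : 0 < c0 * (k' - kap) by rewrite mulr_gt0.
have := layer_cake (itgm iT) P0 P_lt_weak M0 cd0 hT.
set V := fun z => wtrunc kap s z `^ P * \1_[set z | (c0 * (k' - kap) < wtrunc kap s z)%R] z.
rewrite -/(V) => hV.
have mV : measT V.
 apply: mfunM; first exact: (mcomp (measurable_powR P) (itgm iT)).
 by apply: mindic; apply: mset_gt; exact: itgm iT.
have V0 z : 0 <= V z by rewrite mulr_ge0 ?powR_ge0.
have iV : itg V.
 apply/integrableP; split; first exact/mEFinP.
 apply: le_lt_trans (le_lt_trans hV (ltry _)); apply: le_of_eq.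
 by apply: eq_integral => z _; rewrite /= ger0_norm.
have {}hV : II V <= layerC m P * weakM kap * (c0 * (k' - kap)) `^ (P - m).
 by rewrite -lee_fin (IIE iV).
set cc := (k' / (k' - kap) / c0) `^ P.
apply: (letr (cc * II V)); last by rewrite ler_wpM2l ?powR_ge0.
rewrite -(IIZ _ iV).
have le z : `|w z| `^ P * (\1_(above w k') z * \1_(obox a' b') z) <= cc * V z.
 rewrite !indicE; case: (boolP (z \in above w k')); last by rewrite mul0r mulr0 mulr_ge0 ?powR_ge0.
 case: (boolP (z \in obox a' b')); last by rewrite !mulr0 mulr_ge0 ?powR_ge0.
 rewrite !inE => zQ kw; rewrite !mulr1 /V.
 have c0z : c0 <= ze s z.
  apply: tens_cutf_ge => // o; have := zQ o; rewrite /= in_itv/= => /andP[h1 h2].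
  by rewrite (le_trans (aa o) (ltW h1)) (le_trans (ltW h2) (bb o)).
 have wk : kap < w z by exact: lt_trans kw.
 have Tz : c0 * (w z - kap) <= wtrunc kap s z.
  rewrite /wtrunc /ppart max_l ?subr_ge0 ?(ltW wk)// mulrC ler_wpM2l// subr_ge0 ltW//.
 rewrite indicE mem_set ?mulr1; last first.
  by rewrite /=; apply: lt_le_trans Tz; rewrite ltr_pM2l// ltrD2r.
 rewrite /cc -(powRM _ _ (T0 z)) ?divr_ge0 ?(ltW c00) ?(ltW d0) ?(ltW k'0)//.
 have K1 : 0 <= k' / (k' - kap) / c0 by rewrite !divr_ge0 ?(ltW c00) ?(ltW d0) ?(ltW k'0).
 apply: ge0_ler_powR; [exact: ltW P0|by rewrite nnegrE|by rewrite nnegrE; exact: mulr_ge0 K1 (T0 z)|].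
 rewrite gtr0_norm ?(lt_trans k'0 kw)//.
 (* For [w > k'] one has [w <= k' (w - kap) / (k' - kap)], since the difference of the two sides has
    the sign of [kap (w - k')]. *)
 apply: (letr (k' / (k' - kap) / c0 * (c0 * (w z - kap)))); last first.
  by rewrite ler_wpM2l// !mulr_ge0// ?invr_ge0 ltW.
 have -> : k' / (k' - kap) / c0 * (c0 * (w z - kap)) = k' * (w z - kap) / (k' - kap).
  by field; rewrite !gt_eqF.
 rewrite ler_pdivlMr// -subr_ge0.
 have -> : k' * (w z - kap) - w z * (k' - kap) = kap * (w z - k') by ring.
 by rewrite mulr_ge0 ?subr_ge0 ?(ltW kw)// ltW// (lt_trans k0).
apply: le_II => //; last exact: itgZ.
apply: (itg_dom _ _ (itgZ cc iV)) => [|z].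
 apply: mfunM; first by apply: (mpowR P); exact: mcomp.
 by apply: mfunM; apply: mindic; [exact: mset_gt|exact: mset_obox].
by rewrite ger0_norm ?le// !mulr_ge0 ?powR_ge0.
Qed.

End levels.
End step.
End energy_estimates.

(** * The exponents of the iteration and their scaling *)

Section exponents.
Context {R : realType} (N : nat).
Variables (p q P sig : R).
Hypotheses (N0 : (0 < N)%N) (p1 : 1 < p) (q1 : 1 < q) (PE : P = Num.max q p)
 (sig1 : (N%:R + p) / p < sig) (hD : N%:R * q / (N%:R + q) < p).

Notation n := (N%:R : R).
Let n0 : 0 < n. Proof. by rewrite ltr0n. Qed.
Let p0 : 0 < p := lt_trans ltr01 p1.
Let q0 : 0 < q := lt_trans ltr01 q1.

(** The denominator of the first exponent of the estimate; its positivity is again the lower bound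
    on [p]. Below, [beta] is the power of the energy in the weak-type bound and [s] is
    [1 / sigma']. *)
Definition dg_D : R := p * (n + q) - n * P.
Definition dg_beta : R := 1 + p / n.
Definition dg_s : R := 1 - sig^-1.
(** Fixed by [dg_expA]: a source of norm [k^X] times [k] times the power [s] of the measure of a
    superlevel set must scale in [k] like the energy, that is like [k^(D/p)]. *)
Definition dg_X : R := P - 1 + (dg_D / p - P) / sig.
Notation D := dg_D.
Notation beta := dg_beta.
Notation s := dg_s.
Notation X := dg_X.
Notation m := (weak_exp N p q).

Let sig0 : 1 < sig.
Proof. by apply: lt_trans sig1; rewrite ltr_pdivlMr// mul1r ltrDr. Qed.

Let sn0 : sig != 0. Proof. by rewrite gt_eqF// (lt_trans ltr01). Qed.

Lemma dg_sE : (sigc sig)^-1 = s.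
Proof. by rewrite /sigc invf_div /dg_s mulrBl divff// mul1r. Qed.

Lemma dg_s01 : 0 < s < 1.
Proof.
rewrite /dg_s subr_gt0 invf_lt1 ?(lt_trans ltr01)// sig0/=.
by rewrite ltrBlDr ltrDl invr_gt0 (lt_trans ltr01).
Qed.

Lemma dg_D_gt0 : 0 < D.
Proof.
rewrite /dg_D subr_gt0 PE maxr_pMr ?(ltW n0)// gt_max; apply/andP; split.
 by rewrite -ltr_pdivrMr// addr_gt0.
by rewrite mulrC ltr_pM2l// ltrDl.
Qed.

Lemma dg_expA : X + 1 + s * (- P + D / p) = D / p.
Proof. by rewrite /dg_X /dg_s; field; rewrite sn0 gt_eqF. Qed.

Lemma dg_expC : beta * (D / p) + (P - m) = D / p.
Proof. by rewrite /dg_beta /dg_D /weak_exp; field; rewrite !gt_eqF. Qed.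

Lemma dg_expB : X + (D / p * beta * s + (1 - m * s)) = D / p.
Proof.
rewrite (_ : D / p * beta = D / p - P + m); first by rewrite -[RHS]dg_expA; ring.
by have := dg_expC; rewrite mulrC; move: (D / p * beta) (D / p) => u v; lra.
Qed.

Lemma dg_sn : n <= s * (n + p).
Proof.
have h : sig^-1 * (n + p) <= p.
 rewrite mulrC ler_pdivrMr ?(lt_trans ltr01)// mulrC -ler_pdivrMr//; exact: ltW.
by rewrite /dg_s mulrBl mul1r; move: h; move: (_ * _) => u; lra.
Qed.

Lemma dg_beta_s : 1 < beta * s.
Proof.
rewrite -ltr_pdivrMr; last by have /andP[] := dg_s01.
by rewrite mul1r -dg_sE invrK; exact: sigc_lt.
Qed.

Lemma dg_beta_m : beta < m.
Proof.
rewrite /dg_beta /weak_exp; apply: ltrD => //.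
by rewrite ltr_pM2r ?invr_gt0// ltr_pMr.
Qed.

(** The natural unit of the energy at level [k] and scale [R0]. The mass has the unit [U * R0^p],
    because the energy contains [gam^(-p)] times it. *)
Definition dg_U (k R0 : R) : R := k `^ (D / p) * R0 `^ n.
Notation U := dg_U.

Section scaling.
Variables (k R0 : R).
Hypotheses (k0 : 0 < k) (R00 : 0 < R0) (R01 : R0 <= 1).

Lemma dg_U_gt0 : 0 < U k R0. Proof. by rewrite mulr_gt0// powR_gt0. Qed.

Let R0W u v : v <= u -> 0 < v -> R0 `^ u <= R0 `^ v.
Proof. by move=> vu v0; apply: powR_le1W => //; rewrite (ltW R00). Qed.

Let kD u v : k `^ (u + v) = k `^ u * k `^ v.
Proof. by rewrite powRD// (gt_eqF k0) implybT. Qed.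

Let RD u v : R0 `^ (u + v) = R0 `^ u * R0 `^ v.
Proof. by rewrite powRD// (gt_eqF R00) implybT. Qed.

(** In this and the next two lemmas the powers of [k] match exactly by [dg_expA], [dg_expB] and
    [dg_expC]; surplus powers of [R0] are dropped because [R0 <= 1]. *)
Lemma dg_idA : k `^ X * k * (k `^ (- P) * (U k R0 * R0 `^ p)) `^ s <= U k R0.
Proof.
rewrite -[X in _ * X * _](powRr1 (ltW k0)) /dg_U.
have -> : k `^ (- P) * (k `^ (D / p) * R0 `^ n * R0 `^ p) = k `^ (- P + D / p) * R0 `^ (n + p).
 by rewrite kD RD; ring.
rewrite powRM ?powR_ge0// -!powRrM mulrA -!kD mulrC (mulrC (- P + _)) dg_expA mulrC.
rewrite ler_wpM2l ?powR_ge0//; apply: R0W => //; rewrite mulrC; exact: dg_sn.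
Qed.

Lemma dg_idB : k `^ X * (U k R0 `^ beta) `^ s * k `^ (1 - m * s) <= U k R0.
Proof.
rewrite -powRrM /dg_U powRM ?powR_ge0// -!powRrM.
rewrite [X in X <= _](_ : _ = k `^ (X + (D / p * beta * s + (1 - m * s))) * R0 `^ (n * (beta * s))).
 rewrite dg_expB ler_wpM2l ?powR_ge0//; apply: R0W => //.
 by rewrite ler_peMr ?(ltW n0)// ltW// dg_beta_s.
by rewrite -(mulrA (D / p)) !kD; ring.
Qed.

Lemma dg_idC : U k R0 `^ beta * k `^ (P - m) = U k R0 * R0 `^ p.
Proof.
rewrite /dg_U powRM ?powR_ge0// -!powRrM mulrAC -kD mulrC (mulrC (D / p)) dg_expC.
rewrite (_ : n * beta = n + p) ?RD; first by ring.
by rewrite /dg_beta; field; rewrite gt_eqF.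
Qed.

End scaling.
End exponents.

(** * Absorption and fast decay *)

Section recursion.
Context {R : realType}.

Lemma exprn_powR (a r : R) j : 0 <= a -> (a ^+ j) `^ r = (a `^ r) ^+ j.
Proof.
move=> a0; elim: j => [|j IH]; first by rewrite !expr0 powR1.
by rewrite !exprS powRM ?exprn_ge0// IH.
Qed.

(** The unknown [F] occurs on the right with the power [bs > 1]. The free parameter [l] is chosen so
    that this term becomes [F / 2]; the price is a factor [1 + l] that grows like [F^th] with
    [th <= 1], and the smallness hypothesis excludes that [F] is large. *)
Lemma absorb (K y F s bs ms : R) : 1 <= K -> 0 < F -> 0 <= y <= 1 -> 0 < s <= 1 ->
 1 < bs -> bs < ms ->
 (forall l, 0 < l -> F <= K * (y + (1 + l) * y `^ s + l `^ (1 - ms) * F `^ bs)) ->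
 let K' := 2 * K * (2 + (2 * K) `^ (ms - 1)^-1) in
 K' * y `^ s < 1 -> F <= K' * y `^ s.
Proof.
move=> K1 F0 /andP[y0 y1] /andP[s0 s1] bs1 bsm h K' small.
have ms0 : 0 < ms - 1 by rewrite subr_gt0 (lt_trans bs1).
have K0 : 0 < 2 * K by rewrite mulr_gt0// (lt_le_trans ltr01).
pose mu := (ms - 1)^-1; have mu0 : 0 < mu by rewrite invr_gt0.
pose th := (bs - 1) * mu.
have th1 : th <= 1 by rewrite ler_pdivrMr// mul1r lerD2r ltW.
have th0 : 0 <= th by rewrite mulr_ge0 ?subr_ge0// ltW.
(* Solves [K * l^(1 - ms) * F^bs = F / 2]. *)
pose l := (2 * K * F `^ (bs - 1)) `^ mu.
have KF0 : 0 < 2 * K * F `^ (bs - 1) by rewrite mulr_gt0// powR_gt0.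
have l0 : 0 < l by rewrite powR_gt0.
have lE : l `^ (1 - ms) = (2 * K)^-1 * F `^ (1 - bs).
 rewrite /l -powRrM (_ : mu * (1 - ms) = - 1); last by rewrite /mu; field; rewrite gt_eqF.
 rewrite powR_inv1 ?(ltW KF0)// invfM; congr (_ * _).
 by rewrite -powRN opprB.
have lE' : l = (2 * K) `^ mu * F `^ th by rewrite /l powRM ?(ltW K0) ?powR_ge0// -powRrM.
have := h l l0; rewrite lE -mulrA -powRD; last by rewrite (gt_eqF F0) implybT.
rewrite subrK powRr1 ?(ltW F0)// => h1.
have yy : y <= y `^ s.
 rewrite -[leLHS](powRr1 y0); apply: powR_le1W => //; by rewrite y0.
have h2 : F <= 2 * K * ((2 + l) * y `^ s).
 have e : K * (y + (1 + l) * y `^ s + (2 * K)^-1 * F) = K * (y + (1 + l) * y `^ s) + F / 2.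
  by rewrite [LHS]mulrDr; congr (_ + _); field; rewrite gt_eqF// (lt_le_trans ltr01).
 rewrite e in h1.
 have h3 : K * (y + (1 + l) * y `^ s) <= K * ((2 + l) * y `^ s).
  rewrite ler_wpM2l ?(le_trans ler01 K1)//.
  have -> : (2 + l) * y `^ s = y `^ s + (1 + l) * y `^ s by ring.
  by rewrite lerD2r.
 rewrite -mulrA; move: h1 h3; set u := K * _; set v := K * _; clear; lra.
have [F1|F1] := leP F 1.
 apply: (le_trans h2); rewrite mulrA ler_wpM2r ?powR_ge0// ler_wpM2l ?(ltW K0)//.
 rewrite lerD2l lE' -/mu ler_piMr ?powR_ge0//.
 apply: (letr (1 `^ th)); last by rewrite powR1.
 by powR_mono; rewrite ?(ltW F0).
have Fth : F `^ th <= F.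
 by rewrite -[leRHS](powRr1 (ltW F0)) ler_powR// ltW.
have Fth1 : 1 <= F `^ th.
 by rewrite -[leLHS](powRr0 F) ler_powR// ltW.
(* For [F > 1] the bound [F^th <= F] would give [F <= K' y^s F < F], a contradiction. *)
suff : F <= K' * y `^ s * F.
 move=> h4; have : F < F by apply: (le_lt_trans h4); rewrite gtr_pMl.
 by rewrite ltxx.
apply: (le_trans h2); rewrite mulrA [leRHS]mulrAC ler_wpM2r ?powR_ge0// /K' -[leRHS]mulrA.
rewrite ler_wpM2l ?(ltW K0)// mulrDl lE' -/mu; apply: lerD.
 by rewrite ler_peMr// ltW.
by rewrite ler_wpM2l ?powR_ge0.
Qed.

(** Geometric decay for a superlinear recursion. The recursion is granted only while [y j] is small,
    so [eps] must also ensure this smallness at every step; the induction carries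
    [y j <= eps lam^j]. *)
Lemma fast_decay (K b s e0 : R) : 1 <= K -> 1 <= b -> 0 < s -> 0 < e0 ->
 exists2 eps, 0 < eps & forall y : nat -> R, (forall j, 0 <= y j) -> y 0%N <= eps ->
 (forall j, y j <= 1 -> K * b ^+ j * y j `^ s < 1 -> y j.+1 <= K * b ^+ j * y j `^ (1 + e0)) ->
 exists2 lam, 0 < lam < 1 & forall j, y j <= lam ^+ j.
Proof.
move=> K1 b1 s0 e00.
have K0 : 0 < K by exact: lt_le_trans K1.
pose b' := 2 * b; have b'1 : 1 < b' by rewrite /b'; lra.
have b'0 : 0 < b' by exact: lt_trans b'1.
pose e := Num.min s e0; have ep : 0 < e by rewrite lt_min s0.
have es : e <= s by rewrite ge_min lexx.
have ee : e <= e0 by rewrite ge_min lexx orbT.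
(* With [b' = 2 b] this gives [b lam^e = 1/2], so [lam^j] compensates the growth [b^j]. The smaller
   exponent [e] of [s] and [e0] serves both the smallness condition and the decay. *)
pose lam := b' `^ (- e^-1).
have lam0 : 0 < lam by rewrite powR_gt0.
have lame : lam `^ e = b'^-1.
 by rewrite /lam -powRrM mulNr mulVf ?gt_eqF// powR_inv1// ltW.
have lam1 : lam < 1.
 rewrite /lam powRN invf_lt1 ?powR_gt0// -[ltLHS](powRr0 b').
 by rewrite /powR (gt_eqF b'0) ltr_expR ltr_pM2r ?ln_gt0// invr_gt0.
have lamW r : e <= r -> b * lam `^ r <= 1.
 move=> er; apply: (letr (b' * lam `^ e)); last by rewrite lame divff// gt_eqF.
 apply: ler_pM; rewrite ?powR_ge0 ?(le_trans ler01 b1)//; first by rewrite /b'; lra.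
 by apply: powR_le1W => //; rewrite (ltW lam0) ltW.
pose eps := (lam / (2 * K)) `^ e^-1.
have lk0 : 0 < lam / (2 * K) by rewrite divr_gt0// mulr_gt0.
have lk1 : lam / (2 * K) < 1.
 by rewrite ltr_pdivrMr ?mulr_gt0// mul1r (lt_le_trans lam1)//; lra.
have eps0 : 0 < eps by rewrite powR_gt0.
have eps1 : eps <= 1.
 apply: (letr (1 `^ e^-1)); last by rewrite powR1.
 by powR_mono; rewrite ?invr_ge0 ?(ltW ep) ?(ltW lk0) ?(ltW lk1).
have epsW r : e <= r -> K * eps `^ r <= lam / 2.
 move=> er; apply: (letr (K * eps `^ e)).
  by rewrite ler_wpM2l ?(ltW K0)//; apply: powR_le1W => //; rewrite ltW.
 rewrite /eps -powRrM mulVf ?gt_eqF// powRr1 ?(ltW lk0)//.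
 by apply: le_of_eq; field; rewrite gt_eqF.
exists eps => // y y0 y0e rec; exists lam; first by rewrite lam0.
suff key j : y j <= eps * lam ^+ j.
 by move=> j; apply: (le_trans (key j)); rewrite ler_piMl// exprn_ge0// ltW.
have lj i : 0 <= lam ^+ i by rewrite exprn_ge0// ltW.
have lj1 i : lam ^+ i <= 1 by rewrite exprn_ile1// ltW.
elim: j => [|j IH]; first by rewrite expr0 mulr1.
have bnd r : e <= r -> K * b ^+ j * (eps * lam ^+ j) `^ r <= lam / 2.
 move=> er; have ljr : (lam ^+ j) `^ r = (lam `^ r) ^+ j.
  exact: exprn_powR (ltW lam0).
 rewrite powRM ?(ltW eps0)// ljr mulrACA -exprMn.
 apply: le_trans (epsW _ er); rewrite ler_piMr ?mulr_ge0 ?powR_ge0 ?(ltW K0)//.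
 rewrite exprn_ile1// ?lamW// mulr_ge0 ?powR_ge0//; exact: le_trans ler01 b1.
have yj r : e <= r -> K * b ^+ j * y j `^ r <= lam / 2.
 move=> er; apply: le_trans (bnd _ er).
 rewrite ler_wpM2l ?mulr_ge0 ?(ltW K0) ?exprn_ge0 ?(le_trans ler01 b1)//.
 by powR_mono; rewrite ?mulr_ge0 ?(ltW eps0) ?(le_trans (ltW ep) er).
have l2 : lam / 2 < 1 by lra.
have := rec j _ (le_lt_trans (yj _ es) l2).
move=> /(_ (le_trans IH (mulr_ile1 (ltW eps0) (lj j) eps1 (lj1 j)))) h.
apply: (le_trans h); have [->|yn] := eqVneq (y j) 0.
 by rewrite powR0 ?mulr0 ?mulr_ge0 ?(ltW eps0)// gt_eqF// addr_gt0.
rewrite addrC powRD; last by rewrite yn implybT.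
rewrite powRr1// mulrA exprS; apply: (letr (lam / 2 * (eps * lam ^+ j))).
 by apply: ler_pM => //; [rewrite !mulr_ge0 ?powR_ge0 ?exprn_ge0 ?(ltW K0) ?(le_trans ler01 b1)|exact: yj].
apply: (letr (lam * (eps * lam ^+ j))); last by rewrite mulrCA.
by rewrite ler_wpM2r ?mulr_ge0 ?(ltW eps0)//; lra.
Qed.

End recursion.

Lemma powRN_half (R : realType) (k kj P : R) : 0 < P -> 0 < k -> k / 2 <= kj ->
 kj `^ (- P) <= 2 `^ P * k `^ (- P).
Proof.
move=> P0 k0 h; have kj0 : 0 < kj by apply: lt_le_trans h; rewrite divr_gt0.
rewrite !powRN ler_pdivlMr ?powR_gt0// mulrC ler_pdivrMr ?powR_gt0//.
rewrite -powRM ?(ltW kj0)//; powR_mono; rewrite ?mulr_ge0 ?(ltW kj0) ?(ltW k0) ?(ltW P0)//.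
by rewrite mulrC -ler_pdivrMr.
Qed.

Lemma sum3_ge (R : realType) (a b c : R) : 0 <= a -> 0 <= b -> 0 <= c ->
 [/\ a <= a + b + c + 1, b <= a + b + c + 1 & c <= a + b + c + 1].
Proof. by move=> *; split; lra. Qed.

(** * One step of the iteration in normalised quantities *)

Section scalar_step.
Context {R : realType} (N : nat).
Variables (p q P sig C dmax : R).
Hypotheses (N0 : (0 < N)%N) (p1 : 1 < p) (q1 : 1 < q) (PE : P = Num.max q p)
 (sig1 : (N%:R + p) / p < sig) (hD : N%:R * q / (N%:R + q) < p) (C0 : 0 < C).
Notation n := (N%:R : R).
Notation D := (dg_D N p q P).
Notation beta := (dg_beta N p).
Notation s := (dg_s sig).
Notation X := (dg_X N p q P sig).
Notation m := (weak_exp N p q).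
Notation U := (dg_U N p q P).
Let n0 : 0 < n. Proof. by rewrite ltr0n. Qed.
Let p0 : 0 < p := lt_trans ltr01 p1.
Let q0 : 0 < q := lt_trans ltr01 q1.
Let P0 : 0 < P. Proof. by rewrite PE lt_max p0 orbT. Qed.
Let beta0 : 0 < beta. Proof. by rewrite addr_gt0// divr_gt0. Qed.
Let s01 := dg_s01 N0 p1 sig1.
Let s0 : 0 < s. Proof. by have /andP[] := s01. Qed.

Definition dg_c0 : R := expR (- 2 * Num.max 1 (p / q)) ^+ #|{: option 'I_N}|.
Definition dg_K1 : R := sobolevC N p q * (C * 64) `^ (p / n) * @gamC R N p P C dmax.
Definition dg_K2 : R := 2 `^ p + 2 * 2 `^ P + 2 * (layerC m (sigc sig) * dg_K1) `^ s + 1.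
Definition dg_K4 : R := (8 / dg_c0) `^ P * (layerC m P * dg_K1 * (dg_c0 / 8) `^ (P - m)).
Notation c0 := dg_c0.
Notation K1 := dg_K1.
Notation K2 := dg_K2.
Notation K4 := dg_K4.

Let c00 : 0 < c0. Proof. by rewrite exprn_gt0// expR_gt0. Qed.

Let sobC0 : 0 <= sobolevC N p q.
Proof. by rewrite /sobolevC !mulr_ge0 ?powR_ge0. Qed.

Let gamC0 : 0 <= @gamC R N p P C dmax.
Proof.
by rewrite /gamC mulr_ge0// addr_ge0// mulr_ge0 ?powR_ge0 ?(ltW C0)// addr_ge0// ?mulr_ge0 ?powR_ge0.
Qed.

Let K10 : 0 <= K1. Proof. exact: mulr_ge0 (mulr_ge0 sobC0 (powR_ge0 _ _)) gamC0. Qed.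
Let lC0 : 0 <= layerC m (sigc sig).
Proof. by apply: layerC_ge0; exact: sigc_lt_weak. Qed.
Let lCP0 : 0 <= layerC m P.
Proof. by apply: layerC_ge0; exact: (P_lt_weak N0 p1 q1 PE hD). Qed.

Section one_step.
Variables (k R0 t kj Y Isrc fn : R).
Hypotheses (k1 : 1 <= k) (R01 : 0 < R0 <= 1) (t1 : 1 <= t) (kj1 : k / 2 <= kj)
 (kj2 : kj + k / (8 * t) <= k) (Y0 : 0 <= Y) (fn0 : 0 <= fn) (fnk : fn <= k `^ X).
Notation Phi := ((R0 / (2 * t)) `^ (- p) * Y + Isrc).
Hypothesis Phi0 : 0 < Phi.
Notation d := (k / (8 * t)).
Notation kap := (kj + d).
Notation UU := (U k R0).
Notation M := (sobolevC N p q * (C * (1 - kj / kap) ^- 2 * Phi) `^ (p / n) * (@gamC R N p P C dmax * Phi)).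
Notation y := (Y / (UU * R0 `^ p)).
Notation F := (Phi / UU).
Notation sc := (sigc sig).

Let k0 : 0 < k. Proof. exact: lt_le_trans k1. Qed.
Let R00 : 0 < R0. Proof. by have /andP[] := R01. Qed.
Let R0l : R0 <= 1. Proof. by have /andP[] := R01. Qed.
Let t0 : 0 < t. Proof. exact: lt_le_trans t1. Qed.
Let d0 : 0 < d. Proof. by rewrite divr_gt0// mulr_gt0. Qed.
Let kj0 : 0 < kj. Proof. by apply: lt_le_trans kj1; rewrite divr_gt0. Qed.
Let kap0 : 0 < kap. Proof. by rewrite addr_gt0. Qed.
Let U0 : 0 < UU. Proof. exact: dg_U_gt0. Qed.
Let R0p : 0 < R0 `^ p. Proof. by rewrite powR_gt0. Qed.
Let F0 : 0 < F. Proof. by rewrite divr_gt0. Qed.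
Let y0 : 0 <= y. Proof. by rewrite divr_ge0// ltW// mulr_gt0. Qed.
Let PhiE : Phi = F * UU. Proof. by rewrite divfK// gt_eqF. Qed.
Let YE : Y = y * (UU * R0 `^ p). Proof. by rewrite divfK// gt_eqF// mulr_gt0. Qed.

Let M0 : 0 <= M.
Proof. exact: mulr_ge0 (mulr_ge0 sobC0 (powR_ge0 _ _)) (mulr_ge0 gamC0 (ltW Phi0)). Qed.

(** Since [kap <= k], the quotient [1 - kj / kap = d / kap] is at least [1 / (8 t)]; its inverse
    square is the origin of the constant 64 and of the factor [t^(2p/n)]. *)
Lemma step_M : M <= K1 * t `^ (2 * p / n) * Phi `^ beta.
Proof.
have h : 1 - kj / kap = d / kap.
 by rewrite -[X in X - _](divff (lt0r_neq0 kap0)) -mulrBl [X in X / _]addrAC subrr add0r.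
have h1 : (1 - kj / kap) ^- 2 <= 64 * t ^+ 2.
 rewrite h -exprVn invf_div (_ : 64 * t ^+ 2 = (8 * t) ^+ 2); last by ring.
 rewrite ler_pXn2r ?nnegrE ?(divr_ge0 (ltW kap0) (ltW d0)) ?(mulr_ge0 _ (ltW t0))//.
 by rewrite ler_pdivrMr// mulrCA divff ?mulr1// gt_eqF// mulr_gt0.
have h2 : (C * (1 - kj / kap) ^- 2 * Phi) `^ (p / n) <= (C * 64) `^ (p / n) * t `^ (2 * p / n) * Phi `^ (p / n).
 rewrite (_ : 2 * p / n = 2%:R * (p / n)); last by rewrite mulrA.
 rewrite [t `^ _]powRrM powR_mulrn ?(ltW t0)// -!powRM ?mulr_ge0 ?exprn_ge0 ?(ltW C0) ?(ltW t0) ?(ltW Phi0)//.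
 powR_mono; rewrite ?divr_ge0 ?mulr_ge0 ?invr_ge0 ?exprn_ge0 ?(ltW C0) ?(ltW t0) ?(ltW Phi0) ?(ltW p0) ?(ltW n0)//.
  by rewrite h divr_ge0 ?(ltW d0) ?(ltW kap0).
 apply: ler_wpM2r; first exact: ltW.
 rewrite -[leRHS](mulrA C 64); exact: (ler_wpM2l (ltW C0) h1).
have pb (x : R) : 0 < x -> x `^ beta = x `^ (p / n) * x.
 move=> x0; rewrite /dg_beta addrC powRD; last by rewrite (gt_eqF x0) implybT.
 by rewrite powRr1 ?(ltW x0).
rewrite (pb _ Phi0).
set G := @gamC R N p P C dmax.
rewrite (_ : K1 * _ * _ = sobolevC N p q * ((C * 64) `^ (p / n) * t `^ (2 * p / n) * Phi `^ (p / n)) * (G * Phi)); last first.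
 by rewrite /dg_K1 -/G; ring.
apply: ler_wpM2r; first exact: mulr_ge0 gamC0 (ltW Phi0).
exact: ler_wpM2l sobC0 _ _ h2.
Qed.

(** [dg_idC] cancels all powers of [k] and [R0]: in its own unit, the next mass is bounded by the
    power [beta] of the normalised energy, up to powers of [t]. *)
Lemma step_mass Y' k' : k' = kap + d -> k' <= k ->
 Y' <= (k' / (k' - kap) / c0) `^ P * (layerC m P * M * (c0 * (k' - kap)) `^ (P - m)) ->
 Y' / (UU * R0 `^ p) <= K4 * t `^ (m + 2 * p / n) * F `^ beta.
Proof.
have kd : kap + d - kap = d by rewrite [LHS]addrAC subrr add0r.
move=> -> k'k; rewrite kd => h.
rewrite ler_pdivrMr ?(mulr_gt0 U0 R0p)//.
apply: (le_trans h).
have a1 : ((kap + d) / d / c0) `^ P <= (8 / c0) `^ P * t `^ P.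
 rewrite -powRM ?divr_ge0 ?(ltW c00) ?(ltW t0)//.
 powR_mono; rewrite ?divr_ge0 ?mulr_ge0 ?invr_ge0 ?addr_ge0 ?(ltW P0) ?(ltW kap0) ?(ltW kj0) ?(ltW d0) ?(ltW c00) ?(ltW t0) ?(ltW k0)//.
 rewrite [leRHS]mulrAC ler_wpM2r ?invr_ge0 ?(ltW c00)// ler_pdivrMr//.
 by rewrite mulrCA divff ?mulr1// gt_eqF// mulr_gt0.
have a2 : (c0 * d) `^ (P - m) = (c0 / 8) `^ (P - m) * (k `^ (P - m) * t `^ (m - P)).
 have -> : c0 * d = c0 / 8 * (k * t^-1) by field; rewrite gt_eqF.
 rewrite powRM ?mulr_ge0 ?invr_ge0 ?(ltW c00) ?(ltW k0) ?(ltW t0)//; congr (_ * _).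
 rewrite powRM ?invr_ge0 ?(ltW k0) ?(ltW t0)//; congr (_ * _).
 by rewrite -[t^-1]powR_inv1 ?(ltW t0)// -powRrM mulN1r opprB.
have a3 : Phi `^ beta * k `^ (P - m) = F `^ beta * (UU * R0 `^ p).
 rewrite {1}PhiE powRM ?(ltW F0) ?(ltW U0)// -mulrA.
 by rewrite (dg_idC q P N0 p1 k0 R00).
apply: (letr ((8 / c0) `^ P * t `^ P *
  (layerC m P * (K1 * t `^ (2 * p / n) * Phi `^ beta) * (c0 * d) `^ (P - m)))).
 apply: ler_pM => //; rewrite ?powR_ge0//.
  by apply: mulr_ge0 (powR_ge0 _ _); exact: mulr_ge0 lCP0 M0.
 apply: ler_wpM2r; first exact: powR_ge0.
 by apply: ler_wpM2l => //; exact: step_M.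
rewrite a2; apply: le_of_eq.
have tE : t `^ (m + 2 * p / n) = t `^ P * (t `^ (2 * p / n) * t `^ (m - P)).
 rewrite -!powRD ?(gt_eqF t0) ?implybT//; congr (_ `^ _); ring.
rewrite tE -[RHS]mulrA -a3 /dg_K4.
move: ((8 / c0) `^ P) (t `^ P) (layerC m P) K1 (t `^ (2 * p / n)) (Phi `^ beta)
 ((c0 / 8) `^ (P - m)) (k `^ (P - m)) (t `^ (m - P)) => x1 x2 x3 x4 x5 x6 x7 x8 x9; ring.
Qed.

(** The splitting level is taken to be [L = k * l]. Then [dg_idA] and [dg_idB] remove the powers of
    [k], and the dimensionless [l] is left for [absorb]. *)
Lemma step_source :
 (forall L, 0 < L -> Isrc <= fn * ((L `^ sc * (kj `^ (- P) * Y) + layerC m sc * M * L `^ (sc - m)) `^ sc^-1 +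
 (kap - kj) * (kj `^ (- P) * Y) `^ sc^-1)) ->
 forall l, 0 < l -> F <= K2 * t `^ (p + 2 * p / n) *
  (y + (1 + l) * y `^ s + l `^ (1 - m * s) * F `^ (beta * s)).
Proof.
move=> h l l0; have L0 : 0 < k * l by rewrite mulr_gt0.
have kd : kap - kj = d by rewrite [LHS]addrAC subrr add0r.
have {}h := h _ L0; rewrite kd !(dg_sE N0 p1 sig1) in h.
have scs : sc * s = 1.
 have sg1 : 1 < sig.
  by apply: lt_trans sig1; rewrite ltr_pdivlMr// mul1r ltrDr.
 by rewrite -(dg_sE N0 p1 sig1) divff// gt_eqF// divr_gt0 ?subr_gt0// (lt_trans ltr01).
set G := k `^ (- P) * Y; have G0 : 0 <= G by rewrite mulr_ge0 ?powR_ge0.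
have P2 : 1 <= 2 `^ P :> R by rewrite -[leLHS](powRr0 2) ler_powR ?ler1n// ltW.
have P2s : (2 `^ P) `^ s <= 2 `^ P :> R.
 by rewrite -[leRHS](powRr1 (powR_ge0 _ _)) ler_powR//; have /andP[_ /ltW] := s01.
have BG : kj `^ (- P) * Y <= 2 `^ P * G.
 by rewrite mulrA ler_wpM2r//; exact: powRN_half.
have dk : d <= k.
 rewrite ler_pdivrMr ?mulr_gt0// ler_peMr ?(ltW k0)//.
 by apply: le_trans t1 _; rewrite ler_peMl ?(ltW t0)// ler1n.
have s1 : s <= 1 by have /andP[_ /ltW] := s01.
have Gs : k `^ X * k * G `^ s <= y `^ s * UU.
 rewrite /G {1}YE (_ : _ * (y * _) = y * (k `^ (- P) * (UU * R0 `^ p))); last by rewrite mulrCA.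
 have B0 : 0 <= k `^ (- P) * (UU * R0 `^ p) by rewrite !mulr_ge0 ?powR_ge0 ?(ltW U0).
 rewrite (powRM _ y0 B0) mulrCA ler_wpM2l ?powR_ge0//.
 exact: dg_idA.
set H := layerC m sc * K1.
have H0 : 0 <= H by exact: mulr_ge0.
pose T := t `^ (2 * p / n); have T0 : 0 <= T by exact: powR_ge0.
have Ls : ((k * l) `^ sc * (2 `^ P * G)) `^ s <= k * l * (2 `^ P * G `^ s).
 rewrite powRM ?mulr_ge0 ?powR_ge0// -powRrM scs powRr1 ?(ltW L0)//.
 by rewrite ler_wpM2l ?(ltW L0)// powRM ?powR_ge0// ler_wpM2r ?powR_ge0.
have Ms : (H * T * Phi `^ beta * (k * l) `^ (sc - m)) `^ s =
  H `^ s * T `^ s * ((F `^ (beta * s) * l `^ (1 - m * s)) * ((UU `^ beta) `^ s * k `^ (1 - m * s))).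
 have e1 : ((k * l) `^ (sc - m)) `^ s = k `^ (1 - m * s) * l `^ (1 - m * s).
  by rewrite -powRrM mulrBl scs powRM ?(ltW k0) ?(ltW l0).
 have e2 : (Phi `^ beta) `^ s = F `^ (beta * s) * (UU `^ beta) `^ s.
  by rewrite {1}PhiE (powRM _ (ltW F0) (ltW U0)) powRM ?powR_ge0// -powRrM.
 have e3 (a b c d' : R) : 0 <= a -> 0 <= b -> 0 <= c -> 0 <= d' ->
   (a * b * c * d') `^ s = a `^ s * b `^ s * c `^ s * d' `^ s.
  by move=> *; rewrite !powRM ?mulr_ge0.
 rewrite (e3 _ _ _ _ H0 T0 (powR_ge0 _ _) (powR_ge0 _ _)) e1 e2.
 move: (H `^ s) (T `^ s) (F `^ (beta * s)) ((UU `^ beta) `^ s) (k `^ (1 - m * s)) (l `^ (1 - m * s)).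
 by move=> x1 x2 x3 x4 x5 x6; ring.
pose A1 := (k * l) `^ sc * (2 `^ P * G).
pose A2 := H * T * Phi `^ beta * (k * l) `^ (sc - m).
have A1p : 0 <= A1 by rewrite !mulr_ge0 ?powR_ge0.
have A2p : 0 <= A2 by exact: mulr_ge0 (mulr_ge0 (mulr_ge0 H0 T0) (powR_ge0 _ _)) (powR_ge0 _ _).
have As : ((k * l) `^ sc * (kj `^ (- P) * Y) + layerC m sc * M * (k * l) `^ (sc - m)) `^ s <=
  2 * (k * l * (2 `^ P * G `^ s) + A2 `^ s).
 apply: (letr ((A1 + A2) `^ s)).
  powR_mono; rewrite ?(ltW s0) ?addr_ge0//.
  - by rewrite !mulr_ge0 ?powR_ge0.
  - by apply: mulr_ge0; [exact: mulr_ge0|exact: powR_ge0].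
  apply: lerD; first by rewrite ler_wpM2l ?powR_ge0.
  rewrite /A2; apply: ler_wpM2r; first exact: powR_ge0.
  rewrite (_ : H * T * _ = layerC m sc * (K1 * T * Phi `^ beta)); last first.
   by rewrite /H -!(mulrA (layerC m sc)).
  exact: ler_wpM2l lC0 _ _ step_M.
 have gen (u v x : R) : 0 <= u -> 0 <= v -> u `^ s <= x -> (u + v) `^ s <= 2 * (x + v `^ s).
  move=> u0 v0 ux; apply: le_trans (powRD_le u0 v0 (ltW s0)) _.
  apply: (letr (2 * (u `^ s + v `^ s))).
   rewrite ler_wpM2r ?addr_ge0 ?powR_ge0//.
   by rewrite -[leRHS](@powRr1 _ 2)// ler_powR// ler1n.
  by rewrite ler_pM2l// lerD2r.
 exact: gen A1p A2p Ls.
have Bs : (kj `^ (- P) * Y) `^ s <= 2 `^ P * G `^ s.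
 apply: (letr ((2 `^ P * G) `^ s)).
  by powR_mono; rewrite ?mulr_ge0 ?powR_ge0 ?(ltW s0).
 by rewrite powRM ?powR_ge0// ler_wpM2r ?powR_ge0.
have hI : Isrc <= k `^ X * (2 * (k * l * (2 `^ P * G `^ s) + A2 `^ s) + k * (2 `^ P * G `^ s)).
 apply: (le_trans h).
 have gen (f x u u' a b v v' : R) : 0 <= f -> f <= x -> 0 <= u -> u <= u' -> 0 <= a -> a <= b ->
   0 <= v -> v <= v' -> f * (u + a * v) <= x * (u' + b * v').
  move=> *; apply: ler_pM => //; first by rewrite addr_ge0// mulr_ge0.
  by apply: lerD => //; apply: ler_pM.
 exact: (gen _ _ _ _ _ _ _ _ fn0 fnk (powR_ge0 _ _) As (ltW d0) dk (powR_ge0 _ _) Bs).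
clear As Bs Ls h.
set q1' := y `^ s; set q2 := F `^ (beta * s) * l `^ (1 - m * s).
have q1p : 0 <= q1' by exact: powR_ge0.
have q2p : 0 <= q2 by rewrite mulr_ge0 ?powR_ge0.
have hA2 : k `^ X * A2 `^ s <= H `^ s * T `^ s * q2 * UU.
 have r (x a b u v c : R) : x * (a * b * (u * (v * c))) = a * b * u * (x * v * c) by ring.
 rewrite {1}/A2 Ms -/q2 r; apply: ler_wpM2l; last exact: dg_idB.
 exact: mulr_ge0 (mulr_ge0 (powR_ge0 _ _) (powR_ge0 _ _)) q2p.
clear Ms; move: (A2 `^ s) hA2 hI => A2s hA2 hI.
have e1 : (R0 / (2 * t)) `^ (- p) * Y = (2 * t) `^ p * y * UU.
 have t2 : 0 <= 2 * t by rewrite mulr_ge0// ltW.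
 rewrite {1}YE powRM ?invr_ge0 ?(ltW R00)//.
 rewrite -[(2 * t)^-1]powR_inv1// -powRrM mulN1r opprK powRN.
 have Rn := lt0r_neq0 R0p; move: (R0 `^ p) Rn y ((2 * t) `^ p) => x xn v u.
 by field.
have e2 : Isrc <= ((2 * 2 `^ P * l + 2 `^ P) * q1' + 2 * (H `^ s * T `^ s * q2)) * UU.
 apply: (le_trans hI).
 have r (x a g b : R) : x * (2 * (k * l * (a * g) + b) + k * (a * g)) =
  (2 * a * l + a) * (x * k * g) + 2 * (x * b) by ring.
 rewrite r [leRHS]mulrDl; apply: lerD.
  rewrite -[leRHS]mulrA; apply: ler_wpM2l => //.
  by apply: addr_ge0; rewrite ?powR_ge0// mulr_ge0 ?(ltW l0)// mulr_ge0// powR_ge0.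
 by rewrite -[leRHS](mulrA 2); apply: ler_wpM2l.
have hF : F <= (2 * t) `^ p * y + ((2 * 2 `^ P * l + 2 `^ P) * q1' + 2 * (H `^ s * T `^ s * q2)).
 by rewrite ler_pdivrMr// e1 [leRHS]mulrDl lerD2l.
clear e1 e2 hI hA2.
apply: (le_trans hF).
have tp1 : 1 <= t `^ (2 * p / n).
 by rewrite -[leLHS](powRr0 t) ler_powR// divr_ge0 ?mulr_ge0 ?(ltW p0).
have tp2 : 1 <= t `^ p by rewrite -[leLHS](powRr0 t) ler_powR// ltW.
rewrite powRD; last by rewrite (gt_eqF t0) implybT.
rewrite -/T in tp1 *.
have TT : T `^ s <= t `^ p * T.
 apply: (letr T); last by rewrite ler_peMl.
 by rewrite -[leRHS](powRr1 T0) ler_powR.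
have tT : 1 <= t `^ p * T by rewrite mulr_ege1.
have tT2 : t `^ p <= t `^ p * T by rewrite ler_peMr ?powR_ge0.
set V := t `^ p * T in TT tT tT2 *.
have V0 : 0 <= V by exact: le_trans tT.
have Hs : 0 <= H `^ s by exact: powR_ge0.
have -> : K2 * V * (y + (1 + l) * q1' + l `^ (1 - m * s) * F `^ (beta * s)) =
 K2 * V * y + K2 * V * (1 + l) * q1' + K2 * V * q2 by rewrite /q2; ring.
have [K2a K2b K2c] : [/\ 2 `^ p <= K2, 2 * 2 `^ P <= K2 & 2 * H `^ s <= K2].
 by apply: sum3_ge; rewrite ?mulr_ge0 ?powR_ge0.
have K20 : 0 <= K2 by exact: le_trans (powR_ge0 _ _) K2a.
rewrite -(addrA (K2 * V * y)); apply: lerD; last apply: lerD.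
- rewrite ler_wpM2r// powRM ?(ltW t0)//; apply: ler_pM; rewrite ?powR_ge0//.
- rewrite ler_wpM2r//; apply: (letr (K2 * (1 + l))).
  have -> : 2 * 2 `^ P * l + 2 `^ P = 2 `^ P * (2 * l + 1) by ring.
  apply: (letr (2 * 2 `^ P * (1 + l))); last by rewrite ler_wpM2r ?addr_ge0 ?(ltW l0).
  rewrite mulrAC (mulrC _ (2 `^ P)) ler_wpM2l ?powR_ge0//.
  by rewrite mulrDr mulr1 (addrC 2) lerD2l ler1n.
 by rewrite ler_wpM2r ?addr_ge0 ?(ltW l0)// ler_peMr.
- rewrite mulrA mulrA ler_wpM2r//; apply: ler_pM; rewrite ?mulr_ge0//; exact: powR_ge0.
Qed.

End one_step.
End scalar_step.

(** * The De Giorgi iteration *)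

Section degiorgi.
Context {R : realType} {N : nat}.
Notation Z := ('rV[R]_N * mR R)%type.
Notation mu := (@leb R N \x @lebesgue_measure R)%E.
Notation itg := (Rintg mu).
Notation II := (Rint mu).
Implicit Types (o : option 'I_N) (z : Z).

Lemma mass_ge0 (w : Z -> R) (P k : R) a b : 0 <= mass w P k a b.
Proof. by apply: II_ge0 => z; rewrite !mulr_ge0 ?powR_ge0. Qed.

Lemma mass_itg (w : Z -> R) (P k : R) (A B a b : option 'I_N -> R) :
 measT w -> itg (fun z => `|w z| `^ P * \1_(obox A B) z) ->
 (forall o, A o <= a o) -> (forall o, b o <= B o) ->
 itg (fun z => `|w z| `^ P * (\1_(above w k) z * \1_(obox a b) z)).
Proof.
move=> mw iP Aa bB; apply: (itg_dom _ _ iP).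
 apply: mfunM.
  by apply: (mpowR P); exact: mcomp.
 by apply: mfunM; apply: mindic; [exact: mset_gt|exact: mset_obox].
move=> z; rewrite ger0_norm ?mulr_ge0 ?powR_ge0//.
rewrite ler_wpM2l ?powR_ge0// !indicE; case: (boolP (z \in obox a b)); last by rewrite mulr0.
rewrite inE => h; rewrite mulr1 (@mem_set _ (obox A B)) ?lern1 ?leq_b1// => o.
move: (h o); rewrite /= !in_itv/= => /andP[h1 h2].
by rewrite (le_lt_trans (Aa o) h1) (lt_le_trans h2 (bB o)).
Qed.

Lemma mass_mono (w : Z -> R) (P k k' : R) (A B a b a' b' : option 'I_N -> R) :
 measT w -> itg (fun z => `|w z| `^ P * \1_(obox A B) z) ->
 (forall o, A o <= a o) -> (forall o, b o <= B o) -> k <= k' ->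
 (forall o, a o <= a' o) -> (forall o, b' o <= b o) ->
 mass w P k' a' b' <= mass w P k a b.
Proof.
move=> mw iP Aa bB kk aa bb.
apply: le_II; [apply: (mass_itg _ mw iP)|exact: (mass_itg _ mw iP)|].
- by move=> o; exact: le_trans (aa o).
- by move=> o; exact: le_trans (bB o).
move=> z; rewrite ler_wpM2l ?powR_ge0//; apply: ler_pM => //.
 rewrite !indicE; case: (boolP (z \in above w k')) => //; rewrite inE => h.
 by rewrite mem_set//; exact: le_lt_trans h.
rewrite !indicE; case: (boolP (z \in obox a' b')) => //; rewrite inE => h.
rewrite mem_set// => o; move: (h o); rewrite /= !in_itv/= => /andP[h1 h2].
by rewrite (le_lt_trans (aa o) h1) (lt_le_trans h2 (bb o)).
Qed.

Variables (p q P sig C dmax : R).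
Hypotheses (N0 : (0 < N)%N) (p1 : 1 < p) (q1 : 1 < q) (PE : P = Num.max q p)
 (sig1 : (N%:R + p) / p < sig) (hD : N%:R * q / (N%:R + q) < p) (C0 : 0 < C).
Notation n := (N%:R : R).
Notation beta := (dg_beta N p).
Notation s := (dg_s sig).
Notation m := (weak_exp N p q).
Notation U := (dg_U N p q P).
Notation K2 := (dg_K2 N p q P sig C dmax).
Notation K4 := (dg_K4 N p q P C dmax).
Let n0 : 0 < n. Proof. by rewrite ltr0n. Qed.
Let p0 : 0 < p := lt_trans ltr01 p1.
Let q0 : 0 < q := lt_trans ltr01 q1.
Let beta1 : 1 < beta. Proof. by rewrite ltrDl divr_gt0. Qed.
Let s01 := dg_s01 N0 p1 sig1.
Let s0 : 0 < s. Proof. by have /andP[] := s01. Qed.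
Let m0 : 0 < m. Proof. by rewrite addr_gt0// divr_gt0// mulr_gt0. Qed.

(** [e2] and [e4] are the powers of [2^j] lost in [step_source] and [step_mass]; [e3] is the power
    after absorption, and [e5] the power after inserting this into the mass bound. All are dominated
    by the base [b = 2^e]. *)
Let e2 : R := p + 2 * p / n.
Let e4 : R := m + 2 * p / n.
Let mu' : R := (m * s - 1)^-1.
Let e3 : R := e2 * (1 + mu').
Let K3 : R := 2 * K2 * (2 + (2 * K2) `^ mu').
Let e5 : R := e4 + e3 * beta.
Let e : R := e3 + e5.
Let K5 : R := K4 * K3 `^ beta.
Let K : R := 1 + K3 + K5.
Let b : R := 2 `^ e.
Let e0 : R := beta * s - 1.

Let ms1 : 1 < m * s.
Proof.
apply: (lt_trans (dg_beta_s N0 p1 sig1)); rewrite ltr_pM2r//; exact: dg_beta_m.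
Qed.
Let mu0 : 0 < mu'. Proof. by rewrite invr_gt0 subr_gt0. Qed.
Let e20 : 0 < e2. Proof. by rewrite addr_gt0// divr_gt0// mulr_gt0. Qed.
Let e40 : 0 < e4. Proof. by rewrite addr_gt0// divr_gt0// mulr_gt0. Qed.
Let e30 : 0 < e3. Proof. by rewrite mulr_gt0// addr_gt0. Qed.
Let e50 : 0 < e5. Proof. by rewrite addr_gt0// mulr_gt0// (lt_trans ltr01). Qed.
Let K21 : 1 <= K2. Proof. by rewrite lerDr !addr_ge0 ?mulr_ge0 ?powR_ge0. Qed.
Let K40 : 0 <= K4.
Proof.
have lC : 0 <= layerC m P by apply: layerC_ge0; exact: (P_lt_weak N0 p1 q1 PE hD).
have sC : 0 <= sobolevC N p q by rewrite /sobolevC !mulr_ge0 ?powR_ge0.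
have gC : 0 <= @gamC R N p P C dmax.
 by rewrite /gamC mulr_ge0// addr_ge0// mulr_ge0 ?powR_ge0 ?(ltW C0)// addr_ge0// ?mulr_ge0 ?powR_ge0.
have K1 : 0 <= dg_K1 N p q P C dmax by exact: mulr_ge0 (mulr_ge0 sC (powR_ge0 _ _)) gC.
exact: mulr_ge0 (powR_ge0 _ _) (mulr_ge0 (mulr_ge0 lC K1) (powR_ge0 _ _)).
Qed.
Let K30 : 0 <= K3.
Proof.
have h : 0 <= K2 by exact: le_trans K21.
by rewrite /K3 mulr_ge0 ?addr_ge0 ?powR_ge0// mulr_ge0.
Qed.
Let K50 : 0 <= K5. Proof. exact: mulr_ge0 K40 (powR_ge0 _ _). Qed.
Let K1 : 1 <= K. Proof. by rewrite /K -addrA lerDl addr_ge0. Qed.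
Let K3K : K3 <= K. Proof. by rewrite /K (addrC 1) -addrA lerDl addr_ge0. Qed.
Let K5K : K5 <= K. Proof. by rewrite /K lerDr addr_ge0. Qed.
Let e00 : 0 < e0. Proof. by rewrite subr_gt0; exact: (dg_beta_s N0 p1 sig1). Qed.
Let b1 : 1 <= b.
Proof. by rewrite -[leLHS](powRr0 2) ler_powR ?ler1n// ltW// addr_gt0. Qed.

Let bj (j : nat) (e' : R) : e' <= e -> (2 ^+ j) `^ e' <= b ^+ j.
Proof.
move=> ee; rewrite -exprn_powR//; apply: (letr ((2 ^+ j) `^ e)).
 by rewrite ler_powR// exprn_ege1// ler1n.
by rewrite /b exprn_powR.
Qed.

(** First [absorb] bounds the normalised energy by [y^s]; its power [beta] then bounds the next mass
    by [y^(s * beta)], and [s * beta > 1] makes the recursion superlinear. *)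
Let combine (j : nat) (y F y' : R) : 0 <= y <= 1 -> 0 < F ->
 (forall l, 0 < l -> F <= K2 * (2 ^+ j) `^ e2 *
  (y + (1 + l) * y `^ s + l `^ (1 - m * s) * F `^ (beta * s))) ->
 y' <= K4 * (2 ^+ j) `^ e4 * F `^ beta ->
 K * b ^+ j * y `^ s < 1 -> y' <= K * b ^+ j * y `^ (1 + e0).
Proof.
set t : R := 2 ^+ j; move=> y01 F0 hF hy small.
have t1 : 1 <= t by rewrite exprn_ege1// ler1n.
have t0 : 0 < t by exact: lt_le_trans t1.
have te1 : 1 <= t `^ e2 by rewrite -[leLHS](powRr0 t) ler_powR// ltW.
have Kt1 : 1 <= K2 * t `^ e2 by rewrite mulr_ege1.
have K20 : 0 <= K2 by exact: le_trans K21.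
have ys0 : 0 <= y `^ s by exact: powR_ge0.
have y0 : 0 <= y by have /andP[] := y01.
have Kb : 2 * (K2 * t `^ e2) * (2 + (2 * (K2 * t `^ e2)) `^ (m * s - 1)^-1) <= K3 * t `^ e3.
 rewrite -/mu' mulrA powRM ?mulr_ge0 ?powR_ge0// -powRrM /K3.
 have -> : t `^ e3 = t `^ e2 * t `^ (e2 * mu').
  by rewrite /e3 mulrDr mulr1 powRD// (gt_eqF t0) implybT.
 rewrite mulrACA; apply: ler_wpM2l; first by rewrite !mulr_ge0 ?powR_ge0.
 rewrite [leRHS]mulrDl lerD2r ler_peMr// -[leLHS](powRr0 t) ler_powR// mulr_ge0// ltW//.
have e3e : e3 <= e by rewrite lerDl ltW.
have e5e : e5 <= e by rewrite lerDr ltW.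
have K3b : K3 * t `^ e3 <= K * b ^+ j.
 by apply: ler_pM; rewrite ?powR_ge0// ?bj//; exact: K3K.
have FF : F <= K3 * t `^ e3 * y `^ s.
 have bs1 := dg_beta_s N0 p1 sig1.
 have s1 : 0 < s <= 1 by rewrite s0/= ltW//; have /andP[] := s01.
 have bm : beta * s < m * s by rewrite ltr_pM2r//; exact: dg_beta_m.
 apply: (le_trans (absorb Kt1 F0 y01 s1 bs1 bm hF _)).
  apply: le_lt_trans small; apply: ler_wpM2r => //; exact: le_trans K3b.
 exact: ler_wpM2r.
apply: (le_trans hy).
apply: (letr (K4 * t `^ e4 * (K3 * t `^ e3 * y `^ s) `^ beta)).
 apply: ler_wpM2l; first exact: mulr_ge0 K40 (powR_ge0 _ _).
 powR_mono; rewrite ?(ltW F0)//; first by rewrite ltW// (lt_trans ltr01).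
 exact: mulr_ge0 (mulr_ge0 K30 (powR_ge0 _ _)) ys0.
have -> : (K3 * t `^ e3 * y `^ s) `^ beta = K3 `^ beta * t `^ (e3 * beta) * y `^ (s * beta).
 by rewrite (powRM _ (mulr_ge0 K30 (powR_ge0 _ _)) ys0) (powRM _ K30 (powR_ge0 _ _)) -!powRrM.
have -> : 1 + e0 = s * beta by rewrite /e0 subrKC mulrC.
have -> : K4 * t `^ e4 * (K3 `^ beta * t `^ (e3 * beta) * y `^ (s * beta)) =
  K5 * t `^ e5 * y `^ (s * beta).
 rewrite /K5 /e5 powRD ?(gt_eqF t0) ?implybT//.
 by move: K4 (t `^ e4) (K3 `^ beta) (t `^ (e3 * beta)) (y `^ (s * beta)) => x1 x2 x3 x4 x5; ring.
apply: ler_wpM2r; first exact: powR_ge0.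
by apply: ler_pM; rewrite ?powR_ge0// ?bj//; exact: K5K.
Qed.

(** The threshold [eps] precedes the data: it depends on the exponents, [C], [dmax] and [N], but not
    on the functions, the boxes, the scale [R0] or the level [k]. *)
Theorem degiorgi : exists2 eps, 0 < eps &
 forall (w f : Z -> R) (Dw : 'I_N -> Z -> R) (dl : 'I_N -> R) (A B al be : option 'I_N -> R) (R0 k : R),
 energy_data w f Dw dl p q P sig C dmax A B ->
 0 < R0 <= 1 -> (forall i, R0 <= al (Some i) - A (Some i)) ->
 (forall i, R0 <= B (Some i) - be (Some i)) -> R0 `^ p <= al None - A None ->
 be None < B None -> (forall o, al o <= be o) -> 1 <= k ->
 mass w P (k / 2) A B <= eps * (U k R0 * R0 `^ p) ->
 II (fun z => `|f z| `^ sig) `^ sig^-1 <= k `^ (dg_X N p q P sig) ->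
 mass w P k al be = 0.
Proof.
have [eps eps0 heps] := fast_decay K1 b1 s0 e00; exists eps => //.
move=> w f Dw dl A B al be R0 k ED R01 hA hB hAt hBt albe k1 hY hf.
have mw := itgm (ed_w ED); have iP := ed_P ED.
have /andP[R00 R0l] := R01.
have k0 : 0 < k by exact: lt_le_trans k1.
have U0 : 0 < U k R0 * R0 `^ p by rewrite mulr_gt0 ?powR_gt0//; exact: dg_U_gt0.
pose r j : R := (2 ^+ j)^-1.
have r0 j : 0 < r j by rewrite invr_gt0 exprn_gt0.
have r1 j : r j <= 1 by rewrite invf_le1 ?exprn_gt0// exprn_ege1// ler1n.
have rS j : r j = r j.+1 + r j.+1 by rewrite /r exprS; field; rewrite expf_neq0.
pose a_ j o := al o - (al o - A o) * r j.
pose b_ j o := be o + (B o - be o) * r j.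
pose gl j o := (al o - A o) * r j.+1.
pose gr j o := (B o - be o) * r j.+1.
(* Levels rise from [k / 2] towards [k]. Consecutive ones differ by twice [k / (8 * 2^j)], so that
   the intermediate level [kap] is their midpoint. *)
pose k_ j := k * (1 - r j.+1).
have dA o : 0 < al o - A o.
 case: o => [i|]; first exact: lt_le_trans (hA i).
 by apply: lt_le_trans hAt; rewrite powR_gt0.
have dB o : 0 < B o - be o.
 by case: o => [i|]; [exact: lt_le_trans (hB i)|rewrite subr_gt0].
have a0E : a_ 0%N = A by ext => o; rewrite /a_ /r expr0 invr1; ring.
have b0E : b_ 0%N = B by ext => o; rewrite /b_ /r expr0 invr1; ring.
have aS j o : a_ j o + gl j o = a_ j.+1 o by rewrite /a_ /gl (rS j); ring.
have bS j o : b_ j o - gr j o = b_ j.+1 o by rewrite /b_ /gr (rS j); ring.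
have Aa j o : A o <= a_ j o.
 have -> : a_ j o = A o + (al o - A o) * (1 - r j) by rewrite /a_; ring.
 by rewrite lerDl mulr_ge0 ?subr_ge0 ?r1// -subr_ge0 ltW.
have bB j o : b_ j o <= B o.
 have -> : b_ j o = B o - (B o - be o) * (1 - r j) by rewrite /b_; ring.
 by rewrite gerBl mulr_ge0 ?subr_ge0 ?r1// -subr_ge0 ltW.
have aal j o : a_ j o <= al o by rewrite gerBl mulr_ge0 ?(ltW (r0 j)) ?(ltW (dA o)).
have bbe j o : be o <= b_ j o by rewrite lerDl mulr_ge0 ?(ltW (r0 j)) ?(ltW (dB o)).
have ab j o : a_ j o <= b_ j o by exact: le_trans (aal j o) (le_trans (albe o) (bbe j o)).
have kS j : k_ j + k / (8 * 2 ^+ j) + k / (8 * 2 ^+ j) = k_ j.+1.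
 by rewrite /k_ /r !exprS; field; rewrite expf_neq0.
have kk j : k_ j <= k by rewrite ler_piMr ?(ltW k0)// gerBl ltW.
have dj j : 0 < k / (8 * 2 ^+ j) by rewrite divr_gt0// mulr_gt0// exprn_gt0.
pose y j := mass w P (k_ j) (a_ j) (b_ j) / (U k R0 * R0 `^ p).
have y0 j : 0 <= y j by rewrite divr_ge0 ?mass_ge0// ltW.
have k0E : k_ 0%N = k / 2 by rewrite /k_ /r expr1; field.
have ye : y 0%N <= eps by rewrite /y ler_pdivrMr// k0E a0E b0E.
have [|lam /andP[lam0 lam1] hlam] := heps y y0 ye; last first.
 have le0 j : mass w P k al be <= lam ^+ j * (U k R0 * R0 `^ p).
  apply: (letr (mass w P (k_ j) (a_ j) (b_ j))).
   by apply: (mass_mono (A := A) (B := B)) => //.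
  by rewrite -ler_pdivrMr//; exact: hlam.
 apply/eqP; rewrite eq_le mass_ge0 andbT.
 have c : lam ^+ j * (U k R0 * R0 `^ p) @[j --> \oo] --> 0 * (U k R0 * R0 `^ p).
  apply: cvgM; last exact: cvg_cst.
  by apply: cvg_expr; rewrite ger0_norm// ltW.
 rewrite mul0r in c.
 by apply: (cvgr_to_ge c); apply: nearW => j; exact: le0.
move=> j yj1 small; set t : R := 2 ^+ j.
have t1 : 1 <= t by rewrite exprn_ege1// ler1n.
have t0 : 0 < t by exact: lt_le_trans t1.
pose gam := R0 / (2 * t).
have gamE : gam = R0 * r j.+1 by rewrite /gam /r exprS.
have gl0 o : 0 < gl j o by rewrite mulr_gt0.
have gr0 o : 0 < gr j o by rewrite mulr_gt0.
have gam01 : 0 < gam <= 1 by rewrite gamE mulr_gt0//= mulr_ile1 ?r1// ltW.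
have ggl i : gam <= gl j (Some i) by rewrite gamE ler_wpM2r// ltW.
have ggr i : gam <= gr j (Some i) by rewrite gamE ler_wpM2r// ltW.
have ggt : gam `^ p <= gl j None.
 rewrite gamE powRM ?(ltW R00) ?(ltW (r0 _))//; apply: ler_pM; rewrite ?powR_ge0//.
 rewrite -[leRHS](powRr1 (ltW (r0 _))); apply: powR_le1W => //; last exact: ltW.
 by rewrite (ltW (r0 _)) r1.
have kj1 : k / 2 <= k_ j.
 rewrite /k_ ler_wpM2l ?(ltW k0)//; have := r1 j; rewrite (rS j); move: (r j.+1) => u; lra.
have k2 : 2^-1 <= k_ j by apply: le_trans kj1; rewrite ler_peMl.
have kj2 : k_ j + k / (8 * t) <= k.
 by apply: le_trans (kk j.+1); rewrite -kS lerDl; exact: ltW (dj j).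
pose kap := k_ j + k / (8 * t).
have kkap : k_ j < kap by rewrite ltrDl; exact: dj.
have kkap' : kap < k_ j.+1 by rewrite -kS ltrDl; exact: dj.
have isrc := source_itg ED N0 p1 q1 PE sig1 (Aa j) (bB j) (ab j) gl0 gr0 gam01 ggl ggr k2.
set Isrc := II (source w f p (k_ j) (a_ j) (b_ j) (gl j) (gr j)).
have I0 : 0 <= Isrc.
 by apply: II_ge0 => z; rewrite !mulr_ge0 ?tens_cutf_ge0// /ppart le_max lexx orbT.
set Y := mass w P (k_ j) (a_ j) (b_ j); have Y0 : 0 <= Y by exact: mass_ge0.
(* The normalised inequalities need a positive energy. If it is not positive, the present mass is
   already 0, and so is the next one. *)
have [Phi0|Phi0] := ltP 0 (energy_rhs w f p P (k_ j) gam (a_ j) (b_ j) (gl j) (gr j)); last first.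
 have Yz : Y = 0.
  apply/eqP; rewrite eq_le Y0 andbT.
  have : gam `^ (- p) * Y <= 0 by apply: le_trans Phi0; rewrite lerDl.
  by have /andP[g0 _] := gam01; rewrite pmulr_rle0// powR_gt0.
 have -> : y j.+1 = 0.
  apply/eqP; rewrite eq_le y0 andbT ler_pdivrMr// mul0r -Yz.
  apply: (mass_mono (A := A) (B := B)) => //.
  - exact: ltW (lt_trans kkap kkap').
  - by move=> o; rewrite -aS lerDl ltW.
  - by move=> o; rewrite -bS gerBl ltW.
 by rewrite !mulr_ge0 ?powR_ge0 ?exprn_ge0 ?(le_trans ler01 b1) ?(le_trans ler01 K1).
have H1 := source_bound ED N0 p1 q1 PE C0 sig1 (Aa j) (bB j) (ab j) gl0 gr0 gam01 ggl ggr ggt k2 kkap Phi0.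
have H2 := next_mass ED N0 p1 q1 PE C0 sig1 hD (Aa j) (bB j) (ab j) gl0 gr0 gam01 ggl ggr ggt k2 kkap Phi0 kkap'
 (fun o => eq_ind _ (fun v => v <= a_ j.+1 o) (lexx (a_ j.+1 o)) _ (esym (aS j o)))
 (fun o => eq_ind _ (fun v => b_ j.+1 o <= v) (lexx (b_ j.+1 o)) _ (esym (bS j o))).
have S1 := step_source N0 p1 q1 PE sig1 C0 k1 R01 t1 kj1 kj2 Y0 (powR_ge0 _ _) hf Phi0 H1.
have S2 := step_mass N0 p1 q1 PE hD C0 k1 R01 t1 kj1 kj2 Phi0 (esym (kS j)) (kk j.+1) H2.
have yj01 : 0 <= y j <= 1 by rewrite y0 yj1.
have F0 : 0 < energy_rhs w f p P (k_ j) gam (a_ j) (b_ j) (gl j) (gr j) / U k R0.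
 by rewrite divr_gt0//; exact: dg_U_gt0.
exact: (combine yj01 F0 S1 S2 small).
Qed.

End degiorgi.

(** * Smooth steps and plateau functions *)

Section smooth_step.
Context {R : realType}.

Definition sden (x : R) : R := ek 0 x + ek 0 (1 - x).

Definition sstep (x : R) : R := ek 0 x * (sden x)^-1.

Lemma ek0_gt0 (x : R) : 0 < x -> 0 < ek 0 x.
Proof. by move=> x0; rewrite ek_gt0// expr0 mul1r expR_gt0. Qed.

Lemma sden_gt0 x : 0 < sden x.
Proof.
rewrite /sden; have [x0|x0] := ltP 0 x.
 by rewrite ltr_pwDl ?ek_ge0// ek0_gt0.
by rewrite ltr_wpDl ?ek_ge0// ek0_gt0//; lra.
Qed.

Lemma Cinf_sstep : Cinf sstep.
Proof.
have h : Cinf (fun x : R => ek 0 (1 - x)).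
 rewrite (_ : (fun x => _) = fun x => ek 0 (- 1 * x + 1)).
  by apply: Cinf_affine; exact: Cinf_ek.
 by ext => x; rewrite mulN1r addrC.
apply: CinfM; first exact: Cinf_ek.
move=> n; apply: Ck_inv; first by move=> x; rewrite gt_eqF// sden_gt0.
exact: (CinfD (Cinf_ek 0) h).
Qed.

Lemma sstep_le0 x : x <= 0 -> sstep x = 0.
Proof. by move=> x0; rewrite /sstep ek_le0// mul0r. Qed.

Lemma sstep_ge1 x : 1 <= x -> sstep x = 1.
Proof.
move=> x1; have h : ek 0 (1 - x) = 0 :> R by rewrite ek_le0// subr_le0.
by rewrite /sstep /sden h addr0 divff// gt_eqF// ek0_gt0//; lra.
Qed.

Lemma sstep_ge0 x : 0 <= sstep x.
Proof. by rewrite divr_ge0 ?ek_ge0// ltW// sden_gt0. Qed.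

Lemma sstep_le1 x : sstep x <= 1.
Proof. by rewrite ler_pdivrMr ?sden_gt0// mul1r lerDl ek_ge0. Qed.

Lemma bump1_dsstep : bump1 (derive1 sstep).
Proof.
split; first exact: (Cinf_derive1 Cinf_sstep).
have z (f : R -> R) (x c : R) : (\forall y \near x, f y = c) -> derive1 f x = 0.
 move=> h; rewrite derive1E.
 have [_ E] : is_derive x 1 f 0.
  apply: (@near_eq_is_derive _ _ _ (cst c)).
  by near=> y; apply/esym; near: y.
 exact: E.
exists 2 => x; rewrite ler_normr => /orP[h|h].
 apply: (z _ _ 1); near=> y; apply: sstep_ge1; apply: ltW; near: y; apply: lt_nbhsr; lra.
by apply: (z _ _ 0); near=> y; apply: sstep_le0; apply: ltW; near: y; apply: lt_nbhsl; lra.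
Unshelve. all: by end_near. Qed.

Context {N : nat}.
Notation Z := ('rV[R]_N * mR R)%type.
Implicit Types (o : option 'I_N) (z : Z).

(** In contrast to [cutf] this is equal to 1 on the box, so that multiplying by it leaves a function
    and its gradient unchanged there. *)
Definition plateau (a b : option 'I_N -> R) (d : R) : option 'I_N -> R -> R :=
 fun o x => sstep ((x - (a o - d)) / d) * sstep ((b o + d - x) / d).

Lemma bumps_plateau a b d : 0 < d -> bumps (plateau a b d).
Proof.
move=> d0 o; split.
 rewrite /plateau; apply: CinfM.
  rewrite (_ : (fun x => _) = fun x => sstep (d^-1 * x + - ((a o - d) / d))).
   by apply: Cinf_affine; exact: Cinf_sstep.
  by ext => x; congr sstep; rewrite mulrBl mulrC.
 rewrite (_ : (fun x => _) = fun x => sstep (- d^-1 * x + (b o + d) / d)).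
  by apply: Cinf_affine; exact: Cinf_sstep.
 by ext => x; congr sstep; rewrite mulrBl mulNr addrC mulrC.
exists (`|a o - d| + `|b o + d|) => x; rewrite ler_normr => /orP[h|h].
 rewrite /plateau [X in _ * X]sstep_le0 ?mulr0// pmulr_lle0 ?invr_gt0// subr_le0.
 by apply: le_trans (ler_norm _) (le_trans _ h); rewrite lerDr.
rewrite /plateau [X in X * _]sstep_le0 ?mul0r// pmulr_lle0 ?invr_gt0// subr_le0.
rewrite -lerN2; apply: le_trans (ler_norm _) (le_trans _ h); rewrite normrN lerDl//.
Qed.

Lemma plateau_1 a b d z : 0 < d -> (forall o, a o <= co o z <= b o) -> tens (plateau a b d) z = 1.
Proof.
move=> d0 h; apply: big1 => o _; have /andP[h1 h2] := h o.
by rewrite /plateau !sstep_ge1 ?mulr1// ler_pdivlMr// mul1r; lra.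
Qed.

Lemma plateau_01 a b d z : 0 <= tens (plateau a b d) z <= 1.
Proof.
rewrite prodr_ge0 => [|o _]; last by rewrite mulr_ge0 ?sstep_ge0.
by apply: prod_le1 => o; rewrite mulr_ge0 ?sstep_ge0//= mulr_ile1 ?sstep_ge0 ?sstep_le1.
Qed.

Lemma plateau_supp a b d z : 0 < d -> tens (plateau a b d) z != 0 ->
 forall o, a o - d < co o z < b o + d.
Proof.
move=> d0 nz o; rewrite !ltNge -negb_or; apply: contraNN nz => /orP[h|h].
 by rewrite (tens_split o) /plateau sstep_le0 ?mul0r// pmulr_lle0 ?invr_gt0// subr_le0.
by rewrite (tens_split o) /plateau [X in _ * X * _]sstep_le0 ?mulr0 ?mul0r// pmulr_lle0 ?invr_gt0// subr_le0.
Qed.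

End smooth_step.

(** * Null sets, lower integrals and Borel versions *)

Section null_sections.
Context d1 d2 (X : measurableType d1) (Y : measurableType d2) (R : realType).
Variables (m1 : {sigma_finite_measure set X -> \bar R})
 (m2 : {sigma_finite_measure set Y -> \bar R}).

(** Tonelli's theorem for the indicator of a measurable null set containing the exceptional set. *)
Lemma ae_sections (P : X * Y -> Prop) : {ae (m1 \x m2)%E, forall z, P z} ->
 {ae m2, forall y, {ae m1, forall x, P (x, y)}}.
Proof.
move=> [A [mA A0 PA]].
have mf := @measurable_indicE _ _ R _ mA.
have f0 z : (0 <= (\1_A z)%:E :> \bar R)%E by rewrite lee_fin.
have E := @fubini_tonelli2 _ _ _ _ R m1 m2 _ mf f0.
have E0 : (\int[(m1 \x m2)%E]_z (\1_A z)%:E = 0)%E by rewrite integral_indicT.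
have mG : measT (fun y => \int[m1]_x (\1_A (x, y))%:E)%E.
 exact: (@measurable_fun_fubini_tonelli_G _ _ _ _ _ m1 (fun z => (\1_A z)%:E)).
have : (\int[m2]_y `|\int[m1]_x (\1_A (x, y))%:E| = 0)%E.
 rewrite -[RHS]E0 [RHS]E; apply: eq_integral => y _; rewrite gee0_abs//; exact: integral_ge0.
move/(ae_eq_integral_abs _ measurableT mG); apply: filterS => y /(_ I) h.
exists [set x | A (x, y)]; split.
- by rewrite -[X in measurable X]setTI; exact: (pair2_measurable y measurableT mA).
- rewrite -[LHS]integral_indicT//.
 by rewrite -[X in measurable X]setTI; exact: (pair2_measurable y measurableT mA).
- by move=> x /= nP; exact: (PA (x, y)).
Qed.

End null_sections.

Section lower_integral.
Context d (X : measurableType d) (R : realType) (m : {measure set X -> \bar R}).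

(* The integral of a non-measurable nonnegative function is a lower integral, so
 that monotonicity needs no measurability of the larger function. *)
Lemma lower_integral_le (f g : X -> \bar R) : (forall x, 0 <= f x)%E ->
 (forall x, f x <= g x)%E -> (\int[m]_x f x <= \int[m]_x g x)%E.
Proof.
move=> f0 fg; have g0 x : (0 <= g x)%E by exact: le_trans (f0 x) (fg x).
rewrite !ge0_integralTE//; apply: le_ereal_sup => _ /= [h hf <-].
by exists h => // x; exact: le_trans (hf x) (fg x).
Qed.

Lemma lower_integral_ae (f g : X -> \bar R) : measT f -> (forall x, 0 <= f x)%E ->
 (forall x, 0 <= g x)%E -> {ae m, forall x, (f x <= g x)%E} ->
 (\int[m]_x f x <= \int[m]_x g x)%E.
Proof.
move=> mf f0 g0 [A [mA A0 fA]].
have -> : (\int[m]_x f x = \int[m]_x (f \_ (~` A)) x)%E.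
 apply: ae_eq_integral => //.
  by apply/(measurable_restrictT _ (measurableC mA)); exact: measurable_funS mf.
 exists A; split => // x /= h; apply: contrapT => nA; apply: h => _.
 by rewrite patchE mem_set.
apply: lower_integral_le => x; rewrite patchE; case: ifPn => //.
rewrite inE /= => nA; apply: contrapT => h; apply: nA; exact: fA.
Qed.

End lower_integral.

Section integral_versions.
Import HBNNSimple.
Context d (X : measurableType d) (R : realType) (m : {measure set X -> \bar R}).

(** The counterpart of [lower_integral_ae] in which the larger function is the measurable one: a
    simple function below [f] is below [g] almost everywhere, and its integral can be compared
    directly. *)
Lemma lower_integral_ae_le (f g : X -> \bar R) : measT g -> (forall x, 0 <= f x)%E ->
 (forall x, 0 <= g x)%E -> {ae m, forall x, (f x <= g x)%E} ->
 (\int[m]_x f x <= \int[m]_x g x)%E.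
Proof.
move=> mg f0 g0 fg; rewrite (ge0_integralTE _ f0); apply: ge_ereal_sup => _ /= [h hf <-].
rewrite -integralT_nnsfun; apply: ae_ge0_le_integral => //.
- by move=> x _; rewrite lee_fin; exact: fun_ge0.
- exact/mEFinP.
- by apply: filterS fg => x fgx _; exact: le_trans (hf x) fgx.
Qed.

(* The functions of the statement are only almost everywhere equal to measurable
 ones. *)
Lemma integral_version (D : set X) (f g : X -> \bar R) : measurable D -> measurable_fun D g ->
 {ae m, forall x, D x -> f x = g x} -> (\int[m]_(x in D) f x = \int[m]_(x in D) g x)%E.
Proof.
move=> mD mg fg; rewrite [LHS]integral_mkcond [RHS]integral_mkcond.
have mg' : measT (g \_ D) by exact/(measurable_restrictT _ mD).
have fg' : {ae m, forall x, (f \_ D) x = (g \_ D) x}.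
 by apply: filterS fg => x h; rewrite !patchE; case: ifPn => //; rewrite inE; exact: h.
rewrite [LHS]integralE [RHS]integralE; congr (_ - _)%E; apply/eqP; rewrite eq_le; apply/andP; split.
- apply: lower_integral_ae_le => //; first exact: measurable_funepos.
 by apply: filterS fg' => x; rewrite !funeposE => ->.
- apply: lower_integral_ae => //; first exact: measurable_funepos.
 by apply: filterS fg' => x; rewrite !funeposE => ->.
- apply: lower_integral_ae_le => //; first exact: measurable_funeneg.
 by apply: filterS fg' => x; rewrite !funenegE => ->.
- apply: lower_integral_ae => //; first exact: measurable_funeneg.
 by apply: filterS fg' => x; rewrite !funenegE => ->.
Qed.

End integral_versions.

Section real_slices.
Context d1 d2 (X : measurableType d1) (Y : measurableType d2) (R : realType).
Variables (m1 : {sigma_finite_measure set X -> \bar R})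
 (m2 : {sigma_finite_measure set Y -> \bar R}).

Lemma II_slices (F : X * Y -> R) : Rintg (m1 \x m2)%E F ->
 Rint (m1 \x m2)%E F = Rint m2 (fun y => Rint m1 (fun x => F (x, y))) /\
 {ae m2, forall y, Rintg m1 (fun x => F (x, y))}.
Proof.
move=> iF; split; last exact: (ae_integrable2 iF).
rewrite -(II_fubini iF).
have [_ h] := itg_fine (integrable_fubini_F iF).
rewrite [RHS]h /Rint /Rintegral; congr fine.
by rewrite -(integral12_prod_meas1 iF).
Qed.

End real_slices.

(** * Products as smooth test functions *)

Section smooth_tensors.
Context {R : realType} (V : normedModType R) (I : finType) (l : I -> V -> R).
Hypotheses (lin : forall i h u v, l i (h *: u + v) = h * l i u + l i v)
 (lcont : forall i, continuous (l i)).

(** The coordinates are an abstract finite family of continuous linear functionals, so that the same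
    lemmas serve the spatial coordinates [xco] and the space-time coordinates [co]. *)
Definition ftens (b : I -> R -> R) (x : V) : R := \prod_i b i (l i x).

Lemma Cinf_ftens b : (forall i, Cinf (b i)) -> Cinf (ftens b).
Proof.
move=> Cb n; apply: Ck_prod => i.
rewrite (_ : (fun x => _) = fun x => b i (l i x + 0)); last by ext => x; rewrite addr0.
by apply: (@Ck_comp_affine _ V R (l i) 0) => //; exact: Cb.
Qed.

Lemma derive_ftens b i v x : (forall j, l j v = (j == i)%:R) -> Cinf (b i) ->
 'D_v (ftens b) x = ftens (fun j => if j == i then derive1 (b j) else b j) x.
Proof.
move=> lv Ci; pose P := \prod_(j | j != i) b j (l j x).
pose g (r : R) := P * b i (r + l i x).
have gE r : ftens b (r *: v + x) = g r.
 rewrite /ftens (bigD1 i)//= mulrC lin lv eqxx mulr1; congr (_ * _).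
 by apply: eq_bigr => j ji; rewrite lin lv (negbTE ji) mulr0 add0r.
have -> : 'D_v (ftens b) x = 'D_1 g 0.
 apply: (congr1 (fun F : R -> R => lim (F @ (0 : R)^'))); ext => h.
 rewrite /= [h *: 1]mulr1 addr0 gE; congr (_ *: (_ - _)).
 by rewrite -[x in LHS]add0r -[0](scale0r v) gE.
have h1 : is_derive (0 : R) 1 (fun r : R => r + l i x) 1.
 have := is_deriveD (is_derive_id (0 : R) (1 : R)) (is_derive_cst (l i x) (0 : R) 1).
 by rewrite addr0.
have h2 := @is_derive1_comp _ (b i) (fun r : R => r + l i x) 0 _ _ (Cinf_is_derive _ Ci) h1.
have [_ E] := is_deriveZ P h2.
rewrite [LHS]E mulr1 add0r -[_ *: _]/(_ * _) /ftens (bigD1 i)//= eqxx mulrC; congr (_ * _).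
by apply: eq_bigr => j /negbTE ->.
Qed.

Lemma test_fun_ftens (D K : set V) b : (forall i, Cinf (b i)) -> compact K -> closed K ->
 K `<=` D -> (forall x, ftens b x != 0 -> K x) -> test_fun D (ftens b).
Proof.
move=> Cb cK clK KD bK.
have sub : closure [set x | ftens b x != 0] `<=` K.
 by rewrite [X in _ `<=` X](closure_id K).1//; apply: closure_subset => x; exact: bK.
split; first exact: Cinf_smooth (Cinf_ftens Cb).
 by apply: subclosed_compact cK sub; exact: closed_closure.
exact: subset_trans KD.
Qed.

End smooth_tensors.

Section spatial_tensors.
Context {R : realType} {N : nat}.
Notation Z := ('rV[R]_N * mR R)%type.

Definition xco (i : 'I_N) (x : 'rV[R]_N) : R := x ord0 i.

Definition xtens (b : option 'I_N -> R -> R) : 'rV[R]_N -> R :=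
 ftens xco (fun i => b (Some i)).

Lemma xco_lin i h (u v : 'rV[R]_N) : xco i (h *: u + v) = h * xco i u + xco i v.
Proof. by rewrite /xco !mxE. Qed.

Lemma xco_cont i : continuous (xco i).
Proof. exact: coord_continuous. Qed.

Lemma tensE b x t : tens b ((x, t) : Z) = b None t * xtens b x.
Proof. exact: prod_option. Qed.

Lemma tens_dtxE b i x t : tens (dt (Some i) b) ((x, t) : Z) = b None t * xtens (dt (Some i) b) x.
Proof. exact: prod_option. Qed.

Lemma pderiv_xtens b i x : bumps b -> pderiv i (xtens b) x = xtens (dt (Some i) b) x.
Proof.
move=> hb; rewrite /pderiv /xtens (@derive_ftens _ _ _ _ xco_lin _ i).
- by apply: eq_bigr => j _; rewrite /dt (inj_eq (@Some_inj _)); case: eqP => // ->.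
- by move=> j; rewrite /xco mxE eqxx /=.
- exact: (hb _).1.
Qed.

Definition cbox (a b : 'I_N -> R) : set 'rV[R]_N := [set x | forall i, `[a i, b i]%classic (x ord0 i)].

Lemma compact_cbox a b : compact (cbox a b).
Proof. exact: (@rV_compact R N (fun i => `[a i, b i]%classic) (fun i => @segment_compact R (a i) (b i))). Qed.

Lemma closed_cbox a b : closed (cbox a b).
Proof. by apply: compact_closed; [exact: norm_hausdorff|exact: compact_cbox]. Qed.

Lemma test_fun_xtens (Om : set 'rV[R]_N) (b : option 'I_N -> R -> R) (a' b' : 'I_N -> R) :
 bumps b -> cbox a' b' `<=` Om -> (forall x, xtens b x != 0 -> cbox a' b' x) ->
 test_fun Om (xtens b).
Proof.
move=> hb sub supp; apply: (test_fun_ftens xco_lin xco_cont _ (@compact_cbox a' b') (@closed_cbox a' b')) => //.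
by move=> i; exact: (hb _).1.
Qed.

Lemma xtens_bounded b : bumps b -> exists M : R, forall x, `|xtens b x| <= M.
Proof.
move=> hb; pose M i := projT1 (cid (bump1_bounded (hb (Some i)))).
have hM i x : `|b (Some i) x| <= M i by rewrite /M; case: cid.
exists (\prod_i M i) => z; rewrite /xtens /ftens normr_prod.
by apply: ler_prod => i _; rewrite normr_ge0 hM.
Qed.

Lemma measurable_xtens b : bumps b -> measT (xtens b).
Proof.
move=> hb; apply: measurable_prod => i _.
apply: (mcomp (f := b (Some i))); last exact: measurable_coord.
exact: continuous_measurable_fun (Cinf_cont (hb _).1).
Qed.

End spatial_tensors.

(** * Localisation to Borel functions on the whole space *)

Section local_data.
Context {R : realType} {N : nat}.
Notation Z := ('rV[R]_N * mR R)%type.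
Notation mu := (@leb R N \x @lebesgue_measure R)%E.
Notation lam := (@lebesgue_measure R).
Notation itg := (Rintg mu).
Notation II := (Rint mu).
Implicit Types (o : option 'I_N) (z : Z).

(** What remains of [LpW1p] and [C0Lq] after multiplication by a plateau: Borel functions on the
    whole space-time, with weak derivatives in the sense of [wpd] and a bound for almost every time
    slice. *)
Record local_data (w : Z -> R) (Dw : 'I_N -> Z -> R) (p q P : R) : Prop := LocalData {
 ld_w : itg w;
 ld_D : forall i, itg (Dw i);
 ld_wpd : forall i, wpd (Some i) w (Dw i);
 ld_Dp : forall i, itg (fun z => `|Dw i z| `^ p);
 ld_fin : exists S0 : R, {ae lam, forall t : mR R,
  (\int[@leb R N]_x ((`|w (x, t)| `^ q)%:E) <= S0%:E)%E};
 ld_P : itg (fun z => `|w z| `^ P) }.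

Lemma local_dataN w Dw p q P : local_data w Dw p q P ->
 local_data (fun z => - w z) (fun i z => - Dw i z) p q P.
Proof.
move=> [iw iD wD iDp [S0 hS0] iP]; split.
- exact: itgN.
- by move=> i; exact: itgN.
- by move=> i; exact: wpdN.
- by move=> i; under eq_fun do rewrite normrN.
- exists S0; apply: filterS hS0 => t.
 have -> // : (fun x => (`|- w (x, t)| `^ q)%:E) = fun x => (`|w (x, t)| `^ q)%:E :> \bar R.
 by ext => x; rewrite normrN.
- by under eq_fun do rewrite normrN.
Qed.

Section borel_versions.
Variables (Om : set 'rV[R]_N) (T : R).
Hypotheses (oOm : open Om) (bOm : bounded_set Om) (T0 : 0 < T).
Notation cy := (cyl Om T).

Lemma measurable_cyl : measurable (cy : set Z).
Proof. by apply: measurableX; [exact: open_measurable_rV|exact: measurable_itv]. Qed.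

Lemma coord_le_norm (x : 'rV[R]_N) i : `|x ord0 i| <= `|x|.
Proof.
rewrite [leRHS]/Num.norm/= mx_normrE.
by rewrite -[leLHS]/((fun ij : 'I_1 * 'I_N => `|x ij.1 ij.2|) (ord0, i)); exact: le_bigmax.
Qed.

Lemma cyl_fin : (mu cy < +oo)%E.
Proof.
have [M [_ hM]] := bOm; pose M' := Num.max M 0 + 1.
have MM : M < M' by rewrite /M' ltr_pwDr// le_max lexx.
have M'0 : 0 < M' by rewrite ltr_wpDl// le_max lexx orbT.
pose a (o : option 'I_N) : R := if o is Some _ then - (M' + 1) else - 1.
pose b (o : option 'I_N) : R := if o is Some _ then M' + 1 else T + 1.
have MM0 : - (M' + 1) <= M' + 1 by move: (M') M'0 => m m0; lra.
have TT0 : -1 <= T + 1 by move: T0; lra.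
have ab o : a o <= b o by case: o.
apply: le_lt_trans (fin_obox ab); apply: le_measure; rewrite ?inE//.
- exact: measurable_cyl.
- exact: mset_obox.
move=> -[x t] [/= Ox Tt] [i|] /=; rewrite in_itv/=; last by move: Tt; rewrite in_itv/=; lra.
have := le_trans (coord_le_norm x i) (hM M' MM x Ox).
by move: (M') => m; rewrite ler_norml; lra.
Qed.

(** The version is set to 0 outside the cylinder, so that integrals extend to the whole space and
    slices at times outside []0, T[] vanish. *)
Lemma borel_version (v : Z -> R) : ae_measurable (lebesgue_rVxR N) cy v ->
 exists g : Z -> R, [/\ measT g, {ae mu, forall z, cy z -> v z = g z} &
  forall z, ~ cy z -> g z = 0].
Proof.
move=> [g mg vg]; exists (g \_ cy); split.
- exact/(measurable_restrictT _ measurable_cyl).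
- by apply: filterS vg => z h cz; rewrite patchE mem_set//; exact: h.
- by move=> z nz; rewrite patchE memNset.
Qed.

Section one_function.
Variables (v g : Z -> R) (p : R).
Hypotheses (mg : measT g) (vg : {ae mu, forall z, cy z -> v z = g z})
 (g0 : forall z, ~ cy z -> g z = 0) (p1 : 1 < p).
Let p0 : 0 < p := lt_trans ltr01 p1.

Lemma slice_version : {ae lam, forall t : mR R,
 {ae @leb R N, forall x, cy (x, t) -> v (x, t) = g (x, t)}}.
Proof. exact: (ae_sections vg). Qed.

Let mgp : measT (fun z => `|g z| `^ p).
Proof. by apply: (mpowR p); exact: mcomp. Qed.

Lemma slice_LpNorm (r : R) (h : 'rV[R]_N -> R) (t : R) : 0 < r ->
 `]0, T[%classic t -> {ae @leb R N, forall x, Om x -> h x = g (x, t)} ->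
 (\int[@leb R N]_x (`|g (x, t)| `^ r)%:E = LpNorm (lebesgue_rV N) Om r h `^ r)%E.
Proof.
move=> r0 tT hg; rewrite /LpNorm poweR_Lnorm ?gt_eqF//; apply/esym.
have mgt : measT (fun x => g (x, t)).
 exact: (mcomp mg (pair2_measurable t)).
apply: (@integral_version _ _ _ (@leb R N)) => //.
 by apply/mEFinP; apply: (mpowR r); exact: mcomp.
apply: filterS hg => x hx _; rewrite patchE; case: ifPn => [|nx].
 by rewrite inE => ox; rewrite /= hx.
rewrite g0 ?normr0 ?powR0 ?gt_eqF//; first by rewrite abse0 poweR0r// gt_eqF.
by move=> -[/= ox _]; move: nx; rewrite mem_set.
Qed.

(** The slice norms of [v] need not be measurable in time. They enter as a lower integral, above the
    Tonelli integral of the Borel version [g]. *)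
Lemma Lp_itg : (\int[lam]_(t in `]0%R, T[)
  LpNorm (lebesgue_rV N) Om p (fun x => v (x, t)) `^ p < +oo)%E ->
 itg (fun z => `|g z| `^ p).
Proof.
move=> fin; apply/integrableP; split; first exact/mEFinP.
have f0 z : (0 <= (`|g z| `^ p)%:E :> \bar R)%E by rewrite lee_fin powR_ge0.
have mE : measT (fun z : Z => (`|g z| `^ p)%:E : \bar R) by exact/mEFinP.
rewrite (eq_integral (fun z => (`|g z| `^ p)%:E)); last first.
 by move=> z _; rewrite /= ger0_norm ?powR_ge0.
have E := @fubini_tonelli2 _ _ _ _ R (@leb R N) lam _ mE f0.
rewrite E.
apply: le_lt_trans fin; rewrite [leRHS]integral_mkcond; apply: lower_integral_ae.
- exact: (@measurable_fun_fubini_tonelli_G _ _ _ _ _ (@leb R N) (fun z => (`|g z| `^ p)%:E)).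
- by move=> t; exact: integral_ge0.
- by move=> t; rewrite patchE; case: ifP => // _; exact: poweR_ge0.
apply: filterS slice_version => t ht; rewrite patchE; case: ifPn => [|tn].
 rewrite inE => tT; rewrite -(slice_LpNorm p0 tT)//.
 by apply: filterS ht => x h ox; exact: h.
rewrite /fubini_G integral0_eq// => x _; rewrite g0 ?normr0 ?powR0 ?gt_eqF//.
by move=> -[_ /= h]; move: tn; rewrite mem_set.
Qed.

Lemma Lp_itg1 : itg (fun z => `|g z| `^ p) -> itg g.
Proof.
move=> ip; have i1 : itg (\1_cy : Z -> R) by apply: itg_indic; [exact: measurable_cyl|exact: cyl_fin].
apply: (itg_dom mg _ (itgD i1 ip)) => z.
have [cz|cz] := pselect (cy z); last by rewrite (g0 cz) normr0 addr_ge0 ?powR_ge0// indicE.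
rewrite indicE mem_set//; have [h|h] := leP `|g z| 1; first by rewrite ler_wpDr ?powR_ge0.
rewrite ler_wpDl// -[leLHS]powRr1//; apply: ler_powR; exact: ltW.
Qed.

End one_function.

Section sup_in_time.
Variables (q : R) (ut : R -> 'rV[R]_N -> R).
Hypothesis q1 : 1 < q.
Let q0 : 0 < q := lt_trans ltr01 q1.

Let version t : `[0, T]%classic t -> inLp (lebesgue_rV N) Om q (ut t) ->
 exists g, measT g /\ {ae @leb R N, forall x, Om x -> ut t x = g x}.
Proof.
move=> _ [[g mg hg] _]; exists (g \_ Om); split.
 by apply/(measurable_restrictT _ (open_measurable_rV oOm)).
by apply: filterS hg => x h ox; rewrite patchE mem_set//; exact: h.
Qed.

Definition qpow (h : 'rV[R]_N -> R) : \bar R := (\int[@leb R N]_(x in Om) (`|h x| `^ q)%:E)%E.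

Lemma qpow_LpNorm h : (LpNorm (lebesgue_rV N) Om q h `^ q)%E = qpow h.
Proof.
rewrite /LpNorm poweR_Lnorm ?gt_eqF// /qpow [RHS]integral_mkcond; apply: eq_integral => x _.
rewrite !patchE; case: ifP => // _; by rewrite abse0 poweR0r ?gt_eqF.
Qed.

Let qpow_le (h k : 'rV[R]_N -> R) : ae_measurable (lebesgue_rV N) Om h ->
 ae_measurable (lebesgue_rV N) Om k ->
 (qpow h <= (2 `^ q)%:E * (qpow (h \- k)%R + qpow k))%E.
Proof.
move=> [h' mh hh] [k' mk kk].
have mO := open_measurable_rV oOm.
have mpow (f : 'rV[R]_N -> R) : measurable_fun Om f -> measurable_fun Om (fun x => (`|f x| `^ q)%:E : \bar R).
 move=> mf; apply/mEFinP; apply: (mpowR q).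
 exact: mcomp.
have E1 : qpow h = qpow h'.
 by apply: (integral_version mO (mpow _ mh)); apply: filterS hh => x hx /hx ->.
have E2 : qpow k = qpow k'.
 by apply: (integral_version mO (mpow _ mk)); apply: filterS kk => x hx /hx ->.
have mhk : measurable_fun Om (h' \- k') by exact: measurable_funB.
have E3 : qpow (h \- k)%R = qpow (h' \- k')%R.
 apply: (integral_version mO (mpow _ mhk)).
 by apply: filterS2 hh kk => x hx kx ox; rewrite /= hx// kx.
have pow0 (f : 'rV[R]_N -> R) x : Om x -> (0 <= (`|f x| `^ q)%:E :> \bar R)%E.
 by move=> _; rewrite lee_fin powR_ge0.
rewrite E1 E2 E3 /qpow -(ge0_integralD _ mO (pow0 _) (mpow _ mhk) (pow0 _) (mpow _ mk)).
rewrite -(ge0_integralZl_EFin _ mO); last 3 first.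
- by move=> x _; rewrite adde_ge0// lee_fin powR_ge0.
- by apply: emeasurable_funD; exact: mpow.
- exact: powR_ge0.
apply: ge0_le_integral; [exact: mO|exact: pow0|exact: mpow| |].
 by apply: measurable_funeM; apply: emeasurable_funD; exact: mpow.
move=> x _; rewrite -EFinD -EFinM lee_fin.
apply: le_trans (powRD_le (normr_ge0 _) (normr_ge0 _) (ltW q0)).
apply: ge0_ler_powR; [exact: ltW q0|exact: normr_ge0|by rewrite nnegrE addr_ge0 ?normr_ge0|].
by rewrite -[X in `|X| <= _](subrK (k' x)) ler_normD.
Qed.

(** Near a time [t] with [qpow (ut t) <= M], continuity gives the bound [2^q (1 + M)]; compactness
    of [[0, T]] makes it uniform. *)
Lemma C0Lq_bounded : (forall t, `[0, T]%classic t -> inLp (lebesgue_rV N) Om q (ut t)) ->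
 (forall t, `[0, T]%classic t ->
    (fun s => LpNorm (lebesgue_rV N) Om q (ut s \- ut t)) @ within `[0, T] (nbhs t) --> 0%E) ->
 exists S0 : R, forall t, `[0, T]%classic t -> (qpow (ut t) <= S0%:E)%E.
Proof.
move=> hLp hc.
have fin t : `[0, T]%classic t -> exists M : R, (qpow (ut t) <= M%:E)%E.
 move=> /hLp[_ h]; exists (fine (qpow (ut t))); rewrite fineK// ge0_fin_numE.
  by rewrite -qpow_LpNorm; exact: poweR_lty.
 by apply: integral_ge0 => x _; rewrite lee_fin powR_ge0.
have cT : compact (`[0, T] : set R) by exact: segment_compact.
have [n _ hn] : \forall n \near \oo, `[0, T] `<=`
  (fun t : R => `[0, T]%classic t -> (qpow (ut t) <= n%:R%:E)%E).
 apply: ((compact_near_coveringP _).1 cT) => t tT.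
 have [M hM] := fin t tT.
 have near1 : \forall s \near t, `[0, T]%classic s -> (LpNorm (lebesgue_rV N) Om q (ut s \- ut t)%R < 1)%E.
  have := hc t tT; move/(_ [set y | (y < 1)%E]); apply.
  by apply: open_nbhs_nbhs; split => //=; exact: open_ereal_lt_ereal.
 have [n0 _ hn0] := nbhs_infty_ger (2 `^ q * (1 + M)).
 exists ([set s | `[0, T]%classic s -> (LpNorm (lebesgue_rV N) Om q (ut s \- ut t)%R < 1)%E],
   [set n | (n0 <= n)%N]); first by split => //; exists n0.
 move=> [s n] /= [h1 hn] sT; have {}h1 := h1 sT.
 have h2 : (qpow (ut s \- ut t)%R <= 1)%E.
  rewrite -qpow_LpNorm -(poweR1r q); apply: gt0_ler_poweR; rewrite ?(ltW q0)//.
  - by rewrite in_itv/= Lnorm_ge0 leey.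
  - by rewrite in_itv/= lee01 leey.
  - exact: ltW.
 apply: le_trans (qpow_le (hLp s sT).1 (hLp t tT).1) _.
 apply: (letr ((2 `^ q)%:E * (1 + M%:E))%E).
  by apply: lee_wpmul2l; rewrite ?lee_fin ?powR_ge0// leeD.
 by rewrite -EFinD -EFinM lee_fin; exact: hn0.
by exists n%:R => t tT; exact: (hn n (leqnn n) t tT tT).
Qed.

End sup_in_time.
End borel_versions.

Section localise.
Variables (Om : set 'rV[R]_N) (T p q : R) (u : Z -> R) (Du : 'I_N -> Z -> R)
 (ut : R -> 'rV[R]_N -> R).
Hypotheses (oOm : open Om) (bOm : bounded_set Om) (T0 : 0 < T) (p1 : 1 < p) (q1 : 1 < q)
 (hW : LpW1p Om T p u Du) (hC : C0Lq Om T q u ut).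
Variables (A B : option 'I_N -> R) (d : R).
Hypotheses (d0 : 0 < d) (AB : forall o, A o <= B o)
 (sub : forall z, (forall o, A o - d <= co o z <= B o + d) -> cyl Om T z).
Notation cy := (cyl Om T).
Let p0 : 0 < p := lt_trans ltr01 p1.
Let q0 : 0 < q := lt_trans ltr01 q1.

Section versions.
Variables (ub : Z -> R) (Dub : 'I_N -> Z -> R).
Hypotheses (mub : measT ub) (mDub : forall i, measT (Dub i))
 (uub : {ae mu, forall z, cy z -> u z = ub z})
 (DDub : forall i, {ae mu, forall z, cy z -> Du i z = Dub i z})
 (ub0 : forall z, ~ cy z -> ub z = 0) (Dub0 : forall i z, ~ cy z -> Dub i z = 0).

Lemma itg_version : itg (fun z => `|ub z| `^ p).
Proof.
have [_ _ _ fin] := hW; apply: (Lp_itg mub uub ub0 p1).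
apply: le_lt_trans fin; rewrite [leLHS]integral_mkcond [leRHS]integral_mkcond.
apply: lower_integral_le => t; rewrite !patchE; case: ifP => // _; first exact: poweR_ge0.
by rewrite leeDl// sume_ge0// => i _; exact: poweR_ge0.
Qed.

Lemma itg_Dversion i : itg (fun z => `|Dub i z| `^ p).
Proof.
have [_ _ _ fin] := hW; apply: (Lp_itg (mDub i) (@DDub i) (@Dub0 i) p1).
apply: le_lt_trans fin; rewrite [leLHS]integral_mkcond [leRHS]integral_mkcond.
apply: lower_integral_le => t; rewrite !patchE; case: ifP => // _; first exact: poweR_ge0.
rewrite (bigD1 i)//= addeA addeAC leeDr// adde_ge0 ?poweR_ge0//.
by rewrite sume_ge0// => j _; exact: poweR_ge0.
Qed.

Let iu : itg ub. Proof. exact: (Lp_itg1 oOm bOm T0 mub ub0 p1 itg_version). Qed.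
Let iD i : itg (Dub i).
Proof. exact: (Lp_itg1 oOm bOm T0 (mDub i) (@Dub0 i) p1 (itg_Dversion i)). Qed.

Lemma version_bounded : exists S0 : R, 0 <= S0 /\ {ae lam, forall t : mR R,
  (\int[@leb R N]_x ((`|ub (x, t)| `^ q)%:E) <= S0%:E)%E}.
Proof.
have [hLp hc hut] := hC; have [S0 hS0] := C0Lq_bounded oOm q1 hLp hc.
have S00 : 0 <= S0.
 have h0 : `[0, T]%classic 0 by rewrite /= in_itv/= lexx ltW.
 rewrite -lee_fin; apply: le_trans (hS0 0 h0); apply: integral_ge0 => x _.
 by rewrite lee_fin powR_ge0.
exists S0; split => //.
have sl := slice_version uub.
apply: filterS2 sl hut => t h2 h1.
have [tT|tT] := pselect (`]0, T[%classic t); last first.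
 rewrite integral0_eq ?lee_fin// => x _; rewrite ub0 ?normr0 ?powR0 ?gt_eqF//.
 by case.
have tT' : `[0, T]%classic t by move: tT; rewrite /= !in_itv/= => /andP[/ltW-> /ltW->].
rewrite (slice_LpNorm mub ub0 (h := ut t) q0 tT).
 by rewrite qpow_LpNorm//; exact: hS0.
apply: filterS2 (h1 tT) h2 => x e1 e2 ox; rewrite -e1// e2//.
Qed.

(** The hypothesis concerns single time slices. On the slice at [t] the product is the constant
    [bb None t] times a spatial test function, and the slices are put together by Fubini's
    theorem. *)
Lemma wpd_local i bb : bumps bb ->
 (forall z, tens bb z != 0 -> forall o, A o - d <= co o z <= B o + d) ->
 II (fun z => ub z * tens (dt (Some i) bb) z) = - II (fun z => Dub i z * tens bb z).
Proof.
move=> hb supp.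

have i1 := itg_mul_tens (bumps_dt (Some i) hb) iu.
have i2 := itg_mul_tens hb (iD i).
rewrite (II_slices i1).1 (II_slices i2).1 -(IIN (itg_fubini2 i2)).
apply/esym; apply: (eq_II_ae (itg_fubini2 i1) _ _).2.
 exact: (itgm (itgN (itg_fubini2 i2))).
have [_ _ hS _] := hW.
have su := slice_version uub; have sD := slice_version (@DDub i).
have [_ siu] := II_slices iu; have [_ siD] := II_slices (iD i).
have E0 (F : Z -> R) b t : Rintg (@leb R N) (fun x => F (x, t)) -> bumps b ->
  Rint (@leb R N) (fun x => F (x, t) * (bb None t * xtens b x)) =
  bb None t * Rint (@leb R N) (fun x => F (x, t) * xtens b x).
 move=> iF hb'; rewrite -IIZ; first by congr Rint; ext => x; ring.
 have [M hM] := xtens_bounded hb'.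
 exact: (itg_bnd (measurable_xtens hb') hM iF).
apply: filterS2 (filterI su (filterI sD (filterI siu siD))) hS => t [h2 [h3 [iut iDt]]] h1.
have -> : (fun x => ub (x, t) * tens (dt (Some i) bb) (x, t)) =
  (fun x => ub (x, t) * (bb None t * xtens (dt (Some i) bb) x)).
 by ext => x; rewrite tens_dtxE.
have -> : (fun x => Dub i (x, t) * tens bb (x, t)) =
  (fun x => Dub i (x, t) * (bb None t * xtens bb x)).
 by ext => x; rewrite tensE.
rewrite (E0 ub _ t iut (bumps_dt _ hb)) (E0 (Dub i) _ t iDt hb).
have [->|bt] := eqVneq (bb None t) 0; first by rewrite !mul0r oppr0.
rewrite -mulrN; congr (_ * _).
have [tT|tT] := pselect (`]0, T[%classic t); last first.
 have nc x : ~ cy (x, t) by case.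
 rewrite (_ : (fun x => ub (x, t) * _) = fun=> 0); last first.
  by ext => x; rewrite ub0// mul0r.
 rewrite (_ : (fun x => Dub i (x, t) * _) = fun=> 0); last first.
  by ext => x; rewrite Dub0// mul0r.
 by rewrite /Rint /Rintegral integral0 oppr0.
have [_ /(_ i)[_ wk]] := h1 tT.
have eta : test_fun Om (xtens bb).
 apply: (test_fun_xtens (a' := fun j => A (Some j) - d) (b' := fun j => B (Some j) + d)) => //.
  move=> x hx; suff [] : cy (x, A None) by [].
  apply: sub => -[j|] /=; first by have := hx j; rewrite /= in_itv.
  by rewrite /= lerBlDr lerDl ltW//= (le_trans (AB None))// lerDl ltW.
 move=> x nx j; rewrite /= in_itv/=; apply: (supp (x, t) _ (Some j)).
 by rewrite tensE mulf_neq0.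
have := wk _ eta; have mO := open_measurable_rV oOm.
have mslice (F : Z -> R) : measT F -> measT (fun x => F (x, t)).
 by move=> mF; exact: (mcomp mF (pair2_measurable t)).
have mOm (F : 'rV[R]_N -> R) : measT F -> measurable_fun Om F.
 by move=> mF; apply: (measurable_funS measurableT (@subsetT _ _)).
have E1 : (\int[@leb R N]_(x in Om) (u (x, t) * pderiv i (xtens bb) x)%:E =
  \int[@leb R N]_(x in Om) (ub (x, t) * xtens (dt (Some i) bb) x)%:E)%E.
 apply: (integral_version mO).
  apply/mEFinP; apply: mfunM; apply: mOm; first exact: mslice.
  exact: measurable_xtens (bumps_dt _ hb).
 by apply: filterS h2 => x hx ox; rewrite pderiv_xtens// hx.
have E2 : (\int[@leb R N]_(x in Om) (Du i (x, t) * xtens bb x)%:E =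
  \int[@leb R N]_(x in Om) (Dub i (x, t) * xtens bb x)%:E)%E.
 apply: (integral_version mO).
  apply/mEFinP; apply: mfunM; apply: mOm; first exact: mslice.
  exact: measurable_xtens.
 by apply: filterS h3 => x hx ox; rewrite hx.
move=> E; have {E1 E2}E := etrans (esym E1) (etrans E (congr1 oppe E2)); move: E.
rewrite [in X in X = _ -> _]integral_mkcond [in X in _ = X -> _]integral_mkcond.
have P0 (F : Z -> R) (e : 'rV[R]_N -> R) : (forall z, ~ cy z -> F z = 0) ->
  ((fun x => (F (x, t) * e x)%:E) \_ Om)%E = (fun x => (F (x, t) * e x)%:E).
 move=> F0; ext => x; rewrite patchE; case: ifPn => // nx.
 by rewrite F0 ?mul0r//; case=> /= ox _; move: nx; rewrite mem_set.
by rewrite (P0 _ _ ub0) (P0 _ _ (@Dub0 i)) /Rint /Rintegral => ->; rewrite fineN.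
Qed.

Let bchi : bumps (plateau A B d). Proof. exact: bumps_plateau. Qed.

Definition loc_fun z := ub z * tens (plateau A B d) z.

Definition loc_der i z := Dub i z * tens (plateau A B d) z + ub z * tens (dt (Some i) (plateau A B d)) z.

Lemma itg_loc_der i : itg (loc_der i).
Proof.

apply: itgD; first exact: (itg_mul_tens bchi (iD i)).
exact: (itg_mul_tens (bumps_dt (Some i) bchi) iu).
Qed.

Lemma itg_loc_fun : itg loc_fun.
Proof.

exact: (itg_mul_tens bchi iu).
Qed.

Lemma loc_fun_le z : `|loc_fun z| <= `|ub z|.
Proof.
have /andP[h0 h1] := plateau_01 A B d z.
by rewrite normrM ler_piMr// ger0_norm.
Qed.

Lemma itg_norm_powR (F : Z -> R) r : itg (fun z => `|F z| `^ r) -> measT F ->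
 forall G : Z -> R, measT G -> 0 <= r -> (forall z, `|G z| <= `|F z|) ->
 itg (fun z => `|G z| `^ r).
Proof.
move=> iF mF G mG r0 GF; apply: (itg_dom (g := fun z => `|F z| `^ r)) => //.
 by apply: (mpowR r); exact: mcomp.
move=> z; rewrite ger0_norm ?powR_ge0//; apply: ge0_ler_powR => //.
Qed.

(** The uniform slice bound is integrated over the finite interval []0, T[], outside of which the
    version vanishes. *)
Lemma itg_version_q : itg (fun z => `|ub z| `^ q).
Proof.
have [S0 [S00 hS0]] := version_bounded.
have mq : measT (fun z => `|ub z| `^ q).
 by apply: (mpowR q); exact: mcomp.
apply/integrableP; split; first exact/mEFinP.
have f0 z : (0 <= (`|ub z| `^ q)%:E :> \bar R)%E by rewrite lee_fin powR_ge0.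
have mE : measT (fun z : Z => (`|ub z| `^ q)%:E : \bar R) by exact/mEFinP.
rewrite (eq_integral (fun z => (`|ub z| `^ q)%:E)); last first.
 by move=> z _; rewrite /= ger0_norm ?powR_ge0.
have E := @fubini_tonelli2 _ _ _ _ R (@leb R N) lam _ mE f0.
rewrite E.
apply: (@le_lt_trans _ _ (\int[lam]_t ((S0 * \1_(`]0, T[%classic) t)%:E))%E).
 apply: ae_ge0_le_integral => //.
 - by move=> t _; exact: integral_ge0.
 - exact: (@measurable_fun_fubini_tonelli_G _ _ _ _ _ (@leb R N) (fun z => (`|ub z| `^ q)%:E)).
 - by move=> t _; rewrite lee_fin mulr_ge0.
 - by apply/mEFinP; apply: mfunM.
 apply: filterS hS0 => t ht _; have [tT|nt] := pselect (`]0, T[%classic t).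
  by rewrite indicE mem_set// mulr1.
 rewrite indicE memNset// mulr0 /fubini_G integral0_eq// => x _.
 by rewrite ub0 ?normr0 ?powR0 ?gt_eqF//; case.
have i1 : Rintg lam (fun t => S0 * \1_(`]0, T[%classic) t).
 apply: itgZ; apply: itg_indic => //.
 rewrite -[ltLHS]/(@lebesgue_measure R `]0, T[%classic) lebesgue_measure_itv/=.
 by case: ifP => _; rewrite ?ltry// -EFinB ltry.
by rewrite -(IIE i1) ltry.
Qed.

Lemma local_data_loc : local_data loc_fun loc_der p q (Num.max q p).
Proof.
have [S0 [_ hS0]] := version_bounded.
split.
- exact: itg_loc_fun.
- exact: itg_loc_der.
- move=> i b hb.
 (* The plateau is transferred to the test function, whose support then lies where [wpd_local]
    applies. *)
 have hcb : bumps (fun o x => plateau A B d o x * b o x).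
  by move=> o; apply: bump1_mul; [exact: bchi|exact: (hb o).1].
 have supp z : tens (fun o x => plateau A B d o x * b o x) z != 0 ->
   forall o, A o - d <= co o z <= B o + d.
  rewrite tens_mul mulf_eq0 negb_or => /andP[nz _] o.
  by have /andP[/ltW-> /ltW->] := plateau_supp d0 nz o.
 have E := wpd_local i hcb supp.
 have [M1 hM1] := tens_bounded (bumps_dt (Some i) hcb).
 have i1 := itg_mul_tens (bumps_dt (Some i) hcb) iu.
 have i2 := itg_mul_tens hb (itg_mul_tens (bumps_dt (Some i) bchi) iu).
 have i3 := itg_mul_tens hcb (iD i).
 rewrite (_ : (fun z => loc_fun z * _) = fun z => ub z * tens (dt (Some i) (fun o x => plateau A B d o x * b o x)) z -
   ub z * tens (dt (Some i) (plateau A B d)) z * tens b z); last first.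
  by ext => z; rewrite /loc_fun (tens_dt_mul _ _ bchi hb); ring.
 rewrite (IIB i1 i2) E -opprD -(IID i3 i2); congr (- II _).
 by ext => z; rewrite /loc_der tens_mul; ring.
- move=> i.
 have [M1 hM1] := tens_bounded (bumps_dt (Some i) bchi).
 have mD := itgm (itg_loc_der i).
 apply: (itg_dom (g := fun z => 2 `^ p * (`|Dub i z| `^ p + M1 `^ p * `|ub z| `^ p))).
 + by apply: (mpowR p); exact: mcomp.
 + move=> z; rewrite ger0_norm ?powR_ge0//.
  have /andP[h0 h1] := plateau_01 A B d z.
  have M10 : 0 <= M1 by exact: le_trans (hM1 z).
  rewrite -powRM//; apply: le_trans (powRD_le (normr_ge0 _) (mulr_ge0 M10 (normr_ge0 _)) (ltW p0)).
  powR_mono; rewrite ?(ltW p0) ?addr_ge0 ?mulr_ge0 ?normr_ge0//.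
  apply: le_trans (ler_normD _ _) _; rewrite !normrM lerD//.
   by rewrite ler_piMr// ger0_norm.
  by rewrite mulrC ler_wpM2r.
 + by apply: itgZ; apply: itgD; [exact: itg_Dversion|apply: itgZ; exact: itg_version].
- exists S0; apply: filterS hS0 => t; apply: le_trans; apply: lower_integral_le => x.
  by rewrite lee_fin powR_ge0.
 rewrite lee_fin; powR_mono; rewrite ?(ltW q0) ?normr_ge0//.
 exact: loc_fun_le.
- have mw := itgm itg_loc_fun; have [h|h] := leP q p.
  apply: (itg_norm_powR itg_version mub mw (ltW p0)); exact: loc_fun_le.
 apply: (itg_norm_powR itg_version_q mub mw (ltW q0)); exact: loc_fun_le.
Qed.

Lemma loc_fun_box z : (forall o, A o <= co o z <= B o) -> loc_fun z = ub z.
Proof. by move=> hz; rewrite /loc_fun plateau_1 ?mulr1. Qed.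

Lemma loc_der_box i z : obox A B z -> loc_der i z = Dub i z.
Proof.
move=> hz; rewrite /loc_der plateau_1//; last first.
 by move=> o; have := hz o; rewrite /= in_itv/= => /andP[/ltW-> /ltW->].
rewrite tens_dt; have -> : derive1 (plateau A B d (Some i)) (co (Some i) z) = 0.
 rewrite derive1E; suff : is_derive (co (Some i) z) (1 : R) (plateau A B d (Some i)) 0 by case.
 apply: (@near_eq_is_derive _ R R (cst 1)).
 have /andP[h1 h2] : A (Some i) < co (Some i) z < B (Some i) by have := hz (Some i); rewrite /= in_itv.
 near=> y; have ya : A (Some i) < y by near: y; exact: lt_nbhsr.
 have yb : y < B (Some i) by near: y; exact: lt_nbhsl.
 rewrite /plateau !sstep_ge1 ?mulr1// ler_pdivlMr// mul1r; lra.
by rewrite mul0r mulr0 addr0 mulr1.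
Unshelve. all: by end_near. Qed.

End versions.

Theorem localisation : exists w Dw, [/\ local_data w Dw p q (Num.max q p),
 {ae mu, forall z, (forall o, A o <= co o z <= B o) -> u z = w z} &
 forall i, {ae mu, forall z, obox A B z -> Du i z = Dw i z}].
Proof.
have [mu_ mD _ _] := hW.
have [ub [mub uub ub0]] := borel_version oOm mu_.
pose Dv i := projT1 (cid (borel_version oOm (mD i))).
have hDv i : [/\ measT (Dv i), {ae mu, forall z, cy z -> Du i z = Dv i z} &
  forall z, ~ cy z -> Dv i z = 0] by rewrite /Dv; case: cid.
have mDv i := let: And3 h _ _ := hDv i in h.
have DDv i := let: And3 _ h _ := hDv i in h.
have Dv0 i := let: And3 _ _ h := hDv i in h.
have incl z : (forall o, A o <= co o z <= B o) -> cy z.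
 move=> hz; apply: sub => o; have /andP[h1 h2] := hz o.
 by rewrite (le_trans _ h1) ?gerBl ?(ltW d0)//= (le_trans h2)// lerDl ltW.
exists (loc_fun ub), (loc_der ub Dv); split.
- exact: local_data_loc mub mDv uub DDv ub0 Dv0.
- by apply: filterS uub => z hz bz; rewrite loc_fun_box// hz//; exact: incl.
- move=> i; apply: filterS (DDv i) => z hz bz; rewrite loc_der_box// hz//; apply: incl => o.
 by have := bz o; rewrite /= in_itv/= => /andP[/ltW-> /ltW->].
Qed.

End localise.

End local_data.

(** * From the energy class to the inequalities on boxes *)

Section energy_class_data.
Context {R : realType}.

(** The factor [2^P] is for arguments between 1/2 and 1, where a larger exponent makes the power
    smaller. *)
Lemma pow_above (r P k x : R) : 0 <= r <= P -> 2^-1 <= k -> k < x ->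
 x `^ r <= 2 `^ P * x `^ P.
Proof.
move=> /andP[r0 rP] k2 kx; have x2 : 2^-1 <= x by exact: le_trans k2 (ltW kx).
have x0 : 0 < x by apply: lt_le_trans x2; rewrite invr_gt0.
have P0 : 0 <= P by exact: le_trans rP.
rewrite -powRM ?(ltW x0)//; have [x1|x1] := leP x 1.
 have h : 1 <= (2 * x) `^ P.
  apply: (letr (1 `^ P)); first by rewrite powR1.
  by powR_mono; rewrite ?mulr_ge0 ?(ltW x0)//; lra.
 apply: le_trans h; apply: (letr (1 `^ r)); last by rewrite powR1.
 apply: ge0_ler_powR => //; rewrite nnegrE ?(ltW x0)//.
apply: (letr (x `^ P)); first by rewrite ler_powR// ltW.
by powR_mono; rewrite ?mulr_ge0 ?(ltW x0)//; lra.
Qed.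

(** With [v = sgb plus * w] and the level [sgb plus * k], both signs of the energy inequality become
    one statement about the positive part of [v - k]. *)
Definition sgb (plus : bool) : R := if plus then 1 else - 1.

Lemma sgbK plus x : sgb plus * (sgb plus * x) = x.
Proof. by rewrite /sgb; case: plus; rewrite ?mul1r// !mulN1r opprK. Qed.

Lemma norm_sgb plus x : `|sgb plus * x| = `|x|.
Proof. by rewrite /sgb; case: plus; rewrite ?mul1r// mulN1r normrN. Qed.

Lemma sgn_part_sgb plus x : sgn_part plus (sgb plus * x) = Num.max x 0.
Proof. by rewrite /sgn_part /sgb; case: plus; rewrite ?mul1r// mulN1r opprK. Qed.

Lemma spow_sgb plus x g : spow (sgb plus * x) g = sgb plus * spow x g.
Proof. by rewrite /spow norm_sgb; ring. Qed.

Lemma spow_gt0 (x g : R) : 0 < x -> spow x g = x `^ g.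
Proof.
move=> x0; rewrite /spow gtr0_norm// -[X in _ * X]powRr1 ?(ltW x0)// -powRD.
 by rewrite subrK.
by rewrite (gt_eqF x0) implybT.
Qed.

Lemma spow_le0 (x g : R) : x <= 0 -> spow x g <= 0.
Proof. by move=> x0; rewrite /spow mulr_ge0_le0// powR_ge0. Qed.

Section halves.
Variables (h k : R).
Hypotheses (h2 : 2^-1 < h) (k0 : 0 < k).
Let h0 : 0 < h. Proof. by apply: lt_trans h2; rewrite invr_gt0. Qed.

Lemma half_part_le x : Num.max (spow x h - spow k h) 0 ^+ 2 <= ((k < x)%R)%:R * x `^ (h * 2).
Proof.
rewrite (spow_gt0 _ k0); have [kx|xk] := ltP k x.
 have x0 : 0 < x by exact: lt_trans kx.
 rewrite (spow_gt0 _ x0) mul1r max_l; last first.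
  by rewrite subr_ge0; powR_mono; rewrite ?(ltW h0) ?(ltW k0) ?(ltW x0) ?(ltW kx).
 rewrite powRrM powR_mulrn ?powR_ge0//; rewrite ler_sqr ?nnegrE ?powR_ge0 ?gerBl ?powR_ge0//.
 by rewrite subr_ge0; powR_mono; rewrite ?(ltW h0) ?(ltW k0) ?(ltW x0) ?(ltW kx).
rewrite mul0r max_r ?expr0n// subr_le0; have [x0|x0] := leP x 0.
 by apply: le_trans (spow_le0 _ x0) _; rewrite powR_ge0.
rewrite (spow_gt0 _ x0); powR_mono; rewrite ?(ltW h0) ?(ltW k0) ?(ltW x0)//.
Qed.

(** As [h > 1/2] and [k <= x], [(k/x)^h <= (k/x)^(1/2) <= (1 + k/x)/2]. Hence [x^h - k^h] is at
    least half of [(1 - k/kap) x^h]; squaring produces the 4. *)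
Lemma half_part_ge kap x : k < kap -> kap < x ->
 (1 - k / kap) ^+ 2 * x `^ (h * 2) <= 4 * Num.max (spow x h - spow k h) 0 ^+ 2.
Proof.
move=> kk kx; have kap0 : 0 < kap by exact: lt_trans kk.
have x0 : 0 < x by exact: lt_trans kx.
rewrite (spow_gt0 _ k0) (spow_gt0 _ x0) powRrM powR_mulrn ?powR_ge0// -exprMn.
have -> : 4 = 2 ^+ 2 :> R by rewrite -natrX.
rewrite -exprMn.
have y1 : k / x <= 1 by rewrite ler_pdivrMr// mul1r (le_trans (ltW kk) (ltW kx)).
have y0 : 0 <= k / x by rewrite divr_ge0// ltW.
have key : (k / x) `^ h <= (1 + k / x) / 2.
 apply: (letr ((k / x) `^ (2^-1))).
  have [->|yn] := eqVneq (k / x) 0; first by rewrite !powR0 ?gt_eqF ?invr_gt0.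
  by apply: ger_powR; rewrite ?(ltW h2)// y1 andbT lt_neqAle eq_sym yn.
 rewrite powR12_sqrt//; set s := Num.sqrt _.
 have <- : s ^+ 2 = k / x by rewrite sqr_sqrtr.
 have := sqr_ge0 (s - 1); rewrite !expr2; nra.
have kp : k `^ h = (k / x) `^ h * x `^ h.
 by rewrite -powRM ?(ltW x0)// mulfVK ?gt_eqF.
have c0 : 0 <= 1 - k / kap by rewrite subr_ge0 ler_pdivrMr// mul1r ltW.
have c1 : k / x <= k / kap by rewrite ler_wpM2l ?(ltW k0)// lef_pV2 ?posrE// ltW.
have X0 := powR_ge0 x h.
have M0 : 0 <= 2 * Num.max (x `^ h - k `^ h) 0 by rewrite mulr_ge0// le_max lexx orbT.
have M1 : 0 <= (1 - k / kap) * x `^ h by exact: mulr_ge0.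
rewrite ler_sqr ?nnegrE//.
apply: (letr (2 * (x `^ h - k `^ h))); last by rewrite ler_wpM2l// le_max lexx.
rewrite kp -[X in _ * (X - _)]mul1r -mulrBl mulrA ler_wpM2r//.
move: key c1; move: ((k / x) `^ h) (k / x) (k / kap) => A B D; lra.
Qed.

End halves.

Context {N : nat}.

Lemma enorm_le (x : 'rV[R]_N) (c : R) : 0 <= c -> (forall i, `|x ord0 i| <= c) ->
 enorm x <= N%:R * c.
Proof.
move=> c0 hx; rewrite /enorm -[leRHS]ger0_norm ?mulr_ge0// -sqrtr_sqr ler_wsqrtr//.
apply: (letr (\sum_(i < N) c ^+ 2)).
 by apply: ler_sum => i _; rewrite -real_normK ?num_real// ler_sqr ?nnegrE.
rewrite sumr_const card_ord exprMn -[leLHS]mulr_natl; apply: ler_wpM2r; first exact: sqr_ge0.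
by rewrite -natrX ler_nat; case: (N) => // m; rewrite expnS expn1 leq_pmulr.
Qed.

End energy_class_data.

Section integral_comparison.
Context d (X : measurableType d) (R : realType) (m : {measure set X -> \bar R}).
Variables (D : set X) (F G : X -> R).
Hypotheses (F0 : forall z, 0 <= F z) (G0 : forall z, 0 <= G z).

Lemma set_integral_le : Rintg m G -> {ae m, forall z, D z -> F z <= G z} ->
 (\int[m]_(z in D) (F z)%:E <= (Rint m G)%:E)%E.
Proof.
move=> iG FG; rewrite IIE// integral_mkcond; apply: lower_integral_ae_le.
- by apply/mEFinP; exact: (itgm iG).
- by move=> z; rewrite patchE; case: ifP => // _; rewrite lee_fin.
- by move=> z; rewrite lee_fin.
by apply: filterS FG => z h; rewrite patchE; case: ifPn; rewrite ?inE => h'; rewrite lee_fin//; exact: h.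
Qed.

Lemma set_integral_ge : measT G ->
 {ae m, forall z, G z != 0 -> D z /\ G z <= F z} ->
 (\int[m]_z (G z)%:E <= \int[m]_(z in D) (F z)%:E)%E.
Proof.
move=> mG GF; rewrite [leRHS]integral_mkcond; apply: lower_integral_ae.
- exact/mEFinP.
- by move=> z; rewrite lee_fin.
- by move=> z; rewrite patchE; case: ifP => // _; rewrite lee_fin.
apply: filterS GF => z h; have [->|/h[Dz le]] := eqVneq (G z) 0.
 by rewrite patchE; case: ifP => // _; rewrite lee_fin.
by rewrite patchE mem_set// lee_fin.
Qed.

End integral_comparison.

Section energy_class_energy.
Context {R : realType} {N : nat}.
Notation Z := ('rV[R]_N * mR R)%type.
Notation mu := (@leb R N \x @lebesgue_measure R)%E.
Notation lam := (@lebesgue_measure R).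
Notation itg := (Rintg mu).
Notation II := (Rint mu).
Implicit Types (o : option 'I_N) (z : Z).

Section cutoff_gradient.
Variables (a b gl gr : option 'I_N -> R) (gam p : R).
Hypotheses (gl0 : forall o, 0 < gl o) (gr0 : forall o, 0 < gr o) (gam0 : 0 < gam)
 (ggl : forall i, gam <= gl (Some i)) (ggr : forall i, gam <= gr (Some i)) (p0 : 0 < p)
 (ggt : gam `^ p <= gl None).
Notation eta := (xtens (cutf a b gl gr 1)).
Notation phi := (cutf a b gl gr 1 None).
Let hb : bumps (cutf a b gl gr 1). Proof. exact: bumps_cutf. Qed.

Lemma eta_phi z : eta z.1 `^ p * phi z.2 = tens (cutf a b gl gr p) z.
Proof. by rewrite tens_cutfE. Qed.

Lemma grad_cutoff z :
 enorm (grad eta z.1) `^ p * phi z.2 <= (4 * N%:R) `^ p * gam `^ (- p) * \1_(obox a b) z.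
Proof.
case: z => x t /=; have phi0 := cutf_ge0 a b gl gr 1 None t.
have phi1 := cutf_le1 a b gl gr 1 None t.
have [->|pn] := eqVneq (phi t) 0; first by rewrite mulr0 !mulr_ge0 ?powR_ge0.
have E i : phi t * grad eta x ord0 i = tens (dt (Some i) (cutf a b gl gr 1)) ((x, t) : Z).
 by rewrite /grad mxE (pderiv_xtens _ _ hb) tens_dtxE.
have le i := @tens_dt_cutf_le _ _ a b gl gr gl0 gr0 1 (Some i) ((x, t) : Z) ltr01.
rewrite indicE; have [xb|xb] := boolP (((x, t) : Z) \in obox a b); last first.
 have g0 i : grad eta x ord0 i = 0.
  apply/eqP; rewrite -(mulrI_eq0 _ (lregP pn)) E.
  by have := le i; rewrite indicE (negbTE xb) mulr0 normr_le0.
 rewrite mulr0 (_ : enorm _ = 0) ?powR0 ?gt_eqF ?mul0r//.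
 by rewrite /enorm big1 ?sqrtr0// => i _; rewrite g0 expr0n.
rewrite mulr1; apply: (letr (enorm (grad eta x) `^ p)); first by rewrite ler_piMr ?powR_ge0.
have g0 := ltW gam0.
have -> : gam `^ (- p) = gam^-1 `^ p by rewrite -[gam^-1]powR_inv1// -powRrM mulN1r.
rewrite -powRM ?invr_ge0 ?mulr_ge0//; powR_mono; rewrite ?(ltW p0) ?mulr_ge0 ?invr_ge0 ?sqrtr_ge0//.
have -> : 4 * N%:R * gam^-1 = N%:R * (4 / gam) by ring.
apply: enorm_le => [|i]; first by rewrite divr_ge0.
rewrite /grad mxE (pderiv_xtens _ _ hb) /xtens /ftens (bigD1 i)//= normrM -[leRHS]mulr1.
have dE : dt (Some i) (cutf a b gl gr 1) (Some i) = derive1 (cutf a b gl gr 1 (Some i)).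
 by rewrite /dt eqxx.
apply: ler_pM; rewrite ?normr_ge0//.
 rewrite dE; apply: le_trans (derive1_cutf_le a b gl0 gr0 _ _ ltr01) _.
 apply: (letr (2 / gl (Some i) + 2 / gr (Some i))).
  by rewrite /cutw !mul1r ler_piMr ?lern1 ?leq_b1// addr_ge0// divr_ge0// ltW.
 rewrite (_ : 4 / gam = 2 / gam + 2 / gam); last by ring.
 by apply: lerD; rewrite ler_wpM2l// lef_pV2// posrE.
rewrite (eq_bigr (fun j => cutf a b gl gr 1 (Some j) (xco j x))).
 by rewrite ger0_norm ?prodr_ge0// => [|j _]; [apply: prod_le1 => j; rewrite cutf_ge0 cutf_le1|exact: cutf_ge0].
by move=> j ji; rewrite /dt (inj_eq (@Some_inj _)) (negbTE ji).
Qed.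

(** The factor at the top end decreases, so it contributes negatively to the derivative and only the
    gap at the bottom enters the positive part. This is why the gap at the top may be arbitrarily
    small. *)
Lemma phi_deriv t : Num.max (derive1 phi t) 0 <= 2 * gam `^ (- p) * ((a None < t < b None)%R)%:R.
Proof.
have g0 := gl0 None; have r0 := gr0 None.
have gp : 0 <= 2 * gam `^ (- p) by rewrite mulr_ge0 ?powR_ge0.
have gpE : (gl None)^-1 <= gam `^ (- p).
 by rewrite powRN lef_pV2 ?posrE ?powR_gt0.
rewrite derive1_cutf /cutw !mul1r; case: (boolP (a None < t < b None)).
 move=> _; rewrite mulr1 ge_max gp andbT lerBlDr.
 apply: (letr (2 * gam `^ (- p))); last first.
  by rewrite lerDl mulr_ge0 ?ek_ge0// mulr_ge0 ?ek_ge0// invr_ge0 ltW.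
 rewrite -[leRHS]mulr1; apply: ler_pM; rewrite ?ek_ge0 ?ek0_le1//.
  by rewrite mulr_ge0 ?ek_ge0// invr_ge0 ltW.
 by apply: ler_pM; rewrite ?ek_ge0 ?ek2_le2 ?invr_ge0 ?(ltW g0).
rewrite negb_and -!leNgt mulr0 => /orP[h|h].
 by rewrite !(ek_div_le0 _ g0) ?subr_le0// !mul0r subr0 maxxx.
by rewrite !(ek_div_le0 _ r0) ?subr_le0// mul0r !mulr0 subr0 maxxx.
Qed.

Lemma eta_dphi z : eta z.1 `^ p * Num.max (derive1 phi z.2) 0 <=
 2 * gam `^ (- p) * \1_(obox a b) z.
Proof.
have g1 := phi_deriv z.2; have c0 : 0 <= 2 * gam `^ (- p) by rewrite mulr_ge0 ?powR_ge0.
have M0 : 0 <= Num.max (derive1 phi z.2) 0 by rewrite le_max lexx orbT.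
have e0 : 0 <= eta z.1 by apply: prodr_ge0 => i _; exact: cutf_ge0.
have [->|en] := eqVneq (eta z.1) 0; first by rewrite powR0 ?gt_eqF// mul0r mulr_ge0.
have e1 : eta z.1 <= 1 by apply: prod_le1 => i; rewrite cutf_ge0 cutf_le1.
have zb i : a (Some i) < co (Some i) z < b (Some i).
 apply: (cutf_supp gl0 gr0 ltr01); apply: contraNN en => /eqP h.
 by rewrite /xtens /ftens (bigD1 i)//= [cutf _ _ _ _ _ _ _]h mul0r.
have -> : \1_(obox a b) z = ((a None < z.2 < b None)%R)%:R :> R.
 rewrite indicE; have [h|h] := boolP (a None < z.2 < b None).
  by rewrite mem_set// => -[i|] /=; rewrite in_itv/=.
 by rewrite memNset// => /(_ None)/=; rewrite in_itv/=; exact/negP.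
apply: le_trans _ g1; rewrite ler_piMl//.
apply: (letr (1 `^ p)); last by rewrite powR1.
by powR_mono; rewrite ?(ltW p0).
Qed.

End cutoff_gradient.

(** The leading 4 comes from [half_part_ge]; [(4 N)^p] and 2 bound the spatial gradient and the time
    derivative of the cut-off, and the last 1 belongs to the source. *)
Definition energyC (C p P : R) : R := 4 * C * (2 `^ P * ((4 * N%:R) `^ p + 2) + 1).

Lemma ppart_pow_le (r P k x : R) : 0 < r <= P -> 2^-1 <= k ->
 Num.max (x - k) 0 `^ r <= ((k < x)%R)%:R * (2 `^ P * `|x| `^ P).
Proof.
move=> /andP[r0 rP] k2; have [kx|xk] := ltP k x; last first.
 by rewrite max_r ?subr_le0// powR0 ?gt_eqF// mul0r.
have k0 : 0 < k by apply: lt_le_trans k2; rewrite invr_gt0.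
have x0 : 0 < x by exact: lt_trans kx.
rewrite mul1r gtr0_norm// max_l ?subr_ge0 ?(ltW kx)//.
apply: (le_trans _ (pow_above (r := r) _ k2 kx)); last by rewrite (ltW r0).
by powR_mono; rewrite ?(ltW r0) ?(ltW x0) ?subr_ge0 ?(ltW kx)// gerBl ltW.
Qed.

Lemma indic_above (v : Z -> R) k z : \1_(above v k) z = ((k < v z)%R)%:R :> R.
Proof. rewrite indicE; have [h|h] := boolP (k < v z); first by rewrite mem_set.
by rewrite memNset//; exact/negP. Qed.

Section raw.
Variables (Om : set 'rV[R]_N) (T alpha p C : R) (delta : 'I_N -> R) (f f' u w : Z -> R)
 (Du Dw : 'I_N -> Z -> R) (ut : R -> 'rV[R]_N -> R) (A B : option 'I_N -> R) (d : R) (plus : bool).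
Notation q := (alpha + 1).
Notation P := (Num.max q p).
Notation v := (fun z => sgb plus * w z).
Notation Dv := (fun i z => sgb plus * Dw i z).
Hypotheses (T0 : 0 < T) (p1 : 1 < p) (alpha0 : 0 < alpha) (C0 : 0 < C) (d0 : 0 < d)
 (LD : local_data w Dw p q P) (AB : forall o, A o <= B o)
 (sub : forall z, (forall o, A o - d <= co o z <= B o + d) -> cyl Om T z)
 (hu : {ae mu, forall z, (forall o, A o <= co o z <= B o) -> u z = w z})
 (hD : forall i, {ae mu, forall z, obox A B z -> Du i z = Dw i z})
 (hdl : forall i, 0 <= delta i)
 (hf : {ae mu, forall z, cyl Om T z -> f z = f' z})
 (hut : {ae lam, forall t, `]0, T[%classic t -> {ae @leb R N, forall x, Om x -> u (x, t) = ut t x}})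
 (en : forall (k : R) (eta : 'rV[R]_N -> R) (phi : R -> R),
  test_fun Om eta -> (forall x, 0 <= eta x) ->
  smooth phi -> (forall t, 0 <= t <= T -> 0 <= phi t) ->
  (exists2 e, 0 < e & forall t, 0 <= t < e -> phi t = 0) ->
  energy_inequality Om T alpha p delta f u Du ut C k eta phi plus).
Variables (a b gl gr : option 'I_N -> R) (gam k : R).
Hypotheses (Aa : forall o, A o <= a o) (bB : forall o, b o <= B o)
 (gl0 : forall o, 0 < gl o) (gr0 : forall o, 0 < gr o) (gam01 : 0 < gam <= 1)
 (ggl : forall i, gam <= gl (Some i)) (ggr : forall i, gam <= gr (Some i))
 (ggt : gam `^ p <= gl None) (k2 : 2^-1 <= k) (isrc : itg (source v f' p k a b gl gr)).
Notation eta := (xtens (cutf a b gl gr 1)).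
Notation phi := (cutf a b gl gr 1 None).
Notation tau := (tens (cutf a b gl gr p)).
Let p0 : 0 < p := lt_trans ltr01 p1.
Let k0 : 0 < k. Proof. by apply: lt_le_trans k2; rewrite invr_gt0. Qed.
Let gam0 : 0 < gam. Proof. by case/andP: gam01. Qed.
Let hb : bumps (cutf a b gl gr 1). Proof. exact: bumps_cutf. Qed.

Let inAB z : obox a b z -> forall o, A o <= co o z <= B o.
Proof.
move=> h o; have := h o; rewrite /= in_itv/= => /andP[h1 h2].
by rewrite (le_trans (Aa o) (ltW h1)) (le_trans (ltW h2) (bB o)).
Qed.

Let cylAB z : (forall o, A o <= co o z <= B o) -> cyl Om T z.
Proof.
move=> hz; apply: sub => o; have /andP[h1 h2] := hz o.
by rewrite (le_trans _ h1) ?gerBl ?(ltW d0)//= (le_trans h2)// lerDl ltW.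
Qed.

Let incl z : obox a b z -> cyl Om T z.
Proof. by move=> /inAB/cylAB. Qed.

Let tau0 z : 0 <= tau z. Proof. exact: tens_cutf_ge0. Qed.
Let tau_supp z : ~ obox a b z -> tau z = 0.
Proof. by move=> h; apply/eqP; apply: contra_notT h; exact: tens_cutf_supp. Qed.

Let eta0 x : 0 <= eta x. Proof. by apply: prodr_ge0 => i _; exact: cutf_ge0. Qed.
Let phi0 t : 0 <= phi t. Proof. exact: cutf_ge0. Qed.
Let sg0 (s : R) : 0 <= sgn_part plus s.
Proof. by rewrite /sgn_part; case: plus; rewrite le_max lexx orbT. Qed.

Let A0 : 0 < A None.
Proof.
have : cyl Om T ((\row_i A (Some i), A None) : Z).
 by apply: cylAB => -[i|] /=; rewrite ?mxE lexx AB.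
by case=> _ /=; rewrite in_itv/= => /andP[].
Qed.

Let E : energy_inequality Om T alpha p delta f u Du ut C (sgb plus * k) eta phi plus.
Proof.
apply: en => //.
- apply: (test_fun_xtens (a' := fun j => A (Some j)) (b' := fun j => B (Some j))) => //.
  move=> x hx; suff [] : cyl Om T (x, A None) by [].
  by apply: cylAB => -[j|] /=; [have := hx j; rewrite /= in_itv|rewrite lexx AB].
 move=> x nx j; rewrite /= in_itv/=.
 have : cutf a b gl gr 1 (Some j) (xco j x) != 0.
  by apply: contraNN nx => /eqP h; rewrite /xtens /ftens (bigD1 j)//= h mul0r.
 move=> /(cutf_supp gl0 gr0 ltr01)/andP[h1 h2].
 by rewrite (le_trans (Aa _) (ltW h1)) (le_trans (ltW h2) (bB _)).
- by apply: Cinf_smooth; exact: (hb None).1.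
- exists (A None) => // t /andP[_ tA]; apply/eqP; apply: contraTT isT.
 move=> /(cutf_supp gl0 gr0 ltr01)/andP[h1 _].
 by move: (lt_trans (le_lt_trans (Aa None) h1) tA); rewrite ltxx.
Qed.

Let rhs := energy_rhs v f' p P k gam a b gl gr.
Let m := mass v P k a b.
Let S := II (source v f' p k a b gl gr).

Let imass : itg (fun z => `|v z| `^ P * (\1_(above v k) z * \1_(obox a b) z)).
Proof.
have mw := itgm (itgZ (sgb plus) (ld_w LD)).
apply: (@mass_itg _ _ _ P k A B a b mw) => //.
have mI : measT (\1_(obox A B) : Z -> R) by apply: mindic; exact: mset_obox.
have := itg_bnd mI (M := 1) _ (ld_P LD); rewrite (_ : (fun z => `|v z| `^ P * _) = (fun z => `|w z| `^ P * \1_(obox A B) z)).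
 by apply=> z; rewrite indicE; case: (_ \in _); rewrite ?normr1 ?normr0.
by ext => z; rewrite norm_sgb.
Qed.

Let uv z : u z = w z -> u z = sgb plus * v z.
Proof. by rewrite sgbK. Qed.

Let pP : p <= P. Proof. by rewrite le_max lexx orbT. Qed.
Let qP : q <= P. Proof. by rewrite le_max lexx. Qed.
Let q0 : 0 < q. Proof. by rewrite ltr_wpDl// ltW. Qed.
Let h2 : 2^-1 < q / 2.
Proof. by rewrite -[ltLHS]mul1r ltr_pM2r ?invr_gt0// ltrDr. Qed.

Let rhs_le : (C%:E * \int[mu]_(z in cyl Om T)
    (sgn_part plus (u z - sgb plus * k) `^ p * enorm (grad eta z.1) `^ p
    * phi z.2)%:E
  + C%:E * \int[mu]_(z in cyl Om T)
    (sgn_part plus (spow (u z) (q / 2) - spow (sgb plus * k) (q / 2)) ^+ 2 * eta z.1 `^ p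
    * Num.max (phi^`()%classic z.2) 0)%:E
  + C%:E * \int[mu]_(z in cyl Om T)
    (sgn_part plus (u z - sgb plus * k) * `|f z| * eta z.1 `^ p * phi z.2)%:E
 <= (energyC C p P / 4 * rhs)%:E)%E.
Proof.
pose c1 := 2 `^ P * ((4 * N%:R) `^ p * gam `^ (- p)).
pose c2 := 2 `^ P * (2 * gam `^ (- p)).
pose G z := `|v z| `^ P * (\1_(above v k) z * \1_(obox a b) z).
have G0 z : 0 <= G z by rewrite !mulr_ge0 ?powR_ge0.
have P0 : 0 <= P by rewrite le_max (ltW p0) orbT.
have I1 : (\int[mu]_(z in cyl Om T) (sgn_part plus (u z - sgb plus * k) `^ p *
  enorm (grad eta z.1) `^ p * phi z.2)%:E <= (c1 * m)%:E)%E.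
 have iG := itgZ c1 imass; rewrite -(IIZ c1 imass).
 apply: set_integral_le => //.
 - by move=> z; rewrite mulr_ge0 ?phi0// mulr_ge0 ?powR_ge0.
 - by move=> z; rewrite mulr_ge0 ?G0// /c1 !mulr_ge0 ?powR_ge0.
 apply: filterS hu => z hz _; rewrite -mulrA.
 have g1 := grad_cutoff a b gl0 gr0 gam0 ggl ggr p0 z.
 have g0 : 0 <= enorm (grad eta z.1) `^ p * phi z.2 by rewrite mulr_ge0 ?powR_ge0 ?phi0.
 have [zb|zb] := pselect (obox a b z); last first.
  move: g1; rewrite indicE memNset// mulr0 => g1.
  rewrite (le_anti (_ : enorm _ `^ p * phi z.2 <= 0 <= _)) ?g1//.
  by rewrite !mulr0.
 rewrite (uv (hz (inAB zb))) -mulrBr sgn_part_sgb.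
 move: g1; rewrite indicE mem_set// !mulr1 => g1.
 apply: le_trans (ler_pM (powR_ge0 _ _) g0 (ppart_pow_le (v z) _ k2) g1) _.
  by rewrite p0/=; exact: pP.
 by rewrite indic_above /c1; apply: le_of_eq; ring.
have I2 : (\int[mu]_(z in cyl Om T) (sgn_part plus (spow (u z) (q / 2) - spow (sgb plus * k) (q / 2)) ^+ 2 *
  eta z.1 `^ p * Num.max (phi^`()%classic z.2) 0)%:E <= (c2 * m)%:E)%E.
 have iG := itgZ c2 imass; rewrite -(IIZ c2 imass).
 apply: set_integral_le => //.
 - by move=> z; rewrite mulr_ge0 ?le_max ?lexx ?orbT// mulr_ge0 ?powR_ge0 ?sqr_ge0.
 - by move=> z; rewrite mulr_ge0 ?G0// /c2 !mulr_ge0 ?powR_ge0.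
 apply: filterS hu => z hz _.
 have g2 := eta_dphi a b gl0 gr0 gam0 p0 ggt z.
 have g0 : 0 <= eta z.1 `^ p * Num.max (phi^`()%classic z.2) 0.
  by rewrite mulr_ge0 ?powR_ge0// le_max lexx orbT.
 rewrite -mulrA; have [zb|zb] := pselect (obox a b z); last first.
  move: g2; rewrite indicE memNset// mulr0 => g2.
  rewrite (le_anti (_ : eta z.1 `^ p * _ <= 0 <= _)) ?g2//.
  by rewrite !mulr0.
 rewrite (uv (hz (inAB zb))) (spow_sgb _ (v z)) (spow_sgb _ k) -mulrBr sgn_part_sgb.
 move: g2; rewrite indicE mem_set// !mulr1 => g2.
 apply: le_trans (ler_pM (sqr_ge0 _) g0 (half_part_le h2 k0 (v z)) g2) _.
 rewrite mulfVK ?pnatr_eq0// indic_above.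
 have [kv|kv] := ltP k (v z); last by rewrite !mul0r !mulr0.
 rewrite !mul1r ?mulr1.
 rewrite [leRHS](_ : _ = (2 `^ P * `|v z| `^ P) * (2 * gam `^ (- p))); last by rewrite /c2; ring.
 rewrite ler_wpM2r ?mulr_ge0 ?powR_ge0// gtr0_norm ?(lt_trans k0)//.
 by apply: (pow_above _ k2 kv); rewrite qP ltW.
have I3 : (\int[mu]_(z in cyl Om T) (sgn_part plus (u z - sgb plus * k) * `|f z| *
  eta z.1 `^ p * phi z.2)%:E <= S%:E)%E.
 apply: set_integral_le => //.
 - by move=> z; rewrite mulr_ge0 ?phi0// mulr_ge0 ?powR_ge0// mulr_ge0 ?sg0.
 - by move=> z; rewrite /source !mulr_ge0// le_max lexx orbT.
 apply: filterS2 hu hf => z hz hfz cz; rewrite -mulrA (eta_phi a b gl gr p0) /source.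
 have [zb|zb] := pselect (obox a b z); last by rewrite tau_supp// !mulr0.
 by rewrite (uv (hz (inAB zb))) -mulrBr sgn_part_sgb hfz.
have C0' : (0 <= C%:E :> \bar R)%E by rewrite lee_fin ltW.
apply: (letr (C%:E * (c1 * m)%:E + C%:E * (c2 * m)%:E + C%:E * S%:E)%E).
 by apply: leeD; [apply: leeD|]; exact: lee_wpmul2l.
rewrite -!EFinM -!EFinD lee_fin.
have m0 : 0 <= m by exact: mass_ge0.
have S0 : 0 <= S by apply: II_ge0 => z; rewrite /source !mulr_ge0// le_max lexx orbT.
rewrite /rhs /energy_rhs -/m -/S /energyC /c1 /c2.
move: (powR_ge0 gam (- p)) (powR_ge0 2 P) (powR_ge0 (4 * N%:R) p); move: (gam `^ _) (2 `^ P) ((4 * N%:R) `^ p).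
move=> x y z x0 y0 z0.
rewrite (_ : _ / 4 = C * (y * (z + 2) + 1)); last by field.
have -> : C * (y * (z * x) * m) + C * (y * (2 * x) * m) + C * S = C * (y * (z + 2) * (x * m) + S) by ring.
have xm0 : 0 <= x * m by exact: mulr_ge0.
have yz0 : 0 <= y * (z + 2) by rewrite mulr_ge0 ?addr_ge0.
rewrite -[leRHS]mulrA; apply: ler_wpM2l; first exact: ltW.
move: (x * m) xm0 (y * (z + 2)) yz0 => U U0 V V0.
have -> : (V + 1) * (U + S) = V * U + S + (V * S + U) by ring.
by rewrite lerDl addr_ge0// mulr_ge0.
Qed.

Let lhs_sum_ge0 : (0 <= \sum_(i < N) \int[mu]_(z in cyl Om T)
   ((Num.max (`|Du i z| - delta i) 0) `^ p * eta z.1 `^ p * phi z.2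
    * \1_[set y | (0 < sgn_part plus (u y - sgb plus * k))%R]%R z)%:E)%E.
Proof.
apply: sume_ge0 => i _; apply: integral_ge0 => z _; rewrite lee_fin.
exact: mulr_ge0 (mulr_ge0 (mulr_ge0 (powR_ge0 _ _) (powR_ge0 _ _)) (phi0 _)) _.
Qed.

Let slice_ge0 t : (0 <= \int[@leb R N]_(x in Om)
   (sgn_part plus (spow (ut t x) (q / 2) - spow (sgb plus * k) (q / 2)) ^+ 2
    * eta x `^ p * phi t)%:E)%E.
Proof.
by apply: integral_ge0 => x _; rewrite lee_fin mulr_ge0 ?phi0// mulr_ge0 ?powR_ge0 ?sqr_ge0.
Qed.

Let t00 : `[0, T]%classic 0. Proof. by rewrite /= in_itv/= lexx ltW. Qed.

Lemma energy_class_gradient i :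
 II (fun z => Num.max (`|Dv i z| - delta i) 0 `^ p * (\1_(above v k) z * tau z))
  <= energyC C p P * rhs.
Proof.
have mtau : measT tau by apply: bumps_meas; exact: bumps_cutf.
have mv := itgm (itgZ (sgb plus) (ld_w LD)).
have mD := itgm (itgZ (sgb plus) (ld_D LD i)).
have mL : measT (fun z => Num.max (`|Dv i z| - delta i) 0 `^ p * (\1_(above v k) z * tau z)).
 apply: mfunM; last first.
  by apply: mfunM => //; apply: mindic; exact: mset_gt.
 apply: (mpowR p); apply: measurable_maxr => //.
 by apply: measurable_funB => //; exact: mcomp.
have iL : itg (fun z => Num.max (`|Dv i z| - delta i) 0 `^ p * (\1_(above v k) z * tau z)).
 apply: (itg_dom (g := fun z => `|Dw i z| `^ p)) => // [z|]; last exact: (ld_Dp LD i).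
 have t1 := tens_cutf_le1 a b gl gr p z; have d0' := hdl i.
 have m0 : 0 <= Num.max (`|Dv i z| - delta i) 0 by rewrite le_max lexx orbT.
 rewrite ger0_norm; last exact: mulr_ge0 (powR_ge0 _ _) (mulr_ge0 _ (tau0 _)).
 apply: (letr (Num.max (`|Dv i z| - delta i) 0 `^ p)).
  rewrite ler_piMr ?powR_ge0// mulr_ile1 ?tau0// indicE; by case: (_ \in _).
 powR_mono; rewrite ?(ltW p0) ?normr_ge0//.
 by rewrite ge_max normr_ge0 andbT norm_sgb gerBl.
rewrite -lee_fin IIE//.
have C40 : 0 < energyC C p P.
 by rewrite /energyC !mulr_gt0// ltr_wpDl// mulr_ge0 ?powR_ge0// addr_ge0 ?powR_ge0.
have rhs0 : 0 <= rhs.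
 rewrite /rhs /energy_rhs addr_ge0// ?mulr_ge0 ?powR_ge0 ?mass_ge0//.
 by apply: II_ge0 => z; rewrite /source !mulr_ge0// le_max lexx orbT.
apply: (@le_trans _ _ (energyC C p P / 4 * rhs)%:E); last first.
 by rewrite lee_fin ler_wpM2r// ler_pdivrMr// ler_peMr ?(ltW C40)// ler1n.
apply: le_trans rhs_le; apply: le_trans E; rewrite -[leLHS]add0e; apply: leeD.
 by apply: le_trans (slice_ge0 0) _; apply: ereal_sup_ubound; exists 0.
rewrite (bigD1 i)//=; rewrite -[leLHS]adde0; apply: leeD; last first.
 apply: sume_ge0 => j _; apply: integral_ge0 => z _; rewrite lee_fin.
 exact: mulr_ge0 (mulr_ge0 (mulr_ge0 (powR_ge0 _ _) (powR_ge0 _ _)) (phi0 _)) _.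
apply: set_integral_ge => //.
- by move=> z; exact: mulr_ge0 (mulr_ge0 (mulr_ge0 (powR_ge0 _ _) (powR_ge0 _ _)) (phi0 _)) _.
- by move=> z; exact: mulr_ge0 (powR_ge0 _ _) (mulr_ge0 _ (tau0 _)).
apply: filterS2 hu (hD i) => z hz hDz nz.
have zb : obox a b z by apply: contrapT => zb; move: nz; rewrite tau_supp// !mulr0 eqxx.
split; first exact: incl.
rewrite -(eta_phi a b gl gr p0) norm_sgb hDz; last first.
 move=> o; have := zb o; rewrite /= !in_itv/= => /andP[h1 h4].
 by rewrite (le_lt_trans (Aa o) h1) (lt_le_trans h4 (bB o)).
rewrite indic_above.
have -> : \1_[set y | (0 < sgn_part plus (u y - sgb plus * k))%R] z = ((k < v z)%R)%:R :> R.
 have e : sgn_part plus (u z - sgb plus * k) = Num.max (v z - k) 0.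
  by rewrite (uv (hz (inAB zb))) -mulrBr sgn_part_sgb.
 rewrite indicE; have [kv|kv] := boolP (k < v z).
  by rewrite mem_set//= e lt_max subr_gt0 kv.
 by rewrite memNset//= e lt_max ltxx orbF subr_gt0; exact/negP.
by apply: le_of_eq; ring.
Qed.

(** The supremum over times is bounded below by its value at [t], and for almost every [t] in []0,
    T[] the representative [ut t] agrees with [u]. At other times the cut-off vanishes. *)
Lemma energy_class_slice kap : k < kap -> {ae lam, forall t : mR R,
 (\int[@leb R N]_x ((`|v (x, t)| `^ q * (\1_(above v kap) (x, t) * tau (x, t)))%:E)
  <= (energyC C p P * (1 - k / kap) ^- 2 * rhs)%:E)%E}.
Proof.
move=> kk; have kap0 : 0 < kap by exact: lt_trans kk.
have c0 : 0 < 1 - k / kap by rewrite subr_gt0 ltr_pdivrMr// mul1r.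
pose c := (1 - k / kap) ^+ 2 / 4.
have cc0 : 0 < c by rewrite divr_gt0// exprn_gt0.
have sl := ae_sections hu.
have mtau : measT tau by apply: bumps_meas; exact: bumps_cutf.
have mv := itgm (itgZ (sgb plus) (ld_w LD)).
have mX : measT (fun z => `|v z| `^ q * (\1_(above v kap) z * tau z)).
 apply: mfunM; last first.
  by apply: mfunM => //; apply: mindic; exact: mset_gt.
 by apply: (mpowR q); exact: mcomp.
apply: filterS2 sl hut => t h1 h3.
have mXt := mcomp mX (pair2_measurable t).
suff : (c%:E * \int[@leb R N]_x ((`|v (x, t)| `^ q * (\1_(above v kap) (x, t) * tau (x, t)))%:E) <=
  (energyC C p P / 4 * rhs)%:E)%E.
 rewrite -[X in (_ <= X)%E -> _](_ : c%:E * (energyC C p P * (1 - k / kap) ^- 2 * rhs)%:E = _)%E.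
  by rewrite lee_pmul2l.
 rewrite -EFinM; congr EFin; move: (lt0r_neq0 c0); rewrite /c.
 by move: (1 - k / kap) (energyC C p P) (rhs) => x y r x0; field.
rewrite -ge0_integralZl_EFin//; last 3 first.
- by move=> x _; rewrite lee_fin; exact: mulr_ge0 (powR_ge0 _ _) (mulr_ge0 _ (tau0 _)).
- exact/mEFinP.
- exact: ltW.
have [tT|tT] := pselect (`]0, T[%classic t); last first.
 rewrite integral0_eq; last first.
  move=> x _; rewrite tau_supp ?mulr0//; first by rewrite mule0.
  by move=> /incl[].
 apply: le_trans rhs_le; apply: le_trans E; apply: adde_ge0 => //.
 by apply: le_trans (slice_ge0 0) _; apply: ereal_sup_ubound; exists 0.
apply: le_trans rhs_le; apply: le_trans E; rewrite -[leLHS]adde0; apply: leeD => //.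
apply: (letr (\int[@leb R N]_(x in Om)
   (sgn_part plus (spow (ut t x) (q / 2) - spow (sgb plus * k) (q / 2)) ^+ 2
    * eta x `^ p * phi t)%:E)%E); last first.
 apply: ereal_sup_ubound; exists t => //; move: tT.
 by rewrite /= !in_itv/= => /andP[/ltW-> /ltW->].
under eq_integral do rewrite -EFinM.
apply: set_integral_ge.
- by move=> x; rewrite mulr_ge0 ?phi0// mulr_ge0 ?powR_ge0 ?sqr_ge0.
- by move=> x; apply: mulr_ge0 (ltW cc0) _; exact: mulr_ge0 (powR_ge0 _ _) (mulr_ge0 _ (tau0 _)).
- exact: mfunM.
apply: filterS2 h1 (h3 tT) => x hx hx' nz.
have zb : obox a b (x, t).
 by apply: contrapT => zb; move: nz; rewrite tau_supp// !mulr0 eqxx.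
split; first by case: (incl zb).
have Ox : Om x by case: (incl zb).
rewrite -(hx' Ox) (uv (hx (inAB zb))) (spow_sgb _ (v (x, t))) (spow_sgb _ k) -mulrBr sgn_part_sgb -mulrA (eta_phi a b gl gr p0 (x, t)).
rewrite indic_above; have [kv|kv] := ltP kap (v (x, t)); last first.
 by rewrite mul0r !mulr0 mulr_ge0 ?sqr_ge0 ?tau0.
have g := half_part_ge h2 k0 kk kv.
rewrite mul1r mulrA ler_wpM2r ?tau0// gtr0_norm ?(lt_trans kap0)// /c.
rewrite mulrAC ler_pdivrMr// [leRHS]mulrC; apply: le_trans g.
by rewrite mulfVK ?pnatr_eq0.
Qed.

End raw.
End energy_class_energy.

(** * Convexity of the time term *)

Section scalar_inequalities.
Context {R : realType}.
Implicit Types x y s k : R.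

Lemma powR_young (r x y : R) : 0 < r < 1 -> 0 <= x -> 0 <= y ->
 x `^ r * y `^ (1 - r) <= r * x + (1 - r) * y.
Proof.
move=> /andP[r0 r1] x0 y0; have r1' : 0 < 1 - r by rewrite subr_gt0.
have := @conjugate_powR R (x `^ r) (y `^ (1 - r)) r^-1 (1 - r)^-1 (powR_ge0 _ _) (powR_ge0 _ _).
rewrite !invr_gt0 !invrK => /(_ r0 r1'); rewrite addrC subrK => /(_ erefl).
by rewrite -!powRrM !mulfV ?gt_eqF// !powRr1// [x * r]mulrC [y * _]mulrC.
Qed.

(** A convex power lies above its tangent at [y]; this is the weighted inequality of arithmetic and
    geometric means with weight [al / (al + 1)]. *)
Lemma powR_tangent (al x y : R) : 0 < al -> 0 <= x -> 0 <= y ->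
 (al + 1) * (y `^ al * (x - y)) <= x `^ (al + 1) - y `^ (al + 1).
Proof.
move=> al0 x0 y0; have q0 : 0 < al + 1 by rewrite ltr_wpDl// ltW.
have r01 : 0 < al / (al + 1) < 1 by rewrite divr_gt0//= ltr_pdivrMr// mul1r ltrDl.
have := powR_young r01 (powR_ge0 y (al + 1)) (powR_ge0 x (al + 1)).
have -> : 1 - al / (al + 1) = (al + 1)^-1 by field; rewrite gt_eqF.
rewrite -!powRrM mulrCA mulfV ?gt_eqF// mulr1 powRr1//.
have -> : y `^ (al + 1) = y `^ al * y.
 by rewrite powRD ?powRr1// gt_eqF.
move=> h; have h' : (al + 1) * (y `^ al * x) <= al * (y `^ al * y) + x `^ (al + 1).
 have := h; rewrite -(ler_pM2l q0); congr (_ <= _).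
 by field; rewrite gt_eqF.
by move: h'; move: (x `^ _) (y `^ al) => X Y; lra.
Qed.

Lemma powR_sub_ge (al m : R) : 0 < al -> 0 <= m <= 1 ->
 Num.min 1 al * (1 - m) <= 1 - m `^ al.
Proof.
move=> al0 /andP[m0 m1]; have [a1|a1] := leP 1 al.
 rewrite mul1r lerD2l lerN2; have [->|mn] := eqVneq m 0; first by rewrite powR0 ?gt_eqF.
 by rewrite ge1r_powR// m1 lt_neqAle eq_sym mn m0.
have := @powR_young al m 1; rewrite powR1 !mulr1 al0 a1 m0 ler01 => /(_ isT isT isT).
lra.
Qed.

(** For [H = trunc k M s] this is the Legendre transform, at the point [spow s al], of the convex
    function [H |-> ((k+H)^(al+1) - k^(al+1)) / (al+1)] on [[0, M]]. For [H = s - k], [s > k], it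
    equals the integral of [tau - k] against [d(tau^al)] from [k] to [s]. *)
Definition bregman (al k H s : R) : R :=
 H * spow s al - ((k + H) `^ (al + 1) - k `^ (al + 1)) / (al + 1).

(** The part of [s] between the levels [k] and [k + M]. Its boundedness makes it admissible in
    correlations with an integrable function; [M] tends to infinity in [energy_level]. *)
Definition trunc (k M s : R) : R := Num.max (s - k) 0 - Num.max (s - (k + M)) 0.

Section bregman.
Variables (al k : R).
Hypotheses (al0 : 0 < al) (k0 : 0 < k).
Let q0 : 0 < al + 1. Proof. by rewrite ltr_wpDl// ltW. Qed.

Lemma spow_mono s s' : s <= s' -> 0 < s' -> spow s al <= s' `^ al.
Proof.
move=> ss s0; have [h|h] := leP s 0; first by rewrite (le_trans (spow_le0 _ h)) ?powR_ge0.
by rewrite (spow_gt0 _ h); powR_mono; rewrite ?(ltW al0) ?(ltW h) ?(ltW s0).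
Qed.

Variant trunc_spec (M s : R) : R -> Type :=
| TruncLow of s <= k : trunc_spec M s 0
| TruncMid of k < s & s <= k + M : trunc_spec M s (s - k)
| TruncHigh of k + M < s : trunc_spec M s M.

Lemma truncP M s : 0 <= M -> trunc_spec M s (trunc k M s).
Proof.
move=> M0; rewrite /trunc; have [h1|h1] := leP s k.
 by rewrite !max_r ?subr0; [constructor|rewrite subr_le0 (le_trans h1)// lerDl|rewrite subr_le0].
have [h2|h2] := leP s (k + M).
 by rewrite max_l ?max_r ?subr0 ?subr_le0 ?subr_ge0 ?(ltW h1)//; constructor.
rewrite !max_l ?subr_ge0 ?(ltW h1) ?(ltW h2)//.
by rewrite (_ : s - k - (s - (k + M)) = M); [constructor|ring].
Qed.

Lemma trunc_ge0 M s : 0 <= M -> 0 <= trunc k M s.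
Proof. by move=> M0; case: truncP => // h _; rewrite subr_ge0 ltW. Qed.

Lemma trunc_le M s : 0 <= M -> trunc k M s <= M.
Proof. by move=> M0; case: truncP => // h1 h2; rewrite lerBlDl. Qed.

Lemma trunc_le_pos M s : 0 <= M -> trunc k M s <= Num.max (s - k) 0.
Proof. by move=> M0; rewrite /trunc gerBl le_max lexx orbT. Qed.

(** Fenchel's inequality: [trunc k M s'] maximises [H spow(s') - Psi(H)] over [[0, M]], so its value
    there is at least the value at [H = trunc k M s]. The proof adds the tangent inequality and the
    sign condition [key] that characterises the maximiser. *)
Lemma bregman_convex M s s' : 0 <= M ->
 bregman al k (trunc k M s) s - bregman al k (trunc k M s') s' <=
 (spow s al - spow s' al) * trunc k M s.
Proof.
move=> M0; have h0 := trunc_ge0 s M0; have hM := trunc_le s M0; have h0' := trunc_ge0 s' M0.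
have t := powR_tangent al0 (addr_ge0 (ltW k0) h0) (addr_ge0 (ltW k0) h0').
set h := trunc k M s in h0 hM t *; rewrite /bregman.
have key : 0 <= ((k + trunc k M s') `^ al - spow s' al) * (h - trunc k M s').
 case: truncP => // [sk|ks sM|Ms].
 - by rewrite addr0 subr0 mulr_ge0// subr_ge0 spow_mono.
 - by rewrite subrKC (spow_gt0 _ (lt_trans k0 ks)) subrr mul0r.
 - have s0 : 0 < s' by apply: lt_trans Ms; rewrite ltr_pwDl.
  rewrite mulr_le0// ?subr_le0// (spow_gt0 _ s0).
  by powR_mono; rewrite ?(ltW al0) ?(ltW s0) ?(ltW Ms)// addr_ge0// ltW.
move: key t; move: (trunc k M s') => h'.
rewrite (_ : k + h - (k + h') = h - h'); last by ring.
move: ((k + h) `^ _) ((k + h') `^ _) ((k + h') `^ _) (k `^ _) (spow s al) (spow s' al) => A B X K S S' key t.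
have t' : X * (h - h') <= (A - B) / (al + 1) by rewrite ler_pdivlMr// mulrC.
rewrite !mulrBl; move: t' key; rewrite !mulrBl !mulrBr.
move: (A / _) (B / _) (K / _) => a b c; lra.
Qed.

Lemma bregman_ge0 M s : 0 <= M -> 0 <= bregman al k (trunc k M s) s.
Proof.
move=> M0; rewrite /bregman; case: truncP => // [sk|ks sM|Ms].
- by rewrite mul0r addr0 subrr mul0r subr0.
- rewrite subrKC (spow_gt0 _ (lt_trans k0 ks)).
 have := powR_tangent al0 (ltW k0) (ltW (lt_trans k0 ks)).
 rewrite subr_ge0 ler_pdivrMr//; move: (s `^ _) (s `^ _) (k `^ _) => a b c; lra.
- have s0 : 0 < s by apply: lt_trans Ms; rewrite ltr_pwDl.
 have kM : 0 <= k + M by rewrite addr_ge0// ltW.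
 have h1 : (k + M) `^ al <= spow s al.
  by rewrite (spow_gt0 _ s0); powR_mono; rewrite ?(ltW al0) ?(ltW s0) ?(ltW Ms).
 have := powR_tangent al0 (ltW k0) kM; rewrite subr_ge0 ler_pdivrMr// => h2.
 have : M * (k + M) `^ al <= M * spow s al by rewrite ler_wpM2l.
 move: h2; rewrite (_ : k - (k + M) = - M); last by ring.
 move: (spow s al) ((k + M) `^ al) ((k + M) `^ (al + 1)) (k `^ _) => a b c d h2 h3.
 apply: (letr ((al + 1) * (M * b))); first by lra.
 by rewrite mulrC ler_wpM2r// ltW.
Qed.

Lemma bregman_le M s : 0 <= M ->
 bregman al k (trunc k M s) s <= ((k < s)%R)%:R * (trunc k M s * `|s| `^ al).
Proof.
move=> M0; have h0 := trunc_ge0 s M0.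
have p0 : 0 <= ((k + trunc k M s) `^ (al + 1) - k `^ (al + 1)) / (al + 1).
 rewrite divr_ge0 ?(ltW q0)// subr_ge0; powR_mono; rewrite ?(ltW q0) ?(ltW k0)//.
  by rewrite addr_ge0// ltW.
 by rewrite lerDl.
move: p0 h0; rewrite /bregman; case: truncP => // [sk|ks sM|Ms] p0 h0.
- by rewrite ltNge sk mul0r mul0r addr0 subrr mul0r subr0.
- by rewrite ks mul1r (spow_gt0 _ (lt_trans k0 ks)) gtr0_norm ?(lt_trans k0)// gerBl.
- have s0 : 0 < s by apply: lt_trans Ms; rewrite ltr_pwDl.
 by rewrite (le_lt_trans _ Ms) ?lerDl// mul1r (spow_gt0 _ s0) gtr0_norm// gerBl.
Qed.

(** With [x = k / s] the claim is a quadratic lower bound in [1 - x]. One tangent at 1 gives only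
    nonnegativity; using tangents at 1 and at the midpoint [m] of [x] and 1 leaves
    [(1 - x)(1 - m^al)/2], and [powR_sub_ge] bounds the last factor. *)
Lemma bregman_big M kap s : k < kap -> kap < s -> s <= k + M ->
 Num.min 1 al / 4 * (1 - k / kap) ^+ 2 * `|s| `^ (al + 1) <= bregman al k (trunc k M s) s.
Proof.
move=> kk ks sM; have k's := lt_trans kk ks; have s0 : 0 < s by exact: lt_trans k's.
have kap0 : 0 < kap by exact: lt_trans kk.
have M0 : 0 <= M by rewrite -(lerD2l k) addr0 (le_trans (ltW k's)).
rewrite /bregman; case: truncP => // [|_ _|]; [by rewrite leNgt k's| |by rewrite ltNge sM].
rewrite subrKC (spow_gt0 _ s0) gtr0_norm//.
pose x := k / s; have kE : k = x * s by rewrite mulfVK ?gt_eqF.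
have x0 : 0 <= x by rewrite divr_ge0// ltW.
have x1 : x <= 1 by rewrite ler_pdivrMr// mul1r ltW.
have xk : x <= k / kap by rewrite ler_wpM2l ?(ltW k0)// lef_pV2 ?posrE// ltW.
have kk1 : k / kap <= 1 by rewrite ler_pdivrMr// mul1r ltW.
pose m := (1 + x) / 2.
have m0 : 0 <= m by rewrite divr_ge0// addr_ge0.
have m1 : m <= 1 by rewrite ler_pdivrMr//; lra.
have t1 := powR_tangent al0 x0 m0.
have t2 := powR_tangent al0 m0 (@ler01 R).
have t3 := powR_sub_ge al0 (_ : 0 <= m <= 1); rewrite m0 m1 in t3; have {}t3 := t3 isT.
move: t2; rewrite !powR1 mul1r => t2.
have sE : s `^ al * s = s `^ (al + 1) by rewrite powRD ?powRr1 ?(ltW s0)// gt_eqF// implybT.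
have kqE : k `^ (al + 1) = x `^ (al + 1) * s `^ (al + 1) by rewrite {1}kE powRM ?(ltW s0).
have e1 : (s - k) * s `^ al = s `^ (al + 1) - x * s `^ (al + 1).
 by rewrite -sE; move: kE; move: (x) => y ->; ring.
rewrite kqE e1.
set S := s `^ (al + 1); have S0 : 0 <= S by exact: powR_ge0.
have -> : S - x * S - (S - x `^ (al + 1) * S) / (al + 1) =
 (al - (al + 1) * x + x `^ (al + 1)) / (al + 1) * S by field; rewrite gt_eqF.
rewrite ler_wpM2r// ler_pdivlMr//.
have mn0 : 0 < Num.min 1 al by rewrite lt_min ltr01.
have sq : (1 - k / kap) ^+ 2 <= (1 - x) ^+ 2.
 by rewrite ler_sqr ?nnegrE ?subr_ge0// lerD2l lerN2.
apply: (letr (Num.min 1 al / 4 * (1 - x) ^+ 2 * (al + 1))).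
 by rewrite ler_wpM2r ?(ltW q0)// ler_wpM2l// divr_ge0// ltW.
have xm : x - m = - (1 - x) / 2 by rewrite /m; field.
have m1E : m - 1 = - (1 - x) / 2 by rewrite /m; field.
rewrite xm in t1; rewrite m1E in t2.
have m1E' : 1 - m = (1 - x) / 2 by rewrite /m; field.
rewrite m1E' in t3.
have t4 : Num.min 1 al * ((1 - x) / 2) * (1 - x) <= (1 - m `^ al) * (1 - x).
 by rewrite ler_wpM2r// subr_ge0.
have t5 : (al + 1) * (Num.min 1 al * ((1 - x) / 2) * (1 - x)) <= (al + 1) * ((1 - m `^ al) * (1 - x)).
 by rewrite ler_wpM2l// ltW.
move: t1 t2 t5; rewrite expr2.
move: (x `^ _) (m `^ (al + 1)) (m `^ al) (Num.min 1 al) => X Y U V t1 t2 t5.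
lra.
Qed.

End bregman.

Lemma young_absorb (p eps x y : R) : 1 < p -> 0 < eps -> 0 <= x -> 0 <= y ->
 x `^ (p - 1) * y <= eps * x `^ p + eps `^ (1 - p) * y `^ p.
Proof.
move=> p1 e0 x0 y0; have p10 : 0 < p - 1 by rewrite subr_gt0.
have p0 : 0 < p by exact: lt_trans p1.
have E (z : R) : 0 <= z -> z `^ p = z `^ (p - 1) * z.
 by move=> z0; rewrite -[X in _ * X]powRr1// -powRD ?subrK// gt_eqF.
have [h|h] := leP y (eps * x).
 rewrite -[leLHS]addr0; apply: lerD; last by rewrite mulr_ge0 ?powR_ge0.
 by rewrite (E x x0) mulrCA ler_wpM2l ?powR_ge0.
rewrite -[leLHS]add0r; apply: lerD; first by rewrite mulr_ge0 ?powR_ge0 ?(ltW e0).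
rewrite (E y y0) mulrA ler_wpM2r// (_ : 1 - p = - (p - 1)); last by ring.
rewrite powRN mulrC ler_pdivlMr ?powR_gt0// -powRM ?(ltW e0)// mulrC.
by powR_mono; rewrite ?(ltW p10) ?mulr_ge0 ?(ltW e0)// ltW.
Qed.

End scalar_inequalities.

(** * Correlating the weak equation with a truncation *)

Section weak_equations.
Context {R : realType} {N : nat}.
Notation Z := ('rV[R]_N * mR R)%type.
Notation mu := (@leb R N \x @lebesgue_measure R)%E.
Notation lam := (@lebesgue_measure R).
Notation itg := (Rintg mu).
Notation II := (Rint mu).
Notation muS := (@muZ R N).
Implicit Types (o : option 'I_N) (z : Z).

Section correlation_pairing.
Implicit Types (w x : Z) (F V D : Z -> R).

Lemma itg_corr_fubini F V (rho : Z -> R) Mr : itg V -> itg F -> itg rho ->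
 (forall z, `|rho z| <= Mr) ->
 itg (fun z => V z * II (fun x => F x * rho (x - z))).
Proof.
move=> iV iF ir rM.
have h1 := @itg_corr2 R N V iV F rho Mr iF (itgm ir) rM.
have h2 := @itg_fubini1 _ _ _ _ _ muS muS _ h1.
suff <- : (fun z => Rint muS (fun y => F (z + y) * V z * rho y)) =
  (fun z => V z * II (fun x => F x * rho (x - z))) by exact: h2.
ext => z; rewrite -[Rint muS]/(II).
have i1 : itg (fun x => F x * rho (x - z)).
 by apply: (itg_bnd (M := Mr)) => //; apply: itgm; exact: (itg_shift (- z) ir).
rewrite -(II_shift z i1) -IIZ; last exact: (itg_shift z i1).
by congr Rint; ext => x; rewrite addrK (addrC x z); ring.
Qed.

Lemma corr_fubini_l F V (rho : Z -> R) Mr : itg V -> itg F ->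
 (forall xi, itg (fun z => F (z + xi) * V z)) -> itg rho -> (forall z, `|rho z| <= Mr) ->
 II (fun xi => corr F V xi * rho xi) =
 II (fun z => V z * II (fun x => F x * rho (x - z))).
Proof.
move=> iV iF iFV ir rM.
have h := itg_corr2 iV iF (itgm ir) rM.
have := @II_fubini _ _ _ _ _ muS muS _ h => /= E.
transitivity (II (fun xi => II (fun z => F (z + xi) * V z * rho xi))).
 congr Rint; ext => xi; rewrite mulrC -IIZ; last exact: iFV.
 by congr Rint; ext => z; rewrite mulrC.
rewrite -E; congr Rint; ext => z.
have i1 : itg (fun x => F x * rho (x - z)).
 by apply: (itg_bnd (M := Mr)) => //; apply: itgm; exact: (itg_shift (- z) ir).
rewrite -(II_shift z i1) -IIZ; last exact: (itg_shift z i1).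
by congr Rint; ext => x; rewrite addrK (addrC x z); ring.
Qed.

Lemma corr_swap F V xi : (forall xi, itg (fun z => F (z + xi) * V z)) ->
 itg (fun z => V (z - xi) * F z) /\ corr F V xi = corr V F (- xi).
Proof.
move=> iFV; have h := itg_shift (- xi) (iFV xi).
have e : (fun z => F (z - xi + xi) * V (z - xi)) = (fun z => V (z - xi) * F z).
 by ext => z; rewrite subrK mulrC.
split; first by rewrite -e; exact: h.
by rewrite /corr -(II_shift (- xi) (iFV xi)) -e.
Qed.

Lemma corr_fubini_r F V (rho : Z -> R) Mr : itg V -> itg F ->
 (forall xi, itg (fun z => F (z + xi) * V z)) -> itg rho -> (forall z, `|rho z| <= Mr) ->
 II (fun xi => corr F V xi * rho xi) =
 II (fun x => F x * II (fun z => V z * rho (x - z))).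
Proof.
move=> iV iF iFV ir rM.
have iVF xi : itg (fun z => V (z + xi) * F z).
 by have [+ _] := corr_swap (- xi) iFV; rewrite opprK.
have nE z : - z = - z + 0 by rewrite addr0.
have ir' : itg (fun z => rho (- z)).
 by under eq_fun do rewrite nE; exact: (itg_refl 0 ir).
have iL : itg (fun xi => corr F V xi * rho xi).
 have h := itg_corr2 iV iF (itgm ir) rM.
 have := @itg_fubini2 _ _ _ _ _ muS muS _ h.
 congr (Rintg _ _); ext => xi; rewrite [RHS]mulrC -IIZ; last exact: iFV.
 by congr Rint; ext => z; rewrite mulrC.
rewrite -(II_refl 0 iL).
have -> : (fun z => corr F V (- z + 0) * rho (- z + 0)) = (fun z => corr V F z * rho (- z)).
 by ext => z; rewrite !addr0 (corr_swap (- z) iFV).2 opprK.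
rewrite (corr_fubini_l iF iV iVF ir' (fun z => rM (- z))).
by congr Rint; ext => x; congr (_ * Rint _ _); ext => z; rewrite opprB.
Qed.

(** The bump [z |-> b (x - z)]: after Fubini the other factor of the correlation is tested with
    it. *)
Definition rfl (b : option 'I_N -> R -> R) x : option 'I_N -> R -> R :=
 fun o y => b o (co o x - y).

Lemma tens_rfl b x z : tens (rfl b x) z = tens b (x - z).
Proof. by apply: eq_bigr => o _; rewrite /rfl coB. Qed.

Lemma bumps_rfl b x : bumps b -> bumps (rfl b x).
Proof.
move=> hb o; have [Cb [A hA]] := hb o; split.
 rewrite /rfl (_ : (fun y => _) = fun y => b o (- 1 * y + co o x)).
  exact: Cinf_affine.
 by ext => y; congr b; ring.
exists (`|A| + `|co o x|) => y hy; rewrite /rfl hA//.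
have := ler_normB (co o x) (co o x - y); rewrite opprB addrC subrK.
have := ler_norm A; move: hy; lra.
Qed.

Lemma tens_dt_rfl o b x z : bumps b -> tens (dt o (rfl b x)) z = - tens (dt o b) (x - z).
Proof.
move=> hb; rewrite !tens_dt -mulNr; congr (_ * _); last first.
 by apply: eq_bigr => o' _; rewrite /rfl coB.
rewrite /rfl coB derive1E.
have d1 : is_derive (co o z) (1 : R) (fun y : R => co o x - y) (- 1).
 by have := is_deriveB (is_derive_cst (co o x) (co o z) (1 : R)) (is_derive_id (co o z) 1); rewrite sub0r.
have [_ ->] := @is_derive1_comp _ (b o) (fun y : R => co o x - y) (co o z) _ _ (Cinf_is_derive _ (hb o).1) d1.
by rewrite mulrN1.
Qed.

(** The derivative falls on the second factor. There the shift enters with the opposite sign, which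
    cancels the sign of the integration by parts. *)
Lemma corr_wpd_r F V D o b MV : itg F -> itg V -> (forall z, `|V z| <= MV) -> itg D ->
 (forall xi, itg (fun z => F (z + xi) * D z)) -> wpd o V D -> bumps b ->
 II (fun z => corr F V z * tens (dt o b) z) = II (fun z => corr F D z * tens b z).
Proof.
move=> iF iV VM iD iFD VD hb; have hd := bumps_dt o hb.
have [M1 hM1] := tens_bounded hd; have [M2 hM2] := tens_bounded hb.
rewrite (corr_fubini_r iV iF _ (itg_tens hd) hM1); last by move=> xi; exact: (itg_corr iV VM).
rewrite (corr_fubini_r iD iF iFD (itg_tens hb) hM2).
congr Rint; ext => x; congr (_ * _).
have := VD _ (bumps_rfl x hb).
have -> : (fun z => V z * tens (dt o (rfl b x)) z) = (fun z => - (V z * tens (dt o b) (x - z))).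
 by ext => z; rewrite tens_dt_rfl// mulrN.
have -> : (fun z => D z * tens (rfl b x) z) = (fun z => D z * tens b (x - z)).
 by ext => z; rewrite tens_rfl.
rewrite IIN => [/oppr_inj//|].
rewrite (_ : (fun z => _) = fun z => V z * - tens (dt o (rfl b x)) z); last first.
 by ext => z; rewrite tens_dt_rfl// opprK.
have [M3 hM3] := tens_bounded (bumps_dt o (bumps_rfl x hb)).
apply: (itg_bnd (M := M3) _ _ iV); last by move=> z; rewrite normrN.
exact: (itgm (itgN (itg_tens (bumps_dt o (bumps_rfl x hb))))).
Qed.

Section continuity.
Variables (p : R) (F D : Z -> R).
Hypotheses (p1 : 1 < p) (iF : itg F) (iD : itg D)
 (iFp : itg (fun z => `|F z| `^ (p / (p - 1)))) (iDp : itg (fun z => `|D z| `^ p)).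
Let p0 : 0 < p := lt_trans ltr01 p1.
Let p10 : 0 < p - 1. Proof. by rewrite subr_gt0. Qed.
Let r0 : 0 < p / (p - 1). Proof. by rewrite divr_gt0. Qed.

Lemma young_conj (x y : R) : 0 <= x -> 0 <= y -> x * y <= x `^ (p / (p - 1)) + y `^ p.
Proof.
move=> x0 y0; have e : x `^ (p / (p - 1)) = x * x `^ (p - 1)^-1.
 rewrite (_ : p / (p - 1) = 1 + (p - 1)^-1); last by field; rewrite gt_eqF.
 by rewrite powRD ?powRr1// gt_eqF// addr_gt0// invr_gt0.
have e' : y `^ p = y `^ (p - 1) * y.
 by rewrite -[X in _ * X]powRr1// -powRD ?subrK// gt_eqF.
have [h|h] := leP y (x `^ (p - 1)^-1).
 by rewrite -[leLHS]addr0 e lerD ?powR_ge0// ler_wpM2l.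
rewrite -[leLHS]add0r e' lerD ?powR_ge0// ler_wpM2r//.
have -> : x = (x `^ (p - 1)^-1) `^ (p - 1) by rewrite -powRrM mulVf ?powRr1// gt_eqF.
by powR_mono; rewrite ?powR_ge0 ?(ltW p10)// ltW.
Qed.

Lemma itg_pair xi : itg (fun z => F (z + xi) * D z).
Proof.
apply: (itg_dom (g := fun z => `|F (z + xi)| `^ (p / (p - 1)) + `|D z| `^ p)).
- by apply: mfunM; [exact: itgm (itg_shift xi iF)|exact: itgm iD].
- by move=> z; rewrite normrM; exact: young_conj.
- by apply: itgD => //; exact: (itg_shift xi iFp).
Qed.

Lemma corr_pair_bnd xi :
 `|corr F D xi| <= II (fun z => `|F z| `^ (p / (p - 1))) + II (fun z => `|D z| `^ p).
Proof.
rewrite -(II_shift xi iFp) -IID//; last exact: (itg_shift xi iFp).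
apply: le_trans (normII (itg_pair xi)) _; apply: le_II.
- exact: itg_norm (itg_pair xi).
- by apply: itgD => //; exact: (itg_shift xi iFp).
- by move=> z; rewrite normrM; exact: young_conj.
Qed.

End continuity.

(** Here neither factor is bounded: [F] is in L^(p') and [D] in L^p. The function [F] is cut off at
    height [n]; the bounded part is treated by [corr_ucont] with the roles exchanged, and the rest
    is small in L^(p'). *)
Lemma corr_pair_cont (p : R) F D : 1 < p -> itg F -> itg D ->
 itg (fun z => `|F z| `^ (p / (p - 1))) -> itg (fun z => `|D z| `^ p) ->
 forall e, 0 < e -> exists2 d, 0 < d &
 forall w, near0 d w -> `|corr F D w - corr F D 0| <= e.
Proof.
move=> p1 iF iD iFp iDp e e0.
have p0 : 0 < p by exact: lt_trans p1.
have p10 : 0 < p - 1 by rewrite subr_gt0.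
have r0 : 0 < p / (p - 1) by rewrite divr_gt0.
set r := p / (p - 1) in r0 iFp *.
pose Dp := II (fun z => `|D z| `^ p).
have Dp0 : 0 <= Dp by apply: II_ge0 => z; exact: powR_ge0.
pose e8 := e / 8; have e80 : 0 < e8 by rewrite divr_gt0.
(* The weight in Young's inequality, making the term of [D] at most [e / 8] first; the height [n0]
   is chosen afterwards for the term of [F]. *)
pose eta := (e8 / (Dp + 1)) `^ p^-1.
have Dp1 : 0 < Dp + 1 by rewrite ltr_wpDl.
have eta0 : 0 < eta by rewrite powR_gt0// divr_gt0.
have etap : eta `^ p * Dp <= e8.
 rewrite -powRrM mulVf ?gt_eqF// powRr1 ?divr_ge0 ?(ltW e80) ?(ltW e0) ?(ltW Dp1)//.
 by rewrite mulrAC ler_pdivrMr// ler_wpM2l ?(ltW e80)// lerDl.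
pose Fn n z := F z * ((`|F z| <= n%:R)%R)%:R.
have mind n : measT (fun z => ((`|F z| <= n%:R)%R)%:R : R).
 have -> : (fun z => ((`|F z| <= n%:R)%R)%:R) = \1_[set z | `|F z| <= n%:R] :> (Z -> R).
  by ext => z; rewrite indicE; congr (nat_of_bool _)%:R; apply/idP/idP => [/mem_set|/set_mem].
 by apply: mindic; apply: mset_le; exact: (itgm (itg_norm iF)).
have mFn n : measT (Fn n) by apply: mfunM => //; exact: (itgm iF).
have FnF n z : `|Fn n z| <= `|F z|.
 by rewrite /Fn normrM; case: (`|F z| <= n%:R); rewrite ?normr1 ?normr0 ?mulr1 ?mulr0.
have Fnn n z : `|Fn n z| <= n%:R.
 by rewrite /Fn normrM; case: (leP `|F z| n%:R) => h; rewrite ?normr1 ?normr0 ?mulr1 ?mulr0.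
have iFn n : itg (Fn n) by apply: (itg_dom (mFn n) (FnF n)); exact: itg_norm.
pose rest n z := F z - Fn n z.
have restF n z : `|rest n z| <= `|F z|.
 by rewrite /rest /Fn; case: (`|F z| <= n%:R); rewrite ?mulr1 ?mulr0 ?subrr ?subr0 ?normr0.
have irest n : itg (rest n) by exact: itgB.
have irp n : itg (fun z => `|rest n z| `^ r).
 apply: (itg_dom _ _ iFp).
  apply: (mpowR r); apply: mcomp => //.
  exact: itgm (irest n).
 move=> z; rewrite ger0_norm ?powR_ge0//; powR_mono; rewrite ?(ltW r0)//.
have [n0 hn0] : exists n, II (fun z => `|rest n z| `^ r) <= e8 * eta `^ r.
 have : II (fun z => `|rest n z| `^ r) @[n --> \oo] --> II (fun=> 0).
  apply: (II_cvg (g := fun z => `|F z| `^ r)) => //.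
  - by move=> n; exact: itgm (irp n).
  - apply: aeW => z; apply: cvg_near_cst; near=> n.
   rewrite /rest /Fn (_ : (`|F z| <= n%:R) = true) ?mulr1 ?subrr ?normr0 ?powR0 ?gt_eqF//.
   by near: n; exact: nbhs_infty_ger.
  - move=> n z; rewrite ger0_norm ?powR_ge0//; powR_mono; rewrite ?(ltW r0)//.
 rewrite (_ : II (fun=> 0) = 0); last by rewrite /Rint /Rintegral integral0.
 move=> h; have c0 : 0 < e8 * eta `^ r by rewrite mulr_gt0// powR_gt0.
 have [n _ hn] := cvgr0_norm_le _ h _ c0.
 have R0 : 0 <= II (fun z => `|rest n z| `^ r) by apply: II_ge0 => z; exact: powR_ge0.
 by exists n; have := hn n (leqnn n); rewrite /= (ger0_norm R0).
have restB w : `|corr (rest n0) D w| <= e8 + e8.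
 have eta1 := powR_gt0 r eta0.
 have b1 z : `|rest n0 (z + w) * D z| <=
   (eta `^ r)^-1 * `|rest n0 (z + w)| `^ r + eta `^ p * `|D z| `^ p.
  rewrite normrM.
  have -> : `|rest n0 (z + w)| * `|D z| = (eta^-1 * `|rest n0 (z + w)|) * (eta * `|D z|).
   by rewrite mulrACA mulVf ?mul1r// gt_eqF.
  apply: le_trans (young_conj p1 _ _) _; rewrite ?mulr_ge0 ?invr_ge0 ?(ltW eta0)//.
  rewrite !powRM ?invr_ge0 ?(ltW eta0)// -/r.
  by rewrite -[eta^-1]powR_inv1 ?(ltW eta0)// -powRrM mulN1r powRN.
 have i1 := itg_shift w (irp n0).
 have i2 : itg (fun z => (eta `^ r)^-1 * `|rest n0 (z + w)| `^ r + eta `^ p * `|D z| `^ p).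
  by apply: itgD; exact: itgZ.
 apply: le_trans (normII (itg_pair p1 (irest n0) iD (irp n0) iDp w)) _.
 apply: le_trans (le_II (itg_norm (itg_pair p1 (irest n0) iD (irp n0) iDp w)) i2 b1) _.
 rewrite (IID (itgZ _ i1) (itgZ _ iDp)) (IIZ _ i1) (IIZ _ iDp) (II_shift w (irp n0)).
 by apply: lerD; [rewrite mulrC ler_pdivrMr|exact: etap].
have e20 : 0 < e / 2 by rewrite divr_gt0.
have [d d0 hd] := corr_ucont (iFn n0) (Fnn n0) iD e20.
exists d => // w wd.
have FE xi : corr F D xi = corr (Fn n0) D xi + corr (rest n0) D xi.
 rewrite /corr -IID.
 - by congr Rint; ext => z; rewrite /rest; ring.
 - rewrite (_ : (fun z => _) = fun z => D z * Fn n0 (z + xi)); last by ext => z; rewrite mulrC.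
  by apply: (itg_bnd (M := n0%:R) _ _ iD) => //; exact: itgm (itg_shift xi (iFn n0)).
 - exact: (itg_pair p1 (irest n0) iD (irp n0) iDp xi).
have iFnD xi : itg (fun z => Fn n0 (z + xi) * D z).
 rewrite (_ : (fun z => _) = fun z => D z * Fn n0 (z + xi)); last by ext => z; rewrite mulrC.
 by apply: (itg_bnd (M := n0%:R) _ _ iD) => //; exact: itgm (itg_shift xi (iFn n0)).
have key : `|corr (Fn n0) D w - corr (Fn n0) D 0| <= e / 2.
 rewrite (corr_swap w iFnD).2 (corr_swap 0 iFnD).2 oppr0 -[- w]add0r.
 by apply: hd => o; rewrite -[- w]sub0r coB (_ : co o 0 = 0) ?sub0r ?normrN// ; case: (o) => [i|] //=; rewrite mxE.
rewrite !FE; have := restB w; have := restB 0; move: key; rewrite /e8.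
move: (corr _ _ w) (corr _ _ 0) (corr (rest n0) D w) (corr (rest n0) D 0) => a b c c'.
rewrite !ler_norml; lra.
Unshelve. all: by end_near. Qed.

End correlation_pairing.

Section testing.
Implicit Types (w x : Z).

Definition cont0 (K : Z -> R) := forall e, 0 < e -> exists2 d, 0 < d &
 forall w, near0 d w -> `|K w - K 0| <= e.

Lemma cont0D K L : cont0 K -> cont0 L -> cont0 (fun w => K w + L w).
Proof.
move=> cK cL e e0; have e2 : 0 < e / 2 by rewrite divr_gt0.
have [d1 d10 h1] := cK _ e2; have [d2 d20 h2] := cL _ e2.
exists (Num.min d1 d2); first by rewrite lt_min d10.
move=> w hw; have := h1 w (near0W _ hw); have := h2 w (near0W _ hw).
rewrite !ge_min !lexx orbT => /(_ isT) l2 /(_ isT) l1.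
have -> : K w + L w - (K 0 + L 0) = (K w - K 0) + (L w - L 0) by ring.
by rewrite (splitr e); apply: le_trans (ler_normD _ _) (lerD l1 l2).
Qed.

Lemma cont0N K : cont0 K -> cont0 (fun w => - K w).
Proof.
move=> cK e e0; have [d d0 h] := cK e e0; exists d => // w hw.
by rewrite -opprD normrN; exact: h.
Qed.

Lemma cont0_sum (I : Type) (s : seq I) (K : I -> Z -> R) : (forall i, cont0 (K i)) ->
 cont0 (fun w => \sum_(i <- s) K i w).
Proof.
move=> h; elim: s => [|i s IH].
 by move=> e e0; exists 1 => // w _; rewrite !big_nil subrr normr0 ltW.
have -> : (fun w => \sum_(j <- i :: s) K j w) = (fun w => K i w + \sum_(j <- s) K j w).
 by ext => w; rewrite big_cons.
exact: cont0D.
Qed.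

Variables (p : R) (f Bf v : Z -> R) (Fl Dv : 'I_N -> Z -> R) (A B : option 'I_N -> R) (e MV : R).
Hypotheses (p1 : 1 < p) (iFl : forall i, itg (Fl i))
 (iFlp : forall i, itg (fun z => `|Fl i z| `^ (p / (p - 1)))) (if_ : itg f) (iB : itg Bf)
 (iv : itg v) (vM : forall z, `|v z| <= MV)
 (vsupp : forall z, v z != 0 -> forall o, A o <= co o z <= B o)
 (iDv : forall i, itg (Dv i)) (iDvp : forall i, itg (fun z => `|Dv i z| `^ p))
 (vD : forall i, wpd (Some i) v (Dv i)) (e0 : 0 < e)
 (weq : forall bb, bumps bb ->
  (forall z, tens bb z != 0 -> forall o, A o - e <= co o z <= B o + e) ->
  II (fun z => Bf z * tens (dt None bb) z) =
  \sum_i II (fun z => Fl i z * tens (dt (Some i) bb) z) - II (fun z => f z * tens bb z)).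

(** The right-hand side of the weak equation for the shifted data, tested with [v]; at [xi = 0] it
    is the elliptic part minus the source part. *)
Definition pairing xi := \sum_i corr (Fl i) (Dv i) xi - corr f v xi.

Let pair_itg i xi : itg (fun z => Fl i (z + xi) * Dv i z).
Proof. exact: (itg_pair p1 (iFl i) (iDv i) (iFlp i) (iDvp i)). Qed.

Lemma pairing_cont0 : cont0 pairing.
Proof.
apply: cont0D; first by apply: cont0_sum => i; exact: (corr_pair_cont p1).
apply: cont0N => eps eps0; have [d d0 h] := corr_ucont iv vM if_ eps0.
by exists d => // w hw; have := h 0 w hw; rewrite add0r.
Qed.

Lemma measurable_pairing : measT pairing.
Proof.
apply: measurable_funB; last exact: corr_measurable.
by apply: measurable_sum => i; exact: corr_measurable.
Qed.

Definition pairing_bound := \sum_i (II (fun z => `|Fl i z| `^ (p / (p - 1))) + II (fun z => `|Dv i z| `^ p)) +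
 MV * II (fun z => `|f z|).

Lemma pairing_bnd xi : `|pairing xi| <= pairing_bound.
Proof.
apply: le_trans (ler_normB _ _) _; apply: lerD; last exact: (corr_bnd iv vM).
apply: le_trans (ler_norm_sum _ _ _) _; apply: ler_sum => i _.
exact: (corr_pair_bnd p1).
Qed.

Lemma corr_weak_derivative bb : bumps bb -> (forall z, tens bb z != 0 -> forall o, `|co o z| <= e) ->
 II (fun xi => corr Bf v xi * tens (dt None bb) xi) = II (fun xi => pairing xi * tens bb xi).
Proof.
move=> hb supp.
have [M0 hM0] := tens_bounded hb.
pose Md o := projT1 (cid (tens_bounded (bumps_dt o hb))).
have hMd o z : `|tens (dt o bb) z| <= Md o by rewrite /Md; case: cid.
have hd o := itg_tens (bumps_dt o hb); have hi := itg_tens hb.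
have iFV i xi := itg_corr iv vM xi (iFl i).
have ifV xi := itg_corr iv vM xi if_.
rewrite (corr_fubini_l iv iB _ (hd None) (hMd None)); last by move=> xi; exact: (itg_corr iv vM).
have i1 i := itg_corr_fubini iv (iFl i) (hd (Some i)) (hMd (Some i)).
have i2 := itg_corr_fubini iv if_ hi hM0.
transitivity (II (fun z => \sum_i v z * II (fun x => Fl i x * tens (dt (Some i) bb) (x - z)) -
  v z * II (fun x => f x * tens bb (x - z)))).
 congr Rint; ext => z; have [->|vz] := eqVneq (v z) 0.
  transitivity (0 : R); first exact: mul0r.
  rewrite big1; last by move=> i _; exact: mul0r.
  by rewrite mul0r subr0.
 rewrite -mulr_sumr -mulrBr; congr (_ * _).
 have E o : (fun x => tens (dt o bb) (x - z)) = tens (dt o (shb z bb)).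
  by ext => x; rewrite dt_shb tens_shb.
 have := weq (bumps_shb z hb) _.
 have -> : (fun x => Bf x * tens (dt None (shb z bb)) x) = fun x => Bf x * tens (dt None bb) (x - z).
  by ext => x; rewrite -(E None).
 have -> : (fun x => f x * tens (shb z bb) x) = fun x => f x * tens bb (x - z).
  by ext => x; rewrite tens_shb.
 move=> ->; last first.
  move=> x; rewrite tens_shb => /supp hx o; have := hx o; rewrite coB.
  have /andP[] := vsupp vz o; rewrite ler_norml; move: (co o x) (co o z) => a b; lra.
 congr (_ - _); apply: eq_bigr => i _; congr Rint; ext => x.
 by rewrite -(E (Some i)).
rewrite (IIB (itg_sum _ i1) i2) (II_sum _ i1).
have -> : (fun xi => pairing xi * tens bb xi) = (fun xi => \sum_i (corr (Fl i) (Dv i) xi * tens bb xi) -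
  corr f v xi * tens bb xi) by ext => xi; rewrite /pairing mulrBl mulr_suml.
have i3 i : itg (fun xi => corr (Fl i) (Dv i) xi * tens bb xi).
 apply: (itg_bounded_tens hb (corr_measurable (iDv i) (iFl i))) => xi.
 exact: (corr_pair_bnd p1 (iFl i) (iDv i) (iFlp i) (iDvp i) xi).
have i4 : itg (fun xi => corr f v xi * tens bb xi).
 by apply: (itg_bounded_tens hb (corr_measurable iv if_)) => xi; exact: (corr_bnd iv vM).
rewrite (IIB (itg_sum _ i3) i4) (II_sum _ i3); congr (_ - _).
 apply: eq_bigr => i _.
 by rewrite -(corr_wpd_r (iFl i) iv vM (iDv i) (pair_itg i) (vD i) hb)
  -(corr_fubini_l iv (iFl i) (iFV i) (hd (Some i)) (hMd (Some i))).
by rewrite -(corr_fubini_l iv if_ ifV hi hM0).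
Qed.

(** The weak derivative becomes a genuine one at 0, because [pairing] is continuous there. The
    increment runs from [- h] to 0, so that the difference of the time terms is multiplied by the
    test function at the later time, as in [bregman_convex]. *)
Lemma corr_time_increment eps : 0 < eps -> exists2 d, 0 < d & forall h, 0 < h < d ->
 `|corr Bf v 0 - corr Bf v (dir None (- h)) + h * pairing 0| <= h * eps.
Proof.
move=> eps0; have [d1 d10 hd1] := pairing_cont0 eps0.
pose d := Num.min (d1 / 2) (e / 2).
have d0 : 0 < d by rewrite lt_min !divr_gt0.
have dd1 : d <= d1 / 2 by rewrite ge_min lexx.
have dde : d <= e / 2 by rewrite ge_min lexx orbT.
exists d => // h /andP[h0 hd].
have mK := corr_measurable iv iB.
have mP : measT (fun z => - pairing z).
 have := measurable_funB (@measurable_cst _ _ Z R setT 0) measurable_pairing.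
 by congr measurable_fun; ext => z; rewrite /= sub0r.
have bP z : `|- pairing z| <= pairing_bound by rewrite normrN; exact: pairing_bnd.
have := @weak_increment R N (corr Bf v) (fun z => - pairing z) (dir None (- h)) None h
 (- pairing 0) eps d _ pairing_bound mK (fun z => corr_bnd iv vM z iB) mP bP h0 d0.
have s0 : dir None (- h) + dir None h = 0 :> Z.
 by apply: coP => o; rewrite coD !co_dir; case: eqP => // _; rewrite ?addr0 ?addNr; case: (o) => [i|] //=; rewrite ?mxE.
move=> H; have -> : corr Bf v 0 = corr Bf v (dir None (- h) + dir None h) by rewrite s0.
rewrite -[h * pairing 0]opprK -mulrN; apply: H.
- move=> b hb hsupp; rewrite (corr_weak_derivative hb).
  rewrite -IIN.
   by congr Rint; ext => z; rewrite mulNr opprK.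
  exact: (itg_bounded_tens hb mP bP).
 move=> z /hsupp[r /andP[r0 rh] nz] o; have := nz o; rewrite coB coD !co_dir.
 move: hd dde; case: eqP => _; rewrite ltr_norml ler_norml; move: (d) (co o z) => dd c; lra.
- exact: (corr_cont_at iv vM).
- exact: (corr_cont_at iv vM).
move=> r w /andP[r0 rh] nw; rewrite -opprD normrN; apply: hd1 => o.
have := nw o; rewrite !coD !co_dir; move: hd dd1; case: eqP => _; rewrite !ltr_norml; move: (d) (co o w) => dd c; lra.
Qed.

End testing.

Section truncated_energy.
Implicit Types (x : Z).

Lemma tens_forward_cvg b o z : bumps b ->
 n.+1%:R * (tens b (z + dir o n.+1%:R^-1) - tens b z) @[n --> \oo] --> tens (dt o b) z.
Proof.
move=> hb; have := @tens_quotient_cvg _ _ _ o (- z) (bumps_rfl 0 hb).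
have E y : tens (rfl b 0) y = tens b (- y) by rewrite tens_rfl sub0r.
by rewrite tens_dt_rfl// opprK sub0r opprK; under eq_fun do rewrite !E opprD !opprK.
Qed.

Lemma tens_forward_lipschitz b o : bumps b -> exists2 M : R, 0 <= M & forall z h, 0 < h ->
 `|tens b (z + dir o h) - tens b z| <= M * h.
Proof.
move=> hb; have [M M0 hM] := tens_lipschitz o (bumps_rfl 0 hb); exists M => // z h h0.
have E y : tens (rfl b 0) y = tens b (- y) by rewrite tens_rfl sub0r.
by have := hM (- z) h h0; rewrite !E opprD !opprK.
Qed.

Lemma spow_norm (s al : R) : 0 < al -> `|spow s al| = `|s| `^ al.
Proof.
move=> al0; have [->|s0] := eqVneq s 0.
 by rewrite /spow mulr0 normr0 powR0 ?gt_eqF.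
rewrite /spow normrM ger0_norm ?powR_ge0// -[X in _ * X]powRr1// -powRD ?subrK//.
by rewrite normr_eq0 s0 implybT.
Qed.

Lemma measurable_spow (F : Z -> R) g : measT F ->
 measT (fun z => spow (F z) g).
Proof.
move=> mF; apply: mfunM => //.
by apply: (mpowR (g - 1)); exact: mcomp.
Qed.

Lemma measurable_trunc (F : Z -> R) k M : measT F ->
 measT (fun z => trunc k M (F z)).
Proof.
by move=> mF; apply: measurable_funB; apply: measurable_maxr => //; exact: measurable_funB.
Qed.

Lemma measurable_bregman (F H : Z -> R) al k : measT F -> measT H ->
 measT (fun z => bregman al k (H z) (F z)).
Proof.
move=> mF mH; apply: measurable_funB.
 by apply: mfunM => //; exact: measurable_spow.
apply: mfunM => //; apply: measurable_funB => //.
by apply: (mpowR (al + 1)); exact: measurable_funD.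
Qed.

Lemma tens_dt_supp (A B : option 'I_N -> R) b o z : bumps b ->
 (forall z, tens b z != 0 -> forall o, A o <= co o z <= B o) ->
 tens (dt o b) z != 0 -> forall o, A o <= co o z <= B o.
Proof.
move=> hb supp nz o'; apply: contraNT nz => out; apply/eqP.
have [_ E] := is_derive_tens o z 0 (fun o => (hb o).1).
have z0 : z - dir o 0 = z by apply: coP => j; rewrite coB co_dir; case: eqP; rewrite subr0.
rewrite z0 in E; apply/oppr_inj; rewrite oppr0 -E.
suff : is_derive (0 : R) (1 : R) (fun r => tens b (z - dir o r)) 0 by case.
apply: (@near_eq_is_derive _ R R (cst 0)).
have [c|c] : co o' z < A o' \/ B o' < co o' z.
 by move: out; rewrite negb_and -!ltNge => /orP.
- near=> r; apply/esym/eqP; apply: contraTT isT => /supp/(_ o'); rewrite coB co_dir.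
 have hr : `|r| < A o' - co o' z.
  near: r; apply: (@cvgr0_norm_lt _ _ _ _ _ (fun r : R => r)); first exact: cvg_id.
  by rewrite subr_gt0; exact: c.
 have := c; move: hr; rewrite ltr_norml; case: eqP => _; move: (co o' z) => y; lra.
- near=> r; apply/esym/eqP; apply: contraTT isT => /supp/(_ o'); rewrite coB co_dir.
 have hr : `|r| < co o' z - B o'.
  near: r; apply: (@cvgr0_norm_lt _ _ _ _ _ (fun r : R => r)); first exact: cvg_id.
  by rewrite subr_gt0; exact: c.
 have := c; move: hr; rewrite ltr_norml; case: eqP => _; move: (co o' z) => y; lra.
Unshelve. all: by end_near. Qed.

(* The local weak equation for an abstract flux [Fl]; it is stable under
 [w, Fl, f -> - w, - Fl, - f]. *)
Record weak_local (w f : Z -> R) (Dw Fl : 'I_N -> Z -> R) (dl : 'I_N -> R) (al p Lam e : R)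
  (A B A' B' : option 'I_N -> R) : Prop := WeakLocal {
 wl_m : forall i, measT (Fl i);
 wl_le : forall i z, `|Fl i z| <= Lam * Num.max (`|Dw i z| - dl i) 0 `^ (p - 1) * \1_(obox A' B') z;
 wl_ge : forall i z, obox A' B' z ->
  Num.max (`|Dw i z| - dl i) 0 `^ p <= Lam * (Fl i z * Dw i z);
 wl_sub : forall o, A' o < A o - e /\ B o + e < B' o;
 wl_eq : forall bb, bumps bb ->
  (forall z, tens bb z != 0 -> forall o, A o - e <= co o z <= B o + e) ->
  II (fun z => spow (w z) al * \1_(obox A' B') z * tens (dt None bb) z) =
  \sum_i II (fun z => Fl i z * tens (dt (Some i) bb) z) - II (fun z => f z * tens bb z) }.

Section one_level.
Variables (w f : Z -> R) (Dw Fl : 'I_N -> Z -> R) (dl : 'I_N -> R) (al p Lam e k M : R)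
 (A B A' B' : option 'I_N -> R) (th : option 'I_N -> R -> R).
Hypotheses (WL : weak_local w f Dw Fl dl al p Lam e A B A' B')
 (iw : itg w) (iDw : forall i, itg (Dw i)) (wD : forall i, wpd (Some i) w (Dw i))
 (iDwp : forall i, itg (fun z => `|Dw i z| `^ p)) (iwp : itg (fun z => `|w z| `^ p))
 (if_ : itg f) (iFl : forall i, itg (Fl i))
 (iFlp : forall i, itg (fun z => `|Fl i z| `^ (p / (p - 1))))
 (iB : itg (fun z => spow (w z) al * \1_(obox A' B') z))
 (p1 : 1 < p) (al0 : 0 < al) (k0 : 0 < k) (M0 : 0 <= M) (e0 : 0 < e)
 (hth : bumps th) (th0 : forall z, 0 <= tens th z)
 (thsupp : forall z, tens th z != 0 -> forall o, A o <= co o z <= B o).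
Notation H z := (trunc k M (w z)).
Notation ps i z := (pos_slope k w (Dw i) z - pos_slope (k + M) w (Dw i) z).
Notation G z := (bregman al k (trunc k M (w z)) (w z)).
Let p0 : 0 < p := lt_trans ltr01 p1.

Definition test_der i z : R := ps i z * Dw i z * tens th z + H z * tens (dt (Some i) th) z.

Let iH : itg (fun z => H z).
Proof.
apply: (itg_dom (measurable_trunc k M (itgm iw)) _ (itg_norm iw)) => z.
rewrite ger0_norm ?trunc_ge0//; apply: le_trans (trunc_le_pos k (w z) M0) _.
by rewrite ge_max normr_ge0 andbT lerBlDr (le_trans (ler_norm _))// lerDl ltW.
Qed.

Let ps01 i z : 0 <= ps i z <= 1.
Proof.
have kM : k <= k + M by rewrite lerDl.
rewrite /pos_slope; set b1 := (k < w z) || _; set b2 := (k + M < w z) || _.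
have : b2 ==> b1.
 apply/implyP => /orP[h|/andP[/eqP h1 h2]]; rewrite /b1; first by rewrite (le_lt_trans kM h).
 by rewrite h2 andbT orbC eq_sym -le_eqVlt h1.
by case: b1; case: b2; rewrite ?subrr ?subr0 ?lexx ?ler01.
Qed.

Let mps i : measT (fun z => ps i z).
Proof. by apply: measurable_funB; exact: measurable_pos_slope (itgm iw) (itgm (iDw i)). Qed.

Let ipsD i : itg (fun z => ps i z * Dw i z).
Proof.
rewrite (_ : (fun z => _) = fun z => Dw i z * ps i z); last by ext => z; rewrite mulrC.
apply: (itg_bnd (M := 1) (mps i) _ (iDw i)) => z.
by have /andP[h0 h1] := ps01 i z; rewrite ger0_norm.
Qed.

Let wpdH i : wpd (Some i) (fun z => H z) (fun z => ps i z * Dw i z).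
Proof.
have kM : 0 <= k + M by rewrite addr_ge0// ltW.
have ipos j : 0 <= j -> itg (fun z => Num.max (w z - j) 0).
 move=> j0; apply: (itg_dom _ _ (itg_norm iw)).
  by apply: measurable_maxr => //; apply: measurable_funB => //; exact: itgm iw.
 move=> z; rewrite ger0_norm ?le_max ?lexx ?orbT// ge_max normr_ge0 andbT lerBlDr.
 by rewrite (le_trans (ler_norm _))// lerDl.
have islope j : itg (fun z => pos_slope j w (Dw i) z * Dw i z).
 rewrite (_ : (fun z => _) = fun z => Dw i z * pos_slope j w (Dw i) z); last by ext => z; rewrite mulrC.
 apply: (itg_bnd (M := 1) (measurable_pos_slope j (itgm iw) (itgm (iDw i))) _ (iDw i)) => z.
 by rewrite /pos_slope normr_nat lern1 leq_b1.
have := wpdD (ipos _ (ltW k0)) (islope k) (itgN (ipos _ kM)) (itgN (islope (k + M)))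
 (wpd_pos (ltW k0) iw (iDw i) (wD i)) (wpdN (ipos _ kM) (islope (k + M)) (wpd_pos kM iw (iDw i) (wD i))).
by congr wpd; ext => z; rewrite mulrBl.
Qed.

Let v z := H z * tens th z.

Let iv : itg v.
Proof. by exact: (itg_mul_tens hth iH). Qed.

Let wpdv i : wpd (Some i) v (test_der i).
Proof. exact: (wpd_mul iH (ipsD i) (wpdH i) hth). Qed.

Lemma itg_test_der i : itg (test_der i).
Proof.

apply: itgD; first exact: (itg_mul_tens hth (ipsD i)).
exact: (itg_mul_tens (bumps_dt (Some i) hth) iH).
Qed.

Lemma itg_test_der_p i : itg (fun z => `|test_der i z| `^ p).
Proof.
have [C hC] := tens_bounded hth; have [C' hC'] := tens_bounded (bumps_dt (Some i) hth).
have C0 : 0 <= C by exact: le_trans (normr_ge0 _) (hC 0).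
have C'0 : 0 <= C' by exact: le_trans (normr_ge0 _) (hC' 0).
apply: (itg_dom (g := fun z => 2 `^ p * (C `^ p * `|Dw i z| `^ p + C' `^ p * `|w z| `^ p))).
- apply: (mpowR p); apply: mcomp => //.
 exact: itgm (itg_test_der i).
- move=> z; rewrite ger0_norm ?powR_ge0// -!powRM//.
 apply: le_trans (powRD_le (mulr_ge0 C0 (normr_ge0 _)) (mulr_ge0 C'0 (normr_ge0 _)) (ltW p0)).
 powR_mono; rewrite ?(ltW p0) ?normr_ge0 ?addr_ge0 ?mulr_ge0//.
 apply: le_trans (ler_normD _ _) _; apply: lerD; rewrite normrM mulrC.
  apply: ler_pM => //; rewrite normrM.
  by have /andP[h0 h1] := ps01 i z; rewrite (ger0_norm h0) ler_piMl.
 apply: ler_pM => //; rewrite ger0_norm ?trunc_ge0//; apply: le_trans (trunc_le_pos k (w z) M0) _.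
 by rewrite ge_max normr_ge0 andbT lerBlDr (le_trans (ler_norm _))// lerDl ltW.
- by apply: itgZ; apply: itgD; exact: itgZ.
Qed.

Let Gb z := G z * \1_(obox A' B') z.

Let Gb_le z : `|Gb z| <= M * `|spow (w z) al * \1_(obox A' B') z|.
Proof.
rewrite /Gb normrM ger0_norm ?bregman_ge0// normrM mulrA ler_wpM2r//.
apply: le_trans (bregman_le al0 k0 (w z) M0) _; rewrite spow_norm//.
have [h|h] := ltP k (w z); last by rewrite mul0r mulr_ge0 ?powR_ge0.
by rewrite mul1r ler_wpM2r ?powR_ge0// trunc_le.
Qed.

Let iG : itg Gb.
Proof.
have mG : measT Gb.
 apply: mfunM; last by apply: mindic; exact: mset_obox.
 by apply: measurable_bregman; [exact: (itgm iw)|exact: measurable_trunc (itgm iw)].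
by apply: (itg_dom mG Gb_le); apply: itgZ; exact: itg_norm iB.
Qed.

(** The backward difference of the time term against [v] is, by [bregman_convex], at least that of
    [G] against [th]. A shift of variables moves the latter difference to the smooth [th], and the
    step size tends to 0. *)
Lemma truncated_energy :
 \sum_i II (fun z => Fl i z * test_der i z) - II (fun z => f z * v z) <=
 II (fun z => G z * tens (dt None th) z).
Proof.
have [C hC] := tens_bounded hth.
have vM z : `|v z| <= M * C.
 by rewrite normrM; apply: ler_pM => //; rewrite ger0_norm ?trunc_ge0// trunc_le.
have vsupp z : v z != 0 -> forall o, A o <= co o z <= B o.
 by rewrite mulf_eq0 negb_or => /andP[_]; exact: thsupp.
have inbox z o h : (forall o, A o <= co o z <= B o) -> 0 <= h < e -> obox A' B' (z + dir o (- h)).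
 move=> hz /andP[h0 he] o'; rewrite /= in_itv/= coD co_dir.
 have /andP[] := hz o'; have [] := wl_sub WL o'; case: eqP => _; move: (co o' z) => c; lra.
have inc := corr_time_increment p1 iFl iFlp if_ iB iv vM vsupp itg_test_der itg_test_der_p wpdv e0 (wl_eq WL).
have P0 : pairing f v Fl test_der 0 = \sum_i II (fun z => Fl i z * test_der i z) - II (fun z => f z * v z).
 congr (_ - _); last by congr Rint; ext => z; rewrite addr0.
 by apply: eq_bigr => i _; congr Rint; ext => z; rewrite addr0.
rewrite -P0.
have -> : (fun z => G z * tens (dt None th) z) = (fun z => Gb z * tens (dt None th) z).
 ext => z; rewrite /Gb indicE; have [zb|zb] := pselect (obox A' B' z).
  by rewrite mem_set// mulr1.
 suff -> : tens (dt None th) z = 0 by rewrite !mulr0.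
 apply/eqP; apply: contra_notT zb => nz; rewrite -[z]addr0.
 have -> : 0 = dir None (- 0) :> Z.
  by rewrite /dir oppr0.
 by apply: inbox; [exact: tens_dt_supp hth thsupp nz|rewrite lexx].
apply/ler_addgt0Pr => eps eps0; have [d d0 hd] := inc eps eps0.
have mth := itgm (itg_tens hth).
have mdq n : measT (fun z => n.+1%:R * (tens th (z + dir None n.+1%:R^-1) - tens th z)).
 by apply: mfunM => //; apply: measurable_funB => //; exact: itgm (itg_shift _ (itg_tens hth)).
have lim : II (fun z => Gb z * (n.+1%:R * (tens th (z + dir None n.+1%:R^-1) - tens th z))) @[n --> \oo]
  --> II (fun z => Gb z * tens (dt None th) z).
 have [L L0 hL] := tens_forward_lipschitz None hth.
 apply: (II_cvg (g := fun z => L * `|Gb z|)).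
 - by move=> n; apply: mfunM; [exact: itgm iG|exact: mdq].
 - by apply: mfunM; [exact: itgm iG|exact: bumps_meas (bumps_dt _ hth)].
 - by apply: aeW => z; apply: cvgMr; exact: tens_forward_cvg.
 - by apply: itgZ; exact: itg_norm iG.
 - move=> n z; rewrite normrM mulrC; apply: ler_wpM2r => //.
  rewrite normrM ger0_norm// mulrC -ler_pdivlMr ?ltr0n//.
  by apply: hL; rewrite invr_gt0 ltr0n.
have : eps + II (fun z => Gb z * (n.+1%:R * (tens th (z + dir None n.+1%:R^-1) - tens th z))) @[n --> \oo]
  --> eps + II (fun z => Gb z * tens (dt None th) z).
 by apply: cvgD => //; exact: cvg_cst.
rewrite [leRHS]addrC; move/cvgr_to_ge; apply; have de0 : 0 < Num.min d e by rewrite lt_min d0.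
near=> n; have hde : n.+1%:R^-1 < Num.min d e.
 by near: n; exact: (near_infty_natSinv_lt (PosNum de0)).
pose h : R := n.+1%:R^-1; have h0 : 0 < h by rewrite invr_gt0 ltr0n.
have hd' : 0 < h < d by rewrite h0 (lt_le_trans hde)// ge_min lexx.
have he : 0 <= h < e by rewrite (ltW h0) (lt_le_trans hde)// ge_min lexx orbT.
have {hd}key := hd h hd'.
have hshift z : z + dir None h + dir None (- h) = z :> Z.
 by apply: coP => o; rewrite !coD !co_dir; case: eqP => _; rewrite ?addr0 ?addrK.
have iG1 := itg_bnd mth hC (itg_shift (dir None (- h)) iG).
have iG0 := itg_bnd mth hC iG.
have iG2 : itg (fun z => Gb z * tens th (z + dir None h)).
 exact: (itg_bnd (itgm (itg_shift (dir None h) (itg_tens hth))) (fun z => hC _) iG).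
have E1 : II (fun z => Gb (z + dir None (- h)) * tens th z) = II (fun z => Gb z * tens th (z + dir None h)).
 by rewrite -(II_shift (dir None h) iG1); congr Rint; ext => z; rewrite hshift.
have iv0 := itg_corr iv vM 0 iB; have iv1 := itg_corr iv vM (dir None (- h)) iB.
(* [bregman_convex] is applied with [s] the value of [w] at [z] and [s'] its value at the earlier
   time; both points lie in the box where the time term is not cut off. *)
have conv : II (fun z => Gb z * tens th z) - II (fun z => Gb z * tens th (z + dir None h)) <=
  corr (fun z => spow (w z) al * \1_(obox A' B') z) v 0 -
  corr (fun z => spow (w z) al * \1_(obox A' B') z) v (dir None (- h)).
 rewrite -E1 -(IIB iG0 iG1) -(IIB iv0 iv1); apply: le_II; [exact: itgB|exact: itgB|] => z.
 rewrite -!mulrBl /v mulrA; have [->|nz] := eqVneq (tens th z) 0; first by rewrite !mulr0.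
 rewrite ler_wpM2r// addr0 /Gb !indicE.
 have z1 := inbox z None h (thsupp nz) he.
 have z0 : obox A' B' z.
  move=> o; have /andP[c1 c2] := thsupp nz o; have [s1 s2] := wl_sub WL o.
  rewrite /= in_itv/=; move: c1 c2 s1 s2; move: (co o z) => c; lra.
 by rewrite !mem_set// !mulr1; exact: bregman_convex.
have E2 : II (fun z => Gb z * (n.+1%:R * (tens th (z + dir None n.+1%:R^-1) - tens th z))) =
  h^-1 * (II (fun z => Gb z * tens th (z + dir None h)) - II (fun z => Gb z * tens th z)).
 rewrite -(IIB iG2 iG0) -IIZ; last exact: itgB.
 by congr Rint; ext => z; rewrite /h invrK; ring.
have hh : h * h^-1 = 1 by rewrite mulfV// gt_eqF.
rewrite E2 -(ler_pM2l h0).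
have arith (x y P g1 g2 hi : R) : h * hi = 1 -> `|x - y + h * P| <= h * eps ->
  g1 - g2 <= x - y -> h * P <= h * (eps + hi * (g2 - g1)).
 by move=> hh' /ler_normlP[_ k2] hc; rewrite mulrDr mulrA hh' mul1r; lra.
exact: arith hh key conv.
Unshelve. all: by end_near. Qed.

End one_level.
End truncated_energy.

Section energy_level.
Implicit Types (x : Z).

Lemma trunc_eventually (k s M : R) : 0 <= M -> s <= k + M -> trunc k M s = Num.max (s - k) 0.
Proof. by move=> M0 sM; rewrite /trunc [X in _ - X]max_r ?subr0// subr_le0. Qed.

Variables (w f : Z -> R) (Dw Fl : 'I_N -> Z -> R) (dl : 'I_N -> R) (al p Lam e k : R)
 (A B A' B' : option 'I_N -> R) (th : option 'I_N -> R -> R).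
Hypotheses (WL : weak_local w f Dw Fl dl al p Lam e A B A' B')
 (iw : itg w) (iDw : forall i, itg (Dw i)) (wD : forall i, wpd (Some i) w (Dw i))
 (iDwp : forall i, itg (fun z => `|Dw i z| `^ p)) (iwp : itg (fun z => `|w z| `^ p))
 (if_ : itg f) (iFl : forall i, itg (Fl i))
 (iFlp : forall i, itg (fun z => `|Fl i z| `^ (p / (p - 1))))
 (iB : itg (fun z => spow (w z) al * \1_(obox A' B') z))
 (iwq : itg (fun z => `|w z| `^ (al + 1) * \1_(obox A' B') z))
 (p1 : 1 < p) (al0 : 0 < al) (k0 : 0 < k) (e0 : 0 < e)
 (hth : bumps th) (th0 : forall z, 0 <= tens th z)
 (thsupp : forall z, tens th z != 0 -> forall o, A o <= co o z <= B o)
 (isrc : itg (fun z => ppart w k z * `|f z| * tens th z)).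
Let p0 : 0 < p := lt_trans ltr01 p1.

Definition level_der i z : R :=
 pos_slope k w (Dw i) z * Dw i z * tens th z + ppart w k z * tens (dt (Some i) th) z.

Let box_dt o z : tens (dt o th) z != 0 -> obox A' B' z.
Proof.
move=> nz o'; have /andP[h1 h2] := tens_dt_supp hth thsupp nz o'; have [s1 s2] := wl_sub WL o'.
have e0' := e0; rewrite /= in_itv/=; apply/andP; split; move: e0' h1 h2 s1 s2; move: (co o' z) => c; lra.
Qed.

Let pp0 z : 0 <= ppart w k z. Proof. by rewrite le_max lexx orbT. Qed.

Let ppw z : ppart w k z <= `|w z|.
Proof. by rewrite ge_max normr_ge0 andbT lerBlDr (le_trans (ler_norm _))// lerDl ltW. Qed.

Let mpp : measT (ppart w k).
Proof. by apply: measurable_maxr => //; apply: measurable_funB => //; exact: itgm iw. Qed.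

Let ip2 (F G : Z -> R) : itg (fun z => `|F z| `^ (p / (p - 1))) -> itg (fun z => `|G z| `^ p) ->
 measT F -> measT G -> itg (fun z => `|F z| * `|G z|).
Proof.
move=> iF iG mF mG; apply: (itg_dom _ _ (itgD iF iG)).
 by apply: mfunM; exact: mcomp.
by move=> z; rewrite normrM !normr_id; exact: young_conj.
Qed.

Let I_ n z := \sum_i Fl i z * test_der w Dw k n%:R th i z - f z * (trunc k n%:R (w z) * tens th z) -
 bregman al k (trunc k n%:R (w z)) (w z) * tens (dt None th) z.

Let I z := \sum_i Fl i z * level_der i z - f z * (ppart w k z * tens th z) -
 bregman al k (ppart w k z) (w z) * tens (dt None th) z.

(** The upper truncation is removed: for each [z] the integrand is eventually constant in [n].
    Majorants are the products [|Fl| |Dw|] and [|Fl| |w|], the source integrand, and [|w|^(al+1)] on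
    the box. *)
Lemma energy_level : [/\ forall i, itg (fun z => Fl i z * level_der i z),
 itg (fun z => f z * (ppart w k z * tens th z)),
 itg (fun z => bregman al k (ppart w k z) (w z) * tens (dt None th) z) &
 \sum_i II (fun z => Fl i z * level_der i z) <=
 II (fun z => f z * (ppart w k z * tens th z)) +
 II (fun z => bregman al k (ppart w k z) (w z) * tens (dt None th) z)].
Proof.
have [C hC] := tens_bounded hth.
pose Cd o := projT1 (cid (tens_bounded (bumps_dt o hth))).
have hCd o z : `|tens (dt o th) z| <= Cd o by rewrite /Cd; case: cid.
have C0 : 0 <= C by exact: le_trans (normr_ge0 _) (hC 0).
have Cd0 o : 0 <= Cd o by exact: le_trans (normr_ge0 _) (hCd o 0).
have mth := bumps_meas hth; have mdt o := bumps_meas (bumps_dt o hth).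
have mw := itgm iw; have mf := itgm if_; have mDw i := itgm (iDw i); have mFl i := itgm (iFl i).
have mslope j i := measurable_pos_slope j mw (mDw i).
have tpp n z : 0 <= trunc k n%:R (w z) <= ppart w k z.
 by rewrite trunc_ge0//= trunc_le_pos.
have slope01 j i z : 0 <= pos_slope j w (Dw i) z <= 1 by rewrite ler0n lern1 leq_b1.
pose g1 i z := C * (`|Fl i z| * `|Dw i z|) + Cd (Some i) * (`|Fl i z| * `|w z|).
have ig1 i : itg (g1 i) by apply: itgD; apply: itgZ; exact: ip2.
pose g3 z := Cd None * (`|w z| `^ (al + 1) * \1_(obox A' B') z).
have ig3 : itg g3 by exact: itgZ.
have b1 n i z : `|Fl i z * test_der w Dw k n%:R th i z| <= g1 i z.
 rewrite normrM /g1 [C * _]mulrCA [Cd _ * _]mulrCA -mulrDr; apply: ler_wpM2l => //.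
 apply: le_trans (ler_normD _ _) _; apply: lerD; rewrite normrM mulrC; apply: ler_pM => //.
  rewrite normrM ler_piMl//; have := slope01 k i z; have := slope01 (k + n%:R) i z.
  by rewrite ler_norml; move: (pos_slope _ _ _ _) (pos_slope _ _ _ _) => a b; lra.
 by have /andP[t0 t1] := tpp n z; rewrite ger0_norm// (le_trans t1).
have b1' i z : `|Fl i z * level_der i z| <= g1 i z.
 rewrite normrM /g1 [C * _]mulrCA [Cd _ * _]mulrCA -mulrDr; apply: ler_wpM2l => //.
 apply: le_trans (ler_normD _ _) _; apply: lerD; rewrite normrM mulrC; apply: ler_pM => //.
  by rewrite normrM ler_piMl//; have /andP[s0 s1] := slope01 k i z; rewrite ger0_norm.
 by rewrite ger0_norm.
have b2 (H : R) z : 0 <= H <= ppart w k z -> `|f z * (H * tens th z)| <= ppart w k z * `|f z| * tens th z.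
 move=> /andP[h0 h1]; rewrite !normrM (ger0_norm (th0 z)) (ger0_norm h0) mulrA [`|f z| * _]mulrC.
 by apply: ler_wpM2r => //; exact: ler_wpM2r.
have b3 M z : 0 <= M -> `|bregman al k (trunc k M (w z)) (w z) * tens (dt None th) z| <= g3 z.
 move=> M0; rewrite normrM ger0_norm ?bregman_ge0// mulrC /g3.
 have [->|nz] := eqVneq (tens (dt None th) z) 0.
  by rewrite normr0 mul0r mulr_ge0// mulr_ge0 ?powR_ge0.
 rewrite indicE mem_set ?mulr1; last exact: box_dt nz.
 apply: ler_pM => //; first exact: bregman_ge0.
 apply: le_trans (bregman_le al0 k0 (w z) M0) _.
 have [h|h] := ltP k (w z); last by rewrite mul0r powR_ge0.
 have s0 : 0 < w z by exact: lt_trans h.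
 rewrite mul1r gtr0_norm// powRD ?powRr1 ?(ltW s0)//; last by rewrite (gt_eqF s0) implybT.
 rewrite mulrC ler_wpM2l ?powR_ge0// (le_trans (trunc_le_pos k (w z) M0))//.
 by rewrite ge_max (ltW s0) andbT gerBl ltW.
have b3' z : `|bregman al k (ppart w k z) (w z) * tens (dt None th) z| <= g3 z.
 have -> : ppart w k z = trunc k `|w z| (w z).
  by rewrite trunc_eventually// (le_trans (ler_norm _))// lerDr ltW.
 exact: b3.
have mtr n : measT (fun z => trunc k n%:R (w z)) by exact: measurable_trunc.
have m1 i : measT (fun z => Fl i z * level_der i z) :=
 mfunM (mFl i) (measurable_funD (mfunM (mfunM (mslope k i) (mDw i)) mth)
  (mfunM mpp (mdt (Some i)))).
have m1n n i : measT (fun z => Fl i z * test_der w Dw k n%:R th i z) :=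
 mfunM (mFl i) (measurable_funD (mfunM (mfunM
  (measurable_funB (mslope k i) (mslope (k + n%:R) i)) (mDw i)) mth) (mfunM (mtr n) (mdt (Some i)))).
have m2 (H : Z -> R) : measT H -> measT (fun z => f z * (H z * tens th z)).
 by move=> mH; apply: mfunM => //; exact: mfunM.
have m3 (H : Z -> R) : measT H ->
  measT (fun z => bregman al k (H z) (w z) * tens (dt None th) z).
 by move=> mH; apply: mfunM => //; exact: measurable_bregman.
have i1 i : itg (fun z => Fl i z * level_der i z) by exact: itg_dom (m1 i) (b1' i) (ig1 i).
have i2 : itg (fun z => f z * (ppart w k z * tens th z)).
 by apply: (itg_dom (m2 _ mpp) _ isrc) => z; apply: b2; rewrite pp0 lexx.
have i3 : itg (fun z => bregman al k (ppart w k z) (w z) * tens (dt None th) z).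
 exact: itg_dom (m3 _ mpp) b3' ig3.
split => //.
have i1n n i : itg (fun z => Fl i z * test_der w Dw k n%:R th i z).
 exact: itg_dom (m1n n i) (b1 n i) (ig1 i).
have i2n n : itg (fun z => f z * (trunc k n%:R (w z) * tens th z)).
 by apply: (itg_dom (m2 _ (mtr n)) _ isrc) => z; exact: b2.
have i3n n : itg (fun z => bregman al k (trunc k n%:R (w z)) (w z) * tens (dt None th) z).
 by apply: (itg_dom (m3 _ (mtr n)) _ ig3) => z; exact: b3.
have iIn n : itg (I_ n) by apply: itgB => //; apply: itgB => //; exact: itg_sum.
have iI : itg I by apply: itgB => //; apply: itgB => //; exact: itg_sum.
have le0 n : II (I_ n) <= 0.
 have := truncated_energy WL iw iDw wD iDwp iwp if_ iFl iFlp iB p1 al0 k0 (ler0n R n) e0 hth th0 thsupp.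
 rewrite /I_ (IIB (itgB (itg_sum _ (i1n n)) (i2n n)) (i3n n)) (IIB (itg_sum _ (i1n n)) (i2n n)) (II_sum _ (i1n n)).
 by move=> h; rewrite subr_le0.
have cv : II (I_ n) @[n --> \oo] --> II I.
 apply: (II_cvg (g := fun z => \sum_i g1 i z + ppart w k z * `|f z| * tens th z + g3 z)).
 - by move=> n; exact: itgm (iIn n).
 - exact: itgm iI.
 - apply: aeW => z; apply: cvg_near_cst; near=> n.
  have wn : w z < k + n%:R.
   rewrite -ltrBlDl; apply: (le_lt_trans (ler_norm _)); near: n; exact: nbhs_infty_gtr.
  rewrite /I_ /I (trunc_eventually (ler0n _ _) (ltW wn)) -/(ppart w k z).
  congr (_ - _ - _); apply: eq_bigr => i _; congr (_ * _); rewrite /test_der /level_der.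
  rewrite (trunc_eventually (ler0n _ _) (ltW wn)) -/(ppart w k z).
  by rewrite {2}/pos_slope (ltNge (k + _)) (ltW wn)/= (lt_eqF wn)/= subr0.
 - by apply: itgD => //; apply: itgD => //; exact: itg_sum.
 - move=> n z; apply: le_trans (ler_normB _ _) _; apply: lerD; last exact: b3.
  apply: le_trans (ler_normB _ _) _; apply: lerD; last exact: b2.
  apply: le_trans (ler_norm_sum _ _ _) _; apply: ler_sum => i _; exact: b1.
have : II I <= 0 by apply: (cvgr_to_le cv); apply: nearW.
rewrite /I (IIB (itgB (itg_sum _ i1) i2) i3) (IIB (itg_sum _ i1) i2) (II_sum _ i1).
by rewrite -addrA -opprD subr_le0.
Unshelve. all: by end_near. Qed.

End energy_level.

Section young_level.
Implicit Types (x : Z).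

(** The constant of Young's inequality for the parameter [1 / (2 Lam^2)]. Multiplied by the flux
    bound [Lam], this parameter is half of the ellipticity constant [1 / Lam]. *)
Definition youngC (p Lam : R) : R := Lam * ((2 * Lam ^+ 2)^-1) `^ (1 - p).

Section pointwise.
Variables (p Lam K0 zeta d ex Fl D pp ps : R) (ab : bool).
Hypotheses (p1 : 1 < p) (Lam0 : 0 < Lam) (K00 : 0 <= K0) (z0 : 0 <= zeta) (ex0 : 0 <= ex)
 (hd : `|d| <= K0 * zeta `^ ((p - 1) / p)) (hF : `|Fl| <= Lam * ex `^ (p - 1))
 (hFD : ex `^ p <= Lam * (Fl * D)) (pp0 : 0 <= pp) (hpp : ~~ ab -> pp = 0) (hps : ab%:R <= ps).

(** Ellipticity bounds the gradient part from below, and Young's inequality absorbs the part with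
    the derivative [d] of the cut-off. This needs [|d|] to be bounded by [zeta^((p-1)/p)], the power
    of the weight that goes with [ex^(p-1)]. *)
Lemma young_pointwise : (2 * Lam)^-1 * (ex `^ p * (ab%:R * zeta)) - youngC p Lam * K0 `^ p * pp `^ p <=
 Fl * (ps * D * zeta + pp * d).
Proof.
have p0 : 0 < p by exact: lt_trans p1.
have FD0 : Lam^-1 * ex `^ p <= Fl * D by rewrite ler_pdivrMl.
have X0 : 0 <= ex `^ p by exact: powR_ge0.
have FDp : 0 <= Fl * D by rewrite (le_trans _ FD0)// mulr_ge0 ?invr_ge0 ?(ltW Lam0).
have t1 : Lam^-1 * (ex `^ p * (ab%:R * zeta)) <= Fl * (ps * D * zeta).
 have -> : Fl * (ps * D * zeta) = ps * (Fl * D) * zeta by ring.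
 have -> : Lam^-1 * (ex `^ p * (ab%:R * zeta)) = ab%:R * (Lam^-1 * ex `^ p) * zeta by ring.
 apply: ler_wpM2r => //; apply: ler_pM => //; first by rewrite mulr_ge0 ?invr_ge0 ?(ltW Lam0).
have C0 : 0 <= youngC p Lam * K0 `^ p * pp `^ p.
 by rewrite !mulr_ge0 ?powR_ge0 ?(ltW Lam0).
have t2 : `|Fl * (pp * d)| <= (2 * Lam)^-1 * (ex `^ p * (ab%:R * zeta)) + youngC p Lam * K0 `^ p * pp `^ p.
 case: (boolP ab) => [abT|/hpp ->]; last first.
  by rewrite mul0r mulr0 normr0 mul0r mulr0 powR0 ?gt_eqF// !mulr0 addr0.
 rewrite mul1r !normrM (ger0_norm pp0).
 apply: (letr (Lam * ((ex * zeta `^ p^-1) `^ (p - 1) * (K0 * pp)))).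
  have -> : (ex * zeta `^ p^-1) `^ (p - 1) = ex `^ (p - 1) * zeta `^ ((p - 1) / p).
   by rewrite powRM ?powR_ge0// -powRrM [p^-1 * _]mulrC.
  have -> : Lam * (ex `^ (p - 1) * zeta `^ ((p - 1) / p) * (K0 * pp)) =
   (Lam * ex `^ (p - 1)) * (pp * (K0 * zeta `^ ((p - 1) / p))) by ring.
  apply: ler_pM => //; first exact: mulr_ge0.
  by apply: ler_wpM2l.
 have e0 : 0 < (2 * Lam ^+ 2)^-1 by rewrite invr_gt0 mulr_gt0// exprn_gt0.
 have := young_absorb p1 e0 (mulr_ge0 ex0 (powR_ge0 zeta p^-1)) (mulr_ge0 K00 pp0).
 have -> : (ex * zeta `^ p^-1) `^ p = ex `^ p * zeta.
  by rewrite powRM ?powR_ge0// -powRrM mulVf ?gt_eqF// powRr1.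
 rewrite [in X in _ <= X](powRM _ K00 pp0) => h.
 apply: le_trans (ler_wpM2l (ltW Lam0) h) _.
 apply: le_of_eq; rewrite /youngC.
 move: (_ `^ (1 - p)) (ex `^ p) (K0 `^ p) (pp `^ p) => a b c c'.
 by field; rewrite gt_eqF.
have LE : Lam^-1 = (2 * Lam)^-1 + (2 * Lam)^-1 by field; rewrite gt_eqF.
move: t1 t2; rewrite LE mulrDl [Fl * (_ + _)]mulrDr ler_norml.
move: ((2 * Lam)^-1 * _) (youngC _ _ * _ * _) (Fl * (ps * D * zeta)) (Fl * (pp * d)) => a b c c'.
move=> h1 /andP[h2 _]; lra.
Qed.

End pointwise.

(** Split [e^(-1/y)] as [e^(-1/(p y))] times [e^(-(p-1)/(p y))]: the first factor compensates
    [y^(-2)], the second is the desired power of the cut-off. *)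
Lemma ek2_root (p y : R) : 1 < p -> ek 2 y <= 2 * p ^+ 2 * ek 0 y `^ ((p - 1) / p).
Proof.
move=> p1; have p0 : 0 < p by exact: lt_trans p1.
have p10 : 0 < p - 1 by rewrite subr_gt0.
have [y0|y0] := leP y 0.
 by rewrite ek_le0// !mulr_ge0 ?powR_ge0// ltW.
rewrite ek_powR ?divr_gt0// !ek_gt0 ?divr_gt0// expr0 mul1r.
have h := ek2_le2 (p * y); rewrite (@ek_gt0 R 2) ?mulr_gt0// in h.
have E : y^-1 ^+ 2 * expR (- y^-1) = p ^+ 2 * ((p * y)^-1 ^+ 2 * expR (- (p * y)^-1)) *
  expR (- (y / ((p - 1) / p))^-1).
 rewrite -!mulrA -expRD (_ : - (p * y)^-1 + _ = - y^-1); last first.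
  by field; rewrite !gt_eqF//.
 move: (expR (- y^-1)) => E; by field; rewrite !gt_eqF.
rewrite E ler_wpM2r ?expR_ge0// [2 * _]mulrC ler_wpM2l ?sqr_ge0//.
Qed.

Section cutoff_root.
Variables (a b gl gr : option 'I_N -> R) (gam p : R).
Hypotheses (gl0 : forall o, 0 < gl o) (gr0 : forall o, 0 < gr o) (gam0 : 0 < gam)
 (ggl : forall i, gam <= gl (Some i)) (ggr : forall i, gam <= gr (Some i)) (p1 : 1 < p).
Let p0 : 0 < p := lt_trans ltr01 p1.
Notation r := ((p - 1) / p).
Let r0 : 0 < r. Proof. by rewrite divr_gt0// subr_gt0. Qed.
Let r1 : r <= 1. Proof. by rewrite ler_pdivrMr// mul1r gerBl. Qed.

Let root_le (y : R) : 0 <= y <= 1 -> y <= y `^ r.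
Proof.
move=> /andP[y0 y1]; have [->|yn] := eqVneq y 0; first exact: powR_ge0.
by rewrite ger1_powR// y1 lt_neqAle eq_sym yn y0.
Qed.

Let quotient_le (X Y E F g : R) : 0 <= X -> X <= 2 * p ^+ 2 * E -> 0 <= Y -> Y <= F -> gam <= g ->
 X / (p * g) * Y <= 2 * p / gam * (E * F).
Proof.
move=> X0 XE Y0 YF gg; have g0 : 0 < g by exact: lt_le_trans gg.
have pg : 0 < p * g by exact: mulr_gt0.
apply: (letr ((2 * p ^+ 2 * E / (p * gam)) * F)).
 apply: ler_pM => //; first by rewrite divr_ge0// ltW.
 apply: ler_pM => //; first by rewrite invr_ge0 ltW.
 by rewrite lef_pV2 ?posrE ?mulr_gt0// ler_pM2l.
by apply: le_of_eq; field; rewrite !gt_eqF.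
Qed.

Lemma derive1_cutf_root i (x : R) :
 `|derive1 (cutf a b gl gr p (Some i)) x| <= 4 * p / gam * cutf a b gl gr p (Some i) x `^ r.
Proof.
have s1 := gl0 (Some i); have s2 := gr0 (Some i).
rewrite derive1_cutf /cutf /cutw powRM ?ek_ge0//.
set y1 := (x - _) / _; set y2 := (_ - x) / _.
have e1 := root_le (y := ek 0 y1); have e2 := root_le (y := ek 0 y2).
rewrite !ek_ge0 !ek0_le1 in e1 e2; have {}e1 := e1 isT; have {}e2 := e2 isT.
have k1 := ek2_root y1 p1; have k2 := ek2_root y2 p1.
set E1 := ek 0 y1 `^ r in e1 k1 *; set E2 := ek 0 y2 `^ r in e2 k2 *.
have E10 : 0 <= E1 by exact: powR_ge0.
have E20 : 0 <= E2 by exact: powR_ge0.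
have q1 : ek 2 y1 / (p * gl (Some i)) * ek 0 y2 <= 2 * p / gam * (E1 * E2).
 by apply: quotient_le => //; rewrite ?ek_ge0.
have q2 : ek 0 y1 * (ek 2 y2 / (p * gr (Some i))) <= 2 * p / gam * (E1 * E2).
 by rewrite mulrC [E1 * _]mulrC; apply: quotient_le => //; rewrite ?ek_ge0.
have n1 : 0 <= ek 2 y1 / (p * gl (Some i)) * ek 0 y2.
 by rewrite !mulr_ge0 ?ek_ge0 ?invr_ge0 ?mulr_ge0 ?(ltW p0) ?(ltW s1).
have n2 : 0 <= ek 0 y1 * (ek 2 y2 / (p * gr (Some i))).
 by rewrite !mulr_ge0 ?ek_ge0 ?invr_ge0 ?mulr_ge0 ?(ltW p0) ?(ltW s2).
apply: le_trans (ler_normB _ _) _; rewrite (ger0_norm n1) (ger0_norm n2).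
have -> : 4 * p / gam * (E1 * E2) = 2 * p / gam * (E1 * E2) + 2 * p / gam * (E1 * E2) by ring.
exact: lerD.
Qed.

Lemma tens_dt_cutf_root i z :
 `|tens (dt (Some i) (cutf a b gl gr p)) z| <= 4 * p / gam * tens (cutf a b gl gr p) z `^ r.
Proof.
rewrite tens_dt (tens_split (Some i)) normrM.
have P0 : 0 <= \prod_(o' | o' != Some i) cutf a b gl gr p o' (co o' z).
 by apply: prodr_ge0 => o' _; exact: cutf_ge0.
rewrite powRM ?cutf_ge0// mulrA (ger0_norm P0); apply: ler_pM => //.
 exact: derive1_cutf_root.
by apply: root_le; rewrite P0; apply: prod_le1 => o'; rewrite cutf_ge0 cutf_le1.
Qed.

End cutoff_root.

(** An additional time factor [psi], which need not have compact support. It selects the times in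
    the slice estimate. *)
Definition timecut (b : option 'I_N -> R -> R) (psi : R -> R) : option 'I_N -> R -> R :=
 fun o t => if o is Some _ then b o t else b o t * psi t.

Lemma tens_timecut b psi z : tens (timecut b psi) z = tens b z * psi z.2.
Proof. by rewrite /tens !prod_option /timecut /= mulrAC. Qed.

Lemma bumps_timecut b psi : bumps b -> Cinf psi -> bumps (timecut b psi).
Proof. by move=> hb cpsi [i|]; [exact: hb|apply: bump1_mul => //; exact: hb]. Qed.

Lemma tens_dtx_timecut b psi i z : tens (dt (Some i) (timecut b psi)) z = tens (dt (Some i) b) z * psi z.2.
Proof. by rewrite /tens !prod_option /dt /timecut /= mulrAC. Qed.

Lemma tens_dtt_timecut b psi z : bumps b -> Cinf psi ->
 tens (dt None (timecut b psi)) z = tens (dt None b) z * psi z.2 + tens b z * derive1 psi z.2.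
Proof.
move=> hb cpsi; rewrite /tens !prod_option /dt /=.
have -> : derive1 (timecut b psi None) z.2 = derive1 (b None) z.2 * psi z.2 + b None z.2 * derive1 psi z.2.
 have [_ E] := is_deriveM (Cinf_is_derive z.2 (hb None).1) (Cinf_is_derive z.2 cpsi).
 rewrite derive1E [LHS]E /= -[X in X + _]/(_ * _) -[X in _ + X]/(_ * _); ring.
ring.
Qed.

End young_level.

End weak_equations.

(** * From averages in time to almost every time *)

Section lebesgue_points.
Context {R : realType}.
Notation lam := (@lebesgue_measure R).

Definition step_at (tau r t : R) : R := sstep ((t - tau) / r).

Lemma Cinf_step_at tau r : Cinf (step_at tau r).
Proof.
rewrite /step_at (_ : (fun t => _) = fun t => sstep (r^-1 * t + - (tau / r))).
 by apply: Cinf_affine; exact: Cinf_sstep.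
by ext => t; congr sstep; ring.
Qed.

Lemma derive1_step_at tau r t : derive1 (step_at tau r) t = derive1 sstep ((t - tau) / r) / r.
Proof.
have h1 : is_derive t 1 (fun x : R => (x - tau) / r) r^-1.
 rewrite (_ : (fun x => _) = (r^-1 *: (fun x => x - tau))); last first.
  by ext => y; rewrite mulrC.
 have := is_deriveZ r^-1 (is_deriveB (is_derive_id t (1 : R)) (is_derive_cst tau t 1)).
 by rewrite subr0 [_ *: 1]mulr1.
have [_ E] := @is_derive1_comp _ sstep (fun x : R => (x - tau) / r) t _ _ (Cinf_is_derive _ Cinf_sstep) h1.
by rewrite derive1E [LHS]E.
Qed.

Lemma derive1_locally_constant (f : R -> R) (x c : R) : (\forall y \near x, f y = c) -> derive1 f x = 0.
Proof.
move=> h; rewrite derive1E; suff : is_derive x (1 : R) f 0 by case.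
apply: (@near_eq_is_derive _ R R (cst c)); near=> y.
by apply/esym; near: y.
Unshelve. all: by end_near. Qed.

Lemma derive1_step_supp tau r t : 0 < r -> derive1 (step_at tau r) t != 0 -> tau <= t <= tau + r.
Proof.
move=> r0; apply: contraNT; rewrite negb_and -!ltNge => /orP[h|h]; apply/eqP.
 apply: (@derive1_locally_constant _ _ 0); near=> y; apply: sstep_le0.
 rewrite pmulr_lle0 ?invr_gt0// subr_le0; apply: ltW; near: y; exact: lt_nbhsl.
apply: (@derive1_locally_constant _ _ 1); near=> y; apply: sstep_ge1.
rewrite ler_pdivlMr// mul1r lerBrDl; apply: ltW; near: y; exact: lt_nbhsr.
Unshelve. all: by end_near. Qed.

Lemma step_at_0 tau r : 0 < r -> step_at tau r tau = 0.
Proof. by move=> r0; rewrite /step_at subrr mul0r sstep_le0. Qed.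

Lemma step_at_1 tau r : 0 < r -> step_at tau r (tau + r) = 1.
Proof. by move=> r0; rewrite /step_at addrAC subrr add0r divff ?gt_eqF// sstep_ge1. Qed.

Lemma bump1_dstep tau r : 0 < r -> bump1 (derive1 (step_at tau r)).
Proof.
move=> r0; split; first exact: Cinf_derive1 (Cinf_step_at tau r).
exists (`|tau| + r + 1) => t ht; apply/eqP; apply: contraTT isT => /(derive1_step_supp r0)/andP[h1 h2].
have t1 := ler_norm tau; have t2 := ler_norm (- tau); rewrite normrN in t2.
by move: ht; rewrite ler_normr => /orP[]; lra.
Qed.

Lemma integral_dstep (tau r : R) : 0 < r ->
 (\int[lam]_(t in `[tau, (tau + r)%R]) (derive1 (step_at tau r) t)%:E = 1)%E.
Proof.
move=> r0; rewrite (@continuous_FTC2 _ _ (step_at tau r)).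
- by rewrite step_at_1// step_at_0// sube0.
- by rewrite ltrDl.
- by apply: continuous_subspaceT; exact: Cinf_cont (Cinf_derive1 (Cinf_step_at tau r)).
- have cs := Cinf_cont (Cinf_step_at tau r).
 split => [x _||]; first by have [] := Cinf_is_derive x (Cinf_step_at tau r).
  by apply: cvg_at_right_filter; exact: cs.
 by apply: cvg_at_left_filter; exact: cs.
- by [].
Qed.

(** The derivatives of the steps have integral 1 and are supported in [[tau, tau + r]] with height
    at most [L / r]; integrated against [g] they tend to [g tau] at every Lebesgue point [tau]. *)
Lemma lebesgue_bound (g : mR R -> R) (Rb : R) : Rintg lam g ->
 (forall tau r, 0 < r -> Rint lam (fun t => g t * derive1 (step_at tau r) t) <= Rb) ->
 {ae lam, forall tau : mR R, g tau <= Rb}.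
Proof.
move=> ig hR.
have [L hL] := bump1_bounded (@bump1_dsstep R).
have L0 : 0 <= L by exact: le_trans (hL 0).
have lg : locally_integrable setT g by apply: open_integrable_locally => //; exact: openT.
have lb : {ae lam, forall x : mR R, lebesgue_pt g x} := lebesgue_differentiation lg.
apply: (@filterS _ _ (ae_filter_ringOfSetsType _) _ _ _ lb) => tau hl.
apply/ler_addgt0Pr => e e0.
(* With [r = s / 2] and a ball of length [2 s], the height [L / r] turns a mean deviation [e'] into
   at most [4 L e']. *)
pose e' := e / (4 * (L + 1)).
have L1 : 0 < 4 * (L + 1) by rewrite mulr_gt0// ltr_wpDl.
have e'0 : 0 < e' by rewrite divr_gt0.
have : \forall r \near 0^'+, (davg g tau r < e'%:E)%E.
 move: hl; rewrite /lebesgue_pt => /(_ [set y | (y < e'%:E)%E]); apply.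
 by apply: open_nbhs_nbhs; split; [exact: open_ereal_lt_ereal|rewrite /= lte_fin].
move=> hnear; have [s [s0 hs]] : exists s, 0 < s /\ (davg g tau s < e'%:E)%E.
 near (0 : R)^'+ => s; exists s; split; first by near: s; exact: nbhs_right_gt.
 by near: s.
pose r := s / 2; have r0 : 0 < r by rewrite divr_gt0.
pose Bs : set (mR R) := ball tau s.
have mB : measurable Bs by exact: measurable_ball.
have mu0 : lam (Bs) = (s *+ 2)%:E by exact: (lebesgue_measure_ball tau (ltW s0)).
have iB : Rintg lam (\1_(Bs)).
 have fB : (lam Bs < +oo)%E by rewrite mu0 ltry.
 exact: (itg_indic mB fB).
have mg := itgm ig.
have i1 : Rintg lam (fun t => `|g t - g tau| * \1_(Bs) t).
 apply: (itg_dom (g := fun t : mR R => `|g t| + `|g tau| * \1_(Bs) t)).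
 - by apply: mfunM; [apply: mcomp => //; exact: measurable_funB|exact: mindic].
 - move=> t; rewrite normrM normr_id indicE; case: (_ \in _); rewrite ?normr1 ?normr0 ?mulr1 ?mulr0 ?addr0//.
  exact: ler_normB.
 - by apply: itgD; [exact: itg_norm|exact: itgZ].
have avg : Rint lam (fun t => `|g t - g tau| * \1_(Bs) t) <= e' * (s *+ 2).
 have s20 : 0 < s *+ 2 by rewrite mulrn_wgt0.
 move: hs; rewrite /davg /iavg mu0 inver gt_eqF// => hs.
 have E : (\int[lam]_(y in Bs) `|((center (g tau) \o g) y)%:E| =
   (Rint lam (fun t => `|g t - g tau| * \1_(Bs) t))%:E)%E.
  rewrite (IIE i1) [LHS]integral_mkcond; apply: eq_integral => y _.
  by rewrite patchE indicE; case: (_ \in _); rewrite ?mulr1 ?mulr0.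
 move: hs; rewrite E -EFinM lte_fin => hs.
 by rewrite -ler_pdivrMr// mulrC ltW.
have [dC [dA hdA]] := bump1_dstep tau r0.
pose rho : mR R -> R := derive1 (step_at tau r).
have mrho : measT rho by exact: continuous_measurable_fun (Cinf_cont dC).
have rhoL t : `|rho t| <= L / r.
 by rewrite /rho derive1_step_at normrM (gtr0_norm (_ : 0 < r^-1)) ?invr_gt0// ler_wpM2r// invr_ge0 ltW.
have i2 : Rintg lam (fun t : mR R => g t * rho t) by exact: itg_bnd mrho rhoL ig.
have rhoB t : rho t != 0 -> Bs t.
 move=> /(derive1_step_supp r0)/andP[h1 h2]; rewrite /Bs -ball_normE/= ler0_norm ?subr_le0//.
 by rewrite opprB ltrBlDl (le_lt_trans h2)// ltrD2l /r ltr_pdivrMr//; lra.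
have i3 : Rintg lam rho.
 apply: (itg_dom (g := fun t : mR R => L / r * \1_(Bs) t) mrho).
  move=> t; have [->|nz] := eqVneq (rho t) 0; first by rewrite normr0 mulr_ge0// divr_ge0// ltW.
  by rewrite indicE mem_set ?mulr1//; exact: rhoB.
 exact: itgZ.
have rho1 : Rint lam rho = 1.
 rewrite /Rint /Rintegral (_ : (\int[lam]_x (rho x)%:E = 1)%E)//.
 rewrite -(integral_dstep tau r0) [RHS]integral_mkcond; apply: eq_integral => t _.
 rewrite patchE; case: ifPn => // nt; apply/eqP; rewrite eqe; apply: contraNT nt => nz.
 by rewrite mem_set//= in_itv/=; exact: derive1_step_supp.
have key : `|g tau - Rint lam (fun t => g t * rho t)| <= e.
 have -> : g tau = Rint lam (fun t => g tau * rho t) by rewrite (IIZ _ i3) rho1 mulr1.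
 rewrite -(IIB (itgZ _ i3) i2); apply: le_trans (normII (itgB (itgZ _ i3) i2)) _.
 apply: (letr (Rint lam (fun t => L / r * (`|g t - g tau| * \1_(Bs) t)))).
  apply: le_II; [exact: itg_norm (itgB (itgZ _ i3) i2)|exact: itgZ|] => t.
  rewrite -mulrBl normrM distrC mulrCA [leLHS]mulrC.
  have Lr : 0 <= L / r by rewrite divr_ge0// ltW.
  have [->|nz] := eqVneq (rho t) 0.
   by rewrite normr0 mul0r; exact: mulr_ge0 (normr_ge0 _) (mulr_ge0 Lr _).
  by rewrite indicE mem_set ?mulr1; [rewrite mulrC; exact: ler_wpM2l|exact: rhoB].
 rewrite (IIZ _ i1); apply: le_trans (ler_wpM2l _ avg) _; first by rewrite divr_ge0// ltW.
 have -> : L / r * (e' * (s *+ 2)) = e * (L / (L + 1)).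
  by rewrite /e' /r; field; rewrite (gt_eqF s0) gt_eqF// ltr_wpDl.
 by rewrite ler_piMr ?(ltW e0)// ler_pdivrMr ?ltr_wpDl// mul1r lerDl.
have := hR tau r r0; rewrite -/rho; move: key; rewrite ler_norml => /andP[_ h1] h2; lra.
Unshelve. all: by end_near. Qed.

End lebesgue_points.

Section local_regularity.
Context {R : realType} {N : nat}.
Notation Z := ('rV[R]_N * mR R)%type.
Notation mu := (@leb R N \x @lebesgue_measure R)%E.
Notation lam := (@lebesgue_measure R).
Notation itg := (Rintg mu).
Notation II := (Rint mu).
Implicit Types (o : option 'I_N) (z : Z).

(** * The energy inequality of weak solutions *)

Section weak_energy.

Definition weakC1 (p Lam P : R) : R :=
 N%:R * youngC p Lam * (4 * p) `^ p * 2 `^ P + 2 * 2 `^ P + 1.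

(** [2 Lam] is the factor of the gradient bound, and [4 / min 1 al] that of the slice bound, where
    it inverts the constant of [bregman_big]. *)
Definition weakC (al p Lam P : R) : R :=
 (2 * Lam + 4 / Num.min 1 al) * weakC1 p Lam P.

Variables (w f : Z -> R) (Dw Fl : 'I_N -> Z -> R) (dl : 'I_N -> R) (al p Lam e : R)
 (A B A' B' : option 'I_N -> R).
Notation q := (al + 1).
Notation P := (Num.max q p).
Hypotheses (LD : local_data w Dw p q P) (p1 : 1 < p) (al0 : 0 < al) (Lam0 : 0 < Lam)
 (hdl : forall i, 0 <= dl i) (AB' : forall o, A' o <= B' o).
Let p0 : 0 < p := lt_trans ltr01 p1.
Let q0 : 0 < q. Proof. by rewrite ltr_wpDl// ltW. Qed.
Let pP : p <= P. Proof. by rewrite le_max lexx orbT. Qed.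
Let qP : q <= P. Proof. by rewrite le_max lexx. Qed.
Let iw := ld_w LD.
Let iDw := ld_D LD.
Let iDwp := ld_Dp LD.
Let mw := itgm iw.
Let mDw i := itgm (iDw i).
Notation ex i z := (Num.max (`|Dw i z| - dl i) 0).

Let i1 : itg (\1_(obox A' B') : Z -> R).
Proof. by apply: itg_indic; [exact: mset_obox|exact: fin_obox]. Qed.

Let powR_interp (r s t x : R) : 0 <= x -> 0 < r -> r <= s -> s <= t -> x `^ s <= x `^ r + x `^ t.
Proof.
move=> x0 r0 rs st; have [h|h] := leP x 1.
 rewrite -[leLHS]addr0 lerD ?powR_ge0//.
 have [->|xn] := eqVneq x 0; first by rewrite !powR0 ?gt_eqF// (lt_le_trans r0).
 by apply: ger_powR; rewrite // h lt_neqAle eq_sym xn x0.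
by rewrite -[leLHS]add0r lerD ?powR_ge0// ler_powR// ltW.
Qed.

Let iw_pow s : 1 <= s -> s <= P -> itg (fun z => `|w z| `^ s).
Proof.
move=> s1 sP; apply: (itg_dom _ _ (itgD (itg_norm iw) (ld_P LD))).
 by apply: (mpowR s); exact: mcomp.
move=> z; rewrite ger0_norm ?powR_ge0//; apply: le_trans (powR_interp _ ltr01 s1 sP) _ => //.
by rewrite powRr1.
Qed.

Let iwp : itg (fun z => `|w z| `^ p). Proof. exact: iw_pow (ltW p1) pP. Qed.
Let iwq0 : itg (fun z => `|w z| `^ q).
Proof. by apply: iw_pow; rewrite ?lerDr ?(ltW al0). Qed.

Let m1 : measT (\1_(obox A' B') : Z -> R).
Proof. by apply: mindic; exact: mset_obox. Qed.

Let iwq : itg (fun z => `|w z| `^ q * \1_(obox A' B') z).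
Proof.
by apply: (itg_bnd (M := 1) m1 _ iwq0) => z; rewrite indicE; case: (_ \in _); rewrite ?normr1 ?normr0.
Qed.

Lemma itg_spow_box : itg (fun z => spow (w z) al * \1_(obox A' B') z).
Proof.
apply: (itg_dom _ _ (itgD i1 iwq)).
 by apply: mfunM => //; exact: measurable_spow.
move=> z; rewrite normrM (spow_norm _ al0) indicE; case: (_ \in _); last by rewrite normr0 !mulr0 addr0.
rewrite normr1 !mulr1; have := @powR_interp al al q `|w z| (normr_ge0 _) al0 (lexx _).
move: (powR_ge0 `|w z| q); have [h|h] := leP `|w z| 1.
 move=> g _; rewrite -[leLHS]addr0 lerD//.
 by apply: (letr (1 `^ al)); [powR_mono; rewrite ?(ltW al0)|rewrite powR1].
by move=> g _; rewrite -[leLHS]add0r lerD// ler_powR// ?(ltW h)// lerDl.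
Qed.

Let ex0 i z : 0 <= ex i z. Proof. by rewrite le_max lexx orbT. Qed.
Let exD i z : ex i z <= `|Dw i z|.
Proof. by rewrite ge_max normr_ge0 andbT gerBl. Qed.
Let mex i : measT (fun z => ex i z).
Proof. by apply: measurable_maxr => //; apply: measurable_funB => //; exact: mcomp. Qed.

Let iexp i : itg (fun z => ex i z `^ p).
Proof.
apply: (itg_dom _ _ (iDwp i)); first exact: (mpowR p).
by move=> z; rewrite ger0_norm ?powR_ge0//; powR_mono; rewrite ?(ltW p0) ?normr_ge0.
Qed.

Lemma itg_flux i (F : Z -> R) : measT F ->
 (forall z, `|F z| <= Lam * ex i z `^ (p - 1) * \1_(obox A' B') z) -> itg F.
Proof.
move=> mF hF; apply: (itg_dom mF _ (itgZ Lam (itgD i1 (iexp i)))) => z.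
apply: le_trans (hF z) _; rewrite -mulrA; apply: ler_wpM2l; first exact: ltW.
rewrite indicE; case: (_ \in _); last by rewrite mulr0 add0r powR_ge0.
rewrite mulr1; have p10 : 0 <= p - 1 by rewrite subr_ge0 ltW.
have [h|h] := leP (ex i z) 1.
 rewrite -[leLHS]addr0 lerD ?powR_ge0//.
 by apply: (letr (1 `^ (p - 1))); [apply: ge0_ler_powR; rewrite ?nnegrE|rewrite powR1].
by rewrite -[leLHS]add0r lerD// ler_powR// ?(ltW h)// gerBl.
Qed.

Hypotheses (WL : weak_local w f Dw Fl dl al p Lam e A B A' B') (if_ : itg f) (e0 : 0 < e).

Let iFl i : itg (Fl i).
Proof. exact: itg_flux (wl_m WL i) (wl_le WL i). Qed.

Let iFlp i : itg (fun z => `|Fl i z| `^ (p / (p - 1))).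
Proof.
have p10 : 0 < p - 1 by rewrite subr_gt0.
have r0 : 0 <= p / (p - 1) by rewrite divr_ge0 ?ltW.
apply: (itg_dom _ _ (itgZ (Lam `^ (p / (p - 1))) (iexp i))).
 by apply: (mpowR _); apply: mcomp => //; exact: wl_m WL i.
move=> z; rewrite ger0_norm ?powR_ge0//.
have le : `|Fl i z| <= Lam * ex i z `^ (p - 1).
 by apply: le_trans (wl_le WL i z) _; rewrite ler_piMr ?mulr_ge0 ?powR_ge0 ?(ltW Lam0).
apply: (letr ((Lam * ex i z `^ (p - 1)) `^ (p / (p - 1)))).
 apply: ge0_ler_powR; [exact: r0|by rewrite nnegrE| |exact: le].
 by rewrite nnegrE mulr_ge0 ?powR_ge0 ?(ltW Lam0).
rewrite powRM ?powR_ge0 ?(ltW Lam0)// -powRrM (_ : (p - 1) * (p / (p - 1)) = p)//.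
by rewrite mulrC mulfVK ?gt_eqF.
Qed.

Variables (a b gl gr : option 'I_N -> R) (gam k : R).
Hypotheses (Aa : forall o, A o <= a o) (bB : forall o, b o <= B o)
 (gl0 : forall o, 0 < gl o) (gr0 : forall o, 0 < gr o) (gam01 : 0 < gam <= 1)
 (ggl : forall i, gam <= gl (Some i)) (ggr : forall i, gam <= gr (Some i))
 (ggt : gam `^ p <= gl None) (k2 : 2^-1 <= k) (isrc : itg (source w f p k a b gl gr)).
Notation cf := (cutf a b gl gr p).
Let k0 : 0 < k. Proof. by apply: lt_le_trans k2; rewrite invr_gt0. Qed.
Let gam0 : 0 < gam. Proof. by case/andP: gam01. Qed.
Let hb : bumps cf. Proof. exact: bumps_cutf. Qed.
Let cf0 z : 0 <= tens cf z. Proof. exact: tens_cutf_ge0. Qed.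
Let cf1 z : tens cf z <= 1. Proof. exact: tens_cutf_le1. Qed.
Let rhs := energy_rhs w f p P k gam a b gl gr.
Let pp0 z : 0 <= ppart w k z. Proof. by rewrite le_max lexx orbT. Qed.

Let inAB z : obox a b z -> forall o, A o <= co o z <= B o.
Proof.
move=> h o; have := h o; rewrite /= in_itv/= => /andP[h1 h2].
by rewrite (le_trans (Aa o) (ltW h1)) (le_trans (ltW h2) (bB o)).
Qed.

Let inAB' z : obox a b z -> obox A' B' z.
Proof.
move=> /inAB h o; have /andP[h1 h2] := h o; have [s1 s2] := wl_sub WL o; have e0' := e0.
rewrite /= in_itv/=; apply/andP; split; move: e0' h1 h2 s1 s2; move: (co o z) => c; lra.
Qed.

Let mu1 := (fun z => `|w z| `^ P * (\1_(above w k) z * \1_(obox a b) z)).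

Let imass : itg mu1.
Proof.
apply: (@mass_itg _ _ _ P k a b a b mw) => //.
apply: (itg_bnd (M := 1) _ _ (ld_P LD)); first by apply: mindic; exact: mset_obox.
by move=> z; rewrite indicE; case: (_ \in _); rewrite ?normr1 ?normr0.
Qed.

Let Gf z := bregman al k (ppart w k z) (w z).

Let Gf_trunc z : Gf z = bregman al k (trunc k `|w z| (w z)) (w z).
Proof.
rewrite /Gf (_ : ppart w k z = trunc k `|w z| (w z))//.
by rewrite trunc_eventually// (le_trans (ler_norm _))// lerDr ltW.
Qed.

Let Gf0 z : 0 <= Gf z. Proof. by rewrite Gf_trunc bregman_ge0. Qed.

Let Gf_le z : Gf z <= ((k < w z)%R)%:R * `|w z| `^ q.
Proof.
rewrite Gf_trunc; apply: le_trans (bregman_le al0 k0 (w z) (normr_ge0 _)) _.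
have [h|h] := ltP k (w z); last by rewrite !mul0r.
have s0 : 0 < w z by exact: lt_trans h.
rewrite !mul1r gtr0_norm// powRD ?powRr1 ?(ltW s0)//; last by rewrite (gt_eqF s0) implybT.
rewrite mulrC ler_wpM2l ?powR_ge0//; exact: trunc_le (ltW s0).
Qed.

Let mG : measT Gf.
Proof.
apply: measurable_bregman => //.
by apply: measurable_maxr => //; exact: measurable_funB.
Qed.

Let iG : itg Gf.
Proof.
apply: (itg_dom mG _ iwq0) => z; rewrite ger0_norm//; apply: le_trans (Gf_le z) _.
by case: (_ < _); rewrite ?mul1r// mul0r powR_ge0.
Qed.

Let dt_top z : tens (dt None cf) z <= 2 * gam `^ (- p) * \1_(obox a b) z.
Proof.
have := @tens_dt_cutf_le _ _ a b gl gr gl0 gr0 p None z p0; rewrite indicE.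
have [zb|zb] := boolP (z \in obox a b); last first.
 by rewrite !mulr0 normr_le0 => /eqP ->.
move=> _; rewrite mulr1 tens_dt.
have Q0 : 0 <= \prod_(o' | o' != None) cf o' (co o' z) by apply: prodr_ge0 => o' _; exact: cutf_ge0.
have Q1 : \prod_(o' | o' != None) cf o' (co o' z) <= 1.
 by apply: prod_le1 => o'; rewrite cutf_ge0 cutf_le1.
have h := phi_deriv a b gl0 gr0 gam0 ggt (co None z).
have c0 : 0 <= 2 * gam `^ (- p) by rewrite mulr_ge0 ?powR_ge0.
apply: (letr (Num.max (derive1 (cf None) (co None z)) 0)).
 have M0 : 0 <= Num.max (derive1 (cf None) (co None z)) 0 by rewrite le_max lexx orbT.
 apply: (letr (Num.max (derive1 (cf None) (co None z)) 0 * \prod_(o' | o' != None) cf o' (co o' z))).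
  by rewrite ler_wpM2r// le_max lexx.
 by rewrite ler_piMr.
apply: le_trans h _; rewrite -[leRHS]mulr1 ler_wpM2l// lern1 leq_b1//.
Qed.

Section time_weight.
Variables (psi : R -> R) (L : R).
Hypotheses (Cpsi : Cinf psi) (psi01 : forall t, 0 <= psi t <= 1) (psiL : forall t, `|derive1 psi t| <= L).
Notation th := (timecut cf psi).
Let hth : bumps th. Proof. exact: bumps_timecut. Qed.
Let thE z : tens th z = tens cf z * psi z.2. Proof. exact: tens_timecut. Qed.
Let th0 z : 0 <= tens th z.
Proof. by rewrite thE mulr_ge0//; have /andP[] := psi01 z.2. Qed.
Let thle z : tens th z <= tens cf z.
Proof. by rewrite thE ler_piMr//; have /andP[] := psi01 z.2. Qed.
Let thbox z : tens th z != 0 -> obox a b z.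
Proof. by rewrite thE mulf_eq0 negb_or => /andP[nz _]; exact: tens_cutf_supp nz. Qed.
Let thsupp z : tens th z != 0 -> forall o, A o <= co o z <= B o.
Proof. by move=> /thbox/inAB. Qed.

Let mth := bumps_meas hth.

Let iths : itg (fun z => ppart w k z * `|f z| * tens th z).
Proof.
apply: (itg_dom _ _ isrc).
 apply: mfunM => //; apply: mfunM.
  by apply: measurable_maxr => //; exact: measurable_funB.
 by apply: mcomp => //; exact: itgm if_.
move=> z; rewrite ger0_norm; last exact: mulr_ge0 (mulr_ge0 (pp0 z) (normr_ge0 _)) (th0 z).
by rewrite /source; apply: ler_wpM2l => //; exact: mulr_ge0 (pp0 z) (normr_ge0 _).
Qed.

Let K0 := 4 * p / gam.
Let K00 : 0 <= K0. Proof. by rewrite divr_ge0 ?mulr_ge0 ?ltW. Qed.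

Let root i z : `|tens (dt (Some i) th) z| <= K0 * tens th z `^ ((p - 1) / p).
Proof.
rewrite tens_dtx_timecut normrM thE; have /andP[h0 h1] := psi01 z.2.
rewrite powRM// mulrA (ger0_norm h0); apply: ler_pM => //.
 exact: (tens_dt_cutf_root a b gl0 gr0 gam0 ggl ggr p1).
have [->|n0] := eqVneq (psi z.2) 0; first exact: powR_ge0.
by rewrite ger1_powR ?h1 ?lt_neqAle ?(eq_sym 0) ?n0 ?h0// ler_pdivrMr// mul1r gerBl.
Qed.

Let ieth i : itg (fun z => ex i z `^ p * (\1_(above w k) z * tens th z)).
Proof.
apply: (itg_bnd (M := 1) _ _ (iexp i)).
 by apply: mfunM => //; apply: mindic; exact: mset_gt.
move=> z; rewrite normrM (ger0_norm (th0 z)); apply: mulr_ile1 => //.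
 by rewrite indicE; case: (_ \in _); rewrite ?normr1 ?normr0.
exact: le_trans (thle z) (cf1 z).
Qed.

(** One inequality for both halves of the energy: [psi = 1] leaves the gradient term, and a [psi]
    that steps down near a time [tau] makes the second term an average over times near [tau]. *)
Lemma weighted_energy :
 (2 * Lam)^-1 * \sum_i II (fun z => ex i z `^ p * (\1_(above w k) z * tens th z)) +
 II (fun z => Gf z * (tens cf z * - derive1 psi z.2)) <= weakC1 p Lam P * rhs.
Proof.
have [j1 j2 j3 le] := energy_level WL iw iDw (ld_wpd LD) iDwp iwp if_ iFl iFlp itg_spow_box iwq p1 al0 k0 e0 hth th0 thsupp iths.
have m0 : 0 <= II mu1 by exact: mass_ge0.
have S0 : 0 <= II (source w f p k a b gl gr).
 by apply: II_ge0 => z; exact: mulr_ge0 (mulr_ge0 (pp0 z) (normr_ge0 _)) (cf0 z).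
have yC0 : 0 <= youngC p Lam by rewrite mulr_ge0 ?powR_ge0 ?ltW.
pose c1 := youngC p Lam * K0 `^ p * 2 `^ P.
have c10 : 0 <= c1 by exact: mulr_ge0 (mulr_ge0 yC0 (powR_ge0 _ _)) (powR_ge0 _ _).
have s1 : (2 * Lam)^-1 * \sum_i II (fun z => ex i z `^ p * (\1_(above w k) z * tens th z)) -
  N%:R * (c1 * II mu1) <= \sum_i II (fun z => Fl i z * level_der w Dw k th i z).
 have cE : N%:R * (c1 * II mu1) = \sum_(i < N) c1 * II mu1 by rewrite sumr_const card_ord mulr_natl.
 rewrite mulr_sumr cE -sumrB; apply: ler_sum => i _.
 rewrite -(IIZ _ (ieth i)) -(IIZ c1 imass) -(IIB (itgZ _ (ieth i)) (itgZ _ imass)).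
 apply: le_II; [exact: itgB (itgZ _ (ieth i)) (itgZ _ imass)|exact: j1|] => z.
 have [zb|zb] := pselect (obox a b z); last first.
  have t0 : tens th z = 0 by apply/eqP; apply: contra_notT zb; exact: thbox.
  have d0 : tens (dt (Some i) th) z = 0.
   by apply/eqP; rewrite -normr_le0; apply: le_trans (root i z) _; rewrite t0 powR0 ?mulr0// gt_eqF// divr_gt0// subr_gt0.
  have m0z : mu1 z = 0 by rewrite /mu1 [\1_(obox a b) z]indicE memNset// !mulr0.
  by rewrite /level_der t0 d0 m0z !mulr0 subr0 addr0 mulr0.
 have hpp : ~~ (k < w z) -> ppart w k z = 0 by rewrite -leNgt => h; rewrite /ppart max_r// subr_le0.
 have hps : ((k < w z)%R)%:R <= pos_slope k w (Dw i) z.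
  by rewrite /pos_slope; case: (k < w z) => //=; rewrite ler0n.
 have hF : `|Fl i z| <= Lam * ex i z `^ (p - 1).
  by have := wl_le WL i z; rewrite indicE mem_set ?mulr1//; exact: inAB'.
 have := young_pointwise p1 Lam0 K00 (th0 z) (ex0 i z) (root i z) hF (wl_ge WL i (inAB' zb)) (pp0 z) hpp hps.
 apply: le_trans; rewrite indic_above; apply: lerD => //; rewrite lerN2 /c1 -[leRHS]mulrA.
 apply: ler_wpM2l; first exact: mulr_ge0 yC0 (powR_ge0 _ _).
 rewrite /mu1 indic_above indicE mem_set// mulr1.
 apply: le_trans (ppart_pow_le (w z) _ k2) _; first by rewrite p0; exact: pP.
 by apply: le_of_eq; ring.
have s2 : II (fun z => f z * (ppart w k z * tens th z)) <= II (source w f p k a b gl gr).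
 apply: le_II => // z; rewrite /source.
 apply: (letr (`|f z| * (ppart w k z * tens th z))).
  by apply: ler_wpM2r; [exact: mulr_ge0 (pp0 z) (th0 z)|exact: ler_norm].
 rewrite mulrA [`|f z| * _]mulrC; apply: ler_wpM2l => //; exact: mulr_ge0 (pp0 z) (normr_ge0 _).
have mpsi' : measT (fun z : Z => derive1 psi z.2).
 apply: (mcomp (f := derive1 psi)); last exact: measurable_snd.
 exact: continuous_measurable_fun (Cinf_cont (Cinf_derive1 Cpsi)).
have iGd : itg (fun z => Gf z * (tens cf z * - derive1 psi z.2)).
 apply: (itg_bnd (M := L) _ _ iG).
  apply: mfunM; first exact: bumps_meas hb.
  by have := measurable_funB (@measurable_cst _ _ Z R setT 0) mpsi'; congr measurable_fun; ext => z; rewrite /= sub0r.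
 move=> z; rewrite normrM normrN (ger0_norm (cf0 z)).
 by apply: le_trans (ler_piMl _ (cf1 z)) _.
pose c3 := 2 * gam `^ (- p) * 2 `^ P.
have c30 : 0 <= c3 by exact: mulr_ge0 (mulr_ge0 _ (powR_ge0 _ _)) (powR_ge0 _ _).
have s3 : II (fun z => Gf z * tens (dt None th) z) <=
  c3 * II mu1 - II (fun z => Gf z * (tens cf z * - derive1 psi z.2)).
 rewrite -(IIZ c3 imass) -(IIB (itgZ _ imass) iGd); apply: le_II => //.
  exact: itgB (itgZ _ imass) iGd.
 move=> z; rewrite (tens_dtt_timecut _ hb Cpsi) mulrDr mulrN mulrN opprK; apply: lerD => //.
 have /andP[h0 h1] := psi01 z.2.
 apply: (letr (Gf z * (2 * gam `^ (- p) * \1_(obox a b) z))).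
  apply: ler_wpM2l => //.
  have b0 : 0 <= 2 * gam `^ (- p) * \1_(obox a b) z by rewrite mulr_ge0// mulr_ge0 ?powR_ge0.
  apply: le_trans (ler_wpM2r h0 (dt_top z)) _; exact: ler_piMr.
 rewrite /mu1 indic_above /c3.
 apply: le_trans (ler_wpM2r _ (Gf_le z)) _; first by rewrite mulr_ge0// mulr_ge0 ?powR_ge0.
 have [h|h] := ltP k (w z); last by rewrite !mul0r !mulr0.
 rewrite !mul1r.
 have hq : `|w z| `^ q <= 2 `^ P * `|w z| `^ P.
  by rewrite gtr0_norm ?(lt_trans k0)//; apply: (pow_above _ k2 h); rewrite qP ltW.
 apply: le_trans (ler_wpM2r _ hq) _; first by rewrite mulr_ge0// mulr_ge0 ?powR_ge0.
 by apply: le_of_eq; ring.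
have K0p : K0 `^ p = (4 * p) `^ p * gam `^ (- p).
 rewrite /K0 powRM ?invr_ge0 ?mulr_ge0 ?(ltW p0) ?(ltW gam0)//; congr (_ * _).
 by rewrite -[gam^-1]powR_inv1 ?(ltW gam0)// -powRrM mulN1r.
have gp0 := powR_ge0 gam (- p).
rewrite /rhs /energy_rhs -[mass _ _ _ _ _]/(II mu1) /weakC1.
move: s1 s2 s3 le; rewrite /c1 /c3 K0p; set E := _ * \sum_i _; set S1 := \sum_i _; set S2 := II (fun z => f z * _).
set S3 := II (fun z => Gf z * tens _ z); set S4 := II (fun z => Gf z * (_ * _)).
have yy0 : 0 <= N%:R * youngC p Lam * (4 * p) `^ p * 2 `^ P.
 exact: mulr_ge0 (mulr_ge0 (mulr_ge0 (ler0n _ _) yC0) (powR_ge0 _ _)) (powR_ge0 _ _).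
have PP0 : 0 <= 2 * 2 `^ P :> R by rewrite mulr_ge0 ?powR_ge0.
move: m0 S0; move: (II mu1) (II (source _ _ _ _ _ _ _ _)) => m S m0 S0.
have arith (x y u : R) : 0 <= x -> 0 <= y -> 0 <= u -> x * (u * m) + y * (u * m) + S <= (x + y + 1) * (u * m + S).
 move=> x0 y0 u0; have um := mulr_ge0 u0 m0; have h1 := mulr_ge0 x0 S0; have h2 := mulr_ge0 y0 S0.
 have -> : (x + y + 1) * (u * m + S) = x * (u * m) + y * (u * m) + S + (x * S + y * S + u * m) by ring.
 by rewrite lerDl !addr_ge0.
move=> s1 s2 s3 le; apply: le_trans (arith _ _ _ yy0 PP0 gp0).
have e1 : N%:R * (youngC p Lam * ((4 * p) `^ p * gam `^ (- p)) * 2 `^ P * m) =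
 N%:R * youngC p Lam * (4 * p) `^ p * 2 `^ P * (gam `^ (- p) * m) by ring.
have e3 : 2 * gam `^ (- p) * 2 `^ P * m = 2 * 2 `^ P * (gam `^ (- p) * m) by ring.
rewrite e1 in s1; rewrite e3 in s3.
move: s1 s2 s3 le; move: (N%:R * _ * _ * _ * _) (2 * 2 `^ P * _) => x y; lra.
Qed.

End time_weight.
Let C10 : 0 < weakC1 p Lam P.
Proof.
have yC0 : 0 <= youngC p Lam by rewrite mulr_ge0 ?powR_ge0 ?ltW.
have h1 : 0 <= N%:R * youngC p Lam * (4 * p) `^ p * 2 `^ P.
 exact: mulr_ge0 (mulr_ge0 (mulr_ge0 (ler0n _ _) yC0) (powR_ge0 _ _)) (powR_ge0 _ _).
by rewrite /weakC1 ltr_wpDl// addr_ge0// mulr_ge0// powR_ge0.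
Qed.

Let mn0 : 0 < Num.min 1 al. Proof. by rewrite lt_min ltr01. Qed.

Let rhs0 : 0 <= rhs.
Proof.
rewrite /rhs /energy_rhs addr_ge0// ?mulr_ge0 ?powR_ge0 ?mass_ge0//.
by apply: II_ge0 => z; exact: mulr_ge0 (mulr_ge0 (pp0 z) (normr_ge0 _)) (cf0 z).
Qed.

Lemma weak_gradient i :
 II (fun z => ex i z `^ p * (\1_(above w k) z * tens cf z)) <= weakC al p Lam P * rhs.
Proof.
have D0 t : derive1 (fun=> 1 : R) t = 0 :> R by exact: derive1_cst.
have z1 t : `|derive1 (fun=> 1 : R) t| <= (0 : R) by rewrite D0 normr0.
have o1 (t : R) : 0 <= (1 : R) <= 1 by rewrite ler01 lexx.
have := @weighted_energy (fun=> 1) 0 (Cinf_cst _ 1) o1 z1.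
have -> : (fun z => Gf z * (tens cf z * - derive1 (fun=> 1 : R) z.2)) = fun=> 0.
 by ext => z; rewrite D0 oppr0 !mulr0.
rewrite (_ : II (fun=> 0) = 0) ?addr0; last by rewrite /Rint /Rintegral integral0.
have tE : tens (timecut cf (fun=> 1)) = tens cf by ext => z; rewrite tens_timecut mulr1.
rewrite tE => h.
have term0 j : 0 <= II (fun z => ex j z `^ p * (\1_(above w k) z * tens cf z)).
 by apply: II_ge0 => z; exact: mulr_ge0 (powR_ge0 _ _) (mulr_ge0 _ (cf0 z)).
have h' : II (fun z => ex i z `^ p * (\1_(above w k) z * tens cf z)) <= 2 * Lam * (weakC1 p Lam P * rhs).
 rewrite -ler_pdivrMl ?mulr_gt0//; apply: le_trans h.
 apply: ler_wpM2l; first by rewrite invr_ge0 mulr_ge0 ?(ltW Lam0).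
 by rewrite (bigD1 i)//= lerDl sumr_ge0.
apply: le_trans h' _; rewrite /weakC -[leRHS]mulrA; apply: ler_wpM2r.
 exact: mulr_ge0 (ltW C10) rhs0.
by rewrite lerDl divr_ge0// ltW.
Qed.

(** With [psi = 1 - step_at tau r] the weighted inequality bounds all averages of the slice
    integral, and [lebesgue_bound] passes to almost every time. [bregman_big] then compares the time
    term with [|w|^q] above [kap]. *)
Lemma weak_slice kap : k < kap -> {ae lam, forall t : mR R,
 (\int[@leb R N]_x ((`|w (x, t)| `^ q * (\1_(above w kap) (x, t) * tens cf (x, t)))%:E)
  <= (weakC al p Lam P * (1 - k / kap) ^- 2 * rhs)%:E)%E}.
Proof.
move=> kk; have kap0 : 0 < kap by exact: lt_trans kk.
have c0 : 0 < 1 - k / kap by rewrite subr_gt0 ltr_pdivrMr// mul1r.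
have icf : itg (fun z => Gf z * tens cf z).
 by apply: (itg_bnd (M := 1) _ _ iG); [exact: bumps_meas hb|move=> z; rewrite ger0_norm].
pose g (t : mR R) := Rint (@leb R N) (fun x => Gf (x, t) * tens cf (x, t)).
have ig : Rintg lam g by exact: (itg_fubini2 icf).
have gle : {ae lam, forall t : mR R, g t <= weakC1 p Lam P * rhs}.
 apply: (lebesgue_bound ig) => tau r r0.
 pose psi t := 1 - step_at tau r t.
 have Cpsi : Cinf psi.
  rewrite /psi (_ : (fun t => _) = fun t => 1 + (- 1) * step_at tau r t); last by ext => t; rewrite mulN1r.
  by apply: CinfD; [exact: Cinf_cst|apply: CinfM; [exact: Cinf_cst|exact: Cinf_step_at]].
 have psi01 t : 0 <= psi t <= 1 by rewrite /psi subr_ge0 sstep_le1 gerBl sstep_ge0.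
 have dpsi t : derive1 psi t = - derive1 (step_at tau r) t.
  have [_ E] := is_deriveB (is_derive_cst (1 : R) t (1 : R)) (Cinf_is_derive t (Cinf_step_at tau r)).
  by rewrite derive1E [LHS]E sub0r.
 have [L hL] := bump1_bounded (bump1_dstep tau r0).
 have psiL t : `|derive1 psi t| <= L by rewrite dpsi normrN.
 have := weighted_energy Cpsi psi01 psiL.
 set E := _ * _; have E0 : 0 <= E.
  apply: mulr_ge0; first by rewrite invr_ge0 mulr_ge0 ?(ltW Lam0).
  apply: sumr_ge0 => i _; apply: II_ge0 => z; apply: mulr_ge0; first exact: powR_ge0.
  apply: mulr_ge0 => //; rewrite tens_timecut; apply: mulr_ge0 => //.
  by have /andP[] := psi01 z.2.
 move=> h; apply: (letr (II (fun z => Gf z * (tens cf z * - derive1 psi z.2)))); last first.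
  by apply: le_trans h; rewrite lerDr.
 rewrite (_ : (fun z => Gf z * (tens cf z * - derive1 psi z.2)) =
   (fun z => Gf z * tens cf z * derive1 (step_at tau r) z.2)); last first.
  by ext => z; rewrite dpsi opprK mulrA.
 have iGs : itg (fun z => Gf z * tens cf z * derive1 (step_at tau r) z.2).
  apply: (itg_bnd (M := L) _ _ icf) => //.
  apply: (mcomp (f := derive1 (step_at tau r))); last exact: measurable_snd.
  exact: continuous_measurable_fun (Cinf_cont (Cinf_derive1 (Cinf_step_at tau r))).
 rewrite (II_slices iGs).1; apply: le_of_eq.
 have [_ sl] := II_slices icf; have mgd : measT (fun t : mR R => g t * derive1 (step_at tau r) t).
  apply: mfunM; first exact: itgm ig.
  exact: continuous_measurable_fun (Cinf_cont (Cinf_derive1 (Cinf_step_at tau r))).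
 apply: (eq_II_ae (itg_fubini2 iGs) mgd _).2.
 apply: filterS sl => t it /=; rewrite /g [RHS]mulrC -(IIZ _ it).
 by congr Rint; ext => x; rewrite mulrC.
have [_ sl] := II_slices icf.
apply: filterS2 gle sl => t gt it.
pose c := Num.min 1 al / 4 * (1 - k / kap) ^+ 2.
have cc0 : 0 < c by rewrite mulr_gt0 ?exprn_gt0// divr_gt0.
have mX : measT (fun z => `|w z| `^ q * (\1_(above w kap) z * tens cf z)).
 apply: mfunM.
  by apply: (mpowR q); exact: mcomp.
 by apply: mfunM; [apply: mindic; exact: mset_gt|exact: bumps_meas hb].
have mXt := mcomp mX (pair2_measurable t).
have le1 : (\int[@leb R N]_x ((`|w (x, t)| `^ q * (\1_(above w kap) (x, t) * tens cf (x, t)))%:E) <=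
  \int[@leb R N]_x ((c^-1 * (Gf (x, t) * tens cf (x, t)))%:E))%E.
 apply: lower_integral_le => x; first by rewrite lee_fin; exact: mulr_ge0 (powR_ge0 _ _) (mulr_ge0 _ (cf0 _)).
 rewrite lee_fin mulrA mulrA; apply: ler_wpM2r => //; rewrite indic_above.
 have [h|h] := ltP kap (w (x, t)); last by rewrite mulr0 mulr_ge0// invr_ge0 ltW.
 rewrite mulr1 ler_pdivlMl// /c.
 have hw : w (x, t) <= k + `|w (x, t)| by rewrite (le_trans (ler_norm _))// lerDr ltW.
 by have := bregman_big al0 k0 kk h hw; rewrite Gf_trunc.
apply: le_trans le1 _; rewrite -(IIE (itgZ _ it)) lee_fin (IIZ _ it).
have cE : c^-1 = 4 / Num.min 1 al * (1 - k / kap) ^- 2.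
 rewrite /c; move: (lt0r_neq0 c0) (lt0r_neq0 mn0); move: (1 - k / kap) (Num.min 1 al) => x y x0 y0.
 by field; rewrite x0 y0.
apply: (letr (c^-1 * (weakC1 p Lam P * rhs))).
 by apply: ler_wpM2l gt; rewrite invr_ge0 ltW.
have X0 : 0 <= (1 - k / kap) ^- 2 * (weakC1 p Lam P * rhs).
 by rewrite mulr_ge0 ?invr_ge0 ?exprn_ge0 ?(ltW c0)//; exact: mulr_ge0 (ltW C10) rhs0.
rewrite cE /weakC -mulrA -[leRHS]mulrA -[leRHS]mulrA [X in _ <= _ * X]mulrCA; apply: ler_wpM2r => //.
by rewrite lerDr mulr_ge0// ltW.
Qed.

End weak_energy.

(** * Localising the weak equation *)

Section weak_solution_data.

Lemma weak_localN (w f : Z -> R) (Dw Fl : 'I_N -> Z -> R) dl al p Lam e A B A' B' :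
 weak_local w f Dw Fl dl al p Lam e A B A' B' ->
 (forall i, itg (Fl i)) -> itg f -> itg (fun z => spow (w z) al * \1_(obox A' B') z) ->
 weak_local (fun z => - w z) (fun z => - f z) (fun i z => - Dw i z) (fun i z => - Fl i z)
  dl al p Lam e A B A' B'.
Proof.
move=> [m le ge s eq] iF if_ iB; split => //.
- by move=> i; apply: mcomp.
- by move=> i z; rewrite !normrN; exact: le.
- by move=> i z h; rewrite normrN mulrNN; exact: ge.
- move=> bb hb supp; have E := eq bb hb supp.
 have iB' := itg_mul_tens (bumps_dt None hb) iB.
 have iF' i := itg_mul_tens (bumps_dt (Some i) hb) (iF i).
 have if' := itg_mul_tens hb if_.
 have -> : (fun z => spow (- w z) al * \1_(obox A' B') z * tens (dt None bb) z) =
   (fun z => - (spow (w z) al * \1_(obox A' B') z * tens (dt None bb) z)).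
  by ext => z; rewrite -[- w z]mulN1r (spow_sgb false); rewrite /sgb; ring.
 rewrite (IIN iB') E.
 have -> : (fun z => - f z * tens bb z) = (fun z => - (f z * tens bb z)) by ext => z; rewrite mulNr.
 rewrite (IIN if') opprD; congr (_ + _); rewrite -sumrN; apply: eq_bigr => i _.
 by rewrite -(IIN (iF' i)); congr Rint; ext => z; rewrite mulNr.
Qed.

Lemma co_lin o (h : R) (u v : 'rV[R]_N * R) : co o (h *: u + v : Z) = h * co o (u : Z) + co o (v : Z).
Proof. by case: o => [i|]//=; rewrite !mxE. Qed.

Lemma co_cont o : continuous (fun z : 'rV[R]_N * R => co o (z : Z)).
Proof.
case: o => [i|] z; last exact: cvg_snd.
by apply: (@continuous_comp _ _ _ fst (fun x : 'rV[R]_N => x ord0 i)); [exact: (@cvg_fst _ _ (nbhs z.1) (nbhs z.2))|exact: coord_continuous].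
Qed.

Lemma test_fun_tens (Om : set 'rV[R]_N) (T : R) bb (a b : option 'I_N -> R) : bumps bb ->
 (forall z, (forall o, a o <= co o z <= b o) -> cyl Om T z) ->
 (forall z, tens bb z != 0 -> forall o, a o <= co o z <= b o) ->
 test_fun (cyl Om T) (tens bb : 'rV[R]_N * R -> R).
Proof.
move=> hb sub supp.
pose K : set ('rV[R]_N * R) := cbox (fun i => a (Some i)) (fun i => b (Some i)) `*` `[a None, b None].
have KE z : K z <-> forall o, a o <= co o z <= b o.
 split=> [[h1 h2] [i|]|h].
 - by have := h1 i; rewrite /= in_itv.
 - by move: h2; rewrite /= in_itv.
 - by split => [i|]; rewrite /= in_itv/=; [exact: (h (Some i))|exact: (h None)].
have cK : compact K by apply: compact_setX; [exact: compact_cbox|exact: segment_compact].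
apply: (test_fun_ftens co_lin co_cont _ cK) => //.
- by move=> o; exact: (hb o).1.
- by apply: compact_closed; [exact: norm_hausdorff|exact: cK].
- by move=> z /KE; exact: sub.
- by move=> z /supp h; apply/KE.
Qed.

Lemma dspace_tens bb i (z : Z) : bumps bb -> dspace i (tens bb : 'rV[R]_N * R -> R) z = tens (dt (Some i) bb) z.
Proof.
move=> hb; rewrite /dspace [LHS](@derive_ftens _ _ _ _ co_lin bb (Some i)).
- by apply: eq_bigr => j _; rewrite /dt; case: eqP => // ->.
- by case=> [j|] /=; rewrite ?mxE ?eqxx//= (inj_eq (@Some_inj _)).
- exact: (hb _).1.
Qed.

Lemma dtime_tens bb (z : Z) : bumps bb -> dtime (tens bb : 'rV[R]_N * R -> R) z = tens (dt None bb) z.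
Proof.
move=> hb; rewrite /dtime [LHS](@derive_ftens _ _ _ _ co_lin bb None).
- by apply: eq_bigr => j _; rewrite /dt; case: eqP => // ->.
- by case=> [j|] /=; rewrite ?mxE.
- exact: (hb _).1.
Qed.

Section local_equation.
Variables (Om : set 'rV[R]_N) (T alpha p Lam d : R) (delta : 'I_N -> R) (a : 'I_N -> Z -> R)
 (f u f' w : Z -> R) (Du Dw : 'I_N -> Z -> R) (A B : option 'I_N -> R).
Notation A' := (fun o => A o - 2 * d).
Notation B' := (fun o => B o + 2 * d).
Hypotheses (oOm : open Om) (d0 : 0 < d) (p1 : 1 < p) (Lam1 : 1 <= Lam)
 (sub : forall z, (forall o, A' o - d <= co o z <= B' o + d) -> cyl Om T z)
 (hdl : forall i, 0 <= delta i)
 (ma : forall i, ae_measurable mu (cyl Om T) (a i))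
 (ha : forall i, {ae mu, forall z, cyl Om T z -> Lam^-1 <= a i z <= Lam})
 (weq : forall phi, test_fun (cyl Om T) phi ->
 (\int[mu]_(z in cyl Om T)
  (\sum_(i < N) flux a p delta i z (Du^~ z) * dspace i phi z -
   spow (u z) alpha * dtime phi z)%:E =
 \int[mu]_(z in cyl Om T) (f z * phi z)%:E)%E)
 (mDw : forall i, measT (Dw i))
 (hu : {ae mu, forall z, (forall o, A' o <= co o z <= B' o) -> u z = w z})
 (hD : forall i, {ae mu, forall z, obox A' B' z -> Du i z = Dw i z})
 (hf : {ae mu, forall z, cyl Om T z -> f z = f' z}).
Let p0 : 0 < p := lt_trans ltr01 p1.
Let Lam0 : 0 < Lam. Proof. exact: lt_le_trans Lam1. Qed.

(** The integrability of candidate fluxes is a hypothesis because it follows from the growth bound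
    alone, before the flux is constructed. The equation is restricted to products of bumps and
    rewritten for the Borel versions. *)
Lemma weak_solution_local : (forall Fl : 'I_N -> Z -> R, (forall i, measT (Fl i)) ->
  (forall i z, `|Fl i z| <= Lam * Num.max (`|Dw i z| - delta i) 0 `^ (p - 1) * \1_(obox A' B') z) ->
  forall i, itg (Fl i)) -> itg f' -> itg (fun z => spow (w z) alpha * \1_(obox A' B') z) ->
 exists Fl, weak_local w f' Dw Fl delta alpha p Lam d A B A' B'.
Proof.
move=> hint if_ iB.
pose ab i := projT1 (cid (borel_version oOm (ma i))).
have hab i : [/\ measT (ab i), {ae mu, forall z, cyl Om T z -> a i z = ab i z} &
  forall z, ~ cyl Om T z -> ab i z = 0] by rewrite /ab; case: cid.
(* The coefficient is clipped to [[1 / Lam, Lam]], so that the bounds on the flux hold at every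
   point while [a i] satisfies them only almost everywhere. *)
pose ac i z := Num.max Lam^-1 (Num.min Lam (ab i z)).
have LL : Lam^-1 <= Lam by rewrite (le_trans _ Lam1)// invf_le1.
have ac1 i z : Lam^-1 <= ac i z <= Lam by rewrite /ac le_max lexx/= ge_max LL ge_min lexx.
have aca i : {ae mu, forall z, cyl Om T z -> a i z = ac i z}.
 have [_ h _] := hab i; apply: filterS2 h (ha i) => z h1 h2 cz; have /andP[l1 l2] := h2 cz.
 by rewrite /ac -h1// min_r// max_r.
have mac i : measT (ac i).
 by have [m _ _] := hab i; apply: measurable_maxr => //; exact: measurable_minr.
pose ex i z := Num.max (`|Dw i z| - delta i) 0.
pose Fl i z := ac i z * ex i z `^ (p - 1) * (Dw i z / `|Dw i z|) * \1_(obox A' B') z.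
have mFl i : measT (Fl i).
 apply: mfunM; last by apply: mindic; exact: mset_obox.
 apply: mfunM; last first.
  rewrite (_ : (fun z => _) = fun z => \1_[set z | 0 < Dw i z] z - \1_[set z | Dw i z < 0] z).
   by apply: measurable_funB; apply: mindic; [exact: mset_gt|exact: mset_lt].
  ext => z; rewrite !indicE; have [h|h|h] := ltgtP (Dw i z) 0.
  - by rewrite memNset ?mem_set//= ?sub0r ?ltr0_norm// ?invrN ?mulrN ?divff ?lt_eqF// ltNge ltW.
  - by rewrite mem_set ?memNset//= ?subr0 ?gtr0_norm// ?divff ?gt_eqF// ltNge ltW.
  - by rewrite h !memNset ?subr0 ?mul0r//= h ltxx.
 apply: mfunM => //; apply: (mpowR (p - 1)).
 by apply: measurable_maxr => //; apply: measurable_funB => //; exact: mcomp.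
have Fl_le i z : `|Fl i z| <= Lam * ex i z `^ (p - 1) * \1_(obox A' B') z.
 rewrite /Fl normrM [`|\1_ _ _|]ger0_norm//; apply: ler_wpM2r => //.
 have /andP[l1 l2] := ac1 i z; have a0 : 0 <= ac i z by rewrite (le_trans _ l1)// invr_ge0 ltW.
 rewrite !normrM (ger0_norm a0) (ger0_norm (powR_ge0 _ _)) -[leRHS]mulr1.
 apply: ler_pM => //; first exact: mulr_ge0 a0 (powR_ge0 _ _).
  by apply: ler_wpM2r => //; exact: powR_ge0.
 have [->|n0] := eqVneq (Dw i z) 0; first by rewrite normr0 mul0r ler01.
 by rewrite normfV normr_id mulfV// normr_eq0.
exists Fl; split => //.
- move=> i z zb; rewrite /Fl indicE mem_set// mulr1 -/(ex i z).
 have /andP[l1 l2] := ac1 i z; have x0 : 0 <= ex i z by rewrite le_max lexx orbT.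
 have [e0|en] := eqVneq (ex i z) 0.
  rewrite e0 powR0 ?gt_eqF// powR0 ?mulr0 ?mul0r ?mulr0//.
  by rewrite gt_eqF// subr_gt0.
 have D0 : Dw i z != 0.
  by apply: contraNneq en => D0; rewrite /ex D0 normr0 sub0r max_r// oppr_le0.
 have -> : Lam * (ac i z * ex i z `^ (p - 1) * (Dw i z / `|Dw i z|) * Dw i z) =
   (Lam * ac i z) * (ex i z `^ (p - 1) * `|Dw i z|).
  have e : Dw i z / `|Dw i z| * Dw i z = `|Dw i z|.
   apply: (mulIf (_ : `|Dw i z| != 0)); first by rewrite normr_eq0.
   by rewrite -mulrA [_^-1 * _]mulrC mulrA mulfVK ?normr_eq0// -!expr2 real_normK// num_real.
  by rewrite -[in RHS]e; ring.
 have -> : ex i z `^ p = 1 * (ex i z `^ (p - 1) * ex i z).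
  by rewrite mul1r -[X in _ * X]powRr1// -powRD ?subrK// en implybT.
 apply: ler_pM => //; first by rewrite mulr_ge0 ?powR_ge0.
  by rewrite -ler_pdivrMl// mulr1.
 apply: ler_wpM2l; first exact: powR_ge0.
 by rewrite ge_max normr_ge0 andbT gerBl.
- by move=> o; have dd := d0; split; lra.
move=> bb hb supp.

have iFl := hint Fl mFl Fl_le.
have iB' := itg_mul_tens (bumps_dt None hb) iB.
have iF' i := itg_mul_tens (bumps_dt (Some i) hb) (iFl i).
have if' := itg_mul_tens hb if_.
have incl z : (forall o, A o - d <= co o z <= B o + d) -> obox A' B' z.
 move=> h o; have := h o; have dd := d0; rewrite /= in_itv/=; move: (co o z) => c; lra.
have cylc z : obox A' B' z -> forall o, A' o <= co o z <= B' o.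
 by move=> h o; have := h o; rewrite /= in_itv/= => /andP[/ltW-> /ltW->].
have cylA z : obox A' B' z -> cyl Om T z.
 move=> h; apply: sub => o; have := h o; have dd := d0; rewrite /= in_itv/=; move: (co o z) => c; lra.
have tz z : ~ obox A' B' z -> tens bb z = 0.
 by move=> h; apply/eqP; apply: contra_notT h => /supp/incl.
have tdz o z : ~ obox A' B' z -> tens (dt o bb) z = 0.
 by move=> h; apply/eqP; apply: contra_notT h => nz; apply: incl; exact: tens_dt_supp hb supp nz.
have tf : test_fun (cyl Om T) (tens bb : 'rV[R]_N * R -> R).
 by apply: (test_fun_tens hb _ supp) => z h; exact: cylA (incl z h).
have E := weq tf.
pose F1 z := \sum_i Fl i z * tens (dt (Some i) bb) z - spow (w z) alpha * \1_(obox A' B') z * tens (dt None bb) z.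
have i1 : itg F1 by apply: itgB => //; exact: itg_sum.
have mc : measurable (cyl Om T : set Z) by apply: measurable_cyl.
have mres (F : Z -> R) : itg F -> measurable_fun (cyl Om T : set Z) (fun z => (F z)%:E).
 by move=> iF; apply/mEFinP; apply: (measurable_funS measurableT (@subsetT _ _)); exact: itgm iF.
have E1 : (\int[mu]_(z in cyl Om T) (\sum_(i < N) flux a p delta i z (Du^~ z) * dspace i (tens bb) z -
   spow (u z) alpha * dtime (tens bb) z)%:E = \int[mu]_(z in cyl Om T) (F1 z)%:E)%E.
 apply: (integral_version mc (mres _ i1)).
 have hDa : {ae mu, forall z, forall i, obox A' B' z -> Du i z = Dw i z}.
  by apply: (@filter_forall _ _ _ _ (ae_filter_ringOfSetsType _)) => i.
 have haa : {ae mu, forall z, forall i, cyl Om T z -> a i z = ac i z}.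
  by apply: (@filter_forall _ _ _ _ (ae_filter_ringOfSetsType _)) => i.
 apply: filterS2 hu (filterI hDa haa) => z hz [hDz haz] cz.
 congr EFin; rewrite /F1 dtime_tens//; have [zb|zb] := pselect (obox A' B' z); last first.
  rewrite !(tdz None)// !mulr0; congr (_ - _); apply: eq_bigr => i _.
  by rewrite dspace_tens// !(tdz (Some i))// !mulr0.
 rewrite hz; last exact: cylc.
 rewrite indicE mem_set// mulr1; congr (_ - _); apply: eq_bigr => i _.
 by rewrite dspace_tens// /flux haz// hDz// /Fl indicE mem_set// mulr1.
have E2 : (\int[mu]_(z in cyl Om T) (f z * tens bb z)%:E = \int[mu]_(z in cyl Om T) (f' z * tens bb z)%:E)%E.
 by apply: (integral_version mc (mres _ if')); apply: filterS hf => z hz cz; rewrite hz.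
have full (F : Z -> R) : itg F -> (forall z, ~ obox A' B' z -> F z = 0) ->
  (\int[mu]_(z in cyl Om T) (F z)%:E = (II F)%:E)%E.
 move=> iF F0; rewrite (IIE iF) [LHS]integral_mkcond; apply: eq_integral => z _.
 by rewrite patchE; case: ifPn => // nz; rewrite F0// => /cylA h; move: nz; rewrite mem_set.
move: E; rewrite [X in X = _ -> _]E1 [X in _ = X -> _]E2 (full F1 i1) ?(full _ if').
- move=> [E]; rewrite -E /F1 (IIB (itg_sum _ iF') iB') (II_sum _ iF').
 by rewrite opprB addrC subrK.
- by move=> z zb; rewrite tz// mulr0.
- by move=> z zb; rewrite /F1 (tdz None z zb) mulr0 subr0; apply: big1 => i _; rewrite (tdz _ z zb) mulr0.
Qed.

End local_equation.
End weak_solution_data.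

(** * Bounds on boxes *)

Section local_boundedness.

(** Allows the source to be set to 0 outside the box, so that its norm on the whole space is
    controlled by an integral over the given cylinder. *)
Lemma energy_data_source (w f g : Z -> R) Dw dl (p q P sig C dmax : R) A B : 1 < p ->
 energy_data w f Dw dl p q P sig C dmax A B -> measT g ->
 itg (fun z => `|g z| `^ sig) -> (forall z, obox A B z -> `|g z| = `|f z|) ->
 energy_data w g Dw dl p q P sig C dmax A B.
Proof.
move=> p1 [iw iD hw iDp fin iP mf ifs hdl en] mg ig gf; split => //.
move=> a b gl gr gam k Aa bB ab gl0 gr0 gam01 ggl ggr ggt k2.
have E : source w g p k a b gl gr = source w f p k a b gl gr.
 ext => z; rewrite /source.
 have [->|n0] := eqVneq (tens (cutf a b gl gr p) z) 0; first by rewrite !mulr0.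
 rewrite gf// => o; have := tens_cutf_supp gl0 gr0 (lt_trans ltr01 p1) n0 o.
 rewrite /= !in_itv/= => /andP[h1 h2].
 by rewrite (le_lt_trans (Aa o) h1) (lt_le_trans h2 (bB o)).
by rewrite /energy_rhs E => isrc; exact: (en a b gl gr gam k Aa bB ab gl0 gr0 gam01 ggl ggr ggt k2 isrc).
Qed.

Lemma II_eq0 (F : Z -> R) : itg F -> (forall z, 0 <= F z) -> II F = 0 -> {ae mu, forall z, F z = 0}.
Proof.
move=> iF F0 e.
have mF : measT (EFin \o F) by apply/mEFinP; exact: itgm iF.
have [h _] := @ae_eq_integral_abs _ _ _ mu setT measurableT (EFin \o F) mF.
suff /h H : (\int[mu]_z `|(EFin \o F) z| = 0)%E by apply: filterS H => z /(_ I)/= [].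
rewrite (eq_integral (fun z => (F z)%:E)); first by rewrite -(IIE iF) e.
by move=> z _; rewrite /= ger0_norm.
Qed.

(** The common interface of the two parts of the theorem. Of the margin [3 d], one [d] is for the
    plateau; a weak solution takes [2 d] more, since translates of test functions must stay
    inside. *)
Definition has_energy (Om : set 'rV[R]_N) (T p q P sig C dmax : R) (f u : Z -> R) (plus : bool) :=
 forall A B d, 0 < d -> (forall o, A o <= B o) ->
 (forall z, (forall o, A o - 3 * d <= co o z <= B o + 3 * d) -> cyl Om T z) ->
 exists w g Dw dl, [/\ energy_data w g Dw dl p q P sig C dmax A B,
  {ae mu, forall z, obox A B z -> sgb plus * u z = w z} &
  {ae mu, forall z, obox A B z -> `|f z| = `|g z|}].

Section box.
Variables (p q P sig C dmax : R).
Hypotheses (N0 : (0 < N)%N) (p1 : 1 < p) (q1 : 1 < q) (PE : P = Num.max q p)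
 (sig1 : (N%:R + p) / p < sig) (hD : N%:R * q / (N%:R + q) < p) (C0 : 0 < C).
Notation D := (dg_D N p q P).
Notation X := (dg_X N p q P sig).
Let p0 : 0 < p := lt_trans ltr01 p1.
Let D0 : 0 < D. Proof. exact: dg_D_gt0. Qed.
Let P1 : 1 < P. Proof. by rewrite PE lt_max q1. Qed.
Let sig0 : 0 < sig.
Proof. by apply: lt_trans sig1; rewrite divr_gt0// ltr_wpDl. Qed.

Lemma dg_XE : X = (D + p * P * (sig / (P / (P - 1)) - 1)) / (p * sig).
Proof. by rewrite /dg_X; field; rewrite !gt_eqF// ?(lt_trans _ P1)// subr_gt0. Qed.

(** Multiplied out, the numerator is [(p sig - (N + p))(P - 1) + N (p - 1) + p (q - 1)], a sum of
    positive terms. *)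
Lemma dg_X_gt0 : 0 < X.
Proof.
rewrite dg_XE divr_gt0 ?mulr_gt0//.
have n0 : 0 < N%:R :> R by rewrite ltr0n.
have -> : D + p * P * (sig / (P / (P - 1)) - 1) = p * (N%:R + q) - N%:R * P - p * P + p * sig * (P - 1).
 by rewrite /dg_D; field; rewrite !gt_eqF// ?(lt_trans _ P1)// subr_gt0.
have h : N%:R + p < p * sig by rewrite mulrC -ltr_pdivrMr.
have h2 : (N%:R + p) * (P - 1) < p * sig * (P - 1) by rewrite ltr_pM2r// subr_gt0.
have h3 : N%:R < p * N%:R by rewrite ltr_pMl.
have h4 : p < p * q by rewrite ltr_pMr.
rewrite (_ : _ + _ = (p * sig * (P - 1) - (N%:R + p) * (P - 1)) + (p * N%:R - N%:R) + (p * q - p)); last by ring.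
by apply: addr_gt0; [apply: addr_gt0|]; rewrite subr_gt0.
Qed.

(** The two hypotheses of [degiorgi] are solved for [k], after which the vanishing of the mass above
    [k] says that [k] is a bound on the inner box. *)
Lemma box_bound : exists2 eps : R, 0 < eps &
 forall (Om : set 'rV[R]_N) (T : R) (f u : Z -> R) (plus : bool) (Q : set Z) (A B al be : option 'I_N -> R)
  (d R0 Y J : R),
 has_energy Om T p q P sig C dmax f u plus -> 0 < d ->
 (forall z, (forall o, A o - 3 * d <= co o z <= B o + 3 * d) -> cyl Om T z) ->
 obox A B `<=` Q -> 0 < R0 <= 1 -> (forall i, R0 <= al (Some i) - A (Some i)) ->
 (forall i, R0 <= B (Some i) - be (Some i)) -> R0 `^ p <= al None - A None ->
 be None < B None -> (forall o, al o <= be o) ->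
 (\int[mu]_(z in Q) (sgn_part plus (u z) `^ P)%:E = Y%:E)%E ->
 (\int[mu]_(z in Q) (`|f z| `^ sig)%:E = J%:E)%E ->
 {ae mu, forall z, obox al be z ->
  sgb plus * u z <= 1 + (Y / (eps * R0 `^ (N%:R + p))) `^ (p / D) + J `^ (sig * X)^-1}.
Proof.
have [eps eps0 heps] := degiorgi dmax N0 p1 q1 PE sig1 hD C0; exists eps => //.
move=> Om T f u plus Q A B al be d R0 Y J hE d0 sub AQ R01 hA hB hAt hBt albe hY hJ.
have /andP[R00 _] := R01.
have dA o : A o <= al o.
 rewrite -subr_ge0; case: o => [i|]; first exact: le_trans (ltW R00) (hA i).
 by apply: le_trans hAt; exact: powR_ge0.
have dB o : be o <= B o.
 by case: o => [i|]; [rewrite -subr_ge0 (le_trans (ltW R00))|exact: ltW].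
have AB o : A o <= B o by exact: le_trans (dA o) (le_trans (albe o) (dB o)).
have [w [g0 [Dw [dl [ED0 uw fg0]]]]] := hE A B d d0 AB sub.
pose g z := g0 z * \1_(obox A B) z.
have gE z : obox A B z -> g z = g0 z by move=> h; rewrite /g indicE mem_set// mulr1.
have mg : measT g.
 apply: mfunM; first exact: ed_f ED0.
 by apply: mindic; exact: mset_obox.
have ig : itg (fun z => `|g z| `^ sig).
 apply: (itg_dom _ _ (ed_fsig ED0)).
  by apply: (mpowR sig); exact: mcomp.
 move=> z; rewrite ger0_norm ?powR_ge0//; powR_mono; rewrite ?(ltW sig0)//.
 by rewrite /g normrM indicE; case: (_ \in _); rewrite ?normr1 ?mulr1// normr0 mulr0.
have ED := energy_data_source p1 ED0 mg ig (fun z h => congr1 Num.norm (gE z h)).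
have Y0 : 0 <= Y by rewrite -lee_fin -hY; apply: integral_ge0 => z _; rewrite lee_fin powR_ge0.
have J0 : 0 <= J by rewrite -lee_fin -hJ; apply: integral_ge0 => z _; rewrite lee_fin powR_ge0.
set y := Y / (eps * R0 `^ (N%:R + p)).
have e0 : 0 < eps * R0 `^ (N%:R + p) by rewrite mulr_gt0// powR_gt0.
have y0 : 0 <= y by rewrite divr_ge0 ?(ltW e0).
(* The summand 1 keeps [k >= 1], the second gives the smallness of the mass, and the third the bound
   on the norm of the source. *)
set k := 1 + y `^ (p / D) + J `^ (sig * X)^-1.
have k1 : 1 <= k by rewrite /k -addrA lerDl addr_ge0 ?powR_ge0.
have k0 : 0 < k by exact: lt_le_trans k1.
have mw := itgm (ed_w ED); have P0 : 0 <= P by rewrite ltW// (lt_trans ltr01).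
have X0 := dg_X_gt0.
have hmass : mass w P (k / 2) A B <= eps * (dg_U N p q P k R0 * R0 `^ p).
 have im := mass_itg (k / 2) mw (ed_P ED) (fun o => lexx (A o)) (fun o => lexx (B o)).
 apply: (letr Y).
  rewrite -lee_fin -hY (IIE im); apply: set_integral_ge.
  - by move=> z; exact: powR_ge0.
  - by move=> z; rewrite !mulr_ge0 ?powR_ge0.
  - exact: itgm im.
  apply: filterS uw => z hz nz.
  have zb : obox A B z.
   by apply: contrapT => h; move: nz; rewrite [\1_(obox _ _) _]indicE memNset// !mulr0 eqxx.
  split; first exact: AQ.
  have kw : k / 2 < w z.
   by apply: contrapT => h; move: nz; rewrite indicE memNset// mul0r mulr0 eqxx.
  rewrite !indicE !mem_set// !mulr1 -(sgbK plus (u z)) (hz zb) sgn_part_sgb.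
  by rewrite gtr0_norm ?(lt_trans _ kw) ?divr_gt0// max_l// ltW// (lt_trans _ kw) ?divr_gt0.
 have -> : eps * (dg_U N p q P k R0 * R0 `^ p) = k `^ (D / p) * (eps * R0 `^ (N%:R + p)).
  by rewrite /dg_U powRD ?(gt_eqF R00) ?implybT//; ring.
 rewrite -ler_pdivrMr// -/y.
 apply: (letr ((y `^ (p / D)) `^ (D / p))).
  by rewrite -powRrM mulrA mulfVK ?gt_eqF// divff ?gt_eqF// powRr1.
 powR_mono; rewrite ?powR_ge0 ?(ltW k0)//; first by rewrite divr_ge0 ?ltW.
 by rewrite /k addrAC lerDr addr_ge0 ?powR_ge0.
have hsrc : II (fun z => `|g z| `^ sig) `^ sig^-1 <= k `^ X.
 have IJ : II (fun z => `|g z| `^ sig) <= J.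
  rewrite -lee_fin -hJ (IIE ig); apply: set_integral_ge.
  - by move=> z; exact: powR_ge0.
  - by move=> z; exact: powR_ge0.
  - exact: itgm ig.
  apply: filterS fg0 => z hz nz.
  have zb : obox A B z.
   apply: contrapT => h; move: nz; rewrite /g indicE memNset// mulr0 normr0.
   by move/eqP; rewrite powR0// gt_eqF.
  by split; [exact: AQ|rewrite hz// gE].
 apply: (letr (J `^ sig^-1)).
  powR_mono; rewrite ?invr_ge0 ?(ltW sig0)//.
  by apply: II_ge0 => z; exact: powR_ge0.
 apply: (letr ((J `^ (sig * X)^-1) `^ X)).
  by rewrite -powRrM invfM -mulrA mulVf ?gt_eqF// mulr1.
 powR_mono; rewrite ?powR_ge0 ?(ltW k0) ?(ltW X0)//.
 by rewrite /k lerDr addr_ge0 ?powR_ge0.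
have m0 := heps w g Dw dl A B al be R0 k ED R01 hA hB hAt hBt albe k1 hmass hsrc.
have im := mass_itg k mw (ed_P ED) dA dB.
have m0' := II_eq0 im _ m0.
apply: filterS2 uw (m0' _) => [z hz hw zb|z]; last by rewrite !mulr_ge0 ?powR_ge0.
have zb' : obox A B z.
 move=> o; have := zb o; rewrite /= !in_itv/= => /andP[h1 h2].
 by rewrite (le_lt_trans (dA o) h1) (lt_le_trans h2 (dB o)).
rewrite hz// leNgt; apply/negP => kw; move: hw => /eqP.
rewrite !indicE !mem_set// !mulr1 gt_eqF// powR_gt0// gtr0_norm//; exact: lt_trans kw.
Qed.

End box.
End local_boundedness.

(** * Covering the cylinder by boxes *)

Section local_estimate.

Lemma enorm_coord (x : 'rV[R]_N) i : `|x ord0 i| <= enorm x.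
Proof.
rewrite -sqrtr_sqr /enorm; apply: ler_wsqrtr; rewrite (bigD1 i)//= lerDl.
by apply: sumr_ge0 => j _; exact: sqr_ge0.
Qed.

Lemma enorm_perturb (x y : 'rV[R]_N) (c : R) : 0 <= c -> (forall i, `|y ord0 i - x ord0 i| <= c) ->
 enorm y <= enorm x + N%:R * c.
Proof.
move=> c0 h; have e0 : 0 <= enorm x by exact: sqrtr_ge0.
rewrite [leLHS]/enorm -[leRHS]ger0_norm ?addr_ge0 ?mulr_ge0// -sqrtr_sqr; apply: ler_wsqrtr.
apply: (letr (\sum_i (x ord0 i ^+ 2 + (2 * enorm x * c + c ^+ 2)))).
 apply: ler_sum => i _; rewrite (_ : y ord0 i = x ord0 i + (y ord0 i - x ord0 i)); last by rewrite addrC subrK.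
 have hi := h i; rewrite sqrrD -addrA lerD2l lerD//; last first.
  by rewrite -[leLHS]real_normK ?num_real// lerXn2r ?nnegrE.
 rewrite -mulr_natl -[leRHS]mulrA ler_pM2l//; apply: le_trans (ler_norm _) _.
 by rewrite normrM ler_pM//; exact: enorm_coord.
rewrite big_split/= sumr_const card_ord -[X in _ + X <= _]mulr_natl.
have -> : \sum_i x ord0 i ^+ 2 = enorm x ^+ 2 by rewrite /enorm sqr_sqrtr// sumr_ge0// => i _; exact: sqr_ge0.
have NN : c ^+ 2 * N%:R <= c ^+ 2 * N%:R ^+ 2.
 by rewrite ler_wpM2l ?sqr_ge0// -natrX ler_nat; case: (N) => // n; rewrite leq_pmulr.
by move: NN; move: (enorm x) (N%:R) => e n NN; rewrite !expr2 in NN *; lra.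
Qed.

(** Gives [r^p - (s r)^p >= (r (1 - s))^p], the time available between the bottoms of the two
    cylinders. *)
Lemma powR_superadd (p x y : R) : 1 <= p -> 0 <= x -> 0 <= y -> x `^ p + y `^ p <= (x + y) `^ p.
Proof.
move=> p1 x0 y0; have p0 : p != 0 by rewrite gt_eqF// (lt_le_trans ltr01).
have E t : 0 <= t -> t `^ p = t * t `^ (p - 1).
 move=> t0; have [->|tn] := eqVneq t 0; first by rewrite powR0// mul0r.
 by rewrite -[X in X * _]powRr1// -powRD ?subrKC// tn implybT.
rewrite (E _ x0) (E _ y0) (E _ (addr_ge0 x0 y0)) mulrDl.
have p10 : 0 <= p - 1 by rewrite subr_ge0.
apply: lerD; apply: ler_wpM2l => //; apply: (ge0_ler_powR p10); rewrite ?nnegrE ?addr_ge0//.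
 by rewrite lerDl.
by rewrite lerDr.
Qed.

Section bound.
Variables (p q P sig C dmax : R).
Hypotheses (N0 : (0 < N)%N) (p1 : 1 < p) (q1 : 1 < q) (PE : P = Num.max q p)
 (sig1 : (N%:R + p) / p < sig) (hD : N%:R * q / (N%:R + q) < p) (C0 : 0 < C).
Notation D := (dg_D N p q P).
Notation X := (dg_X N p q P sig).
Let p0 : 0 < p := lt_trans ltr01 p1.

(** Rational centres and tops [to - 1/(n+1)] give countably many boxes covering the smaller
    cylinder. The two cylinders share their top, so the boxes approach it with ever smaller gaps
    there; the bound is unaffected by the gap at the top. *)
Lemma cylinder_bound : exists2 eps : R, 0 < eps &
 forall (Om : set 'rV[R]_N) (T : R) (f u : Z -> R) (plus : bool) (zo : Z) (r s Y J : R),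
 has_energy Om T p q P sig C dmax f u plus -> 0 < r -> Qcyl p r zo `<=` cyl Om T -> 0 < s < 1 ->
 (\int[mu]_(z in Qcyl p r zo) (sgn_part plus (u z) `^ P)%:E = Y%:E)%E ->
 (\int[mu]_(z in Qcyl p r zo) (`|f z| `^ sig)%:E = J%:E)%E ->
 {ae mu, forall z, Qcyl p (s * r) zo z -> sgb plus * u z <=
  1 + (Y / (eps * Num.min 1 (r * (1 - s) / (4 * N%:R)) `^ (N%:R + p))) `^ (p / D) + J `^ (sig * X)^-1}.
Proof.
have [eps eps0 heps] := box_bound dmax N0 p1 q1 PE sig1 hD C0; exists eps => //.
move=> Om T f u plus [xo to] r s Y J hE r0 Qsub /andP[s0 s1] hY hJ.
set h := r * (1 - s); have h0 : 0 < h by rewrite mulr_gt0// subr_gt0.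
have n0 : 0 < N%:R :> R by rewrite ltr0n.
have n1 : 1 <= N%:R :> R by rewrite ler1n.
(* A box has half-side [2 R0] around a centre within [R0] of the smaller ball in each coordinate;
   the factor [4 N] keeps it within [3 h / 4] of that ball and leaves room for the margin [d]. *)
set R0 := Num.min 1 (h / (4 * N%:R)).
have R00 : 0 < R0 by rewrite lt_min ltr01 divr_gt0// mulr_gt0.
have R01 : 0 < R0 <= 1 by rewrite R00 ge_min lexx.
have R0h : N%:R * R0 <= h / 4.
 apply: (letr (N%:R * (h / (4 * N%:R)))); first by rewrite ler_pM2l// ge_min lexx orbT.
 by apply: le_of_eq; field; rewrite gt_eqF.
have R0h' : R0 <= h * 4^-1 by apply: le_trans R0h; rewrite ler_peMl// ltW.
pose g := r `^ p - (s * r) `^ p.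
have hg : h `^ p <= g.
 rewrite /g lerBrDr; apply: le_trans (powR_superadd (ltW p1) (ltW h0) _) _; first by rewrite mulr_ge0 ?ltW.
 by rewrite (_ : h + s * r = r)// /h; ring.
have g0 : 0 < g by apply: lt_le_trans hg; rewrite powR_gt0.
have gr : g <= r `^ p by rewrite gerBl powR_ge0.
have R0p : R0 `^ p <= g * 4^-1.
 apply: (letr ((h * 4^-1) `^ p)).
  have h4 : 0 <= h * 4^-1 by exact: le_trans (ltW R00) R0h'.
  by apply: (ge0_ler_powR (ltW p0)); rewrite ?nnegrE; [exact: ltW|exact: h4|exact: R0h'].
 rewrite powRM ?(ltW h0)//; apply: ler_pM; rewrite ?powR_ge0//.
 rewrite -[leRHS]powRr1//; apply: powR_le1W => //; last exact: ltW.
 by rewrite invr_ge0 ler0n/= invf_le1// ler1n.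
have R0p0 : 0 < R0 `^ p by rewrite powR_gt0.
(* The time gap [g] is shared out: half lies below the boxes for the margin, and at most a quarter
   is the rise [R0^p] to the inner box, which still starts below the smaller cylinder. *)
pose tA := to - r `^ p + g / 2.
pose e (n : nat) : R := n.+1%:R^-1.
have e0 n : 0 < e n by rewrite invr_gt0.
pose cc (c : {ffun 'I_N -> rat}) i : R := ratr (c i).
pose al c o := if o is Some i then cc c i - R0 else tA + R0 `^ p.
pose A c o := if o is Some i then cc c i - 2 * R0 else tA.
pose be c n o := if o is Some i then cc c i + R0 else to - e n.
pose B c n o := if o is Some i then cc c i + 2 * R0 else to - e n / 2.
pose good c n := (exists x, enorm (x - xo) < s * r /\ forall i, `|x ord0 i - cc c i| < R0) /\
 tA + R0 `^ p <= to - e n.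
pose K := 1 + (Y / (eps * R0 `^ (N%:R + p))) `^ (p / D) + J `^ (sig * X)^-1.
have each c n : {ae mu, forall z, good c n -> obox (al c) (be c n) z -> sgb plus * u z <= K}.
 have [[[x [hx xc]] tn]|ng] := pselect (good c n); last by apply: nearW => z.
 pose d := Num.min (h / (16 * N%:R)) (Num.min (e n / 12) (g / 12)).
 have d0 : 0 < d by rewrite !lt_min; apply/and3P; split; apply: divr_gt0 => //; exact: mulr_gt0.
 have dh : N%:R * (3 * d) <= 3 * h / 16.
  apply: (letr (N%:R * (3 * (h / (16 * N%:R))))).
   by rewrite !ler_pM2l// ge_min lexx.
  by apply: le_of_eq; field; rewrite gt_eqF.
 have de : 3 * d <= e n / 4.
  have : d <= e n / 12 by rewrite !ge_min lexx orbT.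
  by move: (d) (e n) => u1 u2; lra.
 have dg : 3 * d <= g / 4.
  have : d <= g / 12 by rewrite !ge_min lexx !orbT.
  by move: (d) (g) => u1 u2; lra.
 have incl z : (forall o, A c o - 3 * d <= co o z <= B c n o + 3 * d) -> Qcyl p r ((xo, to) : Z) z.
  move=> hz; split; rewrite /=; last first.
   have := hz None; rewrite in_itv/= /A /B /tA; have := e0 n; move: de dg g0 r0 gr.
   by move: (d) (e n) (g) (r `^ p) (z.2) => u1 u2 u3 u4 u5; lra.
  apply: le_lt_trans (_ : enorm (x - xo) + N%:R * (3 * R0 + 3 * d) < r).
   apply: enorm_perturb => [|i]; first by rewrite addr_ge0// mulr_ge0// ltW.
   have := hz (Some i); have := xc i; rewrite !mxE /A /B /= ltr_norml ler_norml.
   by move: (d) (R0) (cc c i) (x ord0 i) (z.1 ord0 i) (xo ord0 i) => u1 u2 u3 u4 u5 u6; lra.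
  have rE : r = s * r + h by rewrite /h; ring.
  rewrite mulrDr [ltRHS]rE; move: hx dh R0h h0.
  rewrite (_ : N%:R * (3 * R0) = 3 * (N%:R * R0)); last by ring.
  by move: (enorm _) (s * r) (N%:R * (3 * d)) (N%:R * R0) (h) => u1 u2 u3 u4 u5; lra.
 have K1 : al c None <= be c n None by exact: tn.
 suff : {ae mu, forall z, obox (al c) (be c n) z -> sgb plus * u z <= K} by apply: filterS => z hz _.
 apply: (heps Om T f u plus (Qcyl p r ((xo, to) : Z)) (A c) (B c n) (al c) (be c n) d R0 Y J) => //.
 - by move=> z /incl; exact: Qsub.
 - move=> z hz; apply: incl => o; have := hz o; rewrite /= in_itv/=.
  by have := d0; move: (d) (A c o) (B c n o) (co o z) => u1 u2 u3 u4; lra.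
 - by move=> i; rewrite /al /A; move: (cc c i) (R0) => u1 u2; lra.
 - by move=> i; rewrite /be /B; move: (cc c i) (R0) => u1 u2; lra.
 - by rewrite /al /A [leRHS]addrAC subrr add0r.
 - by rewrite /be /B; have := e0 n; move: (e n) => u1; lra.
 - by case=> [i|]//; rewrite /al /be; have := R00; move: (cc c i) (R0) => u1 u2; lra.
have /ae_foralln all : forall m : nat, {ae mu, forall z,
  if unpickle m is Some (c, n) then good c n -> obox (al c) (be c n) z -> sgb plus * u z <= K else True}.
 by move=> m; case: (unpickle m) => [[c n]|]; [exact: each|exact: nearW].
apply: filterS all => z hz [/= zx zt].
have qi i : exists c : rat, `|z.1 ord0 i - ratr c| < R0.
 have hi : z.1 ord0 i - R0 < z.1 ord0 i + R0 by have := R00; move: (R0) (z.1 ord0 i) => u1 u2; lra.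
 have [c] := rat_in_itvoo hi; rewrite in_itv/= => hc; exists c; rewrite ltr_norml.
 by move: hc; move: (R0) (z.1 ord0 i) (ratr c) => u1 u2 u3; lra.
pose c : {ffun 'I_N -> rat} := [ffun i => projT1 (cid (qi i))].
have hc i : `|z.1 ord0 i - cc c i| < R0 by rewrite /cc /c ffunE; case: cid.
have tE : tA + R0 `^ p < to - (s * r) `^ p.
 by rewrite /tA; have := g0; move: R0p; rewrite /g; move: (r `^ p) ((s * r) `^ p) (R0 `^ p) => u1 u2 u3; lra.
move: zt; rewrite in_itv/= => /andP[zt1 zt2].
have tp : 0 < Num.min (to - z.2) (to - (tA + R0 `^ p)).
 rewrite lt_min !subr_gt0 zt2/=; apply: lt_le_trans tE _; rewrite gerBl powR_ge0//.
have [n] := ltr_add_invr tp; rewrite add0r lt_min => /andP[n1' n2].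
have := hz (pickle (c, n)); rewrite pickleK; apply.
 split; first by exists z.1.
 by rewrite /e; move: n2; move: (tA + R0 `^ p) (n.+1%:R^-1) => u1 u2; lra.
move=> [i|]; rewrite /= in_itv/=.
 by have := hc i; rewrite /al /be ltr_norml; move: (cc c i) (R0) (z.1 ord0 i) => u1 u2 u3; lra.
apply/andP; split; first exact: lt_trans zt1.
by rewrite /e; move: n1'; move: (z.2) (n.+1%:R^-1) => u1 u2; lra.
Qed.

End bound.
End local_estimate.

(** * The estimates in their final form *)

Section estimates.
Variables (al p sig C dmax : R).
Notation q := (al + 1).
Notation P := (Num.max q p).
Hypotheses (N0 : (0 < N)%N) (p1 : 1 < p) (al0 : 0 < al)
 (sig1 : (N%:R + p) / p < sig) (hD : N%:R * q / (N%:R + q) < p) (C0 : 0 < C).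
Notation D := (dg_D N p q P).
Notation X := (dg_X N p q P sig).
Notation e2 := (p / (D + p * P * Num.min 0 (sig / (P / (P - 1)) - 1))).
Let p0 : 0 < p := lt_trans ltr01 p1.
Let q1 : 1 < q. Proof. by rewrite ltrDr. Qed.
Let P1 : 1 < P. Proof. by rewrite lt_max p1 orbT. Qed.
Let P0 : 0 < P. Proof. exact: lt_trans P1. Qed.
Let D0 : 0 < D. Proof. exact: dg_D_gt0. Qed.
Let sig0 : 0 < sig. Proof. by apply: lt_trans sig1; rewrite divr_gt0// ltr_wpDl. Qed.

Let den0 : 0 < D + p * P * Num.min 0 (sig / (P / (P - 1)) - 1).
Proof.
have := dg_X_gt0 N0 p1 q1 erefl sig1; rewrite dg_XE// pmulr_lgt0 ?invr_gt0 ?mulr_gt0// => h.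
by rewrite /Num.min; case: ifP => _ //; rewrite mulr0 addr0.
Qed.

(** By [dg_XE] the left side has the same shape as [e2]; taking the minimum with 0 only decreases
    the positive denominator. *)
Lemma source_exponent_le : (sig * X)^-1 <= e2.
Proof.
have X0 := dg_X_gt0 N0 p1 q1 erefl sig1.
have h := X0; rewrite dg_XE// pmulr_lgt0 ?invr_gt0 ?mulr_gt0// in h.
have -> : (sig * X)^-1 = p / (D + p * P * (sig / (P / (P - 1)) - 1)).
 rewrite dg_XE//; move: h; move: (D + p * P * (sig / (P / (P - 1)) - 1)) => E E0.
 by field; rewrite !gt_eqF.
rewrite ler_pM2l// lef_pV2// lerD2l ler_pM2l ?mulr_gt0// ge_min lexx orbT//.
Qed.

(** The bound for [sgb plus * u] gives the essential supremum for [plus = true] and, after changing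
    sign, the essential infimum for [plus = false]. The additive 1 is absorbed by the power of
    [1 + J]. *)
Lemma local_estimates_of_energy : exists2 c : R, 0 < c &
 forall (T : R) (Om : set 'rV[R]_N) (f u : 'rV[R]_N * R -> R),
 (forall plus, has_energy Om T p q P sig C dmax f u plus) ->
 local_estimates Om T al p sig c f u.
Proof.
have [eps eps0 heps] := cylinder_bound dmax N0 p1 q1 erefl sig1 hD C0.
set m := N%:R + p; set e1 := p / D.
have n0 : 0 < N%:R :> R by rewrite ltr0n.
have m0 : 0 < m by rewrite addr_gt0.
have e10 : 0 < e1 by rewrite divr_gt0.
have e20 : 0 < e2 by rewrite divr_gt0.
have M1 : 1 <= (4 * N%:R) `^ m.
 by rewrite -[leLHS](powRr0 (4 * N%:R)) ler_powR ?(ltW m0)// -natrM ler1n muln_gt0.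
pose c1 := ((4 * N%:R) `^ m / eps) `^ e1.
have c10 : 0 <= c1 by exact: powR_ge0.
exists (c1 + 2); first by rewrite ltr_wpDl.
have c0 : 0 < c1 + 2 by rewrite ltr_wpDl.
move=> T Om f u hE zo r s r0 [_ cl] s01.
have Qsub : Qcyl p r zo `<=` cyl Om T by apply: subset_trans cl; exact: subset_closure.
have /andP[s0 s1] := s01.
set h := r * (1 - s); have h0 : 0 < h by rewrite mulr_gt0// subr_gt0.
have Hm0 : 0 < 1 + h `^ (- m) by rewrite ltr_pwDl// powR_ge0.
have bound plus : {ae mu, forall z, Qcyl p (s * r) zo z ->
  ((sgb plus * u z)%:E <= local_bound al p sig (c1 + 2) f (sgn_part plus \o u) zo r s)%E}.
 rewrite /local_bound -/h -/m -[N%:R + al + 1]addrA -/(dg_D N p q P) -/e1.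
 set S := (X in ((1 + _)%:E * X)%E).
 set J := (X in (1 + X)%E).
 have S0 : (0 <= S)%E by apply: integral_ge0 => z _; rewrite lee_fin powR_ge0.
 have J0 : (0 <= J)%E by apply: integral_ge0 => z _; rewrite lee_fin powR_ge0.
 have t10 x : (0 <= (c1 + 2)%:E * ((1 + h `^ (- m))%:E * x) `^ e1 :> \bar R)%E.
  by rewrite mule_ge0 ?poweR_ge0// lee_fin ltW.
 have t20 : (0 <= (c1 + 2)%:E * (1 + J) `^ e2 :> \bar R)%E.
  by rewrite mule_ge0 ?poweR_ge0// lee_fin ltW.
 (* If one of the two integrals is infinite, so is the right-hand side; otherwise the bound for
    finite integrals applies. *)
 case ES : S S0 => [Y||] // S0; last first.
  apply: nearW => z _; rewrite mulry gtr0_sg// mul1e poweRyr ?gt_eqF// mulry gtr0_sg// mul1e.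
  by rewrite addye ?leey// gt_eqF// (lt_le_trans _ t20)// ltNy0.
 case EJ : J J0 t20 => [j||] // J0 t20; last first.
  apply: nearW => z _; rewrite addey// poweRyr ?gt_eqF// mulry gtr0_sg// mul1e.
  by rewrite addey ?leey// gt_eqF// (lt_le_trans _ (t10 _))// ltNy0.
 have := heps Om T f u plus zo r s Y j (hE plus) r0 Qsub s01 ES EJ.
 apply: filterS => z hz Qz; rewrite -EFinD lee_fin.
 apply: le_trans (hz Qz) _; rewrite -/h -/m -/e1.
 set R0 := Num.min _ _.
 have R00 : 0 < R0 by rewrite lt_min ltr01 divr_gt0// mulr_gt0.
 have Y0 : 0 <= Y by rewrite -lee_fin.
 have j0 : 0 <= j by rewrite -lee_fin.
 (* Origin of the factor [1 + (r (1 - s))^(-(N+p))]: the minimum [R0] is either 1 or [h / (4 N)]. *)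
 have R0m : (R0 `^ m)^-1 <= (4 * N%:R) `^ m * (1 + h `^ (- m)).
  rewrite /R0 minElt; case: ifP => _.
   by rewrite powR1 invr1 mulr_ege1// lerDl powR_ge0.
  rewrite powRM ?invr_ge0 ?(ltW h0) ?mulr_ge0//.
  have M0 : 0 < (4 * N%:R) `^ m by exact: lt_le_trans M1.
  have -> : (4 * N%:R)^-1 `^ m = ((4 * N%:R) `^ m)^-1.
   apply: (mulfI (lt0r_neq0 M0)); rewrite -powRM ?invr_ge0 ?mulr_ge0//.
   by rewrite !mulfV ?powR1// gt_eqF// mulr_gt0.
  by rewrite invfM invrK mulrC powRN ler_pM2l// lerDr.
 have b1 : (Y / (eps * R0 `^ m)) `^ e1 <= c1 * ((1 + h `^ (- m)) * Y) `^ e1.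
  rewrite /c1 -powRM ?divr_ge0 ?powR_ge0 ?(ltW eps0)//; last by rewrite mulr_ge0// ltW.
  powR_mono; rewrite ?(ltW e10)//.
  - by rewrite divr_ge0// mulr_ge0 ?powR_ge0// ltW.
  - by rewrite mulr_ge0 ?divr_ge0 ?powR_ge0 ?(ltW eps0)// mulr_ge0// ltW.
  have -> : (4 * N%:R) `^ m / eps * ((1 + h `^ (- m)) * Y) =
    Y / eps * ((4 * N%:R) `^ m * (1 + h `^ (- m))) by ring.
  by rewrite invfM mulrA ler_wpM2l// divr_ge0// ltW.
 have J1 : 1 <= 1 + j by rewrite lerDl.
 have b2 : j `^ (sig * X)^-1 <= (1 + j) `^ e2.
  apply: (letr ((1 + j) `^ (sig * X)^-1)); last exact: ler_powR J1 _ _ source_exponent_le.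
  have X0 := dg_X_gt0 N0 p1 q1 erefl sig1.
  powR_mono; rewrite ?invr_ge0 ?mulr_ge0 ?(ltW sig0) ?(ltW X0)//.
   by rewrite (le_trans ler01).
  by rewrite lerDr.
 have b3 : 1 <= (1 + j) `^ e2 by rewrite -[leLHS](powRr0 (1 + j)) ler_powR// ltW.
 have b4 : 0 <= ((1 + h `^ (- m)) * Y) `^ e1 by exact: powR_ge0.
 move: b1 b2 b3 b4; set x1 := (_ / _) `^ e1; set x2 := (_ * Y) `^ e1; set x3 := (1 + j) `^ e2.
 set x4 := j `^ _ => b1 b2 b3 b4; have b5 : 0 <= c1 * x3 by rewrite mulr_ge0 ?powR_ge0.
 by move: b1 b5; rewrite !mulrDl; move: (c1 * x2) (c1 * x3) => x5 x6; lra.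
split.
 apply/ess_supP; apply: (@filterS _ _ (ae_filter_ringOfSetsType _) _ _ _ (bound true)) => z hz; rewrite /patch; case: ifPn => [|_]; last exact: leNye.
 by rewrite inE => /hz; rewrite mul1r.
rewrite leeNl; apply/ess_infP; apply: (@filterS _ _ (ae_filter_ringOfSetsType _) _ _ _ (bound false)) => z hz; rewrite /patch; case: ifPn => [|_]; last exact: leey.
by rewrite inE => /hz; rewrite leeNl mulN1r EFinN.
Qed.

End estimates.

(** * The energy class and weak solutions provide the energy data *)

Section solutions.

Lemma source_version (Om : set 'rV[R]_N) (T sig : R) (f : Z -> R) : open Om -> bounded_set Om -> 0 < T ->
 1 < sig -> inLp (lebesgue_rVxR N) (cyl Om T) sig f ->
 exists g : Z -> R, [/\ measT g, {ae mu, forall z, cyl Om T z -> f z = g z},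
  itg (fun z => `|g z| `^ sig) & itg g].
Proof.
move=> oOm bOm T0 s1 [mf fin]; have [g [mg fg g0]] := borel_version oOm mf.
have s0 : 0 < sig by exact: lt_trans s1.
have mgs : measT (fun z => `|g z| `^ sig).
 by apply: (mpowR sig); exact: mcomp.
have ig : itg (fun z => `|g z| `^ sig).
 apply/integrableP; split; first exact/mEFinP.
 have : (LpNorm (lebesgue_rVxR N) (cyl Om T) sig f `^ sig < +oo)%E by exact: poweR_lty.
 apply: le_lt_trans; rewrite /LpNorm poweR_Lnorm ?gt_eqF//; apply: lower_integral_ae.
 - by apply: mcomp => //; exact/mEFinP.
 - by move=> z; exact: abse_ge0.
 - by move=> z; exact: poweR_ge0.
 apply: filterS fg => z hz; rewrite /= ger0_norm ?powR_ge0// /patch; case: ifPn => [|nc].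
  by rewrite inE => cz; rewrite /= hz.
 by rewrite g0 ?normr0 ?powR0 ?gt_eqF ?poweR_ge0// => cz; move: nc; rewrite mem_set.
exists g; split => //; exact: (Lp_itg1 oOm bOm T0 mg g0 s1 ig).
Qed.

Section energies.
Variables (Om : set 'rV[R]_N) (T al p sig dmax : R) (delta : 'I_N -> R) (f u : Z -> R).
Notation q := (al + 1).
Notation P := (Num.max q p).
Hypotheses (p1 : 1 < p) (al0 : 0 < al) (T0 : 0 < T) (oOm : open Om) (bOm : bounded_set Om)
 (sig1 : 1 < sig) (hdl : forall i, 0 <= delta i) (hmax : \big[Num.max/0]_(i < N) delta i = dmax)
 (hf : inLp (lebesgue_rVxR N) (cyl Om T) sig f).
Let q1 : 1 < q. Proof. by rewrite ltrDr. Qed.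

Let hdl' i : 0 <= delta i <= dmax.
Proof. by rewrite hdl/= -hmax; exact: le_bigmax. Qed.

Let subw A B (c c' : R) : c' <= c ->
 (forall z, (forall o, A o - c <= co o z <= B o + c) -> cyl Om T z) ->
 forall z, (forall o, A o - c' <= co o z <= B o + c') -> cyl Om T z.
Proof.
move=> cc h z hz; apply: h => o; have := hz o; move: (co o z) (A o) (B o) => x a b.
by move: cc; lra.
Qed.

Let itg_box (w : Z -> R) (A B : option 'I_N -> R) : itg (fun z => `|w z| `^ P) ->
 itg (fun z => `|w z| `^ P * \1_(obox A B) z).
Proof.
move=> iP; apply: (itg_bnd (M := 1) _ _ iP).
 by apply: mindic; exact: mset_obox.
by move=> z; rewrite indicE; case: (_ \in _); rewrite ?normr1 ?normr0.
Qed.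

Lemma energy_class_has_energy C plus : 0 < C -> energy_class Om T al p delta f C u ->
 has_energy Om T p q P sig (@energyC R N C p P) dmax f u plus.
Proof.
move=> C0 [_ [Du [ut [hW hC en]]]] A B d d0 AB sub3.
have [g [mg fg igs ig]] := source_version oOm bOm T0 sig1 hf.
have sub1 : forall z, (forall o, A o - d <= co o z <= B o + d) -> cyl Om T z.
 by apply: (subw _ sub3); have := d0; lra.
have [w [Dw [LD hu hD]]] := localisation oOm bOm T0 p1 q1 hW hC d0 AB sub1.
have [_ _ hut] := hC.
have LDv : local_data (fun z => sgb plus * w z) (fun i z => sgb plus * Dw i z) p q P.
 case: (plus); last first.
  have := local_dataN LD; congr local_data; ext => i; first by rewrite mulN1r.
  by ext => z; rewrite mulN1r.
 move: LD; congr local_data; ext => i; first by rewrite mul1r.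
 by ext => z; rewrite mul1r.
exists (fun z => sgb plus * w z), g, (fun i z => sgb plus * Dw i z), delta; split.
- have [iw iD hw iDp fin iP] := LDv; split => //; first exact: itg_box.
 move=> a b gl gr gam k Aa bB _ gl0 gr0 gam01 ggl ggr ggt k2 isrc.
 have enp k' eta phi h1 h2 h3 h4 h5 := en k' eta phi h1 h2 h3 h4 h5 plus.
 split=> [i|kap kk].
  exact: (energy_class_gradient T0 p1 al0 C0 d0 LD AB sub1 hu hD hdl fg enp Aa bB gl0 gr0 gam01 ggl ggr ggt k2 isrc).
 exact: (energy_class_slice T0 p1 al0 C0 d0 LD AB sub1 hu fg hut enp Aa bB gl0 gr0 gam01 ggl ggr ggt k2 isrc).
- apply: filterS hu => z hz zb; rewrite hz// => o; have := zb o.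
 by rewrite /= in_itv/= => /andP[/ltW-> /ltW->].
- apply: filterS fg => z hz zb; rewrite hz//; apply: sub1 => o; have := zb o; have := d0.
 by rewrite /= in_itv/=; move: (A o) (B o) (co o z) => x y t; lra.
Qed.

Lemma weak_energy_data Lam e w g Dw Fl (A B A' B' : option 'I_N -> R) : 0 < Lam -> 0 < e ->
 (forall o, A' o <= B' o) -> local_data w Dw p q P -> weak_local w g Dw Fl delta al p Lam e A B A' B' ->
 itg g -> itg (fun z => `|g z| `^ sig) ->
 energy_data w g Dw delta p q P sig (weakC al p Lam P) dmax A B.
Proof.
move=> Lam0 e0 AB' LD WL ig igs; have [iw iD hw iDp fin iP] := LD.
split => //; [exact: itg_box|exact: itgm ig|].
move=> a b gl gr gam k Aa bB _ gl0 gr0 gam01 ggl ggr ggt k2 isrc.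
split=> [i|kap kk].
 exact: (weak_gradient LD p1 al0 Lam0 hdl AB' WL ig e0 Aa bB gl0 gr0 gam01 ggl ggr ggt k2 isrc).
exact: (weak_slice LD p1 al0 Lam0 hdl AB' WL ig e0 Aa bB gl0 gr0 gam01 ggl ggr ggt k2 isrc).
Qed.

(** The solution is localised on the box enlarged by [2 d], so that the equation holds around the
    support of every truncation. The minus sign is the same statement for [- w], [- Fl] and
    [- g]. *)
Lemma weak_solution_has_energy Lam a plus : 1 <= Lam ->
 (forall i, ae_measurable (lebesgue_rVxR N) (cyl Om T) (a i)) ->
 (forall i, {ae lebesgue_rVxR N, forall z, cyl Om T z -> Lam^-1 <= a i z <= Lam}) ->
 weak_solution Om T al p delta a f u ->
 has_energy Om T p q P sig (weakC al p Lam P) dmax f u plus.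
Proof.
move=> Lam1 ma ha [_ [Du [ut [hW hC weq]]]] A B d d0 AB sub3.
have Lam0 : 0 < Lam by exact: lt_le_trans Lam1.
have [g [mg fg igs ig]] := source_version oOm bOm T0 sig1 hf.
pose A' o := A o - 2 * d; pose B' o := B o + 2 * d.
have AB' o : A' o <= B' o by have := AB o; have := d0; rewrite /A' /B'; lra.
have sub z : (forall o, A' o - d <= co o z <= B' o + d) -> cyl Om T z.
 move=> h; apply: sub3 => o; have := h o; rewrite /A' /B'; move: (A o) (B o) (co o z) => x y t; lra.
have [w [Dw [LD hu hD]]] := localisation oOm bOm T0 p1 q1 hW hC d0 AB' sub.
have hint (Fl : 'I_N -> Z -> R) (mFl : forall i, measT (Fl i)) (bFl : forall i z, `|Fl i z| <=
  Lam * Num.max (`|Dw i z| - delta i) 0 `^ (p - 1) * \1_(obox A' B') z) i : itg (Fl i).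
 exact: (itg_flux LD p1 Lam0 hdl AB' (mFl i) (bFl i)).
have iB := itg_spow_box LD al0 AB'.
have mDw i := itgm (ld_D LD i).
have [Fl WL] := weak_solution_local oOm d0 p1 Lam1 sub hdl ma ha weq mDw hu hD fg hint ig iB.
have iFl i : itg (Fl i) by apply: hint; [exact: wl_m WL|exact: wl_le WL].
have AA z : obox A B z -> forall o, A' o <= co o z <= B' o.
 move=> zb o; have := zb o; have := d0; rewrite /= in_itv/= /A' /B'.
 by move: (A o) (B o) (co o z) => x y t; lra.
have fg' : {ae mu, forall z, obox A B z -> f z = g z}.
 apply: filterS fg => z hz zb; apply: hz; apply: sub => o; have := AA z zb o; have := d0.
 by move: (A' o) (B' o) (co o z) => x y t; lra.
case: plus.
 exists w, g, Dw, delta; split.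
 - exact: weak_energy_data Lam0 d0 AB' LD WL ig igs.
 - by apply: filterS hu => z hz zb; rewrite /= mul1r hz//; exact: AA.
 - by apply: filterS fg' => z hz zb; rewrite hz.
exists (fun z => - w z), (fun z => - g z), (fun i z => - Dw i z), delta; split.
- apply: (weak_energy_data Lam0 d0 AB' (local_dataN LD) (weak_localN WL iFl ig iB) (itgN ig)).
 by under eq_fun do rewrite normrN.
- by apply: filterS hu => z hz zb; rewrite /= mulN1r hz//; exact: AA.
- by apply: filterS fg' => z hz zb; rewrite normrN hz.
Qed.

End energies.

Lemma energyC_gt0 (C p P : R) : 0 < C -> 0 < @energyC R N C p P.
Proof.
move=> C0; by rewrite /energyC !mulr_gt0// ltr_wpDl// mulr_ge0 ?powR_ge0//.
Qed.

Lemma weakC_gt0 (al p Lam P : R) : 0 < al -> 0 < Lam -> 0 < weakC al p Lam P.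
Proof.
move=> al0 Lam0; have mn0 : 0 < Num.min 1 al by rewrite lt_min ltr01.
apply: mulr_gt0; first by apply: addr_gt0; [exact: mulr_gt0|exact: divr_gt0].
have yC0 : 0 <= youngC p Lam by rewrite mulr_ge0 ?powR_ge0 ?ltW.
have h1 : 0 <= N%:R * youngC p Lam * (4 * p) `^ p * 2 `^ P.
 exact: mulr_ge0 (mulr_ge0 (mulr_ge0 (ler0n _ _) yC0) (powR_ge0 _ _)) (powR_ge0 _ _).
by rewrite /weakC1 ltr_wpDl// addr_ge0// mulr_ge0// powR_ge0.
Qed.

End solutions.

End local_regularity.

Theorem theorem4p2 (R : realType) (N : nat) (alpha p Lambda sigma dmax : R)
  (hN : (2 <= N)%N) (halpha : 0 < alpha) (hp : 1 < p) (hLambda : 1 <= Lambda)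
  (hsigma : (N%:R + p) / p < sigma)
  (hpN : N%:R * (alpha + 1) / (N%:R + alpha + 1) < p) :
  (forall C : R, 0 < C ->
   exists2 c : R, 0 < c &
   forall (T : R) (Om : set 'rV[R]_N) (delta : 'I_N -> R)
     (f u : 'rV[R]_N * R -> R),
     0 < T -> open Om -> bounded_set Om ->
     (forall i, 0 <= delta i) -> \big[Num.max/0]_(i < N) delta i = dmax ->
     inLp (lebesgue_rVxR N) (cyl Om T) sigma f ->
     energy_class Om T alpha p delta f C u ->
     local_estimates Om T alpha p sigma c f u) /\
  (exists2 c : R, 0 < c &
   forall (T : R) (Om : set 'rV[R]_N) (delta : 'I_N -> R)
     (a : 'I_N -> 'rV[R]_N * R -> R) (f u : 'rV[R]_N * R -> R),
     0 < T -> open Om -> bounded_set Om ->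
     (forall i, 0 <= delta i) -> \big[Num.max/0]_(i < N) delta i = dmax ->
     (forall i, ae_measurable (lebesgue_rVxR N) (cyl Om T) (a i)) ->
     (forall i, {ae lebesgue_rVxR N,
        forall z, cyl Om T z -> Lambda^-1 <= a i z <= Lambda}) ->
     inLp (lebesgue_rVxR N) (cyl Om T) sigma f ->
     weak_solution Om T alpha p delta a f u ->
     local_estimates Om T alpha p sigma c f u).
Proof.
have N0 : (0 < N)%N by exact: leq_trans hN.
have p0 : 0 < p by exact: lt_trans hp.
have sig1 : 1 < sigma by apply: lt_trans hsigma; rewrite ltr_pdivlMr// mul1r ltrDr ltr0n.
have hD : N%:R * (alpha + 1) / (N%:R + (alpha + 1)) < p by rewrite addrA.
split=> [C C0|].
  have [c c0 hc] := local_estimates_of_energy dmax N0 hp halpha hsigma hD (@energyC_gt0 R N C p (Num.max (alpha + 1) p) C0).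
  exists c => // T Om delta f u T0 oOm bOm hdl hmax hf hu; apply: hc => plus.
  exact: energy_class_has_energy.
have Lam0 : 0 < Lambda by exact: lt_le_trans hLambda.
have [c c0 hc] := local_estimates_of_energy dmax N0 hp halpha hsigma hD (@weakC_gt0 R N alpha p Lambda (Num.max (alpha + 1) p) halpha Lam0).
exists c => // T Om delta a f u T0 oOm bOm hdl hmax ma ha hf hu; apply: hc => plus.
exact: (weak_solution_has_energy _ _ _ _ _ _ _ _ _ _ hLambda ma ha hu).
Qed.
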